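(* Consider germs $f(z)=z+z^2+z^3+o(z^3)$ of analytic diffeomorphisms of $(\mathbb{C},0)$, and let $\Phi$ be the map attributing to each such germ $f$ its $1$-conjugacy class, $\Phi(f)=[f]_1$ (that is, its $1$-moment, a pair of analytic germs at $0$ whose values at $0$ sum to $0$, up to the identifications described in the context). Let $[f]_0$ denote any analytic class. Then the restriction of $\Phi$ to $[f]_0$ maps $[f]_0$ surjectively onto the set of all $1$-conjugacy classes.
   Context: All germs considered are of the form $f(z)=z+z^2+z^3+o(z^3)$; they are formally conjugated to $f_0(z)=\frac z{1-z}$ by formal series tangent to the identity. The analytic class $[f]_0$ consists of all germs $\varphi^{-1}\circ f\circ\varphi$ with $\varphi\in z+z^2\mathbb{C}\{z\}$. $V_+$, $V_-$ are the attracting and repelling Leau-Fatou petals of $f$ (opening $2\pi$, centered at the negative and positive real axis); $V^{up}$, $V^{low}$ are the components of $V_+\cap V_-$ above and below the real axis, consisting near $0$ of closed orbits. $\Psi_+$ is a trivialisation of the attracting petal: an analytic function on $V_+$ with $\Psi_+(f(z))-\Psi_+(z)=1$ and asymptotic development in $-\frac1z+\mathbb{C}[[z]]$; it is unique up to an additive constant. The $1$-Abel equation is $H(f(z))-H(z)=-z$; writing $H=-\mathrm{Log}(z)+R$ it becomes $R(f(z))-R(z)=-z+\mathrm{Log}\frac{f(z)}z$. This has solutions $R_+$ on $V_+$ and $R_-$ on $V_-$, analytic, with asymptotic developments in $\mathbb{C}[[z]]$, unique up to additive constants. The differences $R_+-R_-$ are constant along orbits in $V^{up}$ and $V^{low}$,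 and there are analytic germs $g_\infty,g_0$ at $t=0$ with $$R_+-R_-=g_\infty\big(e^{2\pi i\Psi_+(z)}\big)\ \text{on }V^{up},\qquad R_--R_+=g_0\big(e^{-2\pi i\Psi_+(z)}\big)\ \text{on }V^{low};$$ one has $g_\infty(0)+g_0(0)=0$. The $1$-moment of $f$ is the pair $(g_\infty,g_0)$, where pairs $(g_\infty^1,g_0^1)$ and $(g_\infty^2,g_0^2)$ are identified if $g^1_\infty(t)=g^2_\infty(bt)+a$ and $g_0^1(t)=g_0^2(t/b)-a$ for some $a\in\mathbb{C}$, $b\in\mathbb{C}^*$ (reflecting the free additive constants). Two germs are $1$-conjugated if they have the same $1$-moment up to these identifications; $[f]_1$ is the corresponding equivalence class. The set of all $1$-conjugacy classes is represented by all pairs $(g_1,g_2)$ of analytic germs at $0$ with $g_1(0)+g_2(0)=0$, up to these identifications. *)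

(* Defs.v *)
From Stdlib Require Export Reals.
From Coquelicot Require Export Coquelicot.
Local Open Scope C_scope.

Definition Cexp (z : C) : C :=
  (exp (Re z) * cos (Im z), exp (Re z) * sin (Im z))%R.

Definition Carg (z : C) : R :=
  if Rlt_dec (Im z) 0 then (- acos (Re z / Cmod z))%R
  else acos (Re z / Cmod z).

(* Principal branch. *)
Definition Clog (z : C) : C := (ln (Cmod z), Carg z).

Definition polar (s theta : R) : C := (s * cos theta, s * sin theta)%R.

Definition expands_at (f : C -> C) (z0 : C) (a : nat -> C) : Prop :=
  exists r : R, (0 < r)%R /\
    forall h : C, (Cmod h < r)%R ->
      @is_pseries C_AbsRing C_NormedModule a h (f (z0 + h)).

Definition analytic_at (f : C -> C) (z0 : C) : Prop :=
  exists a : nat -> C, expands_at f z0 a.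

Definition analytic_on (V : C -> Prop) (f : C -> C) : Prop :=
  forall z : C, V z -> analytic_at f z.

(* A germ at 0 is represented by any total function; only its values near 0
   matter, and two representatives are the same germ when they are [germ_eq]. *)
Definition germ_eq (f g : C -> C) : Prop :=
  exists r : R, (0 < r)%R /\ forall z : C, (Cmod z < r)%R -> f z = g z.

(* Analytic germs z + z^2 + z^3 + o(z^3). *)
Definition parabolic_germ (f : C -> C) : Prop :=
  exists a : nat -> C, expands_at f 0 a /\
    a 0%nat = 0 /\ a 1%nat = 1 /\ a 2%nat = 1 /\ a 3%nat = 1.

(* Germs in z + z^2 C{z}. *)
Definition tangent_to_id (phi : C -> C) : Prop :=
  exists a : nat -> C, expands_at phi 0 a /\ a 0%nat = 0 /\ a 1%nat = 1.

(* [psi] is the inverse germ: a left inverse near 0 suffices, because a germ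
   tangent to the identity maps neighbourhoods of 0 onto neighbourhoods of 0. *)
Definition analytic_class (f f1 : C -> C) : Prop :=
  parabolic_germ f1 /\
  exists phi psi : C -> C,
    tangent_to_id phi /\
    germ_eq (fun z => psi (phi z)) (fun z => z) /\
    germ_eq f1 (fun z => psi (f (phi z))).

(* The sector of radius [rho] and opening [2 * alpha] around the direction
   [theta]. *)
Definition sector (theta alpha rho : R) (z : C) : Prop :=
  exists s t : R, (0 < s < rho)%R /\ (Rabs (t - theta) < alpha)%R /\
    z = polar s t.

(* Poincare asymptotic expansion in C[[z]] as z -> 0 in a domain of opening
   [2 * PI] around [theta]; as usual it is uniform on smaller subsectors. *)
Definition has_asymptotic_series (theta : R) (h : C -> C) : Prop :=
  exists b : nat -> C, forall (alpha : R) (N : nat), (0 < alpha < PI)%R ->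
    exists K rho : R, (0 < rho)%R /\
      forall z : C, sector theta alpha rho z ->
        (Cmod (h z - sum_n (fun k => b k * z ^ k) N)%C <= K * Cmod z ^ S N)%R.

(* A disc on which the germ lives: the last clause places f z / z in the disc
   of centre 1 and radius 1, where the principal logarithm is analytic. *)
Definition disc_of_germ (f : C -> C) (r : R) : Prop :=
  (0 < r)%R /\
  analytic_on (fun z => (Cmod z < r)%R) f /\
  (forall z w : C, (Cmod z < r)%R -> (Cmod w < r)%R -> f z = f w -> z = w) /\
  (forall z : C, (0 < Cmod z < r)%R -> (Cmod (f z - z)%C < Cmod z)%R).

Definition connected_set (K : C -> Prop) : Prop :=
  forall U1 U2 : C -> Prop, open U1 -> open U2 ->
    (forall z, K z -> U1 z \/ U2 z) ->
    (exists z, K z /\ U1 z) -> (exists z, K z /\ U2 z) ->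
    exists z, K z /\ U1 z /\ U2 z.

(* A domain of opening [2 * PI] around [theta], in the punctured disc of
   radius [r], in which all orbits of [step] remain and tend to 0. *)
Definition petal (step : C -> C -> Prop) (theta r : R) (V : C -> Prop) : Prop :=
  open V /\ connected_set V /\
  (forall z, V z -> (0 < Cmod z < r)%R) /\
  (forall alpha : R, (0 < alpha < PI)%R ->
    exists rho : R, (0 < rho)%R /\ forall z, sector theta alpha rho z -> V z) /\
  (forall z, V z -> exists u : nat -> C,
    u 0%nat = z /\ (forall n, V (u n) /\ step (u n) (u (S n))) /\
    is_lim_seq (fun n => Cmod (u n)) 0%R).

Definition attracting_petal (f : C -> C) : R -> (C -> Prop) -> Prop :=
  petal (fun z w => w = f z) PI.

Definition repelling_petal (f : C -> C) : R -> (C -> Prop) -> Prop :=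
  petal (fun z w => z = f w) 0%R.

(* The connected component of [S] containing the points of argument [theta]
   close to 0. *)
Definition component_towards (theta : R) (S : C -> Prop) (z : C) : Prop :=
  exists K : C -> Prop, connected_set K /\ (forall w, K w -> S w) /\ K z /\
    exists rho : R, (0 < rho)%R /\
      forall s : R, (0 < s < rho)%R -> K (polar s theta).

Definition V_up (Vp Vm : C -> Prop) : C -> Prop :=
  component_towards (PI / 2) (fun z => Vp z /\ Vm z).

Definition V_low (Vp Vm : C -> Prop) : C -> Prop :=
  component_towards (- (PI / 2)) (fun z => Vp z /\ Vm z).

Definition trivialisation (f : C -> C) (Vp : C -> Prop) (Psi : C -> C) : Prop :=
  analytic_on Vp Psi /\
  (forall z, Vp z -> Psi (f z) - Psi z = 1) /\
  has_asymptotic_series PI (fun z => Psi z + 1 / z).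

(* The 1-Abel equation H (f z) - H z = - z for H = - Log + F. On a repelling
   petal it makes sense where both z and f z lie in the petal. *)
Definition abel1_solution (f : C -> C) (theta : R) (V : C -> Prop) (F : C -> C)
  : Prop :=
  analytic_on V F /\
  (forall z, V z -> V (f z) -> F (f z) - F z = - z + Clog (f z / z)) /\
  has_asymptotic_series theta F.

Definition germ_pair : Type := ((C -> C) * (C -> C))%type.

(* [g = (g_infty, g_0)] is the 1-moment of [f] for some choice of the petals and
   of the additive constants in [Psi], [Rp] and [Rm]. As [g] is a pair of germs,
   the two identities are required where their arguments are close to 0. *)
Definition one_moment (f : C -> C) (g : germ_pair) : Prop :=
  analytic_at (fst g) 0 /\ analytic_at (snd g) 0 /\
  exists (r : R) (Vp Vm : C -> Prop) (Psi Rp Rm : C -> C),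
    disc_of_germ f r /\ attracting_petal f r Vp /\ repelling_petal f r Vm /\
    trivialisation f Vp Psi /\
    abel1_solution f PI Vp Rp /\ abel1_solution f 0%R Vm Rm /\
    exists eps : R, (0 < eps)%R /\
      (forall z : C, V_up Vp Vm z ->
        let t := Cexp (2 * PI * Ci * Psi z) in
        (Cmod t < eps)%R -> Rp z - Rm z = fst g t) /\
      (forall z : C, V_low Vp Vm z ->
        let t := Cexp (- (2 * PI * Ci * Psi z)) in
        (Cmod t < eps)%R -> Rm z - Rp z = snd g t).

Definition moment_pair (g : germ_pair) : Prop :=
  analytic_at (fst g) 0 /\ analytic_at (snd g) 0 /\ fst g 0 + snd g 0 = 0.

Definition identified (g1 g2 : germ_pair) : Prop :=
  exists a b : C, b <> 0 /\
    germ_eq (fst g1) (fun t => fst g2 (b * t) + a) /\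
    germ_eq (snd g1) (fun t => snd g2 (t / b) - a).

(* 1-conjugacy classes are sets of pairs: [Phi f] is the set of all 1-moments of
   [f], and [one_class g] is the class represented by the pair [g]. *)
Definition Phi (f : C -> C) : germ_pair -> Prop := one_moment f.

Definition one_class (g : germ_pair) : germ_pair -> Prop :=
  fun p => moment_pair p /\ identified p g.

Definition one_conjugacy_class (X : germ_pair -> Prop) : Prop :=
  exists g : germ_pair, moment_pair g /\ (forall p, X p <-> one_class g p).

(* Main.v *)
(* Given f and a pair (g1, g2) with g1(0) + g2(0) = 0, let Psi be the Fatou
   coordinate of f. The function g1(exp(2 i pi Psi)) - g1(0), cut off to the upper
   half of a cusp neighbourhood of the imaginary axis, is flat at 0 because
   |exp(2 i pi Psi)| is about exp(-2 pi / |z|) there; so a Cauchy integral over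
   each boundary arm of the cusp writes it as a difference of two sectorial
   functions with asymptotic expansions, and likewise for g2 below. The resulting
   R_+, R_- have the prescribed differences, which are f-invariant, so R_+ o f - R_+
   and R_- o f - R_- glue to one analytic germ delta = O(z^2). Put
   psi = Log(f(z)/z) - delta, which is tangent to the identity, phi = psi^(-1) and
   f1 = psi o f o phi. Then R_+- o phi - Log(phi(z)/z) solve the 1-Abel equation
   of f1, and the 1-moment of f1 is (g1, g2).

   Conversely two choices of petals and of solutions differ only by additive
   constants along the orbits of points of the imaginary axis, and these points
   give enough values of the horn variable for the identity theorem. *)

Require Import Defs.
From Stdlib Require Import Arith Lra Lia Psatz ClassicalEpsilon.
Local Open Scope R_scope.

(** * Complex differentiability *)

(** The expansions are required on every sector of half-opening less than pi, so the jump cannot be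
    cut along a ray: the cut must be tangent to the real axis. This dictates the cubic cusp
    [|Re z|^3 < (Im z)^2], whose arms are asymptotically the parabolas [|Re w| = (Im w)^2] in
    [w = -1/z]. Each arm lies outside one of the two parabola-shaped petals, so its Cauchy integral
    is analytic on that whole petal. On the arms the horn variable decays only like
    [exp(-c/|z|^(1/2))], which is still flat. Three aperture coefficients result: 4 for the Fatou
    coordinate, which must exist on both arms; 1 for the sectorial solutions; 1/2 for the final
    petals, whose images under the near-identity [phi] must fall in the former.

    The coefficient 1 of [z^3] makes [-1/z] satisfy the Abel equation up to [O(z^2)], so the Fatou
    coordinate has no logarithmic term; the coefficient 1 of [z^2] makes [Log(f(z)/z)] tangent to
    the identity.

    Cauchy's theorem is obtained by contracting a path towards a point, the discs and the cusp being
    convex; at the vertex of the cusp only continuity is available. *)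

Lemma Cmod_minus_sym (x y : C) : Cmod (x - y) = Cmod (y - x).
Proof. rewrite <- Cmod_opp. f_equal. ring. Qed.

Lemma Cmod_minus_le (x y z : C) : Cmod (x - z) <= Cmod (x - y) + Cmod (y - z).
Proof.
  replace (x - z)%C with ((x - y) + (y - z))%C by ring. apply Cmod_triangle.
Qed.

Lemma Cmod_le_minus (x y : C) : Cmod x <= Cmod y + Cmod (x - y).
Proof.
  replace x with (y + (x - y))%C at 1 by ring. apply Cmod_triangle.
Qed.

Lemma Cmod_minus_triangle (x y : C) : Cmod (x - y) <= Cmod x + Cmod y.
Proof. unfold Cminus. rewrite <- (Cmod_opp y). apply Cmod_triangle. Qed.

Lemma Cmod_small_0 (x : C) : (forall e, 0 < e -> Cmod x <= e) -> x = 0%C.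
Proof.
  intros H. apply Cmod_eq_0. apply Rle_antisym; [|apply Cmod_ge_0].
  apply le_epsilon. intros e He. rewrite Rplus_0_l. apply H; lra.
Qed.

Lemma Cmod_minus_0 (x y : C) : Cmod (x - y) = 0 -> x = y.
Proof.
  intros H. apply Cmod_eq_0 in H. replace x with ((x - y) + y)%C by ring.
  rewrite H. ring.
Qed.

Lemma Re_le_Cmod (z : C) : Rabs (Re z) <= Cmod z.
Proof. apply re_le_Cmod. Qed.

Lemma Im_le_Cmod (z : C) : Rabs (Im z) <= Cmod z.
Proof.
  apply Rle_trans with (2 := Rmax_Cmod z). apply Rmax_r.
Qed.

Lemma Cmod_le_Re_Im (z : C) : Cmod z <= Rabs (Re z) + Rabs (Im z).
Proof.
  replace z with (RtoC (Re z) + Ci * RtoC (Im z))%C at 1.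
  - eapply Rle_trans; [apply Cmod_triangle|].
    rewrite Cmod_mult, Cmod_Ci, !Cmod_R. lra.
  - destruct z as [x y]. apply injective_projections; simpl; ring.
Qed.

Lemma Cmod_sq (z : C) : Cmod z * Cmod z = Re z * Re z + Im z * Im z.
Proof. generalize (Cmod2_alt z). simpl. rewrite !Rmult_1_r. auto. Qed.

Lemma Cmod_neq_0 (z : C) : 0 < Cmod z -> z <> 0%C.
Proof. intros H. apply Cmod_gt_0; auto. Qed.

(* Strict differentiability: on an open set it amounts to having a continuous
   complex derivative, with no derivative function to carry around. *)
Definition sderiv (f : C -> C) (z l : C) : Prop :=
  forall e, 0 < e -> exists d, 0 < d /\
    forall a b, Cmod (a - z) < d -> Cmod (b - z) < d ->
      Cmod (f a - f b - l * (a - b)) <= e * Cmod (a - b).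

Definition sdiff (f : C -> C) (z : C) : Prop := exists l, sderiv f z l.

Lemma sderiv_lip f z l : sderiv f z l -> exists d, 0 < d /\
  forall a b, Cmod (a - z) < d -> Cmod (b - z) < d ->
    Cmod (f a - f b) <= (Cmod l + 1) * Cmod (a - b).
Proof.
  intros H. destruct (H 1 Rlt_0_1) as [d [Hd H1]]. exists d. split; auto.
  intros a b Ha Hb. specialize (H1 a b Ha Hb).
  pose proof (Cmod_le_minus (f a - f b) (l * (a - b))) as H2.
  rewrite Cmod_mult in H2. lra.
Qed.

Lemma sderiv_cont f z l : sderiv f z l -> forall e, 0 < e ->
  exists d, 0 < d /\ forall a, Cmod (a - z) < d -> Cmod (f a - f z) < e.
Proof.
  intros H e He. destruct (sderiv_lip f z l H) as [d [Hd H1]].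
  pose proof (Cmod_ge_0 l) as Hl.
  exists (Rmin d (e / (Cmod l + 1))). split.
  { apply Rmin_pos; auto. apply Rdiv_lt_0_compat; lra. }
  intros a Ha.
  assert (Ha1 := Rlt_le_trans _ _ _ Ha (Rmin_l _ _)).
  assert (Ha2 := Rlt_le_trans _ _ _ Ha (Rmin_r _ _)).
  eapply Rle_lt_trans; [apply H1; auto|].
  - replace (z - z)%C with (RtoC 0) by ring. rewrite Cmod_0. auto.
  - apply Rmult_lt_compat_l with (r := Cmod l + 1) in Ha2; [|lra].
    replace ((Cmod l + 1) * (e / (Cmod l + 1))) with e in Ha2 by (field; lra).
    auto.
Qed.

Lemma sdiff_cont f z : sdiff f z -> forall e, 0 < e ->
  exists d, 0 < d /\ forall a, Cmod (a - z) < d -> Cmod (f a - f z) < e.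
Proof. intros [l H]. apply (sderiv_cont f z l H). Qed.

Lemma sderiv_ext_loc f g z l r : 0 < r ->
  (forall x, Cmod (x - z) < r -> f x = g x) -> sderiv f z l -> sderiv g z l.
Proof.
  intros Hr Hfg H e He. destruct (H e He) as [d [Hd H1]].
  exists (Rmin d r). split; [apply Rmin_pos; auto|].
  intros a b Ha Hb.
  assert (Ha1 := Rlt_le_trans _ _ _ Ha (Rmin_l _ _)).
  assert (Ha2 := Rlt_le_trans _ _ _ Ha (Rmin_r _ _)).
  assert (Hb1 := Rlt_le_trans _ _ _ Hb (Rmin_l _ _)).
  assert (Hb2 := Rlt_le_trans _ _ _ Hb (Rmin_r _ _)).
  rewrite <- !Hfg; auto.
Qed.

Lemma sdiff_ext_loc f g z r : 0 < r ->
  (forall x, Cmod (x - z) < r -> f x = g x) -> sdiff f z -> sdiff g z.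
Proof.
  intros Hr H [l Hl]. exists l. apply (sderiv_ext_loc f g z l r); auto.
Qed.

Lemma sdiff_ext f g z : (forall x, f x = g x) -> sdiff f z -> sdiff g z.
Proof. intros H. apply (sdiff_ext_loc f g z 1); auto; lra. Qed.

Lemma sderiv_ext f g z l : (forall x, f x = g x) -> sderiv f z l -> sderiv g z l.
Proof. intros H. apply (sderiv_ext_loc f g z l 1); auto; lra. Qed.

Lemma sderiv_const (c z : C) : sderiv (fun _ => c) z 0.
Proof.
  intros e He. exists 1. split; [lra|]. intros a b _ _.
  replace (c - c - 0 * (a - b))%C with (RtoC 0) by ring. rewrite Cmod_0.
  apply Rmult_le_pos; [lra|apply Cmod_ge_0].
Qed.

Lemma sderiv_id (z : C) : sderiv (fun x => x) z 1.
Proof.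
  intros e He. exists 1. split; [lra|]. intros a b _ _.
  replace (a - b - 1 * (a - b))%C with (RtoC 0) by ring. rewrite Cmod_0.
  apply Rmult_le_pos; [lra|apply Cmod_ge_0].
Qed.

Lemma sderiv_plus f g z l m : sderiv f z l -> sderiv g z m ->
  sderiv (fun x => f x + g x)%C z (l + m).
Proof.
  intros Hf Hg e He.
  destruct (Hf (e / 2)) as [d1 [Hd1 H1]]; [lra|].
  destruct (Hg (e / 2)) as [d2 [Hd2 H2]]; [lra|].
  exists (Rmin d1 d2). split; [apply Rmin_pos; auto|].
  intros a b Ha Hb.
  assert (Ha1 := Rlt_le_trans _ _ _ Ha (Rmin_l _ _)).
  assert (Ha2 := Rlt_le_trans _ _ _ Ha (Rmin_r _ _)).
  assert (Hb1 := Rlt_le_trans _ _ _ Hb (Rmin_l _ _)).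
  assert (Hb2 := Rlt_le_trans _ _ _ Hb (Rmin_r _ _)).
  specialize (H1 a b Ha1 Hb1). specialize (H2 a b Ha2 Hb2).
  replace (f a + g a - (f b + g b) - (l + m) * (a - b))%C
    with ((f a - f b - l * (a - b)) + (g a - g b - m * (a - b)))%C by ring.
  eapply Rle_trans; [apply Cmod_triangle|]. lra.
Qed.

Lemma sderiv_comp f g z l m : sderiv g z l -> sderiv f (g z) m ->
  sderiv (fun x => f (g x)) z (m * l).
Proof.
  intros Hg Hf e He.
  pose proof (Cmod_ge_0 l) as Hl. pose proof (Cmod_ge_0 m) as Hm.
  destruct (sderiv_lip g z l Hg) as [d0 [Hd0 H0]].
  destruct (Hf (e / (2 * (Cmod l + 1)))) as [d1 [Hd1 H1]].
  { apply Rdiv_lt_0_compat; lra. }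
  destruct (Hg (e / (2 * (Cmod m + 1)))) as [d2 [Hd2 H2]].
  { apply Rdiv_lt_0_compat; lra. }
  destruct (sderiv_cont g z l Hg d1 Hd1) as [d3 [Hd3 H3]].
  exists (Rmin (Rmin d0 d2) d3). split; [repeat apply Rmin_pos; auto|].
  intros a b Ha Hb.
  assert (Ha1 := Rlt_le_trans _ _ _ Ha (Rmin_l _ _)).
  assert (Ha3 := Rlt_le_trans _ _ _ Ha (Rmin_r _ _)).
  assert (Hb1 := Rlt_le_trans _ _ _ Hb (Rmin_l _ _)).
  assert (Hb3 := Rlt_le_trans _ _ _ Hb (Rmin_r _ _)).
  assert (Ha0 := Rlt_le_trans _ _ _ Ha1 (Rmin_l _ _)).
  assert (Ha2 := Rlt_le_trans _ _ _ Ha1 (Rmin_r _ _)).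
  assert (Hb0 := Rlt_le_trans _ _ _ Hb1 (Rmin_l _ _)).
  assert (Hb2 := Rlt_le_trans _ _ _ Hb1 (Rmin_r _ _)).
  specialize (H0 a b Ha0 Hb0). specialize (H2 a b Ha2 Hb2).
  specialize (H1 (g a) (g b) (H3 a Ha3) (H3 b Hb3)).
  replace (f (g a) - f (g b) - m * l * (a - b))%C
    with ((f (g a) - f (g b) - m * (g a - g b)) + m * (g a - g b - l * (a - b)))%C by ring.
  eapply Rle_trans; [apply Cmod_triangle|]. rewrite Cmod_mult.
  pose proof (Cmod_ge_0 (a - b)) as Hab.
  assert (E1 : e / (2 * (Cmod l + 1)) * Cmod (g a - g b) <= e / 2 * Cmod (a - b)).
  { replace (e / 2 * Cmod (a - b)) with (e / (2 * (Cmod l + 1)) * ((Cmod l + 1) * Cmod (a - b))) by (field; lra).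
    apply Rmult_le_compat_l; auto. apply Rlt_le, Rdiv_lt_0_compat; lra. }
  assert (E2 : Cmod m * Cmod (g a - g b - l * (a - b)) <= e / 2 * Cmod (a - b)).
  { apply Rle_trans with ((Cmod m + 1) * (e / (2 * (Cmod m + 1)) * Cmod (a - b))).
    - apply Rmult_le_compat; auto; try lra. apply Cmod_ge_0.
    - right. field. lra. }
  lra.
Qed.

Lemma sderiv_mult f g z l m : sderiv f z l -> sderiv g z m ->
  sderiv (fun x => f x * g x)%C z (l * g z + f z * m).
Proof.
  intros Hf Hg e He.
  set (K := (Cmod l + Cmod m + Cmod (f z) + Cmod (g z) + 1)%R).
  pose proof (Cmod_ge_0 l) as Kl. pose proof (Cmod_ge_0 m) as Km.
  pose proof (Cmod_ge_0 (f z)) as Kf. pose proof (Cmod_ge_0 (g z)) as Kg.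
  set (k := e / (4 * K)).
  assert (HK : 0 < K) by (unfold K; lra).
  assert (Hk : 0 < k) by (apply Rdiv_lt_0_compat; lra).
  assert (HkK : K * k = e / 4) by (unfold k; field; lra).
  destruct (Hf k Hk) as [d1 [Hd1 H1]].
  destruct (Hg k Hk) as [d2 [Hd2 H2]].
  destruct (sderiv_cont f z l Hf (Rmin k 1)) as [d3 [Hd3 H3]]; [apply Rmin_pos; lra|].
  destruct (sderiv_cont g z m Hg (Rmin k 1)) as [d4 [Hd4 H4]]; [apply Rmin_pos; lra|].
  exists (Rmin (Rmin d1 d2) (Rmin d3 d4)). split; [repeat apply Rmin_pos; auto|].
  assert (Q : forall a, Cmod (a - z) < Rmin (Rmin d1 d2) (Rmin d3 d4) ->
    Cmod (a - z) < d1 /\ Cmod (a - z) < d2 /\ Cmod (f a - f z) < k /\ Cmod (g a - g z) < k /\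
    Cmod (f a) <= K /\ Cmod (g a) <= K).
  { intros a Ha.
    assert (Ha1 := Rlt_le_trans _ _ _ Ha (Rmin_l _ _)).
    assert (Ha3 := Rlt_le_trans _ _ _ Ha (Rmin_r _ _)).
    assert (Ba := Rlt_le_trans _ _ _ Ha1 (Rmin_l _ _)).
    assert (Bb := Rlt_le_trans _ _ _ Ha1 (Rmin_r _ _)).
    specialize (H3 a (Rlt_le_trans _ _ _ Ha3 (Rmin_l _ _))).
    specialize (H4 a (Rlt_le_trans _ _ _ Ha3 (Rmin_r _ _))).
    pose proof (Rmin_l k 1). pose proof (Rmin_r k 1).
    pose proof (Cmod_le_minus (f a) (f z)). pose proof (Cmod_le_minus (g a) (g z)).
    repeat split; auto; unfold K; lra. }
  intros a b Ha Hb.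
  destruct (Q a Ha) as [A1 [A2 [A3 [A4 [A5 A6]]]]].
  destruct (Q b Hb) as [B1 [B2 [B3 [B4 [B5 B6]]]]].
  specialize (H1 a b A1 B1). specialize (H2 a b A2 B2).
  replace (f a * g a - f b * g b - (l * g z + f z * m) * (a - b))%C
    with (((f a - f b - l * (a - b)) * g a + (g a - g z) * (l * (a - b))) +
          (f b * (g a - g b - m * (a - b)) + (f b - f z) * (m * (a - b))))%C by ring.
  pose proof (Cmod_ge_0 (a - b)) as Hab.
  assert (E : forall x y, 0 <= x -> x <= K -> 0 <= y -> y <= k * Cmod (a - b) ->
    x * y <= e / 4 * Cmod (a - b)).
  { intros x y Hx1 Hx2 Hy1 Hy2. rewrite <- HkK, Rmult_assoc.
    apply Rmult_le_compat; auto. }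
  eapply Rle_trans; [apply Cmod_triangle|].
  pose proof (Cmod_triangle ((f a - f b - l * (a - b)) * g a) ((g a - g z) * (l * (a - b)))) as T1.
  pose proof (Cmod_triangle (f b * (g a - g b - m * (a - b))) ((f b - f z) * (m * (a - b)))) as T2.
  rewrite !Cmod_mult in T1, T2.
  assert (F1 : Cmod (g a) * Cmod (f a - f b - l * (a - b)) <= e / 4 * Cmod (a - b))
    by (apply E; auto using Cmod_ge_0).
  assert (F2 : Cmod (f b) * Cmod (g a - g b - m * (a - b)) <= e / 4 * Cmod (a - b))
    by (apply E; auto using Cmod_ge_0).
  assert (F3 : Cmod l * (Cmod (g a - g z) * Cmod (a - b)) <= e / 4 * Cmod (a - b)).
  { apply E; auto. unfold K; lra. apply Rmult_le_pos; auto using Cmod_ge_0.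
    apply Rmult_le_compat_r; lra. }
  assert (F4 : Cmod m * (Cmod (f b - f z) * Cmod (a - b)) <= e / 4 * Cmod (a - b)).
  { apply E; auto. unfold K; lra. apply Rmult_le_pos; auto using Cmod_ge_0.
    apply Rmult_le_compat_r; lra. }
  lra.
Qed.

Lemma sderiv_inv (z : C) : z <> 0%C -> sderiv (fun x => / x)%C z (- / (z * z)).
Proof.
  intros Hz e He. set (m := Cmod z).
  assert (Hm : 0 < m) by (apply Cmod_gt_0; auto).
  exists (Rmin (m / 2) (e * (m * m * m) / 12)). split.
  { apply Rmin_pos; [lra|]. apply Rdiv_lt_0_compat; [|lra]. repeat apply Rmult_lt_0_compat; auto. }
  set (d := Rmin (m / 2) (e * (m * m * m) / 12)).
  assert (D1 : d <= m / 2) by apply Rmin_l.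
  assert (D2 : d <= e * (m * m * m) / 12) by apply Rmin_r.
  intros a b Ha Hb.
  pose proof (Cmod_le_minus z a) as Pa. rewrite Cmod_minus_sym in Pa.
  pose proof (Cmod_le_minus z b) as Pb. rewrite Cmod_minus_sym in Pb.
  pose proof (Cmod_le_minus a z) as Qa. fold m in Pa, Pb, Qa.
  assert (a <> 0%C) by (apply Cmod_neq_0; lra).
  assert (b <> 0%C) by (apply Cmod_neq_0; lra).
  replace (/ a - / b - - / (z * z) * (a - b))%C
    with ((a - b) * ((a * (b - z) + z * (a - z)) / (z * z * (a * b))))%C by (field; auto).
  rewrite Cmod_mult, Rmult_comm. apply Rmult_le_compat_r; [apply Cmod_ge_0|].
  rewrite Cmod_div, !Cmod_mult; [|repeat apply Cmult_neq_0; auto]. fold m.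
  apply Rle_div_l.
  - assert (0 < Cmod a) by lra. assert (0 < Cmod b) by lra.
    repeat apply Rmult_lt_0_compat; auto.
  - assert (T : Cmod (a * (b - z) + z * (a - z)) <= 3 * m * d).
    { eapply Rle_trans; [apply Cmod_triangle|]. rewrite !Cmod_mult. fold m.
      pose proof (Cmod_ge_0 (a - z)). pose proof (Cmod_ge_0 (b - z)). nra. }
    apply Rle_trans with (1 := T).
    apply Rle_trans with (e * (m * m * (m / 2 * (m / 2)))).
    + replace (e * (m * m * (m / 2 * (m / 2)))) with (3 * m * (e * (m * m * m) / 12)) by field.
      apply Rmult_le_compat_l; lra.
    + apply Rmult_le_compat_l; [lra|]. apply Rmult_le_compat_l; [nra|].
      apply Rmult_le_compat; lra.
Qed.

Lemma sderiv_eq f z l m : l = m -> sderiv f z l -> sderiv f z m.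
Proof. intros <-. auto. Qed.

Lemma sdiff_const (c z : C) : sdiff (fun _ => c) z.
Proof. eexists. apply sderiv_const. Qed.

Lemma sdiff_id (z : C) : sdiff (fun x => x) z.
Proof. eexists. apply sderiv_id. Qed.

Lemma sdiff_plus f g z : sdiff f z -> sdiff g z -> sdiff (fun x => f x + g x)%C z.
Proof. intros [l Hl] [m Hm]. eexists. apply sderiv_plus; eauto. Qed.

Lemma sdiff_mult f g z : sdiff f z -> sdiff g z -> sdiff (fun x => f x * g x)%C z.
Proof. intros [l Hl] [m Hm]. eexists. apply sderiv_mult; eauto. Qed.

Lemma sdiff_comp f g z : sdiff g z -> sdiff f (g z) -> sdiff (fun x => f (g x)) z.
Proof. intros [l Hl] [m Hm]. eexists. apply sderiv_comp; eauto. Qed.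

Lemma sderiv_opp f z l : sderiv f z l -> sderiv (fun x => - f x)%C z (- l).
Proof.
  intros H. apply sderiv_ext with (f := fun x => (-(1) * f x)%C).
  { intros x. ring. }
  apply sderiv_eq with (0 * f z + -(1) * l)%C.
  { ring. }
  apply (sderiv_mult (fun _ => (-(1))%C) f); auto using sderiv_const.
Qed.

Lemma sdiff_opp f z : sdiff f z -> sdiff (fun x => - f x)%C z.
Proof. intros [l H]. eexists. apply sderiv_opp; eauto. Qed.

Lemma sderiv_minus f g z l m : sderiv f z l -> sderiv g z m ->
  sderiv (fun x => f x - g x)%C z (l - m).
Proof. intros Hf Hg. apply (sderiv_plus f (fun x => - g x)%C); auto using sderiv_opp. Qed.

Lemma sdiff_minus f g z : sdiff f z -> sdiff g z -> sdiff (fun x => f x - g x)%C z.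
Proof. intros [l Hl] [m Hm]. eexists. apply sderiv_minus; eauto. Qed.

Lemma sdiff_inv f z : sdiff f z -> f z <> 0%C -> sdiff (fun x => / f x)%C z.
Proof.
  intros H Hz. apply (sdiff_comp (fun x => / x)%C f); auto.
  eexists. apply sderiv_inv; auto.
Qed.

Lemma sdiff_div f g z : sdiff f z -> sdiff g z -> g z <> 0%C -> sdiff (fun x => f x / g x)%C z.
Proof. intros Hf Hg Hz. apply (sdiff_mult f (fun x => / g x)%C); auto using sdiff_inv. Qed.

Lemma sdiff_pow f z n : sdiff f z -> sdiff (fun x => f x ^ n)%C z.
Proof.
  intros H. induction n as [|n IH].
  - apply (sdiff_const 1).
  - apply (sdiff_mult f (fun x => f x ^ n)%C); auto.
Qed.

(** Comparing both linear approximations at [z] and [z + h] with a small real [h] isolates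
    [(m - l) * h]. This converts a Lipschitz bound near [z] into a bound on derivatives. *)
Lemma sderiv_approx f z l m r e : sderiv f z m -> 0 < r ->
  (forall a b, Cmod (a - z) < r -> Cmod (b - z) < r ->
    Cmod (f a - f b - l * (a - b)) <= e * Cmod (a - b)) -> Cmod (m - l) <= e.
Proof.
  intros H Hr He. apply le_epsilon. intros k Hk.
  destruct (H k Hk) as [d [Hd H1]].
  set (h := Rmin d r / 2).
  assert (Hm : 0 < Rmin d r) by (apply Rmin_pos; auto).
  assert (h < d) by (unfold h; pose proof (Rmin_l d r); lra).
  assert (h < r) by (unfold h; pose proof (Rmin_r d r); lra).
  assert (Hh : 0 < h) by (unfold h; lra).
  assert (Ch : Cmod (RtoC h) = h) by (rewrite Cmod_R; apply Rabs_pos_eq; lra).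
  assert (A : (z + RtoC h - z = RtoC h)%C) by ring.
  assert (B : (z - z = 0)%C) by ring.
  specialize (H1 (z + RtoC h)%C z). specialize (He (z + RtoC h)%C z).
  rewrite A, B, Ch, Cmod_0 in *.
  specialize (H1 ltac:(auto) Hd). specialize (He ltac:(auto) Hr).
  pose proof (Cmod_minus_triangle (f (z + RtoC h)%C - f z - l * RtoC h) (f (z + RtoC h)%C - f z - m * RtoC h)) as T.
  replace (f (z + RtoC h) - f z - l * RtoC h - (f (z + RtoC h) - f z - m * RtoC h))%C
    with ((m - l) * RtoC h)%C in T by ring.
  rewrite Cmod_mult, Ch in T. nra.
Qed.

(* [Der f z] is junk unless [sdiff f z]. *)
Definition Der (f : C -> C) (z : C) : C := epsilon (inhabits (RtoC 0)) (sderiv f z).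

Lemma Der_spec f z : sdiff f z -> sderiv f z (Der f z).
Proof. intros H. unfold Der. apply epsilon_spec. exact H. Qed.

(** The strict approximation at [z] is valid for all pairs of points near [z'], so [sderiv_approx]
    bounds the derivative at [z']. Continuity of the derivative is thus built into [sderiv]. *)
Lemma Der_cont f z e : sdiff f z -> 0 < e -> exists d, 0 < d /\
  forall z', Cmod (z' - z) < d -> sdiff f z' -> Cmod (Der f z' - Der f z) <= e.
Proof.
  intros H He. destruct (Der_spec f z H e He) as [d [Hd H1]].
  exists d. split; auto. intros z' Hz' H'.
  apply (sderiv_approx f z' (Der f z) (Der f z') (d - Cmod (z' - z))); [apply Der_spec; auto|lra|].
  intros a b Ha Hb. apply H1.
  - pose proof (Cmod_minus_le a z' z). lra.
  - pose proof (Cmod_minus_le b z' z). lra.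
Qed.

(** * Paths and their integrals *)

(** Compactness of [[0, 1]] as a passage from local to uniform radii. Monotonicity in [d] lets the
    common radius replace the local ones. *)
Lemma compact01 (P : R -> R -> Prop) :
  (forall t, 0 <= t <= 1 -> exists d, 0 < d /\
    forall t', 0 <= t' <= 1 -> Rabs (t' - t) < d -> P t' d) ->
  (forall t d d', 0 < d' <= d -> P t d -> P t d') ->
  exists d, 0 < d /\ forall t, 0 <= t <= 1 -> P t d.
Proof.
  intros H Hmono.
  assert (H' : forall t, exists d : posreal, 0 <= t <= 1 ->
    forall t', 0 <= t' <= 1 -> Rabs (t' - t) < d -> P t' d).
  { intros t. destruct (excluded_middle_informative (0 <= t <= 1)) as [Ht|Ht].
    - destruct (H t Ht) as [d [Hd H1]]. exists (mkposreal d Hd). auto.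
    - exists (mkposreal 1 Rlt_0_1). tauto. }
  destruct (choice _ H') as [delta Hdelta].
  destruct (compactness_value_1d 0 1 delta) as [d Hd].
  exists d. split; [apply cond_pos|]. intros t Ht.
  apply NNPP. intros HP. apply (Hd t Ht). intros [s [Hs [H1 H2]]]. apply HP.
  apply Hmono with (delta s); [split; [apply cond_pos|auto]|].
  apply (Hdelta s Hs t Ht H1).
Qed.

Definition ccont (p : R -> C) : Prop := forall t, 0 <= t <= 1 -> forall e, 0 < e ->
  exists d, 0 < d /\ forall t', 0 <= t' <= 1 -> Rabs (t' - t) < d -> Cmod (p t' - p t) < e.

Definition rderiv (p : R -> C) (t : R) (l : C) : Prop := forall e, 0 < e ->
  exists d, 0 < d /\ forall h, Rabs h < d -> Cmod (p (t + h)%R - p t - l * RtoC h) <= e * Rabs h.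

Definition CI (p : R -> C) : C := (RInt (fun t => Re (p t)) 0 1, RInt (fun t => Im (p t)) 0 1).

(** Freezing a path outside [[0, 1]] makes it continuous on the whole line, so that integration
    theorems with two-sided hypotheses apply up to the endpoints. *)
Definition clamp (t : R) : R := Rmax 0 (Rmin t 1).

Lemma clamp_in t : 0 <= clamp t <= 1.
Proof.
  unfold clamp. split; [apply Rmax_l|]. apply Rmax_lub; [lra|apply Rmin_r].
Qed.

Lemma clamp_id t : 0 <= t <= 1 -> clamp t = t.
Proof. intros H. unfold clamp. rewrite Rmin_left, Rmax_right; lra. Qed.

Lemma clamp_lip s t : Rabs (clamp s - clamp t) <= Rabs (s - t).
Proof.
  unfold clamp, Rmax, Rmin. repeat destruct Rle_dec; unfold Rabs; repeat destruct Rcase_abs; lra.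
Qed.

Lemma ccont_clamp_continuous (p : R -> C) (g : C -> R) :
  (forall x y, Rabs (g x - g y) <= Cmod (x - y)) -> ccont p ->
  forall t, continuous (fun t => g (p (clamp t))) t.
Proof.
  intros Hg H t. apply continuity_pt_filterlim. intros e He.
  destruct (H (clamp t) (clamp_in t) e He) as [d [Hd H1]].
  exists d. split; auto. intros x [_ Hx]. simpl in *. unfold R_dist in *.
  eapply Rle_lt_trans; [apply Hg|]. apply H1; [apply clamp_in|].
  eapply Rle_lt_trans; [apply clamp_lip|]. auto.
Qed.

Lemma Re_lip x y : Rabs (Re x - Re y) <= Cmod (x - y).
Proof. replace (Re x - Re y) with (Re (x - y)%C) by (unfold Re; simpl; ring). apply Re_le_Cmod. Qed.

Lemma Im_lip x y : Rabs (Im x - Im y) <= Cmod (x - y).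
Proof. replace (Im x - Im y) with (Im (x - y)%C) by (unfold Im; simpl; ring). apply Im_le_Cmod. Qed.

Lemma ccont_ex_RInt (p : R -> C) (g : C -> R) :
  (forall x y, Rabs (g x - g y) <= Cmod (x - y)) -> ccont p ->
  ex_RInt (fun t => g (p t)) 0 1.
Proof.
  intros Hg H. apply ex_RInt_ext with (fun t => g (p (clamp t))).
  - intros x. rewrite Rmin_left, Rmax_right by lra. intros Hx. rewrite clamp_id; auto; lra.
  - apply (ex_RInt_continuous (V := R_CompleteNormedModule)).
    intros z _. apply ccont_clamp_continuous; auto.
Qed.

Lemma CI_ext p q : (forall t, 0 <= t <= 1 -> p t = q t) -> CI p = CI q.
Proof.
  intros H. unfold CI. f_equal; apply RInt_ext; intros x;
  rewrite Rmin_left, Rmax_right by lra; intros Hx; rewrite H; auto; lra.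
Qed.

Lemma CI_plus p q : ccont p -> ccont q -> CI (fun t => p t + q t)%C = (CI p + CI q)%C.
Proof.
  intros Hp Hq. unfold CI. apply injective_projections; simpl.
  - rewrite <- (RInt_plus (V := R_CompleteNormedModule)); auto using ccont_ex_RInt, Re_lip.
  - rewrite <- (RInt_plus (V := R_CompleteNormedModule)); auto using ccont_ex_RInt, Im_lip.
Qed.

Lemma CI_scal (c : C) p : ccont p -> CI (fun t => c * p t)%C = (c * CI p)%C.
Proof.
  intros Hp.
  assert (A := ccont_ex_RInt p Re Re_lip Hp). assert (B := ccont_ex_RInt p Im Im_lip Hp).
  destruct c as [x y]. unfold CI.
  assert (S : forall k g, ex_RInt g 0 1 -> RInt (fun t => k * g t) 0 1 = k * RInt g 0 1).
  { intros k g Hg. apply (RInt_scal (V := R_CompleteNormedModule) g 0 1 k Hg). }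
  assert (S' : forall k g, ex_RInt g 0 1 -> ex_RInt (fun t => k * g t) 0 1).
  { intros k g Hg. apply (ex_RInt_scal (V := R_CompleteNormedModule) g 0 1 k Hg). }
  apply injective_projections; simpl.
  - transitivity (RInt (fun t => minus (x * Re (p t)) (y * Im (p t))) 0 1); [reflexivity|].
    rewrite (RInt_minus (V := R_CompleteNormedModule)); auto. rewrite !S; auto.
  - transitivity (RInt (fun t => plus (x * Im (p t)) (y * Re (p t))) 0 1); [reflexivity|].
    rewrite (RInt_plus (V := R_CompleteNormedModule)); auto. rewrite !S; auto.
Qed.

Lemma ccont_const c : ccont (fun _ => c).
Proof.
  intros t _ e He. exists 1. split; [lra|]. intros. replace (c - c)%C with (RtoC 0) by ring.
  rewrite Cmod_0; auto.
Qed.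

Lemma ccont_comp (f : C -> C) p : (forall t, 0 <= t <= 1 -> sdiff f (p t)) -> ccont p ->
  ccont (fun t => f (p t)).
Proof.
  intros Hf Hp t Ht e He. destruct (sdiff_cont f (p t) (Hf t Ht) e He) as [d [Hd H1]].
  destruct (Hp t Ht d Hd) as [d' [Hd' H2]]. exists d'. auto.
Qed.

Lemma ccont_plus p q : ccont p -> ccont q -> ccont (fun t => p t + q t)%C.
Proof.
  intros Hp Hq t Ht e He.
  destruct (Hp t Ht (e / 2)) as [d1 [Hd1 H1]]; [lra|].
  destruct (Hq t Ht (e / 2)) as [d2 [Hd2 H2]]; [lra|].
  exists (Rmin d1 d2). split; [apply Rmin_pos; auto|]. intros t' Ht' Hd.
  specialize (H1 t' Ht' (Rlt_le_trans _ _ _ Hd (Rmin_l _ _))).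
  specialize (H2 t' Ht' (Rlt_le_trans _ _ _ Hd (Rmin_r _ _))).
  replace (p t' + q t' - (p t + q t))%C with ((p t' - p t) + (q t' - q t))%C by ring.
  eapply Rle_lt_trans; [apply Cmod_triangle|]. lra.
Qed.

Lemma ccont_mult p q : ccont p -> ccont q -> ccont (fun t => p t * q t)%C.
Proof.
  intros Hp Hq t Ht e He.
  set (K := Cmod (p t) + Cmod (q t) + 1).
  pose proof (Cmod_ge_0 (p t)) as A. pose proof (Cmod_ge_0 (q t)) as B.
  assert (HK : 0 < K) by (unfold K; lra).
  assert (Hk : 0 < Rmin 1 (e / (2 * K))).
  { apply Rmin_pos; [lra|]. apply Rdiv_lt_0_compat; lra. }
  destruct (Hp t Ht _ Hk) as [d1 [Hd1 H1]].
  destruct (Hq t Ht _ Hk) as [d2 [Hd2 H2]].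
  exists (Rmin d1 d2). split; [apply Rmin_pos; auto|]. intros t' Ht' Hd.
  specialize (H1 t' Ht' (Rlt_le_trans _ _ _ Hd (Rmin_l _ _))).
  specialize (H2 t' Ht' (Rlt_le_trans _ _ _ Hd (Rmin_r _ _))).
  pose proof (Rmin_l 1 (e / (2 * K))). pose proof (Rmin_r 1 (e / (2 * K))).
  replace (p t' * q t' - (p t * q t))%C with ((p t' - p t) * q t' + p t * (q t' - q t))%C by ring.
  eapply Rle_lt_trans; [apply Cmod_triangle|]. rewrite !Cmod_mult.
  pose proof (Cmod_le_minus (q t') (q t)) as Q.
  assert (E1 : Cmod (p t' - p t) * Cmod (q t') <= (Cmod (p t' - p t)) * K).
  { apply Rmult_le_compat_l; [apply Cmod_ge_0|]. unfold K. lra. }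
  assert (E2 : Cmod (p t) * Cmod (q t' - q t) <= K * Cmod (q t' - q t)).
  { apply Rmult_le_compat_r; [apply Cmod_ge_0|]. unfold K. lra. }
  assert (E3 : Cmod (p t' - p t) < e / (2 * K)) by lra.
  assert (E4 : Cmod (q t' - q t) < e / (2 * K)) by lra.
  apply Rmult_lt_compat_r with (r := K) in E3; auto.
  apply Rmult_lt_compat_r with (r := K) in E4; auto.
  replace (e / (2 * K) * K) with (e / 2) in * by (field; lra). lra.
Qed.

Lemma ccont_opp p : ccont p -> ccont (fun t => - p t)%C.
Proof.
  intros H. apply (ccont_comp (fun x => - x)%C); auto.
  intros t _. apply sdiff_opp, sdiff_id.
Qed.

Lemma ccont_minus p q : ccont p -> ccont q -> ccont (fun t => p t - q t)%C.
Proof. intros Hp Hq. apply (ccont_plus p (fun t => - q t)%C); auto using ccont_opp. Qed.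

Lemma ccont_inv p : ccont p -> (forall t, 0 <= t <= 1 -> p t <> 0%C) -> ccont (fun t => / p t)%C.
Proof.
  intros H Hp. apply (ccont_comp (fun x => / x)%C); auto.
  intros t Ht. apply (sdiff_inv (fun x => x)); auto using sdiff_id.
Qed.

Lemma ccont_div p q : ccont p -> ccont q -> (forall t, 0 <= t <= 1 -> q t <> 0%C) ->
  ccont (fun t => p t / q t)%C.
Proof. intros Hp Hq H. apply (ccont_mult p (fun t => / q t)%C); auto using ccont_inv. Qed.

Lemma ccont_pow p n : ccont p -> ccont (fun t => p t ^ n)%C.
Proof.
  intros H. induction n; simpl; auto using ccont_const, ccont_mult.
Qed.

Lemma ccont_ext p q : (forall t, 0 <= t <= 1 -> p t = q t) -> ccont p -> ccont q.
Proof.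
  intros E H t Ht e He. destruct (H t Ht e He) as [d [Hd H1]]. exists d. split; auto.
  intros t' Ht' Hd'. rewrite <- !E; auto.
Qed.

Lemma CI_minus p q : ccont p -> ccont q -> CI (fun t => p t - q t)%C = (CI p - CI q)%C.
Proof.
  intros Hp Hq.
  transitivity (CI (fun t => p t + (-(1)) * q t)%C); [apply CI_ext; intros; ring|].
  rewrite CI_plus, CI_scal; auto using ccont_mult, ccont_const. ring.
Qed.

(** The factor 2 comes from bounding real and imaginary parts separately; it propagates to every
    Cauchy estimate below. *)
Lemma CI_bound p M : ccont p -> (forall t, 0 <= t <= 1 -> Cmod (p t) <= M) -> Cmod (CI p) <= 2 * M.
Proof.
  intros Hp HM. eapply Rle_trans; [apply Cmod_le_Re_Im|]. simpl.
  assert (A : Rabs (RInt (fun t => Re (p t)) 0 1) <= (1 - 0) * M).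
  { apply abs_RInt_le_const; [lra|auto using ccont_ex_RInt, Re_lip|].
    intros t Ht. eapply Rle_trans; [apply Re_le_Cmod|auto]. }
  assert (B : Rabs (RInt (fun t => Im (p t)) 0 1) <= (1 - 0) * M).
  { apply abs_RInt_le_const; [lra|auto using ccont_ex_RInt, Im_lip|].
    intros t Ht. eapply Rle_trans; [apply Im_le_Cmod|auto]. }
  lra.
Qed.

Lemma rderiv_component (g : C -> R) p t l : (forall x y, g (x - y)%C = g x - g y) ->
  (forall x h, g (x * RtoC h)%C = g x * h) -> (forall x, Rabs (g x) <= Cmod x) ->
  rderiv p t l -> is_derive (fun t => g (p t)) t (g l).
Proof.
  intros G1 G2 G3 H. apply is_derive_Reals. intros e He.
  destruct (H (e / 2)) as [d [Hd H1]]; [lra|]. exists (mkposreal d Hd). simpl.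
  intros h Hh Hhd. specialize (H1 h Hhd).
  pose proof (G3 (p (t + h)%R - p t - l * RtoC h)%C) as B. rewrite !G1, G2 in B.
  replace ((g (p (t + h)) - g (p t)) / h - g l) with ((g (p (t + h)) - g (p t) - g l * h) / h) by (field; auto).
  unfold Rdiv. rewrite Rabs_mult, Rabs_inv. apply Rabs_pos_lt in Hh.
  apply Rle_lt_trans with (e / 2); [|lra]. apply Rle_div_l; auto. lra.
Qed.

Lemma rderiv_Re p t l : rderiv p t l -> is_derive (fun t => Re (p t)) t (Re l).
Proof.
  apply rderiv_component; intros; unfold Re, Im; simpl; try ring; apply Re_le_Cmod.
Qed.

Lemma rderiv_Im p t l : rderiv p t l -> is_derive (fun t => Im (p t)) t (Im l).
Proof.
  apply rderiv_component; intros; unfold Re, Im; simpl; try ring; apply Im_le_Cmod.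
Qed.

Lemma CI_FTC (F p : R -> C) : (forall t, 0 <= t <= 1 -> rderiv F t (p t)) -> ccont p ->
  CI p = (F 1 - F 0)%C.
Proof.
  intros H Hp.
  assert (K : forall g : C -> R, (forall x y, Rabs (g x - g y) <= Cmod (x - y)) ->
    (forall t, 0 <= t <= 1 -> is_derive (fun t => g (F t)) t (g (p t))) ->
    RInt (fun t => g (p t)) 0 1 = g (F 1) - g (F 0)).
  { intros g Hg HF. transitivity (RInt (fun t => g (p (clamp t))) 0 1).
    - apply RInt_ext. intros x. rewrite Rmin_left, Rmax_right by lra. intros Hx.
      rewrite clamp_id; auto; lra.
    - apply is_RInt_unique.
      apply (is_RInt_derive (V := R_CompleteNormedModule) (fun t => g (F t))); intros x;
        rewrite Rmin_left, Rmax_right by lra; intros Hx.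
      + rewrite clamp_id by auto. auto.
      + apply ccont_clamp_continuous; auto. }
  unfold CI. apply injective_projections; simpl.
  - rewrite K; auto using Re_lip. intros; apply rderiv_Re; auto.
  - rewrite K; auto using Im_lip. intros; apply rderiv_Im; auto.
Qed.

Lemma rderiv_zero_const (F : R -> C) S : 0 < S -> (forall t, 0 <= t <= S -> rderiv F t 0) ->
  F S = F 0.
Proof.
  intros HS H. apply injective_projections; symmetry.
  - apply (eq_is_derive (V := R_NormedModule) (fun t => Re (F t))); auto.
    intros t Ht. apply (rderiv_Re F t 0); auto.
  - apply (eq_is_derive (V := R_NormedModule) (fun t => Im (F t))); auto.
    intros t Ht. apply (rderiv_Im F t 0); auto.
Qed.

Lemma rderiv_comp (f : C -> C) p t l m : rderiv p t l -> sderiv f (p t) m ->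
  rderiv (fun t => f (p t)) t (m * l).
Proof.
  intros Hp Hf e He.
  pose proof (Cmod_ge_0 l) as Hl. pose proof (Cmod_ge_0 m) as Hm.
  destruct (Hp 1 Rlt_0_1) as [d0 [Hd0 H0]].
  destruct (Hf (e / (2 * (Cmod l + 1)))) as [d1 [Hd1 H1]].
  { apply Rdiv_lt_0_compat; lra. }
  destruct (Hp (e / (2 * (Cmod m + 1)))) as [d2 [Hd2 H2]].
  { apply Rdiv_lt_0_compat; lra. }
  exists (Rmin (Rmin d0 d2) (d1 / (Cmod l + 1))). split.
  { repeat apply Rmin_pos; auto. apply Rdiv_lt_0_compat; lra. }
  intros h Hh.
  assert (A1 := Rlt_le_trans _ _ _ Hh (Rmin_l _ _)).
  assert (A3 := Rlt_le_trans _ _ _ Hh (Rmin_r _ _)).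
  specialize (H0 h (Rlt_le_trans _ _ _ A1 (Rmin_l _ _))).
  specialize (H2 h (Rlt_le_trans _ _ _ A1 (Rmin_r _ _))).
  assert (B : Cmod (p (t + h)%R - p t) <= (Cmod l + 1) * Rabs h).
  { pose proof (Cmod_le_minus (p (t + h)%R - p t) (l * RtoC h)) as T.
    rewrite Cmod_mult, Cmod_R in T. lra. }
  assert (Bd : Cmod (p (t + h)%R - p t) < d1).
  { apply Rle_lt_trans with (1 := B). apply Rmult_lt_compat_l with (r := Cmod l + 1) in A3; [|lra].
    replace ((Cmod l + 1) * (d1 / (Cmod l + 1))) with d1 in A3 by (field; lra). auto. }
  specialize (H1 (p (t + h)%R) (p t) Bd).
  replace (p t - p t)%C with (RtoC 0) in H1 by ring. rewrite Cmod_0 in H1. specialize (H1 Hd1).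
  replace (f (p (t + h)%R) - f (p t) - m * l * RtoC h)%C
    with ((f (p (t + h)%R) - f (p t) - m * (p (t + h)%R - p t)) + m * (p (t + h)%R - p t - l * RtoC h))%C by ring.
  eapply Rle_trans; [apply Cmod_triangle|]. rewrite Cmod_mult.
  pose proof (Rabs_pos h) as Hab.
  assert (E1 : e / (2 * (Cmod l + 1)) * Cmod (p (t + h)%R - p t) <= e / 2 * Rabs h).
  { replace (e / 2 * Rabs h) with (e / (2 * (Cmod l + 1)) * ((Cmod l + 1) * Rabs h)) by (field; lra).
    apply Rmult_le_compat_l; auto. apply Rlt_le, Rdiv_lt_0_compat; lra. }
  assert (E2 : Cmod m * Cmod (p (t + h)%R - p t - l * RtoC h) <= e / 2 * Rabs h).
  { apply Rle_trans with ((Cmod m + 1) * (e / (2 * (Cmod m + 1)) * Rabs h)).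
    - apply Rmult_le_compat; auto; try lra. apply Cmod_ge_0.
    - right. field. lra. }
  lra.
Qed.

Lemma rderiv_pair (x y : R -> R) t a b : is_derive x t a -> is_derive y t b ->
  rderiv (fun t => (x t, y t)) t (a, b).
Proof.
  intros Hx Hy e He. apply is_derive_Reals in Hx, Hy.
  destruct (Hx (e / 2)) as [d1 H1]; [lra|]. destruct (Hy (e / 2)) as [d2 H2]; [lra|].
  exists (Rmin d1 d2). split; [apply Rmin_pos; apply cond_pos|]. intros h Hh.
  specialize (H1 h). specialize (H2 h).
  assert (K : forall g c, (h <> 0 -> Rabs ((g (t + h) - g t) / h - c) < e / 2) ->
    Rabs (g (t + h) - g t - c * h) <= e / 2 * Rabs h).
  { intros g c Hg. destruct (Req_dec h 0) as [->|Hn].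
    - rewrite Rplus_0_r. replace (g t - g t - c * 0) with 0 by ring. rewrite Rabs_R0. lra.
    - specialize (Hg Hn).
      replace (g (t + h) - g t - c * h) with (((g (t + h) - g t) / h - c) * h) by (field; auto).
      rewrite Rabs_mult. apply Rmult_le_compat_r; [apply Rabs_pos|lra]. }
  eapply Rle_trans; [apply Cmod_le_Re_Im|]. simpl.
  pose proof (K x a (fun Hn => H1 Hn (Rlt_le_trans _ _ _ Hh (Rmin_l _ _)))) as K1.
  pose proof (K y b (fun Hn => H2 Hn (Rlt_le_trans _ _ _ Hh (Rmin_r _ _)))) as K2.
  replace (x (t + h) + - x t + - (a * h - b * 0)) with (x (t + h) - x t - a * h) by ring.
  replace (y (t + h) + - y t + - (a * 0 + b * h)) with (y (t + h) - y t - b * h) by ring.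
  lra.
Qed.

Lemma rderiv_ccont p : (forall t, 0 <= t <= 1 -> exists l, rderiv p t l) -> ccont p.
Proof.
  intros H t Ht e He. destruct (H t Ht) as [l Hl]. destruct (Hl 1 Rlt_0_1) as [d [Hd H1]].
  pose proof (Cmod_ge_0 l) as L.
  exists (Rmin d (e / (Cmod l + 1))). split.
  { apply Rmin_pos; auto. apply Rdiv_lt_0_compat; lra. }
  intros t' _ Hd'. specialize (H1 (t' - t) (Rlt_le_trans _ _ _ Hd' (Rmin_l _ _))).
  replace (t + (t' - t)) with t' in H1 by ring.
  pose proof (Cmod_le_minus (p t' - p t) (l * RtoC (t' - t))) as T.
  rewrite Cmod_mult, Cmod_R in T.
  pose proof (Rlt_le_trans _ _ _ Hd' (Rmin_r _ _)) as A3.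
  apply Rmult_lt_compat_l with (r := Cmod l + 1) in A3; [|lra].
  replace ((Cmod l + 1) * (e / (Cmod l + 1))) with e in A3 by (field; lra). lra.
Qed.

Lemma ccont_bounded p : ccont p -> exists M, 0 < M /\ forall t, 0 <= t <= 1 -> Cmod (p t) <= M.
Proof.
  intros H.
  destruct (compact01 (fun t d => Cmod (p t) <= / d)) as [d [Hd H1]].
  - intros t Ht. destruct (H t Ht 1 Rlt_0_1) as [d [Hd H1]].
    pose proof (Cmod_ge_0 (p t)) as P.
    assert (Q : 0 < / (Cmod (p t) + 1)) by (apply Rinv_0_lt_compat; lra).
    exists (Rmin d (/ (Cmod (p t) + 1))). split; [apply Rmin_pos; auto|].
    intros t' Ht' Hd'. specialize (H1 t' Ht' (Rlt_le_trans _ _ _ Hd' (Rmin_l _ _))).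
    pose proof (Cmod_le_minus (p t') (p t)).
    apply Rle_trans with (Cmod (p t) + 1); [lra|].
    rewrite <- (Rinv_inv (Cmod (p t) + 1)) at 1. apply Rinv_le_contravar; [apply Rmin_pos; auto|apply Rmin_r].
  - intros t d d' [H1 H2] H3. apply Rle_trans with (1 := H3). apply Rinv_le_contravar; auto.
  - exists (/ d). split; [apply Rinv_0_lt_compat; auto|auto].
Qed.

Lemma ccont_away p : ccont p -> (forall t, 0 <= t <= 1 -> p t <> 0%C) ->
  exists m, 0 < m /\ forall t, 0 <= t <= 1 -> m <= Cmod (p t).
Proof.
  intros H Hp. destruct (ccont_bounded (fun t => / p t)%C) as [M [HM H1]]; [apply ccont_inv; auto|].
  exists (/ M). split; [apply Rinv_0_lt_compat; auto|]. intros t Ht. specialize (H1 t Ht).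
  rewrite Cmod_inv in H1 by auto. pose proof (proj1 (Cmod_gt_0 _) (Hp t Ht)) as Q.
  rewrite <- (Rinv_inv (Cmod (p t))). apply Rinv_le_contravar; auto. apply Rinv_0_lt_compat; auto.
Qed.

(** * Cauchy's theorem by contraction of a path to a point *)

Definition homothety (c : C) (g : R -> C) (s t : R) : C := (c + RtoC s * (g t - c))%C.

Lemma homothety_ccont c g s : ccont g -> ccont (homothety c g s).
Proof.
  intros H. unfold homothety. apply (ccont_plus (fun _ => c)); auto using ccont_const.
  apply (ccont_mult (fun _ => RtoC s)); auto using ccont_const.
  apply (ccont_minus g (fun _ => c)); auto using ccont_const.
Qed.

Lemma Der_ccont f p : (forall t, 0 <= t <= 1 -> sdiff f (p t)) -> ccont p ->
  ccont (fun t => Der f (p t)).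
Proof.
  intros Hf Hp t Ht e He.
  destruct (Der_cont f (p t) (e / 2) (Hf t Ht)) as [d [Hd H1]]; [lra|].
  destruct (Hp t Ht d Hd) as [d' [Hd' H2]]. exists d'. split; auto.
  intros t' Ht' Hd''. apply Rle_lt_trans with (e / 2); [|lra]. apply H1; auto.
Qed.

Lemma sdiff_uniform f p e : 0 < e -> (forall t, 0 <= t <= 1 -> sdiff f (p t)) -> ccont p ->
  exists d, 0 < d /\ forall t, 0 <= t <= 1 -> forall a b, Cmod (a - p t) < d -> Cmod (b - p t) < d ->
    Cmod (f a - f b - Der f (p t) * (a - b)) <= e * Cmod (a - b).
Proof.
  intros He Hf Hp.
  apply (compact01 (fun t d => forall a b, Cmod (a - p t) < d -> Cmod (b - p t) < d ->
    Cmod (f a - f b - Der f (p t) * (a - b)) <= e * Cmod (a - b))).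
  - intros t Ht.
    destruct (Der_spec f (p t) (Hf t Ht) (e / 2)) as [d1 [Hd1 H1]]; [lra|].
    destruct (Der_cont f (p t) (e / 2) (Hf t Ht)) as [d2 [Hd2 H2]]; [lra|].
    destruct (Hp t Ht (Rmin (d1 / 2) d2)) as [d3 [Hd3 H3]]; [apply Rmin_pos; lra|].
    exists (Rmin (d1 / 2) d3). split; [apply Rmin_pos; lra|].
    intros t' Ht' Hd a b Ha Hb.
    specialize (H3 t' Ht' (Rlt_le_trans _ _ _ Hd (Rmin_r _ _))).
    pose proof (Rlt_le_trans _ _ _ H3 (Rmin_l _ _)). pose proof (Rlt_le_trans _ _ _ H3 (Rmin_r _ _)) as H4.
    pose proof (Rlt_le_trans _ _ _ Ha (Rmin_l _ _)). pose proof (Rlt_le_trans _ _ _ Hb (Rmin_l _ _)).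
    specialize (H2 _ H4 (Hf t' Ht')).
    pose proof (Cmod_minus_le a (p t') (p t)). pose proof (Cmod_minus_le b (p t') (p t)).
    specialize (H1 a b ltac:(lra) ltac:(lra)).
    replace (f a - f b - Der f (p t') * (a - b))%C
      with ((f a - f b - Der f (p t) * (a - b)) - (Der f (p t') - Der f (p t)) * (a - b))%C by ring.
    eapply Rle_trans; [apply Cmod_minus_triangle|]. rewrite Cmod_mult.
    pose proof (Cmod_ge_0 (a - b)). nra.
  - intros t d d' Hd H a b Ha Hb. apply H; lra.
Qed.

(** Differentiation under the integral cancels [g t - c] and leaves for [G] the integral of
    [Der f (p t) * g' t] along the contracted path [p]. Multiplied by [s], the integrand is the
    [t]-derivative of [f (p t)], so only endpoint values survive. This takes the place of Green's
    theorem. *)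
Lemma homothety_rderiv (f : C -> C) (g g' : R -> C) (c : C) (s : R) :
  (forall t, 0 <= t <= 1 -> rderiv g t (g' t)) -> ccont g' ->
  (forall t, 0 <= t <= 1 -> g t <> c) ->
  (forall t, 0 <= t <= 1 -> exists r, 0 < r /\ forall x, Cmod (x - homothety c g s t) < r -> sdiff f x) ->
  exists G,
    rderiv (fun s => CI (fun t => f (homothety c g s t) * (g' t / (g t - c)))%C) s G /\
    (RtoC s * G = f (homothety c g s 1) - f (homothety c g s 0))%C /\
    (s = 0 -> G = Der f c * (g 1 - g 0))%C.
Proof.
  intros Hg Hg' Hc Hs.
  assert (Cg : ccont g) by (apply rderiv_ccont; intros t Ht; eexists; apply Hg; auto).
  assert (Cgc : ccont (fun t => g t - c)%C) by (apply (ccont_minus g (fun _ => c)); auto using ccont_const).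
  assert (Cq : ccont (fun t => g' t / (g t - c))%C).
  { apply (ccont_div g' (fun t => g t - c)%C); auto. intros t Ht E. apply (Hc t Ht).
    replace (g t) with (g t - c + c)%C by ring. rewrite E. ring. }
  set (p := homothety c g s).
  assert (Cp : ccont p) by (apply homothety_ccont; auto).
  assert (Dp : forall t, 0 <= t <= 1 -> sdiff f (p t)).
  { intros t Ht. destruct (Hs t Ht) as [r [Hr H1]]. apply H1.
    fold p. replace (p t - p t)%C with (RtoC 0) by ring. rewrite Cmod_0; auto. }
  assert (Cdp : ccont (fun t => Der f (p t))) by (apply Der_ccont; auto).
  destruct (compact01 (fun t d => forall x, Cmod (x - p t) < d -> sdiff f x)) as [eta [Heta H1]].
  { intros t Ht. destruct (Hs t Ht) as [r [Hr H1]]. fold p in H1.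
    destruct (Cp t Ht (r / 2)) as [d [Hd H2]]; [lra|].
    exists (Rmin d (r / 2)). split; [apply Rmin_pos; lra|]. intros t' Ht' Hd' x Hx.
    apply H1. specialize (H2 t' Ht' (Rlt_le_trans _ _ _ Hd' (Rmin_l _ _))).
    pose proof (Rlt_le_trans _ _ _ Hx (Rmin_r _ _)). pose proof (Cmod_minus_le x (p t') (p t)). lra. }
  { intros t d d' Hd H x Hx. apply H. lra. }
  destruct (ccont_bounded _ Cgc) as [B [HB HB1]].
  destruct (ccont_bounded _ Hg') as [B' [HB' HB1']].
  set (G := CI (fun t => Der f (p t) * g' t)%C).
  assert (Hph : forall h t, (homothety c g (s + h) t - p t = RtoC h * (g t - c))%C).
  { intros h t. unfold p, homothety. rewrite RtoC_plus. ring. }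
  assert (Near : forall h d, 0 < d -> Rabs h < d / B -> forall t, 0 <= t <= 1 ->
    Cmod (homothety c g (s + h) t - p t) < d).
  { intros h d Hd Hh t Ht. rewrite Hph, Cmod_mult, Cmod_R.
    apply Rle_lt_trans with (Rabs h * B).
    - apply Rmult_le_compat_l; [apply Rabs_pos|auto].
    - apply Rlt_div_r; auto. }
  exists G. split; [|split].
  - intros e He.
    set (e' := e / (2 * B')). assert (He' : 0 < e') by (apply Rdiv_lt_0_compat; lra).
    destruct (sdiff_uniform f p e' He' Dp Cp) as [d [Hd H2]].
    exists (Rmin (eta / B) (d / B)). split; [apply Rmin_pos; apply Rdiv_lt_0_compat; lra|].
    intros h Hh.
    assert (Ch : ccont (fun t => f (homothety c g (s + h) t))).
    { apply ccont_comp; [|apply homothety_ccont; auto]. intros t Ht. apply (H1 t Ht).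
      apply Near; auto. apply Rlt_le_trans with (1 := Hh), Rmin_l. }
    assert (Cfp : ccont (fun t => f (p t))) by (apply ccont_comp; auto).
    unfold G. fold p.
    rewrite <- CI_minus; [|apply ccont_mult; auto..].
    replace (CI (fun t => Der f (p t) * g' t) * RtoC h)%C with (CI (fun t => RtoC h * (Der f (p t) * g' t)))%C.
    2: { rewrite CI_scal; [ring|]. apply ccont_mult; auto. }
    rewrite <- CI_minus.
    2: { apply ccont_minus; apply ccont_mult; auto. }
    2: { apply (ccont_mult (fun _ => RtoC h)); auto using ccont_const. apply ccont_mult; auto. }
    apply Rle_trans with (2 * (e' * Rabs h * B')).
    2: { right. unfold e'. field. lra. }
    apply CI_bound.
    + apply ccont_minus.
      * apply ccont_minus; apply ccont_mult; auto.
      * apply (ccont_mult (fun _ => RtoC h)); auto using ccont_const. apply ccont_mult; auto.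
    + intros t Ht.
      assert (Hn : (g t - c <> 0)%C).
      { intros E. apply (Hc t Ht). replace (g t) with (g t - c + c)%C by ring. rewrite E. ring. }
      replace (f (homothety c g (s + h) t) * (g' t / (g t - c)) - f (p t) * (g' t / (g t - c))
        - RtoC h * (Der f (p t) * g' t))%C
        with ((f (homothety c g (s + h) t) - f (p t) - Der f (p t) * (RtoC h * (g t - c))) * (g' t / (g t - c)))%C
        by (field; auto).
      rewrite <- (Hph h t).
      assert (Hpp : Cmod (p t - p t) < d).
      { replace (p t - p t)%C with (RtoC 0) by ring. rewrite Cmod_0; auto. }
      specialize (H2 t Ht (homothety c g (s + h) t) (p t)
        (Near h d Hd (Rlt_le_trans _ _ _ Hh (Rmin_r _ _)) t Ht) Hpp).
      rewrite Cmod_mult, Cmod_div by auto.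
      rewrite (Hph h t) in H2 at 2. rewrite Cmod_mult, Cmod_R in H2.
      pose proof (proj1 (Cmod_gt_0 _) Hn) as Hm.
      specialize (HB1' t Ht).
      apply Rle_trans with (e' * (Rabs h * Cmod (g t - c)) * (B' / Cmod (g t - c))).
      * apply Rmult_le_compat; auto using Cmod_ge_0.
        -- apply Rmult_le_pos; [apply Cmod_ge_0|]. apply Rlt_le, Rinv_0_lt_compat; auto.
        -- apply Rmult_le_compat_r; auto. apply Rlt_le, Rinv_0_lt_compat; auto.
      * right. field. lra.
  - unfold G. rewrite <- CI_scal by (apply ccont_mult; auto).
    fold p. rewrite <- (CI_FTC (fun t => f (p t)) (fun t => RtoC s * (Der f (p t) * g' t)))%C; auto.
    + intros t Ht. replace (RtoC s * (Der f (p t) * g' t))%C with (Der f (p t) * (RtoC s * g' t))%C by ring.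
      apply rderiv_comp; [|apply Der_spec; auto].
      unfold p, homothety. replace (RtoC s * g' t)%C with ((0 + ((0 * (g t - c)) + RtoC s * (1 - 0))) * g' t)%C by ring.
      apply (rderiv_comp (fun x => c + RtoC s * (x - c))%C g); auto.
      apply (sderiv_plus (fun _ => c)); [apply sderiv_const|].
      apply (sderiv_mult (fun _ => RtoC s) (fun x => x - c)%C); [apply sderiv_const|].
      apply (sderiv_minus (fun x => x) (fun _ => c)); [apply sderiv_id|apply sderiv_const].
    + apply (ccont_mult (fun _ => RtoC s)); auto using ccont_const. apply ccont_mult; auto.
  (* At [s = 0] the identity for [s * G] says nothing about [G]. Here [Der f] is constant along the
     degenerate path, which leaves the integral of [g']. *)
  - intros ->. unfold G.
    rewrite (CI_ext _ (fun t => Der f c * g' t)%C).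
    + rewrite CI_scal by auto. f_equal. apply CI_FTC; auto.
    + intros t Ht. f_equal. f_equal. unfold p, homothety. ring.
Qed.

Lemma rderiv_plus p q t l m : rderiv p t l -> rderiv q t m -> rderiv (fun t => p t + q t)%C t (l + m).
Proof.
  intros Hp Hq e He.
  destruct (Hp (e / 2)) as [d1 [Hd1 H1]]; [lra|]. destruct (Hq (e / 2)) as [d2 [Hd2 H2]]; [lra|].
  exists (Rmin d1 d2). split; [apply Rmin_pos; auto|]. intros h Hh.
  specialize (H1 h (Rlt_le_trans _ _ _ Hh (Rmin_l _ _))).
  specialize (H2 h (Rlt_le_trans _ _ _ Hh (Rmin_r _ _))).
  replace (p (t + h)%R + q (t + h)%R - (p t + q t) - (l + m) * RtoC h)%C
    with ((p (t + h)%R - p t - l * RtoC h) + (q (t + h)%R - q t - m * RtoC h))%C by ring.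
  eapply Rle_trans; [apply Cmod_triangle|]. lra.
Qed.

(** With [g 1 = g 0] the endpoint difference vanishes and the integral is constant in the scale; at
    scale 0 the factor [f c] comes out. This is Cauchy's formula up to the winding integral. *)
Lemma closed_homothety_const (f : C -> C) (g g' : R -> C) (c : C) (S : R) : 0 < S ->
  (forall t, 0 <= t <= 1 -> rderiv g t (g' t)) -> ccont g' ->
  (forall t, 0 <= t <= 1 -> g t <> c) -> g 1 = g 0 ->
  (forall s t, 0 <= s <= S -> 0 <= t <= 1 ->
    exists r, 0 < r /\ forall x, Cmod (x - homothety c g s t) < r -> sdiff f x) ->
  CI (fun t => f (homothety c g S t) * (g' t / (g t - c)))%C = (f c * CI (fun t => g' t / (g t - c)))%C.
Proof.
  intros HS Hg Hg' Hc Hclosed Hf.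
  rewrite (rderiv_zero_const (fun s => CI (fun t => f (homothety c g s t) * (g' t / (g t - c)))%C) S HS).
  - rewrite (CI_ext _ (fun t => f c * (g' t / (g t - c)))%C).
    + apply CI_scal. apply ccont_div; auto.
      * apply (ccont_minus g (fun _ => c)); auto using ccont_const.
        apply rderiv_ccont; intros t Ht; eexists; apply Hg; auto.
      * intros t Ht E. apply (Hc t Ht). replace (g t) with (g t - c + c)%C by ring. rewrite E. ring.
    + intros t _. f_equal. f_equal. unfold homothety. ring.
  - intros s Hs. destruct (homothety_rderiv f g g' c s Hg Hg' Hc (fun t => Hf s t Hs)) as [G [H1 [H2 H3]]].
    replace (RtoC 0) with G; auto.
    destruct (Req_dec s 0) as [Hs0|Hs0].
    + rewrite (H3 Hs0), Hclosed. ring.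
    + assert (E : homothety c g s 1 = homothety c g s 0) by (unfold homothety; rewrite Hclosed; auto).
      rewrite E in H2. assert (RtoC s <> 0%C) by (intros K; apply RtoC_inj in K; auto).
      replace G with (/ RtoC s * (RtoC s * G))%C by (field; auto). rewrite H2. field. auto.
Qed.

Definition circle (c : C) (r t : R) : C := (c + RtoC r * (cos (2 * PI * t), sin (2 * PI * t)))%C.
Definition circle' (r t : R) : C := (RtoC (2 * PI) * Ci * (RtoC r * (cos (2 * PI * t), sin (2 * PI * t))))%C.

Lemma circle_rderiv c r t : rderiv (circle c r) t (circle' r t).
Proof.
  replace (circle' r t) with (r * (- (2 * PI) * sin (2 * PI * t)), r * ((2 * PI) * cos (2 * PI * t)))%R.
  2: { unfold circle', Ci, RtoC. apply injective_projections; simpl; ring. }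
  assert (E : forall t, circle c r t = (fst c + r * cos (2 * PI * t), snd c + r * sin (2 * PI * t))%R).
  { intros u. unfold circle, RtoC. apply injective_projections; simpl; ring. }
  intros e He.
  destruct (rderiv_pair (fun t => fst c + r * cos (2 * PI * t))%R (fun t => snd c + r * sin (2 * PI * t))%R t
    (r * (- (2 * PI) * sin (2 * PI * t)))%R (r * ((2 * PI) * cos (2 * PI * t)))%R) with (e := e) as [d [Hd H]]; auto.
  - auto_derive; auto. ring.
  - auto_derive; auto. ring.
  - exists d. split; auto. intros h Hh. rewrite !E. apply H; auto.
Qed.

Lemma circle_dist c r t : 0 <= r -> Cmod (circle c r t - c) = r.
Proof.
  intros Hr. unfold circle.
  replace (c + RtoC r * (cos (2 * PI * t), sin (2 * PI * t)) - c)%C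
    with (RtoC r * (cos (2 * PI * t), sin (2 * PI * t)))%C by ring.
  rewrite Cmod_mult, Cmod_R, Rabs_pos_eq; auto.
  replace (Cmod (cos (2 * PI * t), sin (2 * PI * t))) with 1; [ring|].
  unfold Cmod. simpl. generalize (sin2_cos2 (2 * PI * t)). unfold Rsqr.
  rewrite !Rmult_1_r, Rplus_comm. intros ->. rewrite sqrt_1. auto.
Qed.

Lemma circle_closed c r : circle c r 1 = circle c r 0.
Proof.
  unfold circle. rewrite Rmult_1_r, Rmult_0_r, cos_2PI, sin_2PI, cos_0, sin_0. auto.
Qed.

Lemma circle_ccont c r : ccont (circle c r).
Proof. apply rderiv_ccont. intros; eexists; apply circle_rderiv. Qed.

Lemma circle'_ccont r : ccont (circle' r).
Proof.
  apply (ccont_ext (fun t => RtoC (2 * PI) * Ci * (circle 0 r t))%C).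
  { intros. unfold circle, circle'. ring. }
  apply (ccont_mult (fun _ => RtoC (2 * PI) * Ci)%C); auto using ccont_const, circle_ccont.
Qed.

(** The circle is contracted towards [z] rather than towards its centre; convexity keeps every
    intermediate path in the closed disc. *)
Lemma circle_cauchy0 f c r z : 0 < r -> Cmod (z - c) < r ->
  (forall x, Cmod (x - c) <= r -> exists d, 0 < d /\ forall y, Cmod (y - x) < d -> sdiff f y) ->
  CI (fun t => f (circle c r t) * (circle' r t / (circle c r t - z)))%C
  = (f z * CI (fun t => circle' r t / (circle c r t - z)))%C.
Proof.
  intros Hr Hz Hf.
  rewrite <- (closed_homothety_const f (circle c r) (circle' r) z 1); try lra.
  - apply CI_ext. intros t _. f_equal. f_equal. unfold homothety. ring.
  - intros; apply circle_rderiv.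
  - apply circle'_ccont.
  - intros t _ E. pose proof (circle_dist c r t (Rlt_le _ _ Hr)) as D. rewrite E in D. lra.
  - apply circle_closed.
  - intros s t Hs Ht. apply Hf. unfold homothety.
    replace (z + RtoC s * (circle c r t - z) - c)%C
      with (RtoC (1 - s) * (z - c) + RtoC s * (circle c r t - c))%C.
    2: { rewrite RtoC_minus. ring. }
    eapply Rle_trans; [apply Cmod_triangle|]. rewrite !Cmod_mult, !Cmod_R, !Rabs_pos_eq by lra.
    rewrite circle_dist by lra. nra.
Qed.

(** * Power series *)

Lemma pow_n_Cpow (h : C) k : @pow_n C_Ring h k = (h ^ k)%C.
Proof. induction k as [|k IH]; [reflexivity|]. exact (f_equal (Cmult h) IH). Qed.

Definition psum (a : nat -> C) (h : C) (n : nat) : C := sum_n (fun k => a k * h ^ k)%C n.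

Lemma psum_O a h : psum a h 0 = a 0%nat.
Proof. unfold psum. rewrite sum_O. simpl. ring. Qed.

Lemma psum_S a h n : psum a h (S n) = (psum a h n + a (S n) * h ^ S n)%C.
Proof. unfold psum. rewrite sum_Sn. reflexivity. Qed.

Lemma is_pseries_C a h l : @is_pseries C_AbsRing C_NormedModule a h l <->
  forall e, 0 < e -> exists N, forall n, (N <= n)%nat -> Cmod (psum a h n - l) < e.
Proof.
  assert (E : forall n, sum_n (fun k => @scal C_AbsRing C_NormedModule (@pow_n C_AbsRing h k) (a k)) n = psum a h n).
  { intros n. unfold psum. apply sum_n_ext. intros k.
    change ((@pow_n C_Ring h k * a k)%C = (a k * h ^ k)%C). rewrite pow_n_Cpow. ring. }
  split.
  - intros H e He.
    assert (H' := proj1 (filterlim_locally _ _) H).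
    assert (Hs : 0 < e / 2) by lra.
    destruct (H' (mkposreal _ Hs)) as [N HN].
    exists N. intros n Hn. specialize (HN n Hn). rewrite E in HN. destruct HN as [H1 H2].
    eapply Rle_lt_trans; [apply Cmod_le_Re_Im|].
    assert (R1 : Rabs (Re (psum a h n - l)%C) < e / 2) by exact H1.
    assert (R2 : Rabs (Im (psum a h n - l)%C) < e / 2) by exact H2.
    lra.
  - intros H. apply (proj2 (filterlim_locally _ _)). intros e.
    destruct (H e (cond_pos e)) as [N HN]. exists N. intros n Hn. rewrite E.
    apply C_NormedModule_mixin_compat1. apply HN; auto.
Qed.

Lemma is_pseries_C_unique a h l l' : @is_pseries C_AbsRing C_NormedModule a h l ->
  @is_pseries C_AbsRing C_NormedModule a h l' -> l = l'.
Proof.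
  rewrite !is_pseries_C. intros H H'. apply Cmod_minus_0, Rle_antisym; [|apply Cmod_ge_0].
  apply le_epsilon. intros e He. rewrite Rplus_0_l.
  destruct (H (e / 2)) as [N HN]; [lra|]. destruct (H' (e / 2)) as [N' HN']; [lra|].
  specialize (HN (N + N')%nat ltac:(lia)). specialize (HN' (N + N')%nat ltac:(lia)).
  rewrite Cmod_minus_sym in HN. pose proof (Cmod_minus_le l (psum a h (N + N')) l'). lra.
Qed.

Lemma psum_dist_bound a h l N B : @is_pseries C_AbsRing C_NormedModule a h l ->
  (forall n, (N <= n)%nat -> Cmod (psum a h n - psum a h N) <= B) -> Cmod (l - psum a h N) <= B.
Proof.
  rewrite is_pseries_C. intros H HB. apply le_epsilon. intros e He.
  destruct (H e He) as [M HM]. specialize (HM (N + M)%nat ltac:(lia)).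
  specialize (HB (N + M)%nat ltac:(lia)). rewrite Cmod_minus_sym in HM.
  pose proof (Cmod_minus_le l (psum a h (N + M)) (psum a h N)). lra.
Qed.

Lemma pseries_tail a h l K r N : 0 < r -> Cmod h <= r / 2 ->
  (forall n, Cmod (a n) <= K / r ^ n) -> @is_pseries C_AbsRing C_NormedModule a h l ->
  Cmod (l - psum a h N) <= 2 * K * (Cmod h / r) ^ S N.
Proof.
  intros Hr Hh HK H. set (x := Cmod h / r).
  assert (Hx0 : 0 <= x) by (apply Rdiv_le_0_compat; auto using Cmod_ge_0).
  assert (Hx : x <= 1 / 2).
  { unfold x. apply Rle_div_l; auto. lra. }
  assert (HK0 : 0 <= K). { specialize (HK 0%nat). simpl in HK. pose proof (Cmod_ge_0 (a 0%nat)). lra. }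
  assert (Term : forall n, Cmod (a n * h ^ n) <= K * x ^ n).
  { intros n. rewrite Cmod_mult, Cmod_pow. unfold x. unfold Rdiv. rewrite Rpow_mult_distr, pow_inv.
    apply Rle_trans with (K / r ^ n * Cmod h ^ n).
    - apply Rmult_le_compat_r; auto. apply pow_le, Cmod_ge_0.
    - right. unfold Rdiv. ring. }
  assert (Hxn : forall n, 0 <= x ^ n) by (intros; apply pow_le; auto).
  apply psum_dist_bound; auto. intros n Hn.
  (* Keeping the subtracted [x ^ S n] makes the bound inductive:
     [2 * (x ^ S n - x ^ S (S n)) >= x ^ S n] because [x <= 1 / 2]. *)
  assert (G : Cmod (psum a h n - psum a h N) <= 2 * K * (x ^ S N - x ^ S n)).
  { induction Hn as [|n Hn IH].
    - replace (psum a h N - psum a h N)%C with (RtoC 0) by ring. rewrite Cmod_0. lra.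
    - rewrite psum_S.
      replace (psum a h n + a (S n) * h ^ S n - psum a h N)%C
        with ((psum a h n - psum a h N) + a (S n) * h ^ S n)%C by ring.
      eapply Rle_trans; [apply Cmod_triangle|]. specialize (Term (S n)).
      simpl in *. specialize (Hxn n).
      assert (x * (x * x ^ n) <= 1 / 2 * (x * x ^ n)) by (apply Rmult_le_compat_r; nra).
      assert (K * (x * (x * x ^ n)) <= K * (1 / 2 * (x * x ^ n))) by (apply Rmult_le_compat_l; auto). lra. }
  assert (0 <= 2 * K * x ^ S n) by (apply Rmult_le_pos; auto; lra).
  fold x. simpl in *. lra.
Qed.

Lemma finite_bound (u : nat -> R) N : exists K, forall n, (n <= N)%nat -> u n <= K.
Proof.
  induction N as [|N [K HK]].
  - exists (u 0%nat). intros n Hn. replace n with 0%nat by lia. lra.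
  - exists (Rmax K (u (S N))). intros n Hn. destruct (Nat.eq_dec n (S N)) as [->|E].
    + apply Rmax_r.
    + eapply Rle_trans; [apply HK; lia|apply Rmax_l].
Qed.

(** Convergence at the single point [r0 / 2] is enough: a term is the difference of two consecutive
    partial sums, both eventually within 1 of the limit, hence at most 2. The finitely many earlier
    terms are bounded by [K]. *)
Lemma pseries_coef_bound (f : C -> C) (z : C) (a : nat -> C) r0 : 0 < r0 ->
  (forall h, Cmod h < r0 -> @is_pseries C_AbsRing C_NormedModule a h (f (z + h)%C)) ->
  exists K, 0 < K /\ forall n, Cmod (a n) <= K / (r0 / 2) ^ n.
Proof.
  intros Hr0 H. set (r := r0 / 2). assert (Hr : 0 < r) by (unfold r; lra).
  assert (Cr : Cmod (RtoC r) = r) by (rewrite Cmod_R, Rabs_pos_eq; lra).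
  assert (H1 := H (RtoC r)). rewrite Cr in H1. specialize (H1 ltac:(unfold r; lra)).
  rewrite is_pseries_C in H1. destruct (H1 1 Rlt_0_1) as [N HN].
  destruct (finite_bound (fun n => Cmod (a n) * r ^ n) N) as [K HK].
  assert (HK' : forall n, Cmod (a n) * r ^ n <= Rmax K 2).
  { intros n. destruct (le_lt_dec n N) as [Hn|Hn].
    - eapply Rle_trans; [apply HK; auto|apply Rmax_l].
    - destruct n as [|n]; [lia|].
      assert (A := HN n ltac:(lia)). assert (B := HN (S n) ltac:(lia)).
      rewrite psum_S in B.
      eapply Rle_trans; [|apply Rmax_r].
      replace (Cmod (a (S n)) * r ^ S n) with (Cmod (a (S n) * RtoC r ^ S n)).
      2: { rewrite Cmod_mult, Cmod_pow, Cr. auto. }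
      replace (a (S n) * RtoC r ^ S n)%C with
        ((psum a (RtoC r) n + a (S n) * RtoC r ^ S n - f (z + RtoC r)%C) - (psum a (RtoC r) n - f (z + RtoC r)%C))%C by ring.
      eapply Rle_trans; [apply Cmod_minus_triangle|]. lra. }
  exists (Rmax K 2). split.
  - eapply Rlt_le_trans; [|apply Rmax_r]. lra.
  - intros n. apply Rle_div_r; [apply pow_lt; auto|auto].
Qed.

Lemma expands_at_coef_bound f z a : expands_at f z a -> exists r K, 0 < r /\ 0 < K /\
  (forall n, Cmod (a n) <= K / r ^ n) /\
  (forall h, Cmod h < r -> @is_pseries C_AbsRing C_NormedModule a h (f (z + h)%C)).
Proof.
  intros [r0 [Hr0 H]]. destruct (pseries_coef_bound f z a r0 Hr0 H) as [K [HK Ha]].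
  exists (r0 / 2), K. split; [lra|]. split; auto. split; auto.
  intros h Hh. apply H. lra.
Qed.

Lemma Cpow_diff_bound (x y : C) d n : Cmod x <= d -> Cmod y <= d ->
  Cmod (x ^ S n - y ^ S n) <= INR (S n) * d ^ n * Cmod (x - y).
Proof.
  intros Hx Hy. induction n as [|n IH].
  - simpl. right. rewrite !Cmult_1_r. ring.
  - replace (x ^ S (S n) - y ^ S (S n))%C with (x * (x ^ S n - y ^ S n) + (x - y) * y ^ S n)%C by (simpl; ring).
    eapply Rle_trans; [apply Cmod_triangle|]. rewrite !Cmod_mult, Cmod_pow.
    assert (A : Cmod x * Cmod (x ^ S n - y ^ S n) <= d * (INR (S n) * d ^ n * Cmod (x - y))).
    { apply Rmult_le_compat; auto using Cmod_ge_0. }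
    assert (B : Cmod (x - y) * Cmod y ^ S n <= Cmod (x - y) * d ^ S n).
    { apply Rmult_le_compat_l; [apply Cmod_ge_0|]. apply pow_incr. split; auto using Cmod_ge_0. }
    rewrite (S_INR (S n)). simpl (d ^ S n) in *. lra.
Qed.

Lemma pow2_ge n : INR (S n) <= 2 ^ n.
Proof.
  induction n; [simpl; lra|]. rewrite S_INR. simpl (2 ^ S n).
  assert (1 <= 2 ^ n) by (apply pow_R1_Rle; lra). lra.
Qed.

Lemma expands_at_sderiv f z a : expands_at f z a -> sderiv f z (a 1%nat).
Proof.
  intros H. destruct (expands_at_coef_bound f z a H) as [r [K [Hr [HK [Ha Hf]]]]].
  intros e He.
  set (d := Rmin (r / 8) (e * (r * r) / (8 * K))).
  assert (Hrr : 0 < r * r) by nra.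
  assert (Hd : 0 < d).
  { apply Rmin_pos; [lra|]. apply Rdiv_lt_0_compat; [|lra]. nra. }
  assert (D1 : d <= r / 8) by apply Rmin_l.
  assert (D2 : d <= e * (r * r) / (8 * K)) by apply Rmin_r.
  exists d. split; auto. intros x y Hx Hy.
  set (X := (x - z)%C) in *. set (Y := (y - z)%C) in *.
  replace x with (z + X)%C by (unfold X; ring). replace y with (z + Y)%C by (unfold Y; ring).
  replace (z + X - (z + Y))%C with (X - Y)%C by ring.
  assert (PX := Hf X ltac:(lra)). assert (PY := Hf Y ltac:(lra)).
  rewrite is_pseries_C in PX, PY.
  set (q := d / r). assert (Hq0 : 0 < q) by (apply Rdiv_lt_0_compat; auto).
  assert (Hq : q <= 1 / 8) by (apply Rle_div_l; lra).
  assert (Hqn : forall n, 0 <= (2 * q) ^ n) by (intros; apply pow_le; lra).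
  (* A geometric sum of ratio [2 * q <= 1 / 4]: the inequality [INR (S n) <= 2 ^ n] absorbs the
     factor from the difference of two powers. The subtracted term makes the bound vanish at [n = 0]
     and closes the induction. *)
  assert (Main : forall n, Cmod (psum a X (S n) - psum a Y (S n) - a 1%nat * (X - Y))
    <= K / r * Cmod (X - Y) * (4 * q - 2 * (2 * q) ^ (S n))).
  { induction n as [|n IH].
    - rewrite !psum_S, !psum_O. simpl.
      match goal with |- Cmod ?u <= _ => replace u with (RtoC 0) by ring end.
      rewrite Cmod_0. right. ring.
    - rewrite (psum_S a X (S n)), (psum_S a Y (S n)).
      match goal with |- Cmod ?u <= _ => replace u with
        ((psum a X (S n) - psum a Y (S n) - a 1%nat * (X - Y)) + a (S (S n)) * (X ^ S (S n) - Y ^ S (S n)))%C by ring end.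
      eapply Rle_trans; [apply Cmod_triangle|].
      assert (T : Cmod (a (S (S n)) * (X ^ S (S n) - Y ^ S (S n))) <= K / r * Cmod (X - Y) * (2 * q) ^ S n).
      { rewrite Cmod_mult.
        apply Rle_trans with (K / r ^ S (S n) * (INR (S (S n)) * d ^ S n * Cmod (X - Y))).
        - apply Rmult_le_compat; auto using Cmod_ge_0. apply Cpow_diff_bound; lra.
        - apply Rle_trans with (K / r ^ S (S n) * (2 ^ S n * d ^ S n * Cmod (X - Y))).
          + apply Rmult_le_compat_l.
            * apply Rlt_le, Rdiv_lt_0_compat; auto. apply pow_lt; auto.
            * apply Rmult_le_compat_r; [apply Cmod_ge_0|]. apply Rmult_le_compat_r; [apply pow_le; lra|apply pow2_ge].
          + right. rewrite Rpow_mult_distr. unfold q, Rdiv. rewrite (Rpow_mult_distr d), pow_inv.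
            simpl (r ^ S (S n)). rewrite Rinv_mult. fold (r ^ S n). simpl. ring. }
      assert (P : K / r * Cmod (X - Y) * ((2 * q) * (2 * q) ^ S n) <= K / r * Cmod (X - Y) * (1 / 4 * (2 * q) ^ S n)).
      { apply Rmult_le_compat_l.
        - apply Rmult_le_pos; [|apply Cmod_ge_0]. apply Rlt_le, Rdiv_lt_0_compat; auto.
        - apply Rmult_le_compat_r; auto. lra. }
      assert (0 <= K / r * Cmod (X - Y) * (2 * q) ^ S n).
      { apply Rmult_le_pos; auto. apply Rmult_le_pos; [|apply Cmod_ge_0]. apply Rlt_le, Rdiv_lt_0_compat; auto. }
      change ((2 * q) ^ S (S n)) with ((2 * q) * (2 * q) ^ S n). lra. }
  apply Rle_trans with (K / r * Cmod (X - Y) * (4 * q)).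
  - apply le_epsilon. intros e' He'.
    destruct (PX (e' / 2)) as [N1 HN1]; [lra|]. destruct (PY (e' / 2)) as [N2 HN2]; [lra|].
    specialize (HN1 (S (N1 + N2)) ltac:(lia)). specialize (HN2 (S (N1 + N2)) ltac:(lia)).
    specialize (Main (N1 + N2)%nat).
    set (n := S (N1 + N2)) in *.
    replace (f (z + X) - f (z + Y) - a 1%nat * (X - Y))%C
      with ((psum a X n - psum a Y n - a 1%nat * (X - Y)) +
            ((psum a Y n - f (z + Y)) - (psum a X n - f (z + X))))%C by ring.
    eapply Rle_trans; [apply Cmod_triangle|].
    pose proof (Cmod_minus_triangle (psum a Y n - f (z + Y)%C) (psum a X n - f (z + X)%C)).
    assert (0 <= K / r * Cmod (X - Y) * (2 * q) ^ n).
    { apply Rmult_le_pos; auto. apply Rmult_le_pos; [|apply Cmod_ge_0]. apply Rlt_le, Rdiv_lt_0_compat; auto. }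
    lra.
  - rewrite (Rmult_comm (K / r)), Rmult_assoc, Rmult_comm. apply Rmult_le_compat_r; [apply Cmod_ge_0|].
    unfold q. apply Rle_trans with (K / r * (4 * (e * (r * r) / (8 * K) / r))).
    + apply Rmult_le_compat_l; [apply Rlt_le, Rdiv_lt_0_compat; auto|].
      apply Rmult_le_compat_l; [lra|]. apply Rmult_le_compat_r; auto. apply Rlt_le, Rinv_0_lt_compat; auto.
    + replace (K / r * (4 * (e * (r * r) / (8 * K) / r))) with (e / 2) by (field; lra).
      lra.
Qed.

(** * Cauchy's formula *)

Lemma pow_lt_eps (K x e : R) : 0 <= x < 1 -> 0 < e -> exists N, forall n, (N <= n)%nat -> K * x ^ n < e.
Proof.
  intros Hx He.
  assert (HK : 0 < Rabs K + 1) by (pose proof (Rabs_pos K); lra).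
  destruct (pow_lt_1_zero x) with (y := e / (Rabs K + 1)) as [N HN].
  - rewrite Rabs_pos_eq; lra.
  - apply Rdiv_lt_0_compat; auto.
  - exists N. intros n Hn. specialize (HN n Hn). rewrite Rabs_pos_eq in HN by (apply pow_le; lra).
    apply Rle_lt_trans with ((Rabs K + 1) * x ^ n).
    + apply Rmult_le_compat_r; [apply pow_le; lra|]. pose proof (Rle_abs K). lra.
    + apply Rmult_lt_compat_l with (r := Rabs K + 1) in HN; auto.
      replace ((Rabs K + 1) * (e / (Rabs K + 1))) with e in HN by (field; lra). auto.
Qed.

(** The density [p] is arbitrary and [g] need not be closed, so this covers the integrals over
    circles and over the arms of the cusp alike. Expanding the kernel in powers of [h] leaves the
    exact remainder [Rem], of ratio at most [|h| / d]. *)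
Lemma cauchy_integral_expands (p g : R -> C) (z : C) (d : R) : ccont p -> ccont g -> 0 < d ->
  (forall t, 0 <= t <= 1 -> d <= Cmod (g t - z)) ->
  forall h, Cmod h < d ->
  @is_pseries C_AbsRing C_NormedModule (fun n => CI (fun t => p t / (g t - z) ^ S n)%C) h
    (CI (fun t => p t / (g t - (z + h)))%C).
Proof.
  intros Hp Hg Hd Hgz h Hh.
  assert (Cz : forall x, ccont (fun t => g t - x)%C).
  { intros x. apply (ccont_minus g (fun _ => x)); auto using ccont_const. }
  assert (Nz : forall t, 0 <= t <= 1 -> (g t - z <> 0)%C).
  { intros t Ht. apply Cmod_neq_0. specialize (Hgz t Ht). lra. }
  assert (Dh : forall t, 0 <= t <= 1 -> d - Cmod h <= Cmod (g t - (z + h))).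
  { intros t Ht. specialize (Hgz t Ht). pose proof (Cmod_le_minus (g t - z) (g t - (z + h))) as T.
    replace (g t - z - (g t - (z + h)))%C with h in T by ring. lra. }
  assert (Nh : forall t, 0 <= t <= 1 -> (g t - (z + h) <> 0)%C).
  { intros t Ht. apply Cmod_neq_0. specialize (Dh t Ht). lra. }
  assert (C1 : forall n, ccont (fun t => p t / (g t - z) ^ n)%C).
  { intros n. apply ccont_div; auto. apply (ccont_pow (fun t => g t - z)%C); auto.
    intros t Ht. apply Cpow_nz; auto. }
  assert (C2 : forall n, ccont (fun t => p t / ((g t - z) ^ n * (g t - (z + h))))%C).
  { intros n. apply ccont_div; auto.
    - apply ccont_mult; auto. apply (ccont_pow (fun t => g t - z)%C); auto.
    - intros t Ht. apply Cmult_neq_0; auto. apply Cpow_nz; auto. }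
  assert (C0 : ccont (fun t => p t / (g t - (z + h)))%C) by (apply ccont_div; auto).
  set (a := fun n => CI (fun t => p t / (g t - z) ^ S n)%C).
  assert (Rem : forall n, (CI (fun t => p t / (g t - (z + h))) - psum a h n
     = h ^ S n * CI (fun t => p t / ((g t - z) ^ S n * (g t - (z + h)))))%C).
  { induction n as [|n IH].
    - rewrite psum_O. unfold a. rewrite <- CI_scal, <- CI_minus; auto. apply CI_ext.
      intros t Ht. specialize (Nz t Ht). specialize (Nh t Ht). simpl. field. auto.
    - rewrite psum_S.
      replace (CI (fun t => p t / (g t - (z + h))) - (psum a h n + a (S n) * h ^ S n))%C
        with ((CI (fun t => p t / (g t - (z + h))) - psum a h n) - h ^ S n * a (S n))%C by ring.
      rewrite IH. unfold a. rewrite <- !CI_scal; auto. rewrite <- CI_minus.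
      + apply CI_ext. intros t Ht. specialize (Nz t Ht). specialize (Nh t Ht).
        simpl. field. repeat split; auto. apply Cpow_nz; auto.
      + apply (ccont_mult (fun _ => h ^ S n)%C); auto using ccont_const.
      + apply (ccont_mult (fun _ => h ^ S n)%C); auto using ccont_const. }
  destruct (ccont_bounded p Hp) as [B [HB HpB]].
  apply is_pseries_C. intros e He.
  set (x := Cmod h / d).
  assert (Hx : 0 <= x < 1).
  { split; [apply Rdiv_le_0_compat; auto using Cmod_ge_0|]. unfold x. apply Rlt_div_l; auto. lra. }
  destruct (pow_lt_eps (2 * (B / (d - Cmod h))) x e Hx He) as [N HN].
  exists N. intros n Hn. rewrite Cmod_minus_sym, Rem, Cmod_mult.
  eapply Rle_lt_trans; [|apply (HN (S n)); lia].
  rewrite Cmod_pow.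
  apply Rle_trans with (Cmod h ^ S n * (2 * (B / (d ^ S n * (d - Cmod h))))).
  - apply Rmult_le_compat_l; [apply pow_le, Cmod_ge_0|].
    apply CI_bound; auto. intros t Ht. specialize (Nz t Ht). specialize (Nh t Ht).
    rewrite Cmod_div, Cmod_mult, Cmod_pow.
    2: { apply Cmult_neq_0; auto. apply Cpow_nz; auto. }
    apply Rmult_le_compat; auto using Cmod_ge_0.
    + apply Rlt_le, Rinv_0_lt_compat. apply Rmult_lt_0_compat; [apply pow_lt|]; apply Cmod_gt_0; auto.
    + apply Rinv_le_contravar.
      * apply Rmult_lt_0_compat; [apply pow_lt; auto|lra].
      * apply Rmult_le_compat; auto; try lra. apply pow_le; lra. apply pow_incr. specialize (Hgz t Ht). lra.
  - right. unfold x, Rdiv. rewrite Rpow_mult_distr, pow_inv. field. repeat split; try apply pow_nonzero; lra.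
Qed.

Lemma sderiv_pow n z : sderiv (fun x => x ^ S n)%C z (RtoC (INR (S n)) * z ^ n)%C.
Proof.
  induction n as [|n IH].
  - apply sderiv_ext with (fun x => x). { intros; simpl; ring. }
    apply sderiv_eq with (RtoC 1); [simpl; ring|]. apply sderiv_id.
  - apply (sderiv_eq _ _ (1 * z ^ S n + z * (RtoC (INR (S n)) * z ^ n))%C).
    + rewrite (S_INR (S n)), RtoC_plus. simpl. ring.
    + apply (sderiv_mult (fun x => x) (fun x => x ^ S n)%C); auto using sderiv_id.
Qed.

Lemma RtoC_neq_0 x : x <> 0 -> RtoC x <> 0%C.
Proof. intros H E. apply RtoC_inj in E. auto. Qed.

(** A primitive of [1 / (x - z) ^ (n + 2)]; only the exponent 1, responsible for the winding number,
    has none of this form. *)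
Definition pow_prim (z : C) (n : nat) (x : C) : C := (- / (RtoC (INR (S n)) * (x - z) ^ S n))%C.

Lemma CI_pow_prim (g g' : R -> C) (z : C) (n : nat) :
  (forall t, 0 <= t <= 1 -> rderiv g t (g' t)) -> ccont g' -> (forall t, 0 <= t <= 1 -> g t <> z) ->
  CI (fun t => g' t / (g t - z) ^ S (S n))%C = (pow_prim z n (g 1) - pow_prim z n (g 0))%C.
Proof.
  intros Hg Hg' Hz.
  assert (Nz : forall t, 0 <= t <= 1 -> (g t - z <> 0)%C).
  { intros t Ht E. apply (Hz t Ht). replace (g t) with (g t - z + z)%C by ring. rewrite E. ring. }
  assert (NI : RtoC (INR (S n)) <> 0%C) by (apply RtoC_neq_0, not_0_INR; lia).
  apply (CI_FTC (fun t => pow_prim z n (g t))).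
  - intros t Ht. specialize (Nz t Ht).
    replace (g' t / (g t - z) ^ S (S n))%C with (/ (g t - z) ^ S (S n) * g' t)%C by (unfold Cdiv; ring).
    apply (rderiv_comp (pow_prim z n) g); auto. unfold pow_prim.
    set (y := g t) in *.
    apply (sderiv_eq _ _ (- (- / ((RtoC (INR (S n)) * (y - z) ^ S n) * (RtoC (INR (S n)) * (y - z) ^ S n))
       * (0 * (y - z) ^ S n + RtoC (INR (S n)) * (RtoC (INR (S n)) * (y - z) ^ n * (1 - 0)))))%C).
    { simpl. field. repeat split; auto. apply Cpow_nz; auto. }
    apply (sderiv_opp (fun x => / (RtoC (INR (S n)) * (x - z) ^ S n))%C).
    apply (sderiv_comp (fun x => / x)%C (fun x => RtoC (INR (S n)) * (x - z) ^ S n)%C).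
    + apply (sderiv_mult (fun _ => RtoC (INR (S n))) (fun x => (x - z) ^ S n)%C); [apply sderiv_const|].
      apply (sderiv_comp (fun x => x ^ S n)%C (fun x => x - z)%C).
      * apply (sderiv_minus (fun x => x) (fun _ => z)); [apply sderiv_id|apply sderiv_const].
      * apply sderiv_pow.
    + apply sderiv_inv. apply Cmult_neq_0; auto. apply Cpow_nz; auto.
  - apply ccont_div; auto.
    + apply (ccont_pow (fun t => g t - z)%C). apply (ccont_minus g (fun _ => z)); auto using ccont_const.
      apply rderiv_ccont. intros t Ht; eexists; apply Hg; auto.
    + intros t Ht. apply Cpow_nz; auto.
Qed.

Lemma psum_const (a : nat -> C) (h : C) n : (forall k, a (S k) = 0%C) -> psum a h n = a 0%nat.
Proof.
  intros H. induction n as [|n IH]; [apply psum_O|]. rewrite psum_S, IH, H. ring.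
Qed.

Lemma is_pseries_const (a : nat -> C) (h : C) : (forall k, a (S k) = 0%C) ->
  @is_pseries C_AbsRing C_NormedModule a h (a 0%nat).
Proof.
  intros H. apply is_pseries_C. intros e He. exists 0%nat. intros n _.
  rewrite psum_const; auto. replace (a 0%nat - a 0%nat)%C with (RtoC 0) by ring. rewrite Cmod_0; auto.
Qed.

(** Expand the integral in [z - c]. The higher coefficients integrate exact forms over a closed path
    and vanish; the constant one has the constant integrand [2 * PI * Ci]. *)
Lemma circle_winding c r z : 0 < r -> Cmod (z - c) < r ->
  CI (fun t => circle' r t / (circle c r t - z))%C = (RtoC (2 * PI) * Ci)%C.
Proof.
  intros Hr Hz.
  assert (Hdist : forall t, 0 <= t <= 1 -> r <= Cmod (circle c r t - c)).
  { intros t _. rewrite circle_dist; lra. }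
  assert (H1 := cauchy_integral_expands (circle' r) (circle c r) c r (circle'_ccont r) (circle_ccont c r) Hr Hdist (z - c) Hz).
  assert (E : (c + (z - c))%C = z) by ring. rewrite E in H1.
  set (a := fun n => CI (fun t => circle' r t / (circle c r t - c) ^ S n)%C) in H1.
  assert (Nz : forall t, circle c r t <> c).
  { intros t E'. pose proof (circle_dist c r t (Rlt_le _ _ Hr)) as D. rewrite E' in D.
    replace (c - c)%C with (RtoC 0) in D by ring. rewrite Cmod_0 in D. lra. }
  assert (Ha : forall k, a (S k) = 0%C).
  { intros k. unfold a. rewrite (CI_pow_prim (circle c r) (circle' r)); auto.
    - rewrite circle_closed. ring.
    - intros; apply circle_rderiv.
    - apply circle'_ccont. }
  rewrite (is_pseries_C_unique _ _ _ _ H1 (is_pseries_const a _ Ha)). unfold a.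
  rewrite (CI_ext _ (fun _ => 0 + RtoC (2 * PI) * Ci)%C).
  - rewrite (CI_FTC (fun t => RtoC t * (RtoC (2 * PI) * Ci))%C).
    + ring.
    + intros t _ e He. exists 1. split; [lra|]. intros h _. rewrite RtoC_plus.
      match goal with |- Cmod ?u <= _ => replace u with (RtoC 0) by ring end.
      rewrite Cmod_0. apply Rmult_le_pos; [lra|apply Rabs_pos].
    + apply ccont_const.
  - intros t _. unfold circle' in *. unfold circle in *. specialize (Nz t).
    set (u := (RtoC r * (cos (2 * PI * t), sin (2 * PI * t)))%C) in *.
    assert (u <> 0%C). { intros E'. apply Nz. rewrite E'. ring. }
    replace ((c + u - c) ^ 1)%C with u by (simpl; ring). field. auto.
Qed.

Lemma two_PI_Ci_neq_0 : (RtoC (2 * PI) * Ci <> 0)%C.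
Proof.
  apply Cmult_neq_0; [apply RtoC_neq_0; pose proof PI_RGT_0; lra|].
  intros E. pose proof Cmod_Ci as H. rewrite E, Cmod_0 in H. lra.
Qed.

Lemma cauchy_formula f c r z : 0 < r -> Cmod (z - c) < r ->
  (forall x, Cmod (x - c) <= r -> exists d, 0 < d /\ forall y, Cmod (y - x) < d -> sdiff f y) ->
  f z = CI (fun t => (/ (RtoC (2 * PI) * Ci) * (f (circle c r t) * circle' r t)) / (circle c r t - z))%C.
Proof.
  intros Hr Hz Hf. pose proof two_PI_Ci_neq_0 as P.
  assert (Q : forall k x : C, k <> 0%C -> x = (/ k * (x * k))%C) by (intros; field; auto).
  rewrite (Q _ (f z) P).
  rewrite <- (circle_winding c r z) at 2; auto. rewrite <- (circle_cauchy0 f c r z); auto.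
  rewrite <- CI_scal.
  - apply CI_ext. intros t _. unfold Cdiv. ring.
  - apply ccont_mult.
    + apply ccont_comp; [|apply circle_ccont]. intros t _.
      destruct (Hf (circle c r t)) as [d [Hd H]]; [rewrite circle_dist; lra|].
      apply H. replace (circle c r t - circle c r t)%C with (RtoC 0) by ring. rewrite Cmod_0. auto.
    + apply ccont_div; [apply circle'_ccont| |].
      * apply (ccont_minus (circle c r) (fun _ => z)); auto using ccont_const, circle_ccont.
      * intros t _ E. assert (E' : circle c r t = z).
        { replace (circle c r t) with (circle c r t - z + z)%C by ring. rewrite E. ring. }
        pose proof (circle_dist c r t (Rlt_le _ _ Hr)) as D. rewrite E' in D. lra.
Qed.

Lemma circle'_mod r t : 0 <= r -> Cmod (circle' r t) = 2 * PI * r.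
Proof.
  intros Hr. pose proof PI_RGT_0. pose proof (circle_dist 0 r t Hr) as D. unfold circle in D.
  unfold circle'. rewrite !Cmod_mult, Cmod_Ci, Cmod_R, Rabs_pos_eq by lra.
  rewrite <- Cmod_mult.
  replace (0 + RtoC r * (cos (2 * PI * t), sin (2 * PI * t)) - 0)%C
    with (RtoC r * (cos (2 * PI * t), sin (2 * PI * t)))%C in D by ring.
  rewrite D. ring.
Qed.

Lemma sdiff_ball_open f c R : (forall x, Cmod (x - c) < R -> sdiff f x) -> forall r, r < R ->
  forall x, Cmod (x - c) <= r -> exists d, 0 < d /\ forall y, Cmod (y - x) < d -> sdiff f y.
Proof.
  intros Hf r Hr x Hx. exists (R - r). split; [lra|]. intros y Hy. apply Hf.
  pose proof (Cmod_minus_le y x c). lra.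
Qed.

Lemma sdiff_ball_expands f c R r : (forall x, Cmod (x - c) < R -> sdiff f x) -> 0 < r < R ->
  exists a : nat -> C, (forall h, Cmod h < r -> @is_pseries C_AbsRing C_NormedModule a h (f (c + h)%C)) /\
    (forall B, (forall x, Cmod (x - c) <= r -> Cmod (f x) <= B) -> forall n, Cmod (a n) <= 2 * B / r ^ n).
Proof.
  intros Hf Hr. assert (Hop := sdiff_ball_open f c R Hf r ltac:(lra)).
  pose proof two_PI_Ci_neq_0 as P. pose proof PI_RGT_0 as HPI.
  set (p := fun t => (/ (RtoC (2 * PI) * Ci) * (f (circle c r t) * circle' r t))%C).
  assert (Hp : ccont p).
  { apply (ccont_mult (fun _ => / (RtoC (2 * PI) * Ci))%C); auto using ccont_const.
    apply ccont_mult; auto using circle'_ccont. apply ccont_comp; auto using circle_ccont.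
    intros t _. apply Hf. rewrite circle_dist; lra. }
  assert (Hd : forall t, 0 <= t <= 1 -> r <= Cmod (circle c r t - c)).
  { intros t _. rewrite circle_dist; lra. }
  exists (fun n => CI (fun t => p t / (circle c r t - c) ^ S n)%C). split.
  - intros h Hh. rewrite (cauchy_formula f c r (c + h)%C); auto; try lra.
    + apply (cauchy_integral_expands p (circle c r) c r); auto using circle_ccont. lra.
    + replace (c + h - c)%C with h by ring. auto.
  - intros B HB n. apply Rle_trans with (2 * (B / r ^ n)); [|right; unfold Rdiv; ring].
    apply CI_bound.
    + apply ccont_div; auto.
      * apply (ccont_pow (fun t => circle c r t - c)%C).
        apply (ccont_minus (circle c r) (fun _ => c)); auto using ccont_const, circle_ccont.
      * intros t Ht. apply Cpow_nz, Cmod_neq_0. specialize (Hd t Ht). lra.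
    + intros t Ht. assert (Q : Cmod (circle c r t - c) = r) by (apply circle_dist; lra).
      rewrite Cmod_div, Cmod_pow, Q.
      2: { apply Cpow_nz, Cmod_neq_0. lra. }
      unfold p. rewrite !Cmod_mult, Cmod_inv, Cmod_mult, Cmod_Ci, Cmod_R, circle'_mod by (auto; lra).
      rewrite Rabs_pos_eq by lra. specialize (HB (circle c r t) ltac:(lra)).
      assert (0 < r ^ n) by (apply pow_lt; lra).
      replace (/ (2 * PI * 1) * (Cmod (f (circle c r t)) * (2 * PI * r)) / r ^ S n)
        with (Cmod (f (circle c r t)) / r ^ n) by (simpl; field; split; lra).
      apply Rmult_le_compat_r; auto. apply Rlt_le, Rinv_0_lt_compat; auto.
Qed.

Lemma sdiff_ball_analytic f c R : 0 < R -> (forall x, Cmod (x - c) < R -> sdiff f x) -> analytic_at f c.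
Proof.
  intros HR Hf. destruct (sdiff_ball_expands f c R (R / 2) Hf ltac:(lra)) as [a [Ha _]].
  exists a, (R / 2). split; [lra|auto].
Qed.

Lemma analytic_at_sdiff f z : analytic_at f z -> sdiff f z.
Proof. intros [a Ha]. exists (a 1%nat). apply expands_at_sderiv; auto. Qed.

(** Cauchy's formula on the circle of radius [R / 2] passes to the uniform limit; the limit is then
    itself a Cauchy integral, hence analytic. *)
Lemma uniform_limit_analytic (F : nat -> C -> C) (f : C -> C) c R : 0 < R ->
  (forall n x, Cmod (x - c) < R -> sdiff (F n) x) ->
  (forall e, 0 < e -> exists N, forall n x, (N <= n)%nat -> Cmod (x - c) < R -> Cmod (F n x - f x) <= e) ->
  analytic_at f c.
Proof.
  intros HR HF Hlim. set (r := R / 2).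
  pose proof PI_RGT_0 as HPI. pose proof two_PI_Ci_neq_0 as P.
  assert (Cf : ccont (fun t => f (circle c r t))).
  { intros t Ht e He. destruct (Hlim (e / 4)) as [N HN]; [lra|].
    assert (CF : ccont (fun t => F N (circle c r t))).
    { apply ccont_comp; auto using circle_ccont. intros u _. apply HF. rewrite circle_dist; unfold r; lra. }
    destruct (CF t Ht (e / 4)) as [d [Hd H1]]; [lra|]. exists d. split; auto. intros t' Ht' Hd'.
    specialize (H1 t' Ht' Hd').
    assert (A := fun u => HN N (circle c r u) (Nat.le_refl _)).
    assert (A1 := A t ltac:(rewrite circle_dist; unfold r; lra)).
    assert (A2 := A t' ltac:(rewrite circle_dist; unfold r; lra)).
    rewrite Cmod_minus_sym in A2.
    pose proof (Cmod_minus_le (f (circle c r t')) (F N (circle c r t')) (f (circle c r t))).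
    pose proof (Cmod_minus_le (F N (circle c r t')) (F N (circle c r t)) (f (circle c r t))). lra. }
  assert (Hr : 0 < r) by (unfold r; lra).
  set (k := (/ (RtoC (2 * PI) * Ci))%C).
  assert (Cq : forall z, Cmod (z - c) < r -> ccont (fun t => circle' r t / (circle c r t - z))%C).
  { intros z Hz. apply ccont_div; [apply circle'_ccont| |].
    - apply (ccont_minus (circle c r) (fun _ => z)); auto using ccont_const, circle_ccont.
    - intros t _ E. assert (E' : circle c r t = z).
      { replace (circle c r t) with (circle c r t - z + z)%C by ring. rewrite E. ring. }
      pose proof (circle_dist c r t (Rlt_le _ _ Hr)) as D. rewrite E' in D. lra. }
  assert (Formula : forall z, Cmod (z - c) < r ->
    f z = CI (fun t => (k * (f (circle c r t) * circle' r t)) / (circle c r t - z))%C).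
  { intros z Hz.
    rewrite (CI_ext _ (fun t => k * (f (circle c r t) * (circle' r t / (circle c r t - z))))%C).
    2: { intros; unfold Cdiv; ring. }
    destruct (ccont_bounded _ (Cq z Hz)) as [B [HB HqB]].
    pose proof (Cmod_ge_0 k) as Hk.
    apply Cmod_minus_0, Rle_antisym; [|apply Cmod_ge_0].
    apply le_epsilon. intros e He. rewrite Rplus_0_l.
    set (e' := e / (1 + Cmod k * 2 * B)).
    assert (Hden : 0 < 1 + Cmod k * 2 * B) by nra.
    assert (He' : 0 < e') by (apply Rdiv_lt_0_compat; auto).
    destruct (Hlim e' He') as [N HN].
    assert (CF : ccont (fun t => F N (circle c r t))).
    { apply ccont_comp; auto using circle_ccont. intros u _. apply HF. rewrite circle_dist; unfold r; lra. }
    assert (EF := cauchy_formula (F N) c r z Hr Hz (sdiff_ball_open (F N) c R (HF N) r ltac:(unfold r; lra))).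
    rewrite (CI_ext _ (fun t => k * (F N (circle c r t) * (circle' r t / (circle c r t - z))))%C) in EF.
    2: { intros; unfold k, Cdiv; ring. }
    assert (D : Cmod (F N z - CI (fun t => k * (f (circle c r t) * (circle' r t / (circle c r t - z))))%C) <= Cmod k * (2 * (e' * B))).
    { rewrite EF, !CI_scal by (apply ccont_mult; auto).
      match goal with |- Cmod (k * ?a - k * ?b) <= _ => replace (k * a - k * b)%C with (k * (a - b))%C by ring end.
      rewrite Cmod_mult. apply Rmult_le_compat_l; auto.
      rewrite <- CI_minus by (apply ccont_mult; auto).
      apply CI_bound.
      - apply ccont_minus; apply ccont_mult; auto.
      - intros t Ht.
        replace (F N (circle c r t) * (circle' r t / (circle c r t - z)) - f (circle c r t) * (circle' r t / (circle c r t - z)))%C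
          with ((F N (circle c r t) - f (circle c r t)) * (circle' r t / (circle c r t - z)))%C by ring.
        rewrite Cmod_mult. apply Rmult_le_compat; auto using Cmod_ge_0.
        apply HN; auto. rewrite circle_dist; unfold r; lra. }
    specialize (HN N z (Nat.le_refl _) ltac:(unfold r in Hz; lra)). rewrite Cmod_minus_sym in HN.
    eapply Rle_trans; [apply (Cmod_minus_le _ (F N z))|].
    apply Rle_trans with (e' * (1 + Cmod k * 2 * B)); [lra|]. right. unfold e'. field. lra. }
  assert (Hd : forall t, 0 <= t <= 1 -> r <= Cmod (circle c r t - c)).
  { intros t _. rewrite circle_dist; lra. }
  eexists. exists r. split; auto. intros h Hh. rewrite Formula.
  2: { replace (c + h - c)%C with h by ring. auto. }
  apply (cauchy_integral_expands (fun t => k * (f (circle c r t) * circle' r t))%C (circle c r) c r);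
    auto using circle_ccont.
  apply (ccont_mult (fun _ => k)); auto using ccont_const.
  apply ccont_mult; auto using circle'_ccont.
Qed.

Lemma sdiff_psum a x z n : sdiff (fun y => psum a (y - z) n) x.
Proof.
  induction n as [|n IH].
  - apply sdiff_ext with (fun _ => a 0%nat). { intros; rewrite psum_O; auto. } apply sdiff_const.
  - apply sdiff_ext with (fun y => psum a (y - z) n + a (S n) * (y - z) ^ S n)%C.
    { intros; rewrite psum_S; auto. }
    apply sdiff_plus; auto. apply (sdiff_mult (fun _ => a (S n))); auto using sdiff_const.
    apply (sdiff_pow (fun y => y - z)%C). apply (sdiff_minus (fun y => y) (fun _ => z)); auto using sdiff_const, sdiff_id.
Qed.

(** Analyticity at nearby points comes from the uniform convergence of the partial sums, which are
    polynomials, instead of a rearrangement of double series. *)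
Lemma pseries_sdiff f z a r : 0 < r ->
  (forall h, Cmod h < r -> @is_pseries C_AbsRing C_NormedModule a h (f (z + h)%C)) ->
  exists d, 0 < d /\ forall x, Cmod (x - z) < d -> analytic_at f x.
Proof.
  intros Hr H.
  destruct (expands_at_coef_bound f z a (ex_intro _ r (conj Hr H))) as [r' [K [Hr' [HK [Ha Hf]]]]].
  exists (r' / 4). split; [lra|]. intros x Hx.
  apply (uniform_limit_analytic (fun n y => psum a (y - z) n) f x (r' / 4)); [lra| |].
  - intros n y _. apply sdiff_psum.
  - intros e He. destruct (pow_lt_eps (2 * K) (1 / 2) e ltac:(lra) He) as [N HN].
    exists N. intros n y Hn Hy.
    assert (Hyz : Cmod (y - z) <= r' / 2) by (pose proof (Cmod_minus_le y x z); lra).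
    rewrite Cmod_minus_sym.
    assert (Py := Hf (y - z)%C ltac:(lra)). replace (z + (y - z))%C with y in Py by ring.
    eapply Rle_trans; [apply (pseries_tail a (y - z) (f y) K r' n Hr' Hyz Ha Py)|].
    apply Rlt_le. eapply Rle_lt_trans; [|apply (HN (S n)); lia].
    apply Rmult_le_compat_l; [lra|]. apply pow_incr. split.
    + apply Rdiv_le_0_compat; auto using Cmod_ge_0.
    + apply Rle_div_l; auto. lra.
Qed.

Lemma analytic_at_near f z : analytic_at f z -> exists d, 0 < d /\ forall x, Cmod (x - z) < d -> analytic_at f x.
Proof. intros [a [r [Hr H]]]. apply (pseries_sdiff f z a r); auto. Qed.

Lemma analytic_at_sdiff_near f z : analytic_at f z -> exists d, 0 < d /\ forall x, Cmod (x - z) < d -> sdiff f x.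
Proof.
  intros H. destruct (analytic_at_near f z H) as [d [Hd H1]]. exists d. split; auto.
  intros x Hx. apply analytic_at_sdiff; auto.
Qed.

(** The working criterion for analyticity: most closure properties that follow are reduced through
    it to [sdiff] on a ball. *)
Lemma analytic_at_of_sdiff f z d : 0 < d -> (forall x, Cmod (x - z) < d -> sdiff f x) -> analytic_at f z.
Proof. intros Hd H. apply (sdiff_ball_analytic f z d); auto. Qed.

Lemma analytic_at_plus f g z : analytic_at f z -> analytic_at g z -> analytic_at (fun x => f x + g x)%C z.
Proof.
  intros Hf Hg. destruct (analytic_at_sdiff_near f z Hf) as [d [Hd H]].
  destruct (analytic_at_sdiff_near g z Hg) as [d' [Hd' H']].
  apply (analytic_at_of_sdiff _ z (Rmin d d')); [apply Rmin_pos; auto|]. intros x Hx. apply sdiff_plus.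
  - apply H. eapply Rlt_le_trans; [apply Hx|apply Rmin_l].
  - apply H'. eapply Rlt_le_trans; [apply Hx|apply Rmin_r].
Qed.

Lemma analytic_at_scal f (k : C) z : analytic_at f z -> analytic_at (fun x => k * f x)%C z.
Proof.
  intros Hf. destruct (analytic_at_sdiff_near f z Hf) as [d [Hd H]].
  apply (analytic_at_of_sdiff _ z d); auto. intros x Hx. apply (sdiff_mult (fun _ => k)); auto using sdiff_const.
Qed.

Lemma analytic_at_comp f g z : analytic_at g z -> analytic_at f (g z) -> analytic_at (fun x => f (g x)) z.
Proof.
  intros Hg Hf. destruct (analytic_at_sdiff_near g z Hg) as [d [Hd H]].
  destruct (analytic_at_sdiff_near f (g z) Hf) as [d' [Hd' H']].
  destruct (sdiff_cont g z (analytic_at_sdiff g z Hg) d' Hd') as [d2 [Hd2 H2]].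
  apply (analytic_at_of_sdiff _ z (Rmin d d2)); [apply Rmin_pos; auto|]. intros x Hx.
  apply (sdiff_comp f g).
  - apply H. eapply Rlt_le_trans; [apply Hx|apply Rmin_l].
  - apply H', H2. eapply Rlt_le_trans; [apply Hx|apply Rmin_r].
Qed.

Lemma analytic_at_const (c z : C) : analytic_at (fun _ => c) z.
Proof. apply (analytic_at_of_sdiff _ z 1); [lra|]. intros; apply sdiff_const. Qed.

Lemma analytic_at_ext F G (z : C) : (forall x, F x = G x) -> analytic_at F z -> analytic_at G z.
Proof.
  intros E [a [r [Hr H]]]. exists a, r. split; auto. intros h Hh. rewrite <- E. auto.
Qed.

Lemma analytic_at_rescale F k : analytic_at F 0 -> analytic_at (fun t => F (t * k)%C) 0.
Proof.
  intros HF. apply (analytic_at_comp F (fun t => t * k)%C).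
  - apply (analytic_at_of_sdiff _ 0 1); [lra|]. intros x _.
    apply (sdiff_mult (fun t => t) (fun _ => k)); auto using sdiff_id, sdiff_const.
  - rewrite Cmult_0_l. auto.
Qed.

(** * Inverse functions, exponential and logarithm *)

Lemma C_complete (u : nat -> C) :
  (forall e, 0 < e -> exists N, forall n m, (N <= n)%nat -> (N <= m)%nat -> Cmod (u n - u m) < e) ->
  exists l, forall e, 0 < e -> exists N, forall n, (N <= n)%nat -> Cmod (u n - l) < e.
Proof.
  intros H.
  assert (K : forall g : C -> R, (forall x y, Rabs (g x - g y) <= Cmod (x - y)) ->
    exists l, forall e, 0 < e -> exists N, forall n, (N <= n)%nat -> Rabs (g (u n) - l) < e).
  { intros g Hg.
    assert (Hc : ex_lim_seq_cauchy (fun n => g (u n))).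
    { intros e. destruct (H e (cond_pos e)) as [N HN]. exists N. intros n m Hn Hm.
      eapply Rle_lt_trans; [apply Hg|]. apply HN; auto. }
    apply ex_lim_seq_cauchy_corr in Hc. destruct Hc as [l Hl]. exists l.
    apply is_lim_seq_spec in Hl. intros e He. destruct (Hl (mkposreal e He)) as [N HN].
    exists N. auto. }
  destruct (K Re Re_lip) as [x Hx]. destruct (K Im Im_lip) as [y Hy].
  exists (x, y). intros e He.
  destruct (Hx (e / 2)) as [N1 H1]; [lra|]. destruct (Hy (e / 2)) as [N2 H2]; [lra|].
  exists (N1 + N2)%nat. intros n Hn. specialize (H1 n ltac:(lia)). specialize (H2 n ltac:(lia)).
  eapply Rle_lt_trans; [apply Cmod_le_Re_Im|].
  replace (Re (u n - (x, y))%C) with (Re (u n) - x) by (unfold Re; simpl; ring).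
  replace (Im (u n - (x, y))%C) with (Im (u n) - y) by (unfold Im; simpl; ring). lra.
Qed.

Lemma C_complete_geometric (u : nat -> C) K : 0 <= K ->
  (forall n, Cmod (u (S n) - u n) <= K * (1 / 2) ^ n) ->
  exists l, (forall e, 0 < e -> exists N, forall n, (N <= n)%nat -> Cmod (u n - l) < e) /\
    Cmod (l - u 0%nat) <= 2 * K.
Proof.
  intros HK H.
  assert (B : forall n k, Cmod (u (n + k)%nat - u n) <= 2 * K * ((1 / 2) ^ n - (1 / 2) ^ (n + k))).
  { intros n k. induction k as [|k IH].
    - rewrite Nat.add_0_r. replace (u n - u n)%C with (RtoC 0) by ring. rewrite Cmod_0. lra.
    - rewrite Nat.add_succ_r. specialize (H (n + k)%nat).
      pose proof (Cmod_minus_le (u (S (n + k))) (u (n + k)%nat) (u n)). simpl. lra. }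
  assert (B' : forall n k, Cmod (u (n + k)%nat - u n) <= 2 * K * (1 / 2) ^ n).
  { intros n k. specialize (B n k). assert (0 <= (1 / 2) ^ (n + k)) by (apply pow_le; lra). nra. }
  destruct (C_complete u) as [l Hl].
  - intros e He. destruct (pow_lt_eps (4 * K) (1 / 2) e ltac:(lra) He) as [N HN]. exists N.
    intros n m Hn Hm. specialize (HN N (Nat.le_refl _)).
    assert (A1 := B' N (n - N)%nat). assert (A2 := B' N (m - N)%nat).
    replace (N + (n - N))%nat with n in A1 by lia. replace (N + (m - N))%nat with m in A2 by lia.
    rewrite Cmod_minus_sym in A2. pose proof (Cmod_minus_le (u n) (u N) (u m)). lra.
  - exists l. split; auto. apply le_epsilon. intros e He. destruct (Hl e He) as [N HN].
    specialize (HN N (Nat.le_refl _)). specialize (B' 0%nat N). simpl in B'.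
    rewrite Cmod_minus_sym in HN. pose proof (Cmod_minus_le l (u N) (u 0%nat)). lra.
Qed.

Lemma sderiv_expanding (f : C -> C) (z l : C) : l <> 0%C -> sderiv f z l -> exists r, 0 < r /\
  forall a b, Cmod (a - z) < r -> Cmod (b - z) < r ->
    Cmod l / 2 * Cmod (a - b) <= Cmod (f a - f b) /\
    Cmod (f a - f b - l * (a - b)) <= Cmod l / 2 * Cmod (a - b).
Proof.
  intros Hl H. pose proof (proj1 (Cmod_gt_0 _) Hl) as L.
  destruct (H (Cmod l / 2)) as [r [Hr H1]]; [lra|]. exists r. split; auto.
  intros a b Ha Hb. specialize (H1 a b Ha Hb). split; auto.
  pose proof (Cmod_le_minus (l * (a - b)) (f a - f b)) as T. rewrite (Cmod_minus_sym (l * (a - b))), Cmod_mult in T. lra.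
Qed.

Lemma sderiv_inverse (f g : C -> C) (z l : C) d : l <> 0%C -> sderiv f (g z) l -> 0 < d ->
  (forall y, Cmod (y - z) < d -> f (g y) = y) ->
  (forall e, 0 < e -> exists d, 0 < d /\ forall y, Cmod (y - z) < d -> Cmod (g y - g z) < e) ->
  sderiv g z (/ l).
Proof.
  intros Hl Hf Hd Hfg Hc e He. pose proof (proj1 (Cmod_gt_0 _) Hl) as L.
  set (m := Cmod l) in *.
  destruct (Hf (Rmin (m / 2) (e * (m * m) / 2))) as [r [Hr H1]].
  { apply Rmin_pos; [lra|]. apply Rdiv_lt_0_compat; [|lra]. repeat apply Rmult_lt_0_compat; auto. }
  destruct (Hc r Hr) as [d' [Hd' H2]]. exists (Rmin d d'). split; [apply Rmin_pos; auto|].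
  intros a b Ha Hb.
  specialize (H1 (g a) (g b) (H2 a (Rlt_le_trans _ _ _ Ha (Rmin_r _ _))) (H2 b (Rlt_le_trans _ _ _ Hb (Rmin_r _ _)))).
  rewrite !Hfg in H1 by (eapply Rlt_le_trans; [eassumption|apply Rmin_l]).
  pose proof (Rmin_l (m / 2) (e * (m * m) / 2)) as M1. pose proof (Rmin_r (m / 2) (e * (m * m) / 2)) as M2.
  set (k := Rmin (m / 2) (e * (m * m) / 2)) in *.
  pose proof (Cmod_ge_0 (g a - g b)) as G0.
  assert (G : Cmod (g a - g b) <= 2 / m * Cmod (a - b)).
  { pose proof (Cmod_le_minus (l * (g a - g b)) (a - b)) as T. rewrite (Cmod_minus_sym (l * (g a - g b))), Cmod_mult in T.
    fold m in T. assert (k * Cmod (g a - g b) <= m / 2 * Cmod (g a - g b)) by (apply Rmult_le_compat_r; auto).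
    apply Rmult_le_reg_l with (m / 2); [lra|].
    replace (m / 2 * (2 / m * Cmod (a - b))) with (Cmod (a - b)) by (field; lra). lra. }
  replace (g a - g b - / l * (a - b))%C with (- (/ l * (a - b - l * (g a - g b))))%C by (field; auto).
  rewrite Cmod_opp, Cmod_mult, Cmod_inv by auto. fold m.
  apply Rle_trans with (/ m * (e * (m * m) / 2 * (2 / m * Cmod (a - b)))).
  - apply Rmult_le_compat_l; [apply Rlt_le, Rinv_0_lt_compat; auto|].
    apply Rle_trans with (1 := H1). apply Rmult_le_compat; auto.
    unfold k. apply Rlt_le, Rmin_pos; [lra|]. apply Rdiv_lt_0_compat; [|lra]. repeat apply Rmult_lt_0_compat; auto.
  - right. field. lra.
Qed.

(** Newton's iteration with the derivative frozen at [l]: near [z], [f] differs from the linear map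
    by a Lipschitz constant [|l| / 2], so each step is at most half of the previous one. The bound
    [2 / |l|] on the inverse is recorded because later neighbourhoods are sized by it. *)
Lemma inverse_function (f : C -> C) (z l : C) r0 : l <> 0%C -> sderiv f z l -> 0 < r0 ->
  (forall x, Cmod (x - z) < r0 -> sdiff f x) ->
  exists g r d, 0 < r /\ 0 < d /\
    (forall a b, Cmod (a - z) < r -> Cmod (b - z) < r -> f a = f b -> a = b) /\
    (forall y, Cmod (y - f z) < d -> f (g y) = y /\ Cmod (g y - z) < r /\
       Cmod (g y - z) <= 2 / Cmod l * Cmod (y - f z)) /\
    (forall y, Cmod (y - f z) < d -> sdiff g y) /\ sderiv g (f z) (/ l).
Proof.
  intros Hl Hf Hr0 Hs. pose proof (proj1 (Cmod_gt_0 _) Hl) as L. set (m := Cmod l) in *.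
  destruct (sderiv_expanding f z l Hl Hf) as [r1 [Hr1 H1]]. fold m in H1.
  set (r := Rmin r0 r1). assert (Hr : 0 < r) by (apply Rmin_pos; auto).
  assert (rr0 : r <= r0) by apply Rmin_l. assert (rr1 : r <= r1) by apply Rmin_r.
  (* The first step is then at most [r / 8], so the iterates, whose total displacement is at most
     twice as much, stay in the ball of radius [r]. *)
  set (d := m * r / 8). assert (Hd : 0 < d) by (unfold d; nra).
  assert (E : forall y, exists x, Cmod (y - f z) < d ->
    f x = y /\ Cmod (x - z) < r /\ Cmod (x - z) <= 2 / m * Cmod (y - f z)).
  { intros y. destruct (excluded_middle_informative (Cmod (y - f z) < d)) as [Hy|Hy].
    2: { exists z. tauto. }
    set (u := fix u n := match n with O => z | S n => (u n - (f (u n) - y) / l)%C end).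
    assert (US : forall n, u (S n) = (u n - (f (u n) - y) / l)%C) by reflexivity.
    set (K := Cmod (y - f z) / m).
    assert (HK : 0 <= K) by (apply Rdiv_le_0_compat; auto using Cmod_ge_0).
    assert (HKr : K <= r / 8).
    { unfold K. apply Rle_div_l; auto. unfold d in Hy. lra. }
    assert (P : forall n, Cmod (u (S n) - u n) <= K * (1 / 2) ^ n /\
      Cmod (u n - z) <= 2 * K * (1 - (1 / 2) ^ n)).
    { induction n as [|n [IH1 IH2]].
      - split.
        + rewrite US. simpl. replace (z - (f z - y) / l - z)%C with ((y - f z) / l)%C by (field; auto).
          rewrite Cmod_div by auto. right. unfold K, m. ring.
        + simpl. replace (z - z)%C with (RtoC 0) by ring. rewrite Cmod_0. lra.
      - assert (Q : Cmod (u (S n) - z) <= 2 * K * (1 - (1 / 2) ^ S n)).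
        { pose proof (Cmod_minus_le (u (S n)) (u n) z). simpl ((1/2) ^ S n). lra. }
        split; auto.
        assert (Hn0 : 0 <= (1 / 2) ^ n) by (apply pow_le; lra).
        assert (Hn1 : 0 <= (1 / 2) ^ S n) by (apply pow_le; lra).
        assert (A1 : Cmod (u n - z) < r1) by nra.
        assert (A2 : Cmod (u (S n) - z) < r1) by nra.
        destruct (H1 (u (S n)) (u n) A2 A1) as [_ H2].
        rewrite (US (S n)).
        replace (u (S n) - (f (u (S n)) - y) / l - u (S n))%C
          with (- ((f (u (S n)) - f (u n) - l * (u (S n) - u n)) / l))%C.
        2: { rewrite (US n). field. auto. }
        rewrite Cmod_opp, Cmod_div by auto. fold m.
        apply Rle_div_l; auto. apply Rle_trans with (1 := H2).
        apply Rmult_le_compat_l with (r := m / 2) in IH1; [|lra].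
        change ((1 / 2) ^ S n) with (1 / 2 * (1 / 2) ^ n). lra. }
    destruct (C_complete_geometric u K HK (fun n => proj1 (P n))) as [x [Hx1 Hx2]].
    change (u 0%nat) with z in Hx2.
    exists x. intros _.
    assert (Hxr : Cmod (x - z) < r) by lra.
    assert (Ex : f x = y).
    { apply Cmod_minus_0, Rle_antisym; [|apply Cmod_ge_0]. apply le_epsilon. intros e He. rewrite Rplus_0_l.
      destruct (sdiff_cont f x (Hs x ltac:(lra)) (e / 2)) as [d1 [Hd1 C1]]; [lra|].
      destruct (Hx1 d1 Hd1) as [N1 HN1].
      destruct (pow_lt_eps (m * K) (1 / 2) (e / 2) ltac:(lra) ltac:(lra)) as [N2 HN2].
      set (n := (N1 + N2)%nat).
      specialize (C1 (u n) (HN1 n ltac:(lia))). rewrite Cmod_minus_sym in C1.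
      destruct (P n) as [P1 _]. rewrite US in P1.
      replace (u n - (f (u n) - y) / l - u n)%C with (- ((f (u n) - y) / l))%C in P1 by ring.
      rewrite Cmod_opp, Cmod_div in P1 by auto. fold m in P1.
      specialize (HN2 n ltac:(lia)).
      assert (P2 : Cmod (f (u n) - y) <= m * K * (1 / 2) ^ n).
      { replace (Cmod (f (u n) - y)) with (Cmod (f (u n) - y) / m * m) by (field; lra).
        apply Rle_trans with (K * (1 / 2) ^ n * m); [|lra]. apply Rmult_le_compat_r; lra. }
      pose proof (Cmod_minus_le (f x) (f (u n)) y). lra. }
    split; auto. split; auto.
    assert (Zr : Cmod (z - z) < r1).
    { replace (z - z)%C with (RtoC 0) by ring. rewrite Cmod_0; auto. }
    destruct (H1 x z ltac:(lra) Zr) as [H2 _]. rewrite Ex in H2.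
    apply Rmult_le_reg_l with (m / 2); [lra|].
    replace (m / 2 * (2 / m * Cmod (y - f z))) with (Cmod (y - f z)) by (field; lra). auto. }
  destruct (choice _ E) as [g Hg].
  assert (Glip : forall a b, Cmod (a - f z) < d -> Cmod (b - f z) < d -> Cmod (g a - g b) <= 2 / m * Cmod (a - b)).
  { intros a b Ha Hb. destruct (Hg a Ha) as [A1 [A2 _]]. destruct (Hg b Hb) as [B1 [B2 _]].
    destruct (H1 (g a) (g b) ltac:(lra) ltac:(lra)) as [H2 _]. rewrite A1, B1 in H2.
    apply Rmult_le_reg_l with (m / 2); [lra|].
    replace (m / 2 * (2 / m * Cmod (a - b))) with (Cmod (a - b)) by (field; lra). auto. }
  assert (Ginv : forall y k, Cmod (y - f z) < d -> sderiv f (g y) k -> k <> 0%C -> sderiv g y (/ k)).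
  { intros y k Hy Hk Hk0. apply (sderiv_inverse f g y k (d - Cmod (y - f z))); auto; [lra| |].
    - intros y' Hy'. apply Hg. pose proof (Cmod_minus_le y' y (f z)). lra.
    - intros e He. exists (Rmin (d - Cmod (y - f z)) (m / 2 * e)). split; [apply Rmin_pos; [lra|nra]|].
      intros y' Hy'. pose proof (Rlt_le_trans _ _ _ Hy' (Rmin_l _ _)). pose proof (Rlt_le_trans _ _ _ Hy' (Rmin_r _ _)) as Y2.
      pose proof (Cmod_minus_le y' y (f z)).
      eapply Rle_lt_trans; [apply Glip; auto; lra|].
      apply Rmult_lt_compat_l with (r := 2 / m) in Y2; [|apply Rdiv_lt_0_compat; lra].
      replace (2 / m * (m / 2 * e)) with e in Y2 by (field; lra). auto. }
  assert (Z0 : Cmod (f z - f z) < d).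
  { replace (f z - f z)%C with (RtoC 0) by ring. rewrite Cmod_0. auto. }
  assert (Gz : g (f z) = z).
  { destruct (Hg (f z) Z0) as [_ [_ A]]. replace (f z - f z)%C with (RtoC 0) in A by ring.
    rewrite Cmod_0, Rmult_0_r in A. apply Cmod_minus_0, Rle_antisym; auto using Cmod_ge_0. }
  exists g, r, d. split; auto. split; auto. split; [|split; [|split]].
  - intros a b Ha Hb Eab. destruct (H1 a b ltac:(lra) ltac:(lra)) as [H2 _]. rewrite Eab in H2.
    replace (f b - f b)%C with (RtoC 0) in H2 by ring. rewrite Cmod_0 in H2.
    apply Cmod_minus_0, Rle_antisym; auto using Cmod_ge_0.
    pose proof (Cmod_ge_0 (a - b)). nra.
  - exact Hg.
  - intros y Hy. destruct (Hg y Hy) as [A1 [A2 _]]. destruct (Hs (g y) ltac:(lra)) as [k Hk].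
    exists (/ k)%C. apply Ginv; auto.
    assert (Hkl : Cmod (k - l) <= m / 2).
    { apply (sderiv_approx f (g y) l k (r - Cmod (g y - z))); auto; [lra|].
      intros a b Ha Hb. apply H1; [pose proof (Cmod_minus_le a (g y) z)|pose proof (Cmod_minus_le b (g y) z)]; lra. }
    intros K0. rewrite K0 in Hkl. replace (0 - l)%C with (- l)%C in Hkl by ring. rewrite Cmod_opp in Hkl. fold m in Hkl. lra.
  - apply Ginv; auto. rewrite Gz. auto.
Qed.

(** * The complex exponential and the principal logarithm *)

Lemma Cexp_plus a b : Cexp (a + b) = (Cexp a * Cexp b)%C.
Proof.
  unfold Cexp. destruct a as [x y], b as [x' y']. unfold Re, Im; simpl.
  rewrite exp_plus, cos_plus, sin_plus. apply injective_projections; simpl; ring.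
Qed.

Lemma Cexp_0 : Cexp 0 = 1%C.
Proof. unfold Cexp, Re, Im. simpl. rewrite exp_0, cos_0, sin_0. apply injective_projections; simpl; ring. Qed.

Lemma Cmod_Cexp z : Cmod (Cexp z) = exp (Re z).
Proof.
  unfold Cexp. replace (exp (Re z) * cos (Im z), exp (Re z) * sin (Im z))%R
    with (RtoC (exp (Re z)) * (cos (Im z), sin (Im z)))%C.
  - rewrite Cmod_mult, Cmod_R, Rabs_pos_eq by (apply Rlt_le, exp_pos).
    unfold Cmod. simpl. rewrite !Rmult_1_r. generalize (sin2_cos2 (Im z)). unfold Rsqr.
    rewrite Rplus_comm. intros ->. rewrite sqrt_1. ring.
  - apply injective_projections; simpl; ring.
Qed.

Lemma Cexp_neq_0 z : Cexp z <> 0%C.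
Proof. apply Cmod_neq_0. rewrite Cmod_Cexp. apply exp_pos. Qed.

Lemma Cexp_deriv_0 e : 0 < e -> exists d, 0 < d /\
  forall h, Cmod h < d -> Cmod (Cexp h - 1 - h) <= e * Cmod h.
Proof.
  intros He.
  assert (X : rderiv (fun t => (exp t, 0)) 0 (1, 0)).
  { apply (rderiv_pair exp (fun _ => 0)).
    - auto_derive; auto. rewrite exp_0. ring.
    - auto_derive; auto. }
  assert (Y : rderiv (fun t => (cos t, sin t)) 0 (0, 1)).
  { apply rderiv_pair; auto_derive; auto.
    - rewrite sin_0. ring.
    - rewrite cos_0. ring. }
  set (k := Rmin (e / 3) 1). assert (Hk : 0 < k) by (apply Rmin_pos; lra).
  assert (k1 : k <= e / 3) by apply Rmin_l. assert (k2 : k <= 1) by apply Rmin_r.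
  destruct (X k Hk) as [d1 [Hd1 H1]]. destruct (Y k Hk) as [d2 [Hd2 H2]].
  exists (Rmin (Rmin d1 d2) (e / 12)). split; [repeat apply Rmin_pos; lra|]. intros [x y] Hh.
  assert (Hh3 := Rlt_le_trans _ _ _ Hh (Rmin_r _ _)).
  assert (Hh0 := Rlt_le_trans _ _ _ Hh (Rmin_l _ _)).
  assert (Hh1 := Rlt_le_trans _ _ _ Hh0 (Rmin_l _ _)).
  assert (Hh2 := Rlt_le_trans _ _ _ Hh0 (Rmin_r _ _)).
  pose proof (Re_le_Cmod (x, y)) as Bx. pose proof (Im_le_Cmod (x, y)) as By.
  unfold Re in Bx; unfold Im in By; simpl in Bx, By.
  specialize (H1 x ltac:(lra)). specialize (H2 y ltac:(lra)).
  rewrite !Rplus_0_l in *. rewrite exp_0 in H1. rewrite cos_0, sin_0 in H2.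
  set (E := RtoC (exp x)). set (S := (cos y, sin y) : C).
  replace ((exp x, 0) - (1, 0) - (1, 0) * RtoC x)%C with (E - 1 - RtoC x)%C in H1.
  2: { apply injective_projections; simpl; ring. }
  replace ((cos y, sin y) - (1, 0) - (0, 1) * RtoC y)%C with (S - 1 - Ci * RtoC y)%C in H2.
  2: { unfold S. apply injective_projections; simpl; ring. }
  assert (ES : Cexp (x, y) = (E * S)%C).
  { unfold Cexp, E, S, Re, Im. apply injective_projections; simpl; ring. }
  assert (Exy : (x, y) = (RtoC x + Ci * RtoC y)%C).
  { apply injective_projections; simpl; ring. }
  rewrite ES.
  (* Real and imaginary increments are treated separately; the cross term [(E - 1) * (S - 1)] is
     quadratic in [h]. *)
  replace (E * S - 1 - (x, y))%C with ((E - 1 - RtoC x) + (S - 1 - Ci * RtoC y) + (E - 1) * (S - 1))%C.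
  2: { rewrite Exy. ring. }
  set (h := (x, y) : C) in *.
  pose proof (Cmod_triangle ((E - 1 - RtoC x) + (S - 1 - Ci * RtoC y)) ((E - 1) * (S - 1))) as T1.
  pose proof (Cmod_triangle (E - 1 - RtoC x) (S - 1 - Ci * RtoC y)) as T2.
  rewrite Cmod_mult in T1.
  assert (F1 : Cmod (E - 1) <= 2 * Rabs x).
  { pose proof (Cmod_le_minus (E - 1) (RtoC x)) as T. rewrite Cmod_R in T. pose proof (Rabs_pos x). nra. }
  assert (F2 : Cmod (S - 1) <= 2 * Rabs y).
  { pose proof (Cmod_le_minus (S - 1) (Ci * RtoC y)) as T. rewrite Cmod_mult, Cmod_Ci, Cmod_R in T. pose proof (Rabs_pos y). nra. }
  pose proof (Cmod_ge_0 (E - 1)). pose proof (Cmod_ge_0 (S - 1)). pose proof (Cmod_ge_0 h).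
  pose proof (Rabs_pos x). pose proof (Rabs_pos y).
  assert (F3 : Cmod (E - 1) * Cmod (S - 1) <= (2 * Cmod h) * (e / 6)).
  { apply Rmult_le_compat; lra. }
  assert (F4 : k * Rabs x <= e / 3 * Cmod h) by (apply Rmult_le_compat; lra).
  assert (F5 : k * Rabs y <= e / 3 * Cmod h) by (apply Rmult_le_compat; lra).
  lra.
Qed.

Lemma Cexp_sderiv z : sderiv Cexp z (Cexp z).
Proof.
  intros e He. set (m := exp (Re z)). assert (Hm : 0 < m) by apply exp_pos.
  destruct (Cexp_deriv_0 1 Rlt_0_1) as [d0 [Hd0 H0]].
  set (k := e / (8 * m)). assert (Hk : 0 < k) by (apply Rdiv_lt_0_compat; lra).
  destruct (Cexp_deriv_0 k Hk) as [d1 [Hd1 H1]].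
  set (d := Rmin (Rmin (d0 / 2) (d1 / 2)) (Rmin (k / 1) (1 / 4))).
  assert (Hd : 0 < d) by (repeat apply Rmin_pos; lra).
  assert (D0 : d <= d0 / 2) by (unfold d; eapply Rle_trans; [apply Rmin_l|apply Rmin_l]).
  assert (D1 : d <= d1 / 2) by (unfold d; eapply Rle_trans; [apply Rmin_l|apply Rmin_r]).
  assert (D2 : d <= k) by (unfold d; eapply Rle_trans; [apply Rmin_r|]; eapply Rle_trans; [apply Rmin_l|lra]).
  assert (D3 : d <= 1 / 4) by (unfold d; eapply Rle_trans; [apply Rmin_r|apply Rmin_r]).
  exists d. split; auto. intros a b Ha Hb.
  assert (Hab : Cmod (a - b) < 2 * d).
  { pose proof (Cmod_minus_le a z b) as T. rewrite (Cmod_minus_sym z b) in T. lra. }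
  assert (E1 : Cexp a = (Cexp b * Cexp (a - b))%C).
  { rewrite <- Cexp_plus. f_equal. ring. }
  assert (E2 : Cexp b = (Cexp z * Cexp (b - z))%C).
  { rewrite <- Cexp_plus. f_equal. ring. }
  assert (Lz : forall h, Cmod h < d0 -> Cmod (Cexp h - 1) <= 2 * Cmod h).
  { intros h Hh. specialize (H0 h Hh). pose proof (Cmod_le_minus (Cexp h - 1) h). lra. }
  assert (Bz := Lz (b - z)%C ltac:(lra)).
  replace (Cexp a - Cexp b - Cexp z * (a - b))%C
    with (Cexp z * (Cexp (b - z) * (Cexp (a - b) - 1 - (a - b)) + (Cexp (b - z) - 1) * (a - b)))%C.
  2: { rewrite E1, E2. ring. }
  rewrite Cmod_mult, Cmod_Cexp. fold m.
  pose proof (Cmod_ge_0 (a - b)) as G.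
  specialize (H1 (a - b)%C ltac:(lra)).
  pose proof (Cmod_le_minus (Cexp (b - z)) 1) as T. rewrite Cmod_1 in T.
  assert (V : Cmod (Cexp (b - z) * (Cexp (a - b) - 1 - (a - b)) + (Cexp (b - z) - 1) * (a - b)) <= 8 * k * Cmod (a - b)).
  { eapply Rle_trans; [apply Cmod_triangle|]. rewrite !Cmod_mult.
    assert (V1 : Cmod (Cexp (b - z)) * Cmod (Cexp (a - b) - 1 - (a - b)) <= 2 * (k * Cmod (a - b))).
    { apply Rmult_le_compat; auto using Cmod_ge_0; lra. }
    assert (V2 : Cmod (Cexp (b - z) - 1) * Cmod (a - b) <= 2 * k * Cmod (a - b)).
    { apply Rmult_le_compat_r; lra. }
    assert (0 <= k * Cmod (a - b)) by nra. lra. }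
  apply Rle_trans with (m * (8 * k * Cmod (a - b))); [apply Rmult_le_compat_l; lra|].
  right. unfold k. field. lra.
Qed.

Lemma Re_div_Cmod_bound (z : C) : z <> 0%C -> -1 <= Re z / Cmod z <= 1.
Proof.
  intros Hz. pose proof (proj1 (Cmod_gt_0 _) Hz) as H. pose proof (Re_le_Cmod z) as B.
  apply Rabs_le_between in B. split.
  - apply Rle_div_r; auto. lra.
  - apply Rle_div_l; auto. lra.
Qed.

Lemma Cexp_Clog (z : C) : z <> 0%C -> Cexp (Clog z) = z.
Proof.
  intros Hz. pose proof (proj1 (Cmod_gt_0 _) Hz) as H. pose proof (Re_div_Cmod_bound z Hz) as B.
  unfold Cexp, Clog. change (Re (ln (Cmod z), Carg z)) with (ln (Cmod z)).
  change (Im (ln (Cmod z), Carg z)) with (Carg z). rewrite exp_ln by auto.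
  assert (S : Cmod z * sqrt (1 - (Re z / Cmod z)²) = Rabs (Im z)).
  { rewrite <- (sqrt_Rsqr (Cmod z)) at 1 by lra. rewrite <- sqrt_mult_alt by apply Rle_0_sqr.
    rewrite <- sqrt_Rsqr_abs. f_equal. unfold Rsqr. pose proof (Cmod_sq z) as Q.
    replace (Cmod z * Cmod z * (1 - Re z / Cmod z * (Re z / Cmod z))) with (Cmod z * Cmod z - Re z * Re z) by (field; lra).
    lra. }
  unfold Carg. destruct (Rlt_dec (Im z) 0) as [Hn|Hn].
  - rewrite cos_neg, sin_neg, cos_acos, sin_acos by auto. rewrite Rabs_left in S by auto.
    apply injective_projections; simpl.
    + change (fst z) with (Re z). field. lra.
    + change (snd z) with (Im z). unfold Rsqr in *. lra.
  - rewrite cos_acos, sin_acos by auto. rewrite Rabs_pos_eq in S by lra.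
    apply injective_projections; simpl.
    + change (fst z) with (Re z). field. lra.
    + change (snd z) with (Im z). unfold Rsqr in *. lra.
Qed.

Lemma Carg_bound (z : C) : 0 < Re z -> Rabs (Carg z) < PI / 2.
Proof.
  intros Hz. assert (Hz0 : z <> 0%C). { intros E. rewrite E in Hz. unfold Re in Hz. simpl in Hz. lra. }
  pose proof (proj1 (Cmod_gt_0 _) Hz0) as H. pose proof (Re_div_Cmod_bound z Hz0) as B.
  assert (U : 0 < Re z / Cmod z) by (apply Rdiv_lt_0_compat; auto).
  pose proof (acos_bound (Re z / Cmod z)) as A. pose proof PI_RGT_0.
  assert (A2 : acos (Re z / Cmod z) < PI / 2).
  { apply Rnot_le_lt. intros K.
    pose proof (cos_le_0 _ K ltac:(lra)) as K1. rewrite cos_acos in K1 by auto. lra. }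
  unfold Carg. destruct (Rlt_dec (Im z) 0); unfold Rabs; destruct Rcase_abs; lra.
Qed.

Lemma Cexp_inj (x y : C) : Cexp x = Cexp y -> Rabs (Im x - Im y) < PI -> x = y.
Proof.
  intros E H. assert (M : exp (Re x) = exp (Re y)) by (rewrite <- !Cmod_Cexp, E; auto).
  apply exp_inv in M. unfold Cexp in E. rewrite M in E.
  injection E as E1 E2. pose proof (exp_pos (Re y)).
  apply Rmult_eq_reg_l in E1; [|lra]. apply Rmult_eq_reg_l in E2; [|lra].
  assert (C1 : cos (Rabs (Im x - Im y)) = 1).
  { transitivity (cos (Im x - Im y)).
    - unfold Rabs. destruct Rcase_abs; auto. apply cos_neg.
    - rewrite cos_minus, E1, E2. generalize (sin2_cos2 (Im y)). unfold Rsqr. lra. }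
  assert (Z : Rabs (Im x - Im y) = 0).
  { rewrite <- (acos_cos (Rabs (Im x - Im y))) by (split; [apply Rabs_pos|lra]). rewrite C1. apply acos_1. }
  assert (Im x - Im y = 0) by (destruct (Req_dec (Im x - Im y) 0) as [?|N]; auto; apply Rabs_no_R0 in N; lra).
  apply injective_projections; auto. change (Im x = Im y). lra.
Qed.

Lemma Re_pos_neq_0 (z : C) : 0 < Re z -> z <> 0%C.
Proof. intros Hz E. rewrite E in Hz. unfold Re in Hz. simpl in Hz. lra. Qed.

(** Near [z], [Clog] and the local inverse [g] of [Cexp] have the same exponential, and their
    imaginary parts both lie strictly between [- PI / 2] and [PI / 2]; hence they coincide. *)
Lemma Clog_sderiv (z : C) : 0 < Re z -> sderiv Clog z (/ z).
Proof.
  intros Hz. assert (Hz0 := Re_pos_neq_0 z Hz). pose proof (proj1 (Cmod_gt_0 _) Hz0) as Hm.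
  set (L := Clog z). assert (EL : Cexp L = z) by (apply Cexp_Clog; auto).
  assert (HL : sderiv Cexp L z) by (apply (sderiv_eq _ _ (Cexp L)); auto using Cexp_sderiv).
  destruct (inverse_function Cexp L z 1 Hz0 HL Rlt_0_1) as [g [r [d [Hr [Hd [_ [Hg [_ Hg']]]]]]]].
  { intros x _. eexists. apply Cexp_sderiv. }
  rewrite EL in *.
  pose proof (Carg_bound z Hz) as A. set (t := (PI / 2 - Rabs (Carg z)) / 1).
  assert (Ht : 0 < t) by (unfold t; lra).
  apply (sderiv_ext_loc g Clog z _ (Rmin d (Rmin (Re z) (Cmod z / 2 * t)))); auto.
  { repeat apply Rmin_pos; auto. nra. }
  intros y Hy.
  pose proof (Rlt_le_trans _ _ _ Hy (Rmin_l _ _)) as Y1.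
  pose proof (Rlt_le_trans _ _ _ Hy (Rmin_r _ _)) as Y0.
  pose proof (Rlt_le_trans _ _ _ Y0 (Rmin_l _ _)) as Y2.
  pose proof (Rlt_le_trans _ _ _ Y0 (Rmin_r _ _)) as Y3.
  assert (Ry : 0 < Re y).
  { pose proof (Re_lip y z) as T. assert (T' := Rle_lt_trans _ _ _ T Y2). apply Rabs_lt_between in T'. lra. }
  destruct (Hg y Y1) as [G1 [_ G2]].
  apply Cexp_inj.
  - rewrite G1. rewrite Cexp_Clog; auto using Re_pos_neq_0.
  - pose proof (Carg_bound y Ry) as Ay.
    assert (G3 : Rabs (Im (g y) - Im L) < t).
    { eapply Rle_lt_trans; [apply Im_lip|]. eapply Rle_lt_trans; [apply G2|].
      apply Rmult_lt_compat_l with (r := 2 / Cmod z) in Y3; [|apply Rdiv_lt_0_compat; lra].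
      replace (2 / Cmod z * (Cmod z / 2 * t)) with t in Y3 by (field; lra). auto. }
    change (Im L) with (Carg z) in G3. change (Im (Clog y)) with (Carg y).
    unfold t in G3. revert G3 A Ay. unfold Rabs. repeat destruct Rcase_abs; lra.
Qed.

(** In the right half-plane, an argument of absolute value at least [PI / 4] would force
    [|Im a| >= Re a], against [|Im a| < 1 / 2 < Re a]. *)
Lemma Clog_arg_small (a : C) : Cmod (a - 1) < 1 / 2 -> Rabs (Im (Clog a)) < PI / 4.
Proof.
  intros Ha. pose proof (Re_lip a 1) as R1. pose proof (Im_lip a 1) as I1.
  change (Re 1) with 1 in R1. change (Im 1) with 0 in I1.
  assert (Ra : 1 / 2 < Re a). { pose proof (Rabs_def2 _ _ (Rle_lt_trans _ _ _ R1 Ha)). lra. }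
  assert (Ia : Rabs (Im a) < 1 / 2). { replace (Im a) with (Im a - 0) by ring. lra. }
  assert (Hz0 := Re_pos_neq_0 a ltac:(lra)).
  pose proof (Carg_bound a ltac:(lra)) as B. change (Im (Clog a)) with (Carg a).
  pose proof (Cexp_Clog a Hz0) as E.
  pose proof (exp_pos (Re (Clog a))) as P. set (m := exp (Re (Clog a))) in *.
  assert (E1 : m * cos (Carg a) = Re a) by (rewrite <- E at 2; reflexivity).
  assert (E2 : m * sin (Carg a) = Im a) by (rewrite <- E at 2; reflexivity).
  set (t := Carg a) in *. clearbody t m.
  apply Rnot_le_lt. intros K. pose proof PI_RGT_0.
  assert (C1 : cos (Rabs t) = cos t) by (unfold Rabs; destruct Rcase_abs; auto; apply cos_neg).
  assert (S1 : m * sin (Rabs t) <= Rabs (Im a)).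
  { rewrite <- E2. unfold Rabs at 1. destruct Rcase_abs.
    - rewrite sin_neg. rewrite <- Rabs_Ropp. replace (m * - sin t) with (- (m * sin t)) by ring. apply Rle_abs.
    - apply Rle_abs. }
  assert (cos (Rabs t) <= cos (PI / 4)) by (apply cos_decr_1; lra).
  assert (sin (PI / 4) <= sin (Rabs t)) by (apply sin_incr_1; lra).
  assert (Q : cos (PI / 4) = sin (PI / 4)) by (rewrite cos_PI4, sin_PI4; auto).
  rewrite <- C1 in E1. nra.
Qed.

Lemma Clog_1 : Clog 1 = 0%C.
Proof.
  apply Cexp_inj.
  - rewrite Cexp_Clog, Cexp_0; auto. apply RtoC_neq_0. lra.
  - change (Im 0) with 0. rewrite Rminus_0_r.
    pose proof PI_RGT_0. apply Rlt_trans with (PI / 4); [|lra]. apply Clog_arg_small.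
    replace (1 - 1)%C with (RtoC 0) by ring. rewrite Cmod_0. lra.
Qed.

(** Four arguments below [PI / 4] leave the imaginary parts of the two sides less than [PI] apart,
    which rules out a discrepancy by a multiple of [2 * PI * Ci]. *)
Lemma Clog_div_mult (a b c d : C) : Cmod (a - 1) < 1 / 2 -> Cmod (b - 1) < 1 / 2 ->
  Cmod (c - 1) < 1 / 2 -> Cmod (d - 1) < 1 / 2 -> (a * b = c * d)%C ->
  (Clog a + Clog b = Clog c + Clog d)%C.
Proof.
  assert (N : forall x, Cmod (x - 1) < 1 / 2 -> x <> 0%C).
  { intros x Hx E. rewrite E in Hx. replace (0 - 1)%C with (- (1))%C in Hx by ring.
    rewrite Cmod_opp, Cmod_1 in Hx. lra. }
  intros Ha Hb Hc Hd E. apply Cexp_inj.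
  - rewrite !Cexp_plus, !Cexp_Clog; auto.
  - pose proof (Clog_arg_small a Ha). pose proof (Clog_arg_small b Hb).
    pose proof (Clog_arg_small c Hc). pose proof (Clog_arg_small d Hd).
    assert (P : forall x y, Im (x + y)%C = Im x + Im y) by (intros; reflexivity).
    rewrite !P. revert H H0 H1 H2. unfold Rabs. repeat destruct Rcase_abs; lra.
Qed.

(* The value at 0 is the limit [a 1], so that the quotient stays analytic. *)
Definition quot_id (f : C -> C) (c : C) (z : C) : C :=
  if Ceq_dec z 0 then c else (f z / z)%C.

Lemma psum_shift a h n : psum a h (S n) = (a 0%nat + h * psum (fun k => a (S k)) h n)%C.
Proof.
  induction n as [|n IH].
  - rewrite psum_S, !psum_O. simpl. ring.
  - rewrite psum_S, IH, psum_S. simpl. ring.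
Qed.

Lemma quot_id_expands f a : expands_at f 0 a -> a 0%nat = 0%C ->
  expands_at (quot_id f (a 1%nat)) 0 (fun n => a (S n)).
Proof.
  intros [r [Hr H]] Ha. exists r. split; auto. intros h Hh. rewrite Cplus_0_l.
  unfold quot_id. destruct (Ceq_dec h 0) as [->|Hn].
  - apply is_pseries_C. intros e He. exists 0%nat. intros n _.
    assert (E : psum (fun k => a (S k)) 0 n = a 1%nat).
    { induction n as [|n IH]; [apply psum_O|]. rewrite psum_S, IH. simpl. ring. }
    rewrite E. replace (a 1%nat - a 1%nat)%C with (RtoC 0) by ring. rewrite Cmod_0; auto.
  - specialize (H h Hh). rewrite Cplus_0_l, is_pseries_C in H. apply is_pseries_C. intros e He.
    pose proof (proj1 (Cmod_gt_0 _) Hn) as Hm.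
    destruct (H (Cmod h * e)) as [N HN]; [nra|]. exists N. intros n Hn'.
    specialize (HN (S n) ltac:(lia)). rewrite psum_shift, Ha in HN.
    replace (psum (fun k => a (S k)) h n - f h / h)%C with ((0 + h * psum (fun k => a (S k)) h n - f h) / h)%C
      by (field; auto).
    rewrite Cmod_div by auto. apply Rlt_div_l; auto. lra.
Qed.

Lemma expands_at_val f z a : expands_at f z a -> f z = a 0%nat.
Proof.
  intros [r [Hr H]]. specialize (H 0%C). rewrite Cmod_0, Cplus_0_r in H. specialize (H Hr).
  apply (is_pseries_C_unique a (RtoC 0) _ _ H). apply is_pseries_C. intros e He. exists 0%nat. intros n _.
  assert (E : psum a 0 n = a 0%nat).
  { induction n as [|n IH]; [apply psum_O|]. rewrite psum_S, IH. simpl. ring. }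
  rewrite E. replace (a 0%nat - a 0%nat)%C with (RtoC 0) by ring. rewrite Cmod_0; auto.
Qed.

(** * Asymptotic expansions at 0 and a removable singularity *)

Lemma expands_at_tail f a : expands_at f 0 a -> exists r, 0 < r /\ forall N, exists K,
  0 < K /\ forall z, Cmod z < r -> Cmod (f z - psum a z N) <= K * Cmod z ^ S N.
Proof.
  intros H. destruct (expands_at_coef_bound f 0 a H) as [r [K [Hr [HK [Ha Hf]]]]].
  exists (r / 2). split; [lra|]. intros N.
  assert (0 < / r ^ S N) by (apply Rinv_0_lt_compat, pow_lt; auto).
  exists (2 * K * / r ^ S N). split; [nra|].
  intros z Hz. specialize (Hf z ltac:(lra)). rewrite Cplus_0_l in Hf.
  eapply Rle_trans; [apply (pseries_tail a z (f z) K r N); auto; lra|].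
  right. unfold Rdiv. rewrite Rpow_mult_distr, pow_inv. ring.
Qed.

(** The coefficients may depend on the order [N]. This freedom makes composition with an analytic
    map easy; [asy_uniform_coef] recovers a single series at the end. *)
Definition asy (V : C -> Prop) (h : C -> C) : Prop := forall N, exists b K,
  forall z, V z -> Cmod (h z - psum b z N) <= K * Cmod z ^ S N.

Lemma asy_subset (V W : C -> Prop) h : (forall z, W z -> V z) -> asy V h -> asy W h.
Proof. intros H HV N. destruct (HV N) as [b [K HK]]. exists b, K. auto. Qed.

Lemma asy_ext V h k : (forall z, V z -> h z = k z) -> asy V h -> asy V k.
Proof. intros E H N. destruct (H N) as [b [K HK]]. exists b, K. intros z Hz. rewrite <- E; auto. Qed.

Lemma analytic_asy f : analytic_at f 0 -> exists r, 0 < r /\ asy (fun z => Cmod z < r) f.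
Proof.
  intros [a Ha]. destruct (expands_at_tail f a Ha) as [r [Hr H]]. exists r. split; auto.
  intros N. destruct (H N) as [K [_ HK]]. exists a, K. auto.
Qed.

Lemma psum_plus a b z N : psum (fun k => a k + b k)%C z N = (psum a z N + psum b z N)%C.
Proof. induction N as [|N IH]; [rewrite !psum_O; auto|]. rewrite !psum_S, IH. ring. Qed.

Lemma psum_scal c b z N : psum (fun k => c * b k)%C z N = (c * psum b z N)%C.
Proof. induction N as [|N IH]; [rewrite !psum_O; auto|]. rewrite !psum_S, IH. ring. Qed.

Lemma asy_plus V h k : asy V h -> asy V k -> asy V (fun z => h z + k z)%C.
Proof.
  intros Hh Hk N. destruct (Hh N) as [b [K HK]]. destruct (Hk N) as [b' [K' HK']].
  exists (fun n => b n + b' n)%C, (K + K'). intros z Hz. specialize (HK z Hz). specialize (HK' z Hz).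
  rewrite psum_plus.
  replace (h z + k z - (psum b z N + psum b' z N))%C with ((h z - psum b z N) + (k z - psum b' z N))%C by ring.
  eapply Rle_trans; [apply Cmod_triangle|]. lra.
Qed.

Lemma asy_scal V c h : asy V h -> asy V (fun z => c * h z)%C.
Proof.
  intros Hh N. destruct (Hh N) as [b [K HK]].
  exists (fun n => c * b n)%C, (Cmod c * K). intros z Hz. specialize (HK z Hz).
  rewrite psum_scal. replace (c * h z - c * psum b z N)%C with (c * (h z - psum b z N))%C by ring.
  rewrite Cmod_mult, Rmult_assoc. apply Rmult_le_compat_l; auto using Cmod_ge_0.
Qed.

Lemma asy_const V (c : C) : asy V (fun _ => c).
Proof.
  intros N. exists (fun n => match n with O => c | _ => 0%C end), 0. intros z _.
  rewrite psum_const; auto. replace (c - c)%C with (RtoC 0) by ring. rewrite Cmod_0. lra.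
Qed.

Lemma analytic_psum_comp b f N z : sdiff f z -> sdiff (fun x => psum b (f x) N) z.
Proof.
  intros Hf. apply (sdiff_comp (fun y => psum b y N) f); auto.
  apply sdiff_ext with (fun y => psum b (y - 0) N).
  - intros x. f_equal. ring.
  - apply sdiff_psum.
Qed.

(** The polynomial [psum b] composed with [phi] is analytic at 0, so its Taylor polynomial serves as
    the new partial sum. The error of [h] is transported by [|phi z| <= L * |z|]. *)
Lemma asy_comp (V W : C -> Prop) (h phi : C -> C) r L : 0 < r ->
  (forall x, Cmod x < r -> sdiff phi x) ->
  (forall z, W z -> Cmod z < r / 8 /\ Cmod (phi z) <= L * Cmod z /\ V (phi z)) ->
  asy V h -> asy W (fun z => h (phi z)).
Proof.
  intros Hr Hphi HW Hh N. destruct (Hh N) as [b [K HK]].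
  destruct (sdiff_ball_expands (fun x => psum b (phi x) N) 0 r (r / 2)) as [a [Ha Hb]].
  { intros x Hx. apply analytic_psum_comp, Hphi. replace x with (x - 0)%C by ring. auto. }
  { lra. }
  destruct (pseries_coef_bound (fun x => psum b (phi x) N) 0 a (r / 2) ltac:(lra) Ha) as [B0 [HB0 Hab]].
  set (B := 2 * B0 / (r / 2 / 2) ^ S N).
  assert (HB : forall z, Cmod z < r / 8 -> Cmod (psum b (phi z) N - psum a z N) <= B * Cmod z ^ S N).
  { intros z Hz. specialize (Ha z ltac:(lra)). rewrite Cplus_0_l in Ha.
    eapply Rle_trans; [apply (pseries_tail a z (psum b (phi z) N) B0 (r / 2 / 2) N); auto; lra|].
    right. unfold B, Rdiv at 1. rewrite Rpow_mult_distr, pow_inv. unfold Rdiv. ring. }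
  exists a, (Rabs K * Rabs L ^ S N + B). intros z Hz. destruct (HW z Hz) as [Z1 [Z2 Z3]].
  specialize (HB z Z1). specialize (HK (phi z) Z3).
  pose proof (Cmod_minus_le (h (phi z)) (psum b (phi z) N) (psum a z N)) as T.
  assert (M : K * Cmod (phi z) ^ S N <= Rabs K * Rabs L ^ S N * Cmod z ^ S N).
  { apply Rle_trans with (Rabs K * Cmod (phi z) ^ S N).
    - apply Rmult_le_compat_r; [apply pow_le, Cmod_ge_0|apply Rle_abs].
    - rewrite Rmult_assoc. apply Rmult_le_compat_l; [apply Rabs_pos|].
      rewrite <- Rpow_mult_distr. apply pow_incr. split; [apply Cmod_ge_0|].
      apply Rle_trans with (1 := Z2). apply Rmult_le_compat_r; [apply Cmod_ge_0|apply Rle_abs]. }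
  lra.
Qed.

(** A polynomial smaller than its degree allows is zero, tested only along points of [V] tending to
    0. Absorbing the top term into the bound kills the lower coefficients by induction; dividing by
    its power then kills the top one. *)
Lemma psum_zero_coef (V : C -> Prop) (c : nat -> C) N K :
  (forall e, 0 < e -> exists z, V z /\ 0 < Cmod z < e) ->
  (forall z, V z -> Cmod (psum c z N) <= K * Cmod z ^ S N) -> forall k, (k <= N)%nat -> c k = 0%C.
Proof.
  revert V K. induction N as [|N IH]; intros V K HV H.
  - intros k Hk. replace k with 0%nat by lia. apply Cmod_small_0. intros e He.
    destruct (HV (e / (Rabs K + 1))) as [z [Hz1 Hz2]].
    { apply Rdiv_lt_0_compat; auto. pose proof (Rabs_pos K). lra. }
    specialize (H z Hz1). rewrite psum_O in H. apply Rle_trans with (1 := H). simpl. rewrite Rmult_1_r.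
    pose proof (Rle_abs K). pose proof (Rabs_pos K). destruct Hz2 as [Z1 Z2].
    apply Rmult_lt_compat_l with (r := Rabs K + 1) in Z2; [|lra].
    replace ((Rabs K + 1) * (e / (Rabs K + 1))) with e in Z2 by (field; lra). nra.
  - assert (IH' : forall k, (k <= N)%nat -> c k = 0%C).
    { apply (IH (fun z => V z /\ Cmod z < 1) (Rabs K + Cmod (c (S N)))).
      - intros e He. destruct (HV (Rmin e 1)) as [z [Hz1 Hz2]]; [apply Rmin_pos; lra|].
        pose proof (Rmin_l e 1). pose proof (Rmin_r e 1). exists z. repeat split; auto; lra.
      - intros z [Hz1 Hz2]. specialize (H z Hz1). rewrite psum_S in H.
        pose proof (Cmod_le_minus (psum c z N) (psum c z N + c (S N) * z ^ S N)) as T.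
        replace (psum c z N - (psum c z N + c (S N) * z ^ S N))%C with (- (c (S N) * z ^ S N))%C in T by ring.
        rewrite Cmod_opp, Cmod_mult, Cmod_pow in T.
        assert (P : 0 <= Cmod z ^ S N) by (apply pow_le, Cmod_ge_0).
        assert (K * Cmod z ^ S (S N) <= Rabs K * Cmod z ^ S N).
        { pose proof (Rle_abs K). pose proof (Cmod_ge_0 z). change (Cmod z ^ S (S N)) with (Cmod z * Cmod z ^ S N).
          apply Rle_trans with (Rabs K * (Cmod z * Cmod z ^ S N)).
          - apply Rmult_le_compat_r; auto. apply Rmult_le_pos; auto.
          - apply Rmult_le_compat_l; [apply Rabs_pos|]. nra. }
        lra. }
    intros k Hk. destruct (le_lt_dec k N) as [Hk'|Hk']; auto.
    replace k with (S N) by lia. apply Cmod_small_0. intros e He.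
    pose proof (Rle_abs K). pose proof (Rabs_pos K).
    destruct (HV (e / (Rabs K + 1))) as [z [Hz1 [Z1 Z2]]].
    { apply Rdiv_lt_0_compat; auto. lra. }
    specialize (H z Hz1). rewrite psum_S in H.
    assert (E : psum c z N = 0%C).
    { clear - IH'. induction N as [|N IHN]; [rewrite psum_O; apply IH'; lia|].
      rewrite psum_S, IHN, IH'; [ring|lia|]. intros j Hj. apply IH'. lia. }
    rewrite E, Cplus_0_l, Cmod_mult, Cmod_pow in H.
    assert (P : 0 < Cmod z ^ S N) by (apply pow_lt; auto).
    change (Cmod z ^ S (S N)) with (Cmod z * Cmod z ^ S N) in H. rewrite <- Rmult_assoc in H.
    apply Rmult_le_reg_r in H; auto. apply Rle_trans with (1 := H).
    apply Rmult_lt_compat_l with (r := Rabs K + 1) in Z2; [|lra].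
    replace ((Rabs K + 1) * (e / (Rabs K + 1))) with e in Z2 by (field; lra). nra.
Qed.

Lemma psum_ext (a b : nat -> C) z N : (forall k, (k <= N)%nat -> a k = b k) -> psum a z N = psum b z N.
Proof.
  induction N as [|N IH]; intros H; [rewrite !psum_O; auto|].
  rewrite !psum_S, IH, H; auto.
Qed.

(** Truncations of different orders agree by [psum_zero_coef], which needs points of [V] near 0; the
    diagonal [c k k] is then the common series. *)
Lemma asy_uniform_coef (V : C -> Prop) h : (forall e, 0 < e -> exists z, V z /\ 0 < Cmod z < e) ->
  asy V h -> exists b, forall N, exists K, forall z, V z -> Cmod (h z - psum b z N) <= K * Cmod z ^ S N.
Proof.
  intros HV H. destruct (choice _ H) as [c Hc].
  assert (Step : forall N k, (k <= N)%nat -> c (S N) k = c N k).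
  { intros N k Hk. destruct (Hc N) as [K1 H1]. destruct (Hc (S N)) as [K2 H2].
    assert (Z : (c (S N) k + (-(1)) * c N k = 0)%C).
    { apply (psum_zero_coef (fun z => V z /\ Cmod z < 1) (fun k => c (S N) k + (-(1)) * c N k)%C N
        (K1 + Rabs K2 + Cmod (c (S N) (S N)))); auto.
      - intros e He. destruct (HV (Rmin e 1)) as [z [Hz1 Hz2]]; [apply Rmin_pos; lra|].
        pose proof (Rmin_l e 1). pose proof (Rmin_r e 1). exists z. repeat split; auto; lra.
      - intros z [Hz1 Hz2]. specialize (H1 z Hz1). specialize (H2 z Hz1). rewrite psum_S in H2.
        rewrite psum_plus, psum_scal.
        replace (psum (c (S N)) z N + (-(1)) * psum (c N) z N)%C with
          ((h z - psum (c N) z N) - (h z - (psum (c (S N)) z N + c (S N) (S N) * z ^ S N)) - c (S N) (S N) * z ^ S N)%C by ring.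
        eapply Rle_trans; [apply Cmod_minus_triangle|].
        pose proof (Cmod_minus_triangle (h z - psum (c N) z N) (h z - (psum (c (S N)) z N + c (S N) (S N) * z ^ S N))) as T.
        rewrite Cmod_mult, Cmod_pow.
        assert (P : 0 <= Cmod z ^ S N) by (apply pow_le, Cmod_ge_0).
        assert (K2 * Cmod z ^ S (S N) <= Rabs K2 * Cmod z ^ S N).
        { pose proof (Rle_abs K2). pose proof (Cmod_ge_0 z). change (Cmod z ^ S (S N)) with (Cmod z * Cmod z ^ S N).
          apply Rle_trans with (Rabs K2 * (Cmod z * Cmod z ^ S N)).
          - apply Rmult_le_compat_r; auto. apply Rmult_le_pos; auto.
          - apply Rmult_le_compat_l; [apply Rabs_pos|]. nra. }
        lra. }
    replace (c (S N) k) with ((c (S N) k + (-(1)) * c N k) + c N k)%C by ring. rewrite Z. ring. }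
  exists (fun k => c k k). intros N. destruct (Hc N) as [K HK]. exists K. intros z Hz.
  rewrite (psum_ext _ (c N)); auto. clear - Step. intros k Hk. induction Hk as [|N Hk IH]; auto.
  rewrite Step; auto.
Qed.

(** Strict differentiability compares two points [a], [b]. If their distance is at least a fifth of
    [|a|], the quadratic bound at each suffices; otherwise Cauchy's estimate on the disc of radius
    [|a| / 2] about [a] applies, a disc that avoids 0. The constant 100 dominates the [5 + 6] of the
    first case and the 32 of the second. *)
Lemma removable_quadratic (f : C -> C) R K : 0 < R -> (forall z, 0 < Cmod z < R -> sdiff f z) ->
  (forall z, Cmod z < R -> Cmod (f z) <= K * (Cmod z * Cmod z)) -> sderiv f 0 0.
Proof.
  intros HR Hf HK e He.
  assert (HK0 : 0 <= K).
  { specialize (HK (RtoC (R / 2))). rewrite Cmod_R, Rabs_pos_eq in HK by lra.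
    specialize (HK ltac:(lra)). pose proof (Cmod_ge_0 (f (RtoC (R / 2)))).
    assert (P : 0 < R / 2 * (R / 2)) by nra. set (p := R / 2 * (R / 2)) in *. clearbody p.
    apply Rnot_lt_le. intros Q. nra. }
  set (d := Rmin (R / 2) (e / (100 * K + 1))).
  assert (Hd : 0 < d) by (apply Rmin_pos; [lra|apply Rdiv_lt_0_compat; lra]).
  assert (D1 : d <= R / 2) by apply Rmin_l.
  assert (D2 : 100 * K * d <= e).
  { pose proof (Rmin_r (R / 2) (e / (100 * K + 1))) as T. fold d in T.
    apply Rmult_le_compat_l with (r := 100 * K + 1) in T; [|lra].
    replace ((100 * K + 1) * (e / (100 * K + 1))) with e in T by (field; lra). lra. }
  exists d. split; auto.
  assert (Main : forall a b, Cmod a < d -> Cmod b < d -> Cmod (f a - f b) <= 100 * K * d * Cmod (a - b)).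
  { intros a b Ha Hb. pose proof (Cmod_ge_0 (a - b)) as G. pose proof (Cmod_ge_0 a) as Ga. pose proof (Cmod_ge_0 b) as Gb.
    destruct (Rle_lt_dec (Cmod a / 5) (Cmod (a - b))) as [Hc|Hc].
    - pose proof (HK a ltac:(lra)). pose proof (HK b ltac:(lra)).
      pose proof (Cmod_minus_triangle (f a) (f b)).
      pose proof (Cmod_le_minus b a) as B. rewrite Cmod_minus_sym in B.
      assert (A1 : Cmod a * Cmod a <= d * (5 * Cmod (a - b))) by (apply Rmult_le_compat; lra).
      assert (A2 : Cmod b * Cmod b <= d * (6 * Cmod (a - b))) by (apply Rmult_le_compat; lra).
      assert (0 <= d * Cmod (a - b)) by nra.
      assert (K * (Cmod a * Cmod a) <= K * (d * (5 * Cmod (a - b)))) by (apply Rmult_le_compat_l; auto).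
      assert (K * (Cmod b * Cmod b) <= K * (d * (6 * Cmod (a - b)))) by (apply Rmult_le_compat_l; auto).
      assert (0 <= K * (d * Cmod (a - b))) by nra. lra.
    - assert (Ha0 : 0 < Cmod a) by lra.
      set (r := Cmod a / 2).
      destruct (sdiff_ball_expands f a (Cmod a * 3 / 4) r) as [c [Hc1 Hc2]].
      { intros x Hx. pose proof (Cmod_le_minus a x) as T. rewrite (Cmod_minus_sym a x) in T.
        pose proof (Cmod_le_minus x a) as T'. apply Hf. lra. }
      { unfold r. lra. }
      assert (HB : forall n, Cmod (c n) <= (2 * (K * (4 * (Cmod a * Cmod a)))) / r ^ n).
      { apply Hc2. intros x Hx. unfold r in Hx. pose proof (Cmod_le_minus x a) as T'.
        eapply Rle_trans; [apply HK; lra|]. apply Rmult_le_compat_l; auto. pose proof (Cmod_ge_0 x). nra. }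
      assert (Hbr : Cmod (b - a) <= r / 2). { rewrite Cmod_minus_sym. unfold r. lra. }
      assert (T := pseries_tail c (b - a) _ _ r 0 ltac:(unfold r; lra) Hbr HB (Hc1 (b - a)%C ltac:(unfold r in *; lra))).
      replace (a + (b - a))%C with b in T by ring.
      assert (Ea : f a = c 0%nat).
      { apply expands_at_val. exists r. split; [unfold r; lra|auto]. }
      rewrite psum_O, <- Ea in T. rewrite Cmod_minus_sym. apply Rle_trans with (1 := T).
      rewrite pow_1, (Cmod_minus_sym b a). unfold r.
      replace (2 * (2 * (K * (4 * (Cmod a * Cmod a)))) * (Cmod (a - b) / (Cmod a / 2)))
        with (32 * K * Cmod a * Cmod (a - b)) by (field; lra).
      apply Rmult_le_compat_r; auto. nra. }
  intros a b Ha Hb. replace (a - 0)%C with a in Ha by ring. replace (b - 0)%C with b in Hb by ring.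
  replace (f a - f b - 0 * (a - b))%C with (f a - f b)%C by ring.
  eapply Rle_trans; [apply Main; auto|]. apply Rmult_le_compat_r; auto using Cmod_ge_0.
Qed.

(** * Petals *)

(* In the coordinate [w = -1/z] near 0 the germs are close to the translation
   [w + a], [a = 1] or [a = -1], and the petals are outsides of parabolas. *)
Definition wcoord (z : C) : C := (- / z)%C.

Definition height (a k : R) (z : C) : R := k * (Im (wcoord z) * Im (wcoord z)) + a * Re (wcoord z).

(** A larger [k] excludes a thinner parabola and gives a larger region; lowering [k] is what makes
    room for perturbations. *)
Definition parabola (a k M : R) (z : C) : Prop := z <> 0%C /\ M < height a k z.

(** One notion for the germ on its attracting side ([a = 1]) and for its inverse on the repelling
    side ([a = -1]). In terms of [w] the error is [O(1/|w|^2)], with no term in [1/w]. *)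
Definition near_translation (s : C -> C) (a K r : R) : Prop :=
  a * a = 1 /\ 0 < r /\ 0 <= K /\
  forall z, 0 < Cmod z < r -> s z <> 0%C /\ Cmod (wcoord (s z) - wcoord z - RtoC a) <= K * (Cmod z * Cmod z).

Lemma wcoord_mod (z : C) : z <> 0%C -> Cmod (wcoord z) = / Cmod z.
Proof. intros H. unfold wcoord. rewrite Cmod_opp, Cmod_inv; auto. Qed.

Lemma wcoord_invol (z : C) : z <> 0%C -> wcoord (wcoord z) = z.
Proof.
  intros H. unfold wcoord. field. auto.
Qed.

Lemma unit_sign a x : a * a = 1 -> Rabs (a * x) = Rabs x.
Proof.
  intros H. rewrite Rabs_mult. replace (Rabs a) with 1; [ring|].
  assert (Rabs a * Rabs a = 1) by (rewrite <- Rabs_mult, H; apply Rabs_R1).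
  pose proof (Rabs_pos a). nra.
Qed.

Lemma height_le a k (z : C) : a * a = 1 -> 0 < k -> z <> 0%C ->
  height a k z <= k * (/ Cmod z * / Cmod z) + / Cmod z.
Proof.
  intros Ha Hk Hz. unfold height. rewrite <- (wcoord_mod z Hz).
  pose proof (Im_le_Cmod (wcoord z)) as I. pose proof (Re_le_Cmod (wcoord z)) as J.
  pose proof (unit_sign a (Re (wcoord z)) Ha) as U. pose proof (Rle_abs (a * Re (wcoord z))).
  apply Rplus_le_compat; [|lra]. apply Rmult_le_compat_l; [lra|].
  rewrite <- (Rabs_pos_eq (Im (wcoord z) * Im (wcoord z))) by nra.
  rewrite Rabs_mult. apply Rmult_le_compat; auto using Rabs_pos.
Qed.

Lemma parabola_small a k rho : a * a = 1 -> 0 < k -> 0 < rho ->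
  exists M0, 0 < M0 /\ forall M z, M0 <= M -> parabola a k M z -> 0 < Cmod z < rho.
Proof.
  intros Ha Hk Hrho. assert (Hi : 0 < / rho) by (apply Rinv_0_lt_compat; auto).
  exists (k * (/ rho * / rho) + / rho). split; [nra|].
  intros M z HM [Hz Hh]. pose proof (proj1 (Cmod_gt_0 _) Hz) as Hm. split; auto.
  apply Rnot_le_lt. intros Hc.
  pose proof (height_le a k z Ha Hk Hz) as H1.
  assert (I : / Cmod z <= / rho) by (apply Rinv_le_contravar; auto).
  assert (0 < / Cmod z) by (apply Rinv_0_lt_compat; auto).
  assert (/ Cmod z * / Cmod z <= / rho * / rho) by (apply Rmult_le_compat; lra).
  assert (k * (/ Cmod z * / Cmod z) <= k * (/ rho * / rho)) by (apply Rmult_le_compat_l; lra).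
  lra.
Qed.

(** The translation adds [a * a = 1] to the height. With an error [e = O(|z|^2)] and [|w| = 1/|z|],
    the cross term [2 * k * Im w * Im e] is [O(|z|)], so close to 0 the errors eat at most half of
    the gain; [q] collects the constants of this estimate. *)
Lemma height_step s a k K r : near_translation s a K r -> 0 < k ->
  exists rho, 0 < rho <= r /\ forall z, 0 < Cmod z < rho -> s z <> 0%C /\ height a k z + 1 / 2 <= height a k (s z).
Proof.
  intros [Ha [Hr [HK Hs]]] Hk.
  set (q := 4 * k * K + 2 * K + 1). assert (Hq : 0 < q) by (unfold q; nra).
  exists (Rmin r (Rmin 1 (/ q))). split.
  { split; [|apply Rmin_l]. repeat apply Rmin_pos; auto; try lra. apply Rinv_0_lt_compat; auto. }
  intros z [Hz0 Hz].
  pose proof (Rlt_le_trans _ _ _ Hz (Rmin_l _ _)) as Z1.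
  pose proof (Rlt_le_trans _ _ _ Hz (Rmin_r _ _)) as Z2.
  pose proof (Rlt_le_trans _ _ _ Z2 (Rmin_l _ _)) as Z3.
  pose proof (Rlt_le_trans _ _ _ Z2 (Rmin_r _ _)) as Z4.
  destruct (Hs z (conj Hz0 Z1)) as [S1 S2]. split; auto.
  assert (Hzn : z <> 0%C) by (apply Cmod_neq_0; auto).
  set (e := (wcoord (s z) - wcoord z - RtoC a)%C) in *.
  assert (E : wcoord (s z) = (wcoord z + RtoC a + e)%C) by (unfold e; ring).
  unfold height. rewrite E. set (w := wcoord z) in *.
  replace (Im (w + RtoC a + e)) with (Im w + Im e) by (unfold Im; simpl; ring).
  replace (Re (w + RtoC a + e)) with (Re w + a + Re e) by (unfold Re; simpl; ring).
  set (m := Cmod z) in *.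
  assert (Wm : Cmod w = / m) by (apply wcoord_mod; auto).
  pose proof (Im_le_Cmod w) as Iw. rewrite Wm in Iw.
  pose proof (Im_le_Cmod e) as Ie. pose proof (Re_le_Cmod e) as Re_.
  assert (Y : Rabs (Im w * Im e) <= K * m).
  { rewrite Rabs_mult. apply Rle_trans with (/ m * (K * (m * m))).
    - apply Rmult_le_compat; auto using Rabs_pos. lra.
    - right. field. lra. }
  assert (X : Rabs (a * Re e) <= K * m).
  { rewrite unit_sign by auto. apply Rle_trans with (K * (m * m)); [lra|].
    apply Rmult_le_compat_l; auto. nra. }
  assert (Q : q * m <= 1).
  { apply Rmult_le_reg_l with (/ q); [apply Rinv_0_lt_compat; auto|].
    rewrite <- Rmult_assoc, Rinv_l by lra. lra. }
  apply Rabs_le_between in Y, X.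
  assert (k * (Im w * Im e) >= - (k * (K * m))) by nra.
  assert (0 <= k * (Im e * Im e)) by (apply Rmult_le_pos; [lra|nra]).
  replace (k * ((Im w + Im e) * (Im w + Im e)) + a * (Re w + a + Re e))
    with (k * (Im w * Im w) + a * Re w + (2 * (k * (Im w * Im e)) + k * (Im e * Im e) + (a * a) + a * Re e)) by ring.
  rewrite Ha. unfold q in Q. assert (0 <= k * (K * m)) by (apply Rmult_le_pos; [lra|apply Rmult_le_pos; lra]).
  assert (0 <= K * m) by (apply Rmult_le_pos; lra). nra.
Qed.

(** Where the height with coefficient [k] is positive, a negative [a * Re w] is at most
    [k * (Im w)^2] in absolute value; doubling the coefficient therefore leaves a quantity bounded
    below by a multiple of [|w|]. *)
Lemma height_growth a k M (z : C) : a * a = 1 -> 0 < k -> 0 <= M -> parabola a k M z -> Cmod z <= 1 / 2 ->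
  Rmin (k / 4) (1 / 4) * / Cmod z <= height a (2 * k) z.
Proof.
  intros Ha Hk HM [Hz Hh] Hz2. rewrite <- (wcoord_mod z Hz). unfold height in *.
  set (w := wcoord z) in *. set (x := a * Re w) in *. set (y := Im w) in *.
  pose proof (Rmin_l (k / 4) (1 / 4)) as C1. pose proof (Rmin_r (k / 4) (1 / 4)) as C2.
  assert (C0 : 0 < Rmin (k / 4) (1 / 4)) by (apply Rmin_pos; lra).
  set (c := Rmin (k / 4) (1 / 4)) in *.
  assert (W2 : 2 <= Cmod w).
  { unfold w. rewrite wcoord_mod by auto. pose proof (proj1 (Cmod_gt_0 _) Hz).
    replace 2 with (/ (1 / 2)) by field. apply Rinv_le_contravar; auto. }
  assert (W : Cmod w <= 2 * (Rabs x + y * y)).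
  { pose proof (Cmod_le_Re_Im w) as T. fold y in T. unfold x. rewrite unit_sign by auto.
    assert (Rabs y <= y * y + 1).
    { rewrite <- (Rabs_pos_eq (y * y)) by nra. rewrite Rabs_mult. pose proof (Rabs_pos y). nra. }
    lra. }
  assert (Yp : 0 <= y * y) by nra.
  set (Y := y * y) in *. clearbody Y.
  apply Rle_trans with (c * (2 * (Rabs x + Y))); [apply Rmult_le_compat_l; lra|].
  assert (K1 : c * Rabs x <= 1 / 4 * Rabs x) by (apply Rmult_le_compat_r; auto using Rabs_pos).
  assert (K2 : c * Y <= k / 4 * Y) by (apply Rmult_le_compat_r; auto).
  assert (0 <= k * Y) by nra.
  revert K1. unfold Rabs. destruct Rcase_abs; intros; lra.
Qed.

(** Two heights are followed at once: coefficient [k] keeps the orbit in the region, coefficient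
    [2 * k] starts above a multiple of [1/|z|] and gains [1/2] per step. As a height is
    [O(1/|z|^2)], only the square of the modulus gets controlled: the decay obtained is [n^(-1/2)],
    not [1/n]. *)
Lemma parabola_orbit s a k K r : near_translation s a K r -> 0 < k ->
  exists M0 D, 0 < M0 /\ 0 < D /\ forall M z, M0 <= M -> parabola a k M z -> forall n,
    parabola a k M (Nat.iter n s z) /\ 0 < Cmod (Nat.iter n s z) < r /\
    Cmod (Nat.iter n s z) * Cmod (Nat.iter n s z) * (/ Cmod z + INR n) <= D.
Proof.
  intros Hs Hk. assert (Ha : a * a = 1) by apply Hs.
  destruct (height_step s a k K r Hs Hk) as [rho1 [Hrho1 H1]].
  destruct (height_step s a (2 * k) K r Hs ltac:(lra)) as [rho2 [Hrho2 H2]].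
  destruct (parabola_small a k (Rmin (Rmin rho1 rho2) (1 / 2)) Ha Hk) as [M0 [HM0 H3]].
  { repeat apply Rmin_pos; lra. }
  set (c := Rmin (k / 4) (1 / 4)). assert (Hc : 0 < c) by (apply Rmin_pos; lra).
  assert (Hc4 : c <= 1 / 4) by apply Rmin_r.
  exists M0, ((2 * k + 1) / c). split; auto. split; [apply Rdiv_lt_0_compat; lra|].
  intros M z HM Hz.
  assert (Small : forall z, parabola a k M z -> 0 < Cmod z /\ Cmod z < rho1 /\ Cmod z < rho2 /\ Cmod z < 1 / 2).
  { intros x Hx. destruct (H3 M x HM Hx) as [X1 X2].
    pose proof (Rlt_le_trans _ _ _ X2 (Rmin_l _ _)) as X3. pose proof (Rlt_le_trans _ _ _ X2 (Rmin_r _ _)).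
    pose proof (Rlt_le_trans _ _ _ X3 (Rmin_l _ _)). pose proof (Rlt_le_trans _ _ _ X3 (Rmin_r _ _)). auto. }
  assert (Orb : forall n, parabola a k M (Nat.iter n s z) /\
    height a (2 * k) z + INR n / 2 <= height a (2 * k) (Nat.iter n s z)).
  { induction n as [|n [IH1 IH2]].
    - simpl. split; auto. lra.
    - rewrite S_INR. simpl Nat.iter. set (u := Nat.iter n s z) in *.
      destruct (Small u IH1) as [U0 [U1 [U2 U3]]].
      destruct (H1 u (conj U0 U1)) as [A1 A2]. destruct (H2 u (conj U0 U2)) as [_ B2].
      split; [|lra]. split; auto. destruct IH1. lra. }
  intros n. destruct (Orb n) as [O1 O2]. set (u := Nat.iter n s z) in *.
  destruct (Small u O1) as [U0 [U1 [U2 U3]]].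
  split; auto. split; [lra|].
  pose proof (height_growth a k M z Ha Hk ltac:(lra) Hz) as G. fold c in G.
  destruct (Small z Hz) as [Z0 [_ [_ Z3]]]. specialize (G ltac:(lra)).
  pose proof (height_le a (2 * k) u Ha ltac:(lra) (proj1 O1)) as L.
  set (m := Cmod u) in *.
  assert (Im1 : 2 < / m). { replace 2 with (/ (1 / 2)) by field. apply Rinv_lt_contravar; nra. }
  assert (T : c * / Cmod z + INR n / 2 <= (2 * k + 1) * (/ m * / m)) by nra.
  pose proof (pos_INR n) as Hn.
  assert (T2 : c * (/ Cmod z + INR n) <= (2 * k + 1) * (/ m * / m)) by nra.
  apply Rmult_le_reg_l with c; auto.
  replace (c * (m * m * (/ Cmod z + INR n))) with (m * m * (c * (/ Cmod z + INR n))) by ring.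
  replace (c * ((2 * k + 1) / c)) with (m * m * ((2 * k + 1) * (/ m * / m))) by (field; lra).
  apply Rmult_le_compat_l; auto. nra.
Qed.

Lemma open_C (U : C -> Prop) : open U <-> forall z, U z -> exists d, 0 < d /\ forall y, Cmod (y - z) < d -> U y.
Proof.
  split.
  - intros H z Hz. destruct (H z Hz) as [e He]. exists e. split; [apply cond_pos|].
    intros y Hy. apply He. apply C_NormedModule_mixin_compat1. exact Hy.
  - intros H z Hz. destruct (H z Hz) as [d [Hd H1]].
    assert (Hd' : 0 < d / 2) by lra. exists (mkposreal _ Hd'). intros y Hy.
    apply H1. apply (C_NormedModule_mixin_compat2 z y) in Hy. simpl in Hy.
    apply Rlt_le_trans with (1 := Hy).
    assert (sqrt 2 <= 2). { rewrite <- (sqrt_square 2) at 2 by lra. apply sqrt_le_1_alt. lra. }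
    nra.
Qed.

Lemma parabola_open a k M : a * a = 1 -> 0 < k -> open (parabola a k M).
Proof.
  intros Ha Hk. apply open_C. intros z [Hz Hh].
  pose proof (proj1 (Cmod_gt_0 _) Hz) as Hm.
  assert (Sw : sdiff wcoord z).
  { apply (sdiff_opp (fun x => / x)%C). eexists. apply sderiv_inv; auto. }
  set (w := wcoord z). set (g := height a k z - M). assert (Hg : 0 < g) by (unfold g; lra).
  set (B := k * (2 * Cmod w + 1) + 1).
  pose proof (Cmod_ge_0 w) as Wp. assert (HB : 0 < B) by (unfold B; nra).
  destruct (sdiff_cont wcoord z Sw (Rmin 1 (g / B))) as [d [Hd H]].
  { apply Rmin_pos; [lra|]. apply Rdiv_lt_0_compat; auto. }
  exists (Rmin d (Cmod z)). split; [apply Rmin_pos; auto|]. intros y Hy.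
  split.
  - intros E. rewrite E in Hy. replace (0 - z)%C with (- z)%C in Hy by ring. rewrite Cmod_opp in Hy.
    pose proof (Rmin_r d (Cmod z)). lra.
  - specialize (H y (Rlt_le_trans _ _ _ Hy (Rmin_l _ _))). fold w in H.
    pose proof (Rlt_le_trans _ _ _ H (Rmin_l _ _)) as V1. pose proof (Rlt_le_trans _ _ _ H (Rmin_r _ _)) as V2.
    set (v := wcoord y) in *.
    assert (D : height a k z - height a k y <= B * Cmod (v - w)).
    { unfold height. fold w v.
      replace (k * (Im w * Im w) + a * Re w - (k * (Im v * Im v) + a * Re v))
        with (k * ((Im w - Im v) * (Im w + Im v)) + a * (Re w - Re v)) by ring.
      rewrite (Cmod_minus_sym v w) in *.
      pose proof (Rle_abs (a * (Re w - Re v))) as A1. rewrite unit_sign in A1 by auto.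
      pose proof (Re_lip w v) as A2.
      pose proof (Rle_abs ((Im w - Im v) * (Im w + Im v))) as A3. rewrite Rabs_mult in A3.
      pose proof (Im_lip w v) as A4.
      assert (A5 : Rabs (Im w + Im v) <= 2 * Cmod w + 1).
      { replace (Im w + Im v) with (2 * Im w - (Im w - Im v)) by ring.
        unfold Rminus at 1. eapply Rle_trans; [apply Rabs_triang|]. rewrite Rabs_Ropp, Rabs_mult, (Rabs_pos_eq 2) by lra.
        pose proof (Im_le_Cmod w). lra. }
      assert (A6 : Rabs (Im w - Im v) * Rabs (Im w + Im v) <= Cmod (w - v) * (2 * Cmod w + 1)).
      { apply Rmult_le_compat; auto using Rabs_pos. }
      assert (k * ((Im w - Im v) * (Im w + Im v)) <= k * (Cmod (w - v) * (2 * Cmod w + 1))) by (apply Rmult_le_compat_l; lra).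
      unfold B. lra. }
    apply Rmult_lt_compat_l with (r := B) in V2; auto.
    replace (B * (g / B)) with g in V2 by (field; lra). unfold g in V2. lra.
Qed.

Lemma path_connected (K : C -> Prop) :
  (forall x y, K x -> K y -> exists p, ccont p /\ p 0 = x /\ p 1 = y /\ forall t, 0 <= t <= 1 -> K (p t)) ->
  connected_set K.
Proof.
  intros H U1 U2 O1 O2 Hcov [x [Kx Ux]] [y [Ky Uy]].
  destruct (H x y Kx Ky) as [p [Cp [P0 [P1 PK]]]].
  apply NNPP. intros Hno.
  assert (Hdis : forall z, K z -> U1 z -> U2 z -> False) by (intros z A B D; apply Hno; exists z; auto).
  rewrite open_C in O1, O2.
  destruct (compact01 (fun t d => (forall u, 0 <= u <= 1 -> Rabs (u - t) < d -> U1 (p u)) \/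
    (forall u, 0 <= u <= 1 -> Rabs (u - t) < d -> U2 (p u)))) as [d [Hd Hu]].
  { intros t Ht.
    assert (L : forall U : C -> Prop, (forall z, U z -> exists d, 0 < d /\ forall y, Cmod (y - z) < d -> U y) ->
      U (p t) -> exists d, 0 < d /\ forall t', 0 <= t' <= 1 -> Rabs (t' - t) < d ->
        forall u, 0 <= u <= 1 -> Rabs (u - t') < d -> U (p u)).
    { intros U HU Hp. destruct (HU _ Hp) as [e [He He']]. destruct (Cp t Ht e He) as [d [Hd Hd']].
      exists (d / 2). split; [lra|]. intros t' Ht' Htt u Hu Hut. apply He', Hd'; auto.
      replace (u - t) with ((u - t') + (t' - t)) by ring. eapply Rle_lt_trans; [apply Rabs_triang|]. lra. }
    destruct (Hcov (p t) (PK t Ht)) as [V|V].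
    - destruct (L U1 O1 V) as [d [Hd Hd']]. exists d. split; auto. intros t' Ht' Htt. left. apply (Hd' t' Ht' Htt).
    - destruct (L U2 O2 V) as [d [Hd Hd']]. exists d. split; auto. intros t' Ht' Htt. right. apply (Hd' t' Ht' Htt). }
  { intros t e e' He [A|A]; [left|right]; intros u Hu1 Hu2; apply A; auto; lra. }
  assert (Ind : forall n t, 0 <= t <= 1 -> t <= INR n * (d / 2) -> U1 (p t)).
  { induction n as [|n IH]; intros t Ht Hn.
    - simpl in Hn. replace t with 0 by lra. rewrite P0. auto.
    - rewrite S_INR in Hn. destruct (Rle_lt_dec t (d / 2)) as [Ht2|Ht2].
      + destruct (Hu 0 ltac:(lra)) as [A|A].
        * apply A; auto. rewrite Rminus_0_r, Rabs_pos_eq; lra.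
        * exfalso. apply (Hdis (p 0)); [apply PK; lra|rewrite P0; auto|].
          apply A; [lra|]. rewrite Rminus_0_r, Rabs_R0; auto.
      + assert (T1 : U1 (p (t - d / 2))) by (apply IH; lra).
        destruct (Hu (t - d / 2) ltac:(lra)) as [A|A].
        * apply A; auto. rewrite Rabs_pos_eq; lra.
        * exfalso. apply (Hdis (p (t - d / 2))); [apply PK; lra|auto|].
          apply A; [lra|]. rewrite Rminus_diag, Rabs_R0; auto. }
  destruct (INR_unbounded (2 / d)) as [n Hn].
  apply (Hdis y); auto. rewrite <- P1. apply (Ind n); [lra|].
  apply Rmult_lt_compat_r with (r := d / 2) in Hn; [|lra].
  replace (2 / d * (d / 2)) with 1 in Hn by (field; lra). lra.
Qed.

Lemma ccont_RtoC : ccont (fun t => RtoC t).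
Proof.
  intros t _ e He. exists e. split; auto. intros t' _ H. rewrite <- RtoC_minus, Cmod_R. auto.
Qed.

Lemma wcoord_neq_0 (z : C) : z <> 0%C -> wcoord z <> 0%C.
Proof.
  intros Hz. apply Cmod_neq_0. rewrite wcoord_mod by auto. apply Rinv_0_lt_compat, Cmod_gt_0; auto.
Qed.

(* Joining [w1] to [w2] along an arc of parabola makes the height affine. *)
Lemma parabola_connected a k M : a * a = 1 -> 0 <= M -> connected_set (parabola a k M).
Proof.
  intros Ha HM. apply path_connected. intros x y [Hx Hhx] [Hy Hhy].
  set (w1 := wcoord x). set (w2 := wcoord y).
  set (L := k * ((Im w1 - Im w2) * (Im w1 - Im w2))).
  set (w := fun t : R => (w1 + RtoC t * (w2 - w1) + RtoC (a * L) * (RtoC t * (1 - RtoC t)))%C).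
  assert (Cw : ccont w).
  { unfold w. apply ccont_plus; [apply ccont_plus|].
    - apply ccont_const.
    - apply ccont_mult; [apply ccont_RtoC|apply ccont_const].
    - apply (ccont_mult (fun _ => RtoC (a * L))); [apply ccont_const|].
      apply ccont_mult; [apply ccont_RtoC|]. apply (ccont_minus (fun _ => RtoC 1)); [apply ccont_const|apply ccont_RtoC]. }
  assert (Hw : forall t, 0 <= t <= 1 -> M < k * (Im (w t) * Im (w t)) + a * Re (w t)).
  { intros t Ht. unfold height in Hhx, Hhy. fold w1 in Hhx. fold w2 in Hhy.
    replace (Im (w t)) with (Im w1 + t * (Im w2 - Im w1)) by (unfold w, Im, RtoC; simpl; ring).
    replace (Re (w t)) with (Re w1 + t * (Re w2 - Re w1) + a * L * (t * (1 - t))) by (unfold w, Re, RtoC; simpl; ring).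
    replace (k * ((Im w1 + t * (Im w2 - Im w1)) * (Im w1 + t * (Im w2 - Im w1))) +
      a * (Re w1 + t * (Re w2 - Re w1) + a * L * (t * (1 - t))))
      with ((1 - t) * (k * (Im w1 * Im w1) + a * Re w1) + t * (k * (Im w2 * Im w2) + a * Re w2)
        - k * ((Im w1 - Im w2) * (Im w1 - Im w2)) * (t * (1 - t)) + (a * a) * L * (t * (1 - t))) by ring.
    rewrite Ha. fold L. rewrite Rmult_1_l.
    set (A := k * (Im w1 * Im w1) + a * Re w1) in *. set (B := k * (Im w2 * Im w2) + a * Re w2) in *.
    clearbody A B L. assert (0 <= t * (B - M)) by (apply Rmult_le_pos; lra).
    assert (0 <= (1 - t) * (A - M)) by (apply Rmult_le_pos; lra).
    destruct (Rle_lt_dec t (1 / 2)).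
    - assert (0 < (1 - t) * (A - M)) by (apply Rmult_lt_0_compat; lra). lra.
    - assert (0 < t * (B - M)) by (apply Rmult_lt_0_compat; lra). lra. }
  assert (Nw : forall t, 0 <= t <= 1 -> w t <> 0%C).
  { intros t Ht E. specialize (Hw t Ht). rewrite E in Hw. unfold Im, Re in Hw. simpl in Hw. lra. }
  exists (fun t => wcoord (w t)). split; [|split; [|split]].
  - unfold wcoord. apply ccont_opp, ccont_inv; auto.
  - replace (w 0) with w1 by (unfold w; ring). apply wcoord_invol; auto.
  - replace (w 1) with w2 by (unfold w; ring). apply wcoord_invol; auto.
  - intros t Ht. split; [apply wcoord_neq_0; auto|]. unfold height. rewrite wcoord_invol; auto.
Qed.

(** This is the height in polar form, angles being measured from the axis of the petal. Near that
    axis the term [cos b / s] is large and positive; elsewhere in the sector [sin b * sin b] stays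
    above [m] and the term in [1 / s^2] dominates. The excluded region is thus tangent to the
    opposite ray. *)
Lemma sector_height alpha k M : 0 < alpha < PI -> 0 < k -> exists rho, 0 < rho /\
  forall s b, 0 < s < rho -> Rabs b < alpha ->
    M < k * ((sin b * sin b) / (s * s)) + cos b / s.
Proof.
  intros Halpha Hk.
  assert (Hc : cos alpha < 1 /\ -1 < cos alpha).
  { split.
    - rewrite <- cos_0. apply cos_decreasing_1; lra.
    - rewrite <- cos_PI. apply cos_decreasing_1; lra. }
  set (m := Rmin (3 / 4) (1 - cos alpha * cos alpha)).
  assert (Hm : 0 < m) by (apply Rmin_pos; nra).
  set (rho := Rmin (k * m / 2) (/ (2 * (Rabs M + 1)))).
  assert (HM : 0 < Rabs M + 1) by (pose proof (Rabs_pos M); lra).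
  assert (R1 : rho <= k * m / 2) by apply Rmin_l.
  assert (R2 : rho <= / (2 * (Rabs M + 1))) by apply Rmin_r.
  assert (Hkm : 0 < k * m) by (apply Rmult_lt_0_compat; auto).
  exists rho. split.
  { apply Rmin_pos; [lra|]. apply Rinv_0_lt_compat; lra. }
  intros s b Hs Hb.
  assert (IS : 2 * (Rabs M + 1) < / s).
  { rewrite <- (Rinv_inv (2 * (Rabs M + 1))). apply Rinv_lt_contravar; [|lra].
    apply Rmult_lt_0_compat; [lra|apply Rinv_0_lt_compat; lra]. }
  assert (CB : cos alpha <= cos b).
  { replace (cos b) with (cos (Rabs b)) by (unfold Rabs; destruct Rcase_abs; auto; apply cos_neg).
    apply cos_decr_1; try lra; apply Rabs_pos. }
  pose proof (Rle_abs M) as AM.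
  assert (IS2 : / (s * s) = / s * / s) by (field; lra).
  unfold Rdiv. rewrite IS2. set (i := / s) in *.
  assert (SC : sin b * sin b = 1 - cos b * cos b).
  { generalize (sin2_cos2 b). unfold Rsqr. lra. }
  destruct (Rle_lt_dec (1 / 2) (cos b)) as [Hcb|Hcb].
  - assert (0 <= k * (sin b * sin b * (i * i))).
    { apply Rmult_le_pos; [lra|]. apply Rmult_le_pos; nra. }
    nra.
  - assert (Hmb : m <= sin b * sin b).
    { rewrite SC. unfold m. destruct (Rle_lt_dec 0 (cos b)).
      - eapply Rle_trans; [apply Rmin_l|]. nra.
      - eapply Rle_trans; [apply Rmin_r|]. nra. }
    assert (KI : 2 <= k * m * i).
    { assert (s * i = 1) by (unfold i; field; lra).
      assert (k * m * i >= 2 * s * i) by nra. nra. }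
    assert (K1 : k * m * (i * i) <= k * (sin b * sin b * (i * i))).
    { replace (k * (sin b * sin b * (i * i))) with (k * (sin b * sin b) * (i * i)) by ring.
      apply Rmult_le_compat_r; nra. }
    assert (K2 : 2 * i <= k * m * (i * i)) by nra.
    nra.
Qed.

Lemma wcoord_polar s t : s <> 0 -> wcoord (polar s t) = (- cos t / s, sin t / s)%R.
Proof.
  intros Hs. unfold wcoord.
  assert (P : polar s t <> 0%C).
  { intros E. unfold polar in E. injection E as E1 E2. pose proof (sin2_cos2 t) as Q. unfold Rsqr in Q.
    assert (cos t = 0) by (apply (Rmult_eq_reg_l s); lra). assert (sin t = 0) by (apply (Rmult_eq_reg_l s); lra). nra. }
  assert (E : (polar s t * (cos t / s, - sin t / s)%R)%C = 1%C).
  { unfold polar. apply injective_projections; simpl.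
    - replace (s * cos t * (cos t / s) - s * sin t * (- sin t / s)) with (sin t * sin t + cos t * cos t) by (field; auto).
      apply sin2_cos2.
    - field. auto. }
  replace (/ polar s t)%C with ((cos t / s, - sin t / s)%R : C).
  - apply injective_projections; simpl; field; auto.
  - rewrite <- (Cmult_1_r (/ polar s t)). rewrite <- E. rewrite Cmult_assoc, Cinv_l, Cmult_1_l; auto.
Qed.

Lemma polar_neq_0 s t : 0 < s -> polar s t <> 0%C.
Proof.
  intros Hs E. unfold polar in E. injection E as E1 E2. pose proof (sin2_cos2 t) as Q. unfold Rsqr in Q.
  assert (cos t = 0) by (apply (Rmult_eq_reg_l s); lra). assert (sin t = 0) by (apply (Rmult_eq_reg_l s); lra). nra.
Qed.

Lemma Cmod_polar s t : 0 <= s -> Cmod (polar s t) = s.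
Proof.
  intros Hs. unfold Cmod, polar. simpl. rewrite !Rmult_1_r.
  replace (s * cos t * (s * cos t) + s * sin t * (s * sin t)) with (s * s * ((sin t)² + (cos t)²)) by (unfold Rsqr; ring).
  rewrite sin2_cos2, Rmult_1_r. apply sqrt_square; auto.
Qed.

Lemma parabola_sector a theta k M alpha : (a = 1 /\ theta = PI) \/ (a = -1 /\ theta = 0) ->
  0 < alpha < PI -> 0 < k ->
  exists rho, 0 < rho /\ forall z, sector theta alpha rho z -> parabola a k M z.
Proof.
  intros Ha Halpha Hk. destruct (sector_height alpha k M Halpha Hk) as [rho [Hrho H]].
  exists rho. split; auto. intros z [s [t [Hs [Ht ->]]]].
  split; [apply polar_neq_0; lra|].
  specialize (H s (t - theta) Hs Ht). unfold height. rewrite wcoord_polar by lra.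
  change (Im (- cos t / s, sin t / s)) with (sin t / s).
  change (Re (- cos t / s, sin t / s)) with (- cos t / s).
  destruct Ha as [[-> ->]|[-> ->]].
  - rewrite sin_minus, cos_minus, sin_PI, cos_PI in H.
    replace (k * (sin t / s * (sin t / s)) + 1 * (- cos t / s)) with
      (k * ((sin t * -1 - cos t * 0) * (sin t * -1 - cos t * 0) / (s * s)) + (cos t * -1 + sin t * 0) / s); auto.
    field. lra.
  - rewrite Rminus_0_r in H.
    replace (k * (sin t / s * (sin t / s)) + -1 * (- cos t / s)) with (k * (sin t * sin t / (s * s)) + cos t / s); auto.
    field. lra.
Qed.

Lemma parabola_petal (step : C -> C -> Prop) (s : C -> C) a theta k K r r0 :
  (a = 1 /\ theta = PI) \/ (a = -1 /\ theta = 0) ->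
  near_translation s a K r -> 0 < k -> 0 < r0 -> (forall z, 0 < Cmod z < r -> step z (s z)) ->
  exists M0, 0 < M0 /\ forall M, M0 <= M -> petal step theta r0 (parabola a k M).
Proof.
  intros Ha Hs Hk Hr0 Hstep. assert (Haa : a * a = 1) by apply Hs.
  destruct (parabola_orbit s a k K r Hs Hk) as [M1 [D [HM1 [HD H1]]]].
  destruct (parabola_small a k r0 Haa Hk Hr0) as [M2 [HM2 H2]].
  exists (Rmax M1 M2). split; [eapply Rlt_le_trans; [apply HM1|apply Rmax_l]|].
  intros M HM. pose proof (Rmax_l M1 M2). pose proof (Rmax_r M1 M2).
  split; [apply parabola_open; auto|]. split; [apply parabola_connected; auto; lra|].
  split; [intros z Hz; apply (H2 M z); auto; lra|].
  split; [intros alpha Halpha; apply parabola_sector; auto|].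
  intros z Hz. exists (fun n => Nat.iter n s z). split; [reflexivity|].
  assert (O := fun n => H1 M z ltac:(lra) Hz n).
  split.
  - intros n. destruct (O n) as [O1 [O2 _]]. split; [exact O1|]. exact (Hstep _ O2).
  - apply is_lim_seq_spec. intros e. destruct (INR_unbounded (D / (e * e))) as [N HN].
    exists N. intros n Hn. destruct (O n) as [_ [_ O3]].
    rewrite Rminus_0_r, Rabs_pos_eq by apply Cmod_ge_0.
    set (m := Cmod (Nat.iter n s z)) in *.
    assert (m0 : 0 <= m) by apply Cmod_ge_0.
    pose proof (cond_pos e) as He. apply Rnot_le_lt. intros Hme.
    assert (HNn : INR N <= INR n) by (apply le_INR; auto).
    assert (Ee : 0 < e * e) by nra.
    assert (D < INR N * (e * e)).
    { apply Rmult_lt_compat_r with (r := e * e) in HN; auto.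
      replace (D / (e * e) * (e * e)) with D in HN by (field; lra). auto. }
    assert (0 < / Cmod z) by (apply Rinv_0_lt_compat, Cmod_gt_0, Hz).
    assert (e * e <= m * m) by nra.
    assert (e * e * INR n <= m * m * (/ Cmod z + INR n)).
    { apply Rmult_le_compat; try lra. apply pos_INR. }
    nra.
Qed.

(** [S] misses the real axis, so a connected part of it containing points in the direction [theta]
    cannot leave their half-plane; [b] encodes which half-plane that is. *)
Lemma component_towards_half theta b (S : C -> Prop) z : 0 < b * sin theta ->
  (forall w, S w -> Im w <> 0) -> component_towards theta S z -> S z /\ 0 < b * Im z.
Proof.
  intros Hb HS [K [HK [HKS [Kz [rho [Hrho Hpol]]]]]]. split; auto.
  apply Rnot_le_lt. intros Hz.
  assert (Hop : forall c, open (fun w : C => 0 < c * Im w)).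
  { intros c. apply open_C. intros x Hx.
    exists (c * Im x / (Rabs c + 1)). pose proof (Rabs_pos c). split; [apply Rdiv_lt_0_compat; lra|].
    intros y Hy. pose proof (Im_lip y x) as L.
    pose proof (Rle_abs (c * (Im x - Im y))) as A. rewrite Rabs_mult, (Rabs_minus_sym (Im x)) in A.
    assert (Hy' := Rle_lt_trans _ _ _ L Hy).
    apply Rmult_lt_compat_l with (r := Rabs c + 1) in Hy'; [|lra].
    replace ((Rabs c + 1) * (c * Im x / (Rabs c + 1))) with (c * Im x) in Hy' by (field; lra).
    pose proof (Rabs_pos (Im y - Im x)). nra. }
  destruct (HK (fun w => 0 < b * Im w) (fun w => 0 < (- b) * Im w)) as [w [W1 [W2 W3]]]; auto.
  - intros w Hw. specialize (HS w (HKS w Hw)).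
    assert (b <> 0) by (intros E; rewrite E in Hb; lra).
    assert (b * Im w <> 0) by (apply Rmult_integral_contrapositive; auto).
    destruct (Rlt_le_dec 0 (b * Im w)); [left; auto|right; lra].
  - exists (polar (rho / 2) theta). split; [apply Hpol; lra|].
    change (Im (polar (rho / 2) theta)) with (rho / 2 * sin theta). nra.
  - exists z. split; auto. specialize (HS z (HKS z Kz)).
    assert (b <> 0) by (intros E; rewrite E in Hb; lra).
    assert (b * Im z <> 0) by (apply Rmult_integral_contrapositive; auto). lra.
  - lra.
Qed.

Lemma Im_wcoord (z : C) : z <> 0%C -> Im (wcoord z) = Im z / (Cmod z * Cmod z).
Proof.
  intros Hz. pose proof (proj1 (Cmod_gt_0 _) Hz) as Hm. rewrite Cmod_sq.
  unfold wcoord, Im, Re. simpl. pose proof (Cmod_sq z) as Q. unfold Re, Im in Q.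
  field. nra.
Qed.

Lemma Re_wcoord (z : C) : z <> 0%C -> Re (wcoord z) = - Re z / (Cmod z * Cmod z).
Proof.
  intros Hz. pose proof (proj1 (Cmod_gt_0 _) Hz) as Hm. rewrite Cmod_sq.
  unfold wcoord, Im, Re. simpl. pose proof (Cmod_sq z) as Q. unfold Re, Im in Q.
  field. nra.
Qed.

(** On the real axis the two heights are opposite numbers. *)
Lemma parabola_both_Im k M z : 0 <= M -> parabola 1 k M z -> parabola (-1) k M z -> Im z <> 0.
Proof.
  intros HM [Hz H1] [_ H2] E. unfold height in *. rewrite Im_wcoord, E in * by auto.
  unfold Rdiv in *. rewrite Rmult_0_l in *. lra.
Qed.

(** * Quantitative estimates for a parabolic germ and its distance to a translation *)

Record parabolic_on (f : C -> C) (r K : R) : Prop := {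
  po_r : 0 < r <= 1 / 2;
  po_K : 0 < K;
  po_0 : f 0 = 0%C;
  po_sdiff : forall x, Cmod x < r -> sdiff f x;
  po_tail : forall z, Cmod z < r -> Cmod (f z - (z + z ^ 2 + z ^ 3)) <= K * Cmod z ^ 4;
  po_lip : forall a b, Cmod a < r -> Cmod b < r -> Cmod (f a - f b - (a - b)) <= 1 / 2 * Cmod (a - b) }.

Lemma Cminus_0_r (z : C) : (z - 0)%C = z.
Proof. ring. Qed.

Lemma parabolic_germ_local f : parabolic_germ f -> exists r K, parabolic_on f r K.
Proof.
  intros [a [Ha [A0 [A1 [A2 A3]]]]].
  destruct (analytic_at_sdiff_near f 0 (ex_intro _ a Ha)) as [d1 [Hd1 H1]].
  destruct (expands_at_tail f a Ha) as [d2 [Hd2 H2]]. destruct (H2 3%nat) as [K [HK H3]].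
  assert (S1 := expands_at_sderiv f 0 a Ha). rewrite A1 in S1.
  destruct (S1 (1 / 2) ltac:(lra)) as [d3 [Hd3 H4]].
  exists (Rmin (Rmin d1 d2) (Rmin d3 (1 / 2))), K.
  assert (Q : forall x : C, Cmod x < Rmin (Rmin d1 d2) (Rmin d3 (1 / 2)) -> Cmod x < d1 /\ Cmod x < d2 /\ Cmod x < d3).
  { intros x Hx.
    pose proof (Rlt_le_trans _ _ _ Hx (Rmin_l _ _)) as X1. pose proof (Rlt_le_trans _ _ _ Hx (Rmin_r _ _)) as X2.
    pose proof (Rlt_le_trans _ _ _ X1 (Rmin_l _ _)). pose proof (Rlt_le_trans _ _ _ X1 (Rmin_r _ _)).
    pose proof (Rlt_le_trans _ _ _ X2 (Rmin_l _ _)). auto. }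
  split; auto.
  - split; [repeat apply Rmin_pos; lra|]. eapply Rle_trans; apply Rmin_r.
  - rewrite (expands_at_val f 0 a Ha). auto.
  - intros x Hx. destruct (Q x Hx) as [X1 _]. apply H1. rewrite Cminus_0_r. auto.
  - intros z Hz. destruct (Q z Hz) as [_ [X2 _]]. specialize (H3 z X2).
    rewrite !psum_S, psum_O, A0, A1, A2, A3 in H3.
    replace (z + z ^ 2 + z ^ 3)%C with (0 + 1 * z ^ 1 + 1 * z ^ 2 + 1 * z ^ 3)%C by ring. auto.
  - intros x y Hx Hy. destruct (Q x Hx) as [_ [_ X3]]. destruct (Q y Hy) as [_ [_ Y3]].
    specialize (H4 x y). rewrite !Cminus_0_r in H4. specialize (H4 X3 Y3).
    replace (1 * (x - y))%C with (x - y)%C in H4 by ring. auto.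
Qed.

Section ParabolicGerm.
Variables (f : C -> C) (r K : R).
Hypothesis Hf : parabolic_on f r K.

Lemma parabolic_near_id z : Cmod z < r -> Cmod (f z - z) <= 1 / 2 * Cmod z.
Proof.
  intros Hz. pose proof (po_lip f r K Hf z 0 Hz) as H. rewrite Cmod_0, (po_0 f r K Hf), !Cminus_0_r in H.
  apply H. apply (po_r f r K Hf).
Qed.

Lemma parabolic_mod z : Cmod z < r -> Cmod z / 2 <= Cmod (f z) <= 2 * Cmod z.
Proof.
  intros Hz. pose proof (parabolic_near_id z Hz) as H. pose proof (Cmod_le_minus z (f z)) as T1.
  rewrite Cmod_minus_sym in T1. pose proof (Cmod_le_minus (f z) z). pose proof (Cmod_ge_0 z). lra.
Qed.

Lemma parabolic_inj a b : Cmod a < r -> Cmod b < r -> f a = f b -> a = b.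
Proof.
  intros Ha Hb E. pose proof (po_lip f r K Hf a b Ha Hb) as H. rewrite E in H.
  replace (f b - f b - (a - b))%C with (- (a - b))%C in H by ring. rewrite Cmod_opp in H.
  apply Cmod_minus_0. pose proof (Cmod_ge_0 (a - b)). lra.
Qed.

Lemma parabolic_neq_0 (z : C) : 0 < Cmod z < r -> f z <> 0%C.
Proof. intros Hz. apply Cmod_neq_0. pose proof (parabolic_mod z (proj2 Hz)). lra. Qed.

(** With [R] the remainder beyond [z^3], the numerator [f z - z - z * f z] equals [R - z^4 - z * R]:
    the coefficient 1 of [z^3] cancels the cubic term, which would otherwise put a logarithm into
    the Fatou coordinate. *)
Lemma parabolic_wcoord z : 0 < Cmod z < r ->
  Cmod (wcoord (f z) - wcoord z - 1) <= (4 * K + 2) * (Cmod z * Cmod z).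
Proof.
  intros Hz. assert (Hfz := parabolic_neq_0 z Hz). assert (Hz0 : z <> 0%C) by (apply Cmod_neq_0; lra).
  pose proof (parabolic_mod z (proj2 Hz)) as Hm. pose proof (po_tail f r K Hf z (proj2 Hz)) as HT.
  destruct (po_r f r K Hf) as [R0 R1]. pose proof (po_K f r K Hf) as HK.
  set (R := (f z - (z + z ^ 2 + z ^ 3))%C) in *.
  assert (E : (wcoord (f z) - wcoord z - 1 = (R - z ^ 4 - z * R) / (z * f z))%C).
  { unfold wcoord. replace (R - z ^ 4 - z * R)%C with (f z - z - z * f z)%C by (unfold R; simpl; ring). field. auto. }
  rewrite E, Cmod_div by (apply Cmult_neq_0; auto). rewrite Cmod_mult.
  set (m := Cmod z) in *.
  assert (N : Cmod (R - z ^ 4 - z * R) <= (2 * K + 1) * (m * m * (m * m))).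
  { eapply Rle_trans; [apply Cmod_minus_triangle|]. rewrite Cmod_mult.
    pose proof (Cmod_minus_triangle R (z ^ 4)) as T. rewrite Cmod_pow in T. fold m in T.
    replace (m ^ 4) with (m * m * (m * m)) in HT, T by ring. fold m.
    assert (m * Cmod R <= 1 * Cmod R) by (apply Rmult_le_compat_r; [apply Cmod_ge_0|lra]). lra. }
  assert (P : 0 < m * Cmod (f z)) by (apply Rmult_lt_0_compat; lra).
  apply Rle_div_l; auto. apply Rle_trans with (1 := N).
  replace ((2 * K + 1) * (m * m * (m * m))) with ((4 * K + 2) * (m * m) * (m * (m / 2))) by field.
  apply Rmult_le_compat_l; [nra|]. apply Rmult_le_compat_l; lra.
Qed.

Lemma parabolic_translation : near_translation f 1 (4 * K + 2) r.
Proof.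
  destruct (po_r f r K Hf). pose proof (po_K f r K Hf).
  split; [ring|]. split; [lra|]. split; [lra|]. intros z Hz. split; [apply parabolic_neq_0; auto|].
  apply parabolic_wcoord; auto.
Qed.

Lemma parabolic_inverse : exists g d, 0 < d <= r /\ near_translation g (-1) (16 * K + 8) d /\
  (forall z, Cmod z < d -> f (g z) = z /\ Cmod (g z) < r).
Proof.
  destruct (po_r f r K Hf) as [R0 R1]. pose proof (po_K f r K Hf) as HK.
  assert (S1 : exists l, sderiv f 0 l).
  { apply (po_sdiff f r K Hf). rewrite Cmod_0; auto. }
  destruct S1 as [l Hl].
  assert (Hl1 : Cmod (l - 1) <= 1 / 2).
  { apply (sderiv_approx f 0 1 l r); auto. intros a b Ha Hb. rewrite Cminus_0_r in Ha, Hb.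
    replace (1 * (a - b))%C with (a - b)%C by ring. apply (po_lip f r K Hf); auto. }
  assert (Hln : 1 / 2 <= Cmod l).
  { pose proof (Cmod_le_minus 1 l) as T. rewrite Cmod_1, (Cmod_minus_sym 1 l) in T. lra. }
  assert (Hl0 : l <> 0%C) by (apply Cmod_neq_0; lra).
  destruct (inverse_function f 0 l r Hl0 Hl R0) as [g [r1 [d [Hr1 [Hd [_ [Hg _]]]]]]].
  { intros x Hx. rewrite Cminus_0_r in Hx. apply (po_sdiff f r K Hf); auto. }
  rewrite (po_0 f r K Hf) in Hg.
  assert (Inv : forall z, Cmod z < Rmin d (r / 8) -> f (g z) = z /\ Cmod (g z) < r).
  { intros z Hz. destruct (Hg z) as [G1 [_ G3]].
    { rewrite Cminus_0_r. eapply Rlt_le_trans; [apply Hz|apply Rmin_l]. }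
    rewrite !Cminus_0_r in G3. split; auto.
    pose proof (Rlt_le_trans _ _ _ Hz (Rmin_r _ _)) as Z2.
    assert (2 / Cmod l <= 4).
    { apply Rle_div_l; lra. }
    pose proof (Cmod_ge_0 z). nra. }
  exists g, (Rmin d (r / 8)). split; [|split]; auto.
  { split; [apply Rmin_pos; lra|]. eapply Rle_trans; [apply Rmin_r|lra]. }
  split; [ring|]. split; [apply Rmin_pos; lra|]. split; [lra|].
  intros z [Z0 Z1]. destruct (Inv z Z1) as [I1 I2].
  assert (Gn : g z <> 0%C).
  { intros E. rewrite E, (po_0 f r K Hf) in I1. rewrite <- I1, Cmod_0 in Z0. lra. }
  split; auto.
  pose proof (parabolic_wcoord (g z) (conj (proj1 (Cmod_gt_0 _) Gn) I2)) as W. rewrite I1 in W.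
  pose proof (parabolic_mod (g z) I2) as M. rewrite I1 in M.
  replace (wcoord (g z) - wcoord z - RtoC (-1))%C with (- (wcoord z - wcoord (g z) - 1))%C.
  2: { change (-1) with (- (1))%R. rewrite RtoC_opp. ring. }
  rewrite Cmod_opp. apply Rle_trans with (1 := W).
  pose proof (Cmod_ge_0 (g z)).
  replace ((16 * K + 8) * (Cmod z * Cmod z)) with ((4 * K + 2) * (2 * Cmod z * (2 * Cmod z))) by ring.
  apply Rmult_le_compat_l; [lra|]. apply Rmult_le_compat; lra.
Qed.

(** Gives the leading term [n * z^(n+1)] of the difference operator [h o f - h] on [z^n];
    [formal_solution] inverts it degree by degree. *)
Lemma parabolic_pow n : exists B, 0 <= B /\ forall z, Cmod z < r ->
  Cmod (f z ^ n - z ^ n - RtoC (INR n) * z ^ S n) <= B * Cmod z ^ S (S n).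
Proof.
  destruct (po_r f r K Hf) as [R0 R1]. pose proof (po_K f r K Hf) as HK.
  assert (F2 : forall z, Cmod z < r -> Cmod (f z - z - z ^ 2) <= (K + 1) * Cmod z ^ 3).
  { intros z Hz. pose proof (po_tail f r K Hf z Hz) as HT. pose proof (Cmod_ge_0 z) as Z0.
    replace (f z - z - z ^ 2)%C with ((f z - (z + z ^ 2 + z ^ 3)) + z ^ 3)%C by ring.
    eapply Rle_trans; [apply Cmod_triangle|]. rewrite Cmod_pow.
    assert (0 <= Cmod z ^ 3) by (apply pow_le; auto).
    change (Cmod z ^ 4) with (Cmod z * Cmod z ^ 3) in HT.
    assert (K * (Cmod z * Cmod z ^ 3) <= K * (1 * Cmod z ^ 3)).
    { apply Rmult_le_compat_l; [lra|]. apply Rmult_le_compat_r; lra. }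
    lra. }
  assert (F1 : forall z, Cmod z < r -> Cmod (f z - z) <= (K + 2) * Cmod z ^ 2).
  { intros z Hz. pose proof (F2 z Hz) as HT. pose proof (Cmod_ge_0 z) as Z0.
    replace (f z - z)%C with ((f z - z - z ^ 2) + z ^ 2)%C by ring.
    eapply Rle_trans; [apply Cmod_triangle|]. rewrite Cmod_pow.
    assert (0 <= Cmod z ^ 2) by (apply pow_le; auto).
    change (Cmod z ^ 3) with (Cmod z * Cmod z ^ 2) in HT.
    assert ((K + 1) * (Cmod z * Cmod z ^ 2) <= (K + 1) * (1 * Cmod z ^ 2)).
    { apply Rmult_le_compat_l; [lra|]. apply Rmult_le_compat_r; lra. }
    lra. }
  induction n as [|n [B [HB IH]]].
  - exists 0. split; [lra|]. intros z Hz. simpl.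
    match goal with |- Cmod ?u <= _ => replace u with (RtoC 0) by ring end. rewrite Cmod_0. lra.
  - exists (2 * B + (K + 1) + INR n * (K + 2)).
    pose proof (pos_INR n) as Hn. split; [nra|].
    intros z Hz. specialize (IH z Hz). specialize (F1 z Hz). specialize (F2 z Hz).
    destruct (parabolic_mod z Hz) as [_ Hm].
    replace (f z ^ S n - z ^ S n - RtoC (INR (S n)) * z ^ S (S n))%C with
      (f z * (f z ^ n - z ^ n - RtoC (INR n) * z ^ S n) + ((f z - z - z ^ 2) * z ^ n
        + (f z - z) * (RtoC (INR n) * z ^ S n)))%C.
    2: { rewrite S_INR, RtoC_plus. simpl. ring. }
    eapply Rle_trans; [apply Cmod_triangle|].
    pose proof (Cmod_triangle ((f z - z - z ^ 2) * z ^ n) ((f z - z) * (RtoC (INR n) * z ^ S n))) as T.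
    rewrite !Cmod_mult, !Cmod_pow, Cmod_R, (Rabs_pos_eq (INR n)) in T by auto. rewrite Cmod_mult.
    set (m := Cmod z) in *. assert (m0 : 0 <= m) by apply Cmod_ge_0.
    assert (Pn : forall k, 0 <= m ^ k) by (intros; apply pow_le; auto).
    assert (E1 : Cmod (f z) * Cmod (f z ^ n - z ^ n - RtoC (INR n) * z ^ S n) <= 2 * m * (B * m ^ S (S n))).
    { apply Rmult_le_compat; auto using Cmod_ge_0. }
    assert (E2 : Cmod (f z - z - z ^ 2) * m ^ n <= (K + 1) * m ^ 3 * m ^ n) by (apply Rmult_le_compat_r; auto).
    assert (E3 : Cmod (f z - z) * (INR n * m ^ S n) <= (K + 2) * m ^ 2 * (INR n * m ^ S n)).
    { apply Rmult_le_compat_r; auto. apply Rmult_le_pos; auto. }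
    replace ((2 * B + (K + 1) + INR n * (K + 2)) * m ^ S (S (S n))) with
      (2 * m * (B * m ^ S (S n)) + ((K + 1) * m ^ 3 * m ^ n + (K + 2) * m ^ 2 * (INR n * m ^ S n))) by (simpl; ring).
    lra.
Qed.

(** The Fatou coordinate is sought as [wcoord + Rf]; the difference [Rf (f z) - Rf z] then has to
    equal this defect. *)
Definition eta (z : C) : C := if Ceq_dec z 0 then 0%C else (1 - (wcoord (f z) - wcoord z))%C.

Lemma eta_bound z : Cmod z < r -> Cmod (eta z) <= (4 * K + 2) * (Cmod z * Cmod z).
Proof.
  intros Hz. unfold eta. pose proof (po_K f r K Hf). destruct (Ceq_dec z 0) as [->|Hn].
  - rewrite !Cmod_0. lra.
  - replace (1 - (wcoord (f z) - wcoord z))%C with (- (wcoord (f z) - wcoord z - 1))%C by ring.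
    rewrite Cmod_opp. apply parabolic_wcoord. split; auto. apply Cmod_gt_0; auto.
Qed.

Lemma wcoord_sdiff (z : C) : z <> 0%C -> sdiff wcoord z.
Proof. intros Hz. apply (sdiff_opp (fun x => / x)%C). eexists. apply sderiv_inv; auto. Qed.

Lemma eta_sdiff z : Cmod z < r -> sdiff eta z.
Proof.
  destruct (po_r f r K Hf) as [R0 R1].
  assert (P : forall z, 0 < Cmod z < r -> sdiff eta z).
  { intros x [X0 X1]. assert (Hx : x <> 0%C) by (apply Cmod_neq_0; auto).
    apply (sdiff_ext_loc (fun x => 1 - (wcoord (f x) - wcoord x))%C eta x (Cmod x)); auto.
    - intros y Hy. unfold eta. destruct (Ceq_dec y 0) as [E|_]; auto.
      rewrite E in Hy. replace (0 - x)%C with (- x)%C in Hy by ring. rewrite Cmod_opp in Hy. lra.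
    - apply (sdiff_minus (fun _ => RtoC 1)); [apply sdiff_const|].
      apply sdiff_minus; [|apply wcoord_sdiff; auto].
      apply (sdiff_comp wcoord f); [apply (po_sdiff f r K Hf); auto|].
      apply wcoord_sdiff. apply parabolic_neq_0; auto. }
  intros Hz. destruct (Req_dec (Cmod z) 0) as [E|E].
  - apply Cmod_eq_0 in E. rewrite E. exists 0%C.
    apply (removable_quadratic eta r (4 * K + 2)); auto. apply eta_bound.
  - apply P. pose proof (Cmod_ge_0 z). lra.
Qed.
End ParabolicGerm.

(** * The Fatou coordinate *)

Lemma psum_trunc b N n : exists B, 0 <= B /\
  forall z, Cmod z <= 1 -> Cmod (psum b z (N + n) - psum b z N) <= B * Cmod z ^ S N.
Proof.
  induction n as [|n [B [HB IH]]].
  - exists 0. split; [lra|]. intros z _. rewrite Nat.add_0_r.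
    replace (psum b z N - psum b z N)%C with (RtoC 0) by ring. rewrite Cmod_0. lra.
  - exists (B + Cmod (b (S (N + n)))). pose proof (Cmod_ge_0 (b (S (N + n)))). split; [lra|].
    intros z Hz. specialize (IH z Hz). rewrite Nat.add_succ_r, psum_S.
    replace (psum b z (N + n) + b (S (N + n)) * z ^ S (N + n) - psum b z N)%C
      with ((psum b z (N + n) - psum b z N) + b (S (N + n)) * z ^ S (N + n))%C by ring.
    eapply Rle_trans; [apply Cmod_triangle|]. rewrite Cmod_mult, Cmod_pow.
    assert (Cmod z ^ S (N + n) <= Cmod z ^ S N).
    { pose proof (Cmod_ge_0 z). replace (S (N + n)) with (S N + n)%nat by lia. rewrite pow_add.
      rewrite <- (Rmult_1_r (Cmod z ^ S N)) at 2. apply Rmult_le_compat_l; [apply pow_le; auto|].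
      rewrite <- (pow1 n). apply pow_incr. auto. }
    assert (Cmod (b (S (N + n))) * Cmod z ^ S (N + n) <= Cmod (b (S (N + n))) * Cmod z ^ S N) by (apply Rmult_le_compat_l; auto).
    lra.
Qed.

Lemma ball_approaches_0 d : 0 < d -> forall e, 0 < e -> exists z, Cmod z < d /\ 0 < Cmod z < e.
Proof.
  intros Hd e He. exists (RtoC (Rmin d e / 2)).
  assert (0 < Rmin d e) by (apply Rmin_pos; auto). pose proof (Rmin_l d e). pose proof (Rmin_r d e).
  rewrite Cmod_R, Rabs_pos_eq by lra. lra.
Qed.

Lemma leading_term (F : C -> C) r m d B : 0 < r -> (forall z, Cmod z < r -> sdiff F z) -> 0 < d ->
  (forall z, Cmod z < d -> Cmod (F z) <= B * Cmod z ^ S m) ->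
  exists c B', 0 <= B' /\ forall z, Cmod z < r / 8 -> Cmod (F z - c * z ^ S m) <= B' * Cmod z ^ S (S m).
Proof.
  intros Hr HF Hd HB.
  destruct (sdiff_ball_expands F 0 r (r / 2)) as [a [Ha _]].
  { intros x Hx. apply HF. rewrite Cminus_0_r in Hx. auto. }
  { lra. }
  destruct (pseries_coef_bound F 0 a (r / 2) ltac:(lra) Ha) as [A [HA HaA]].
  assert (Tail : forall N z, Cmod z < r / 8 -> Cmod (F z - psum a z N) <= 2 * A / (r / 4) ^ S N * Cmod z ^ S N).
  { intros N z Hz. specialize (Ha z ltac:(lra)). rewrite Cplus_0_l in Ha.
    eapply Rle_trans; [apply (pseries_tail a z (F z) A (r / 2 / 2) N); auto; lra|].
    replace (r / 2 / 2) with (r / 4) by field. right. unfold Rdiv at 1. rewrite Rpow_mult_distr, pow_inv.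
    unfold Rdiv. ring. }
  assert (Z : forall k, (k <= m)%nat -> a k = 0%C).
  { apply (psum_zero_coef (fun z => Cmod z < Rmin d (r / 8)) a m (B + 2 * A / (r / 4) ^ S m)).
    - apply ball_approaches_0. apply Rmin_pos; lra.
    - intros z Hz. pose proof (Rlt_le_trans _ _ _ Hz (Rmin_l _ _)) as Z1.
      specialize (Tail m z (Rlt_le_trans _ _ _ Hz (Rmin_r _ _))). specialize (HB z Z1).
      pose proof (Cmod_minus_triangle (F z) (F z - psum a z m)) as T.
      replace (F z - (F z - psum a z m))%C with (psum a z m) in T by ring. lra. }
  exists (a (S m)), (2 * A / (r / 4) ^ S (S m)). split.
  { apply Rdiv_le_0_compat; [lra|]. apply pow_lt. lra. }
  intros z Hz. specialize (Tail (S m) z Hz). rewrite psum_S in Tail.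
  rewrite (psum_ext a (fun _ => 0%C)) in Tail by auto.
  rewrite psum_const in Tail by auto. rewrite Cplus_0_l in Tail. auto.
Qed.

Section FatouCoordinate.
Variables (f : C -> C) (r K : R).
Hypothesis Hf : parabolic_on f r K.

Definition residual (b : nat -> C) (m : nat) (z : C) : C :=
  (eta f z - (psum b (f z) m - psum b z m))%C.

Lemma residual_sdiff b m z : Cmod z < r -> sdiff (residual b m) z.
Proof.
  intros Hz. unfold residual. apply sdiff_minus; [apply (eta_sdiff f r K Hf); auto|].
  apply sdiff_minus.
  - apply analytic_psum_comp. apply (po_sdiff f r K Hf); auto.
  - apply (analytic_psum_comp b (fun x => x)). apply sdiff_id.
Qed.

(** The leading term [e * z^(m+2)] of the residual is removed by adding [e / (m+1) * z^(m+1)] to the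
    polynomial. As [eta] starts at [z^2], the divisor [m+1] is never 0. *)
Lemma formal_solution m : exists (b : nat -> C) B, b 0%nat = 0%C /\ 0 <= B /\
  forall z, Cmod z < r / 8 -> Cmod (residual b m z) <= B * Cmod z ^ S (S m).
Proof.
  destruct (po_r f r K Hf) as [R0 R1]. pose proof (po_K f r K Hf) as HK.
  induction m as [|m [b [B [Hb0 [HB IH]]]]].
  - exists (fun _ => 0%C), (4 * K + 2). split; auto. split; [lra|]. intros z Hz.
    unfold residual. rewrite !psum_O. replace (eta f z - (0 - 0))%C with (eta f z) by ring.
    simpl. rewrite Rmult_1_r. apply (eta_bound f r K Hf). lra.
  - destruct (leading_term (residual b m) r (S m) (r / 8) B R0 (residual_sdiff b m) ltac:(lra) IH) as [e [B1 [HB1 H1]]].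
    destruct (parabolic_pow f r K Hf (S m)) as [B2 [HB2 H2]].
    assert (Nm : RtoC (INR (S m)) <> 0%C) by (apply RtoC_neq_0, not_0_INR; lia).
    set (c := (e / RtoC (INR (S m)))%C).
    set (b' := fun k => if Nat.eq_dec k (S m) then c else b k).
    assert (Eb : forall x, psum b' x (S m) = (psum b x m + c * x ^ S m)%C).
    { intros x. rewrite psum_S. f_equal.
      - apply psum_ext. intros k Hk. unfold b'. destruct (Nat.eq_dec k (S m)); auto. lia.
      - unfold b'. destruct (Nat.eq_dec (S m) (S m)); auto. lia. }
    exists b', (B1 + Cmod c * B2). split; [|split].
    + unfold b'. simpl. auto.
    + pose proof (Cmod_ge_0 c). nra.
    + intros z Hz. specialize (H1 z Hz). specialize (H2 z ltac:(lra)). unfold residual. rewrite !Eb.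
      replace (eta f z - (psum b (f z) m + c * f z ^ S m - (psum b z m + c * z ^ S m)))%C
        with ((residual b m z - e * z ^ S (S m)) - c * (f z ^ S m - z ^ S m - RtoC (INR (S m)) * z ^ S (S m)))%C.
      2: { unfold residual, c. field. auto. }
      eapply Rle_trans; [apply Cmod_minus_triangle|]. rewrite Cmod_mult.
      pose proof (Cmod_ge_0 c).
      assert (Cmod c * Cmod (f z ^ S m - z ^ S m - RtoC (INR (S m)) * z ^ S (S m)) <= Cmod c * (B2 * Cmod z ^ S (S (S m)))).
      { apply Rmult_le_compat_l; auto. }
      lra.
Qed.

(** Formally, minus the sum of [eta] over the whole forward orbit solves [R o f - R = eta]. *)
Fixpoint orbit_sum (L : nat) (z : C) : C :=
  match L with O => 0%C | S L => (orbit_sum L z - eta f (Nat.iter L f z))%C end.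

Lemma iter_shift n z : Nat.iter n f (f z) = Nat.iter (S n) f z.
Proof. induction n as [|n IH]; auto. simpl in *. rewrite IH. auto. Qed.

Lemma orbit_sum_shift L z : orbit_sum L (f z) = (orbit_sum (S L) z + eta f z)%C.
Proof.
  induction L as [|L IH].
  - simpl. ring.
  - change (orbit_sum (S L) (f z)) with (orbit_sum L (f z) - eta f (Nat.iter L f (f z)))%C.
    rewrite IH, iter_shift. change (orbit_sum (S (S L)) z) with (orbit_sum (S L) z - eta f (Nat.iter (S L) f z))%C. ring.
Qed.

(** The orbit bound [|f^n z|^2 = O(1/n)] is too weak to sum [eta = O(z^2)] absolutely. Adding a
    polynomial from [formal_solution], evaluated at the end of the orbit segment, replaces [eta] by
    a residual of order at least [z^4]. Polynomials of higher degree lead to the same limit and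
    yield its expansion. *)
Lemma fatou_coordinate k : 0 < k -> exists M0 Rf, 0 < M0 /\
  (forall z, parabola 1 k M0 z -> analytic_at Rf z /\ (Rf (f z) - Rf z)%C = eta f z /\ Cmod z < r / 8) /\
  asy (parabola 1 k M0) Rf.
Proof.
  intros Hk. destruct (po_r f r K Hf) as [R0 R1].
  destruct (parabola_orbit f 1 k _ r (parabolic_translation f r K Hf) Hk) as [M1 [D [HM1 [HD Horb]]]].
  destruct (parabola_small 1 k (r / 8)) as [M2 [HM2 Hsm]]; auto; [ring|lra|].
  set (M := Rmax M1 M2).
  pose proof (Rmax_l M1 M2) as ML. pose proof (Rmax_r M1 M2) as MR. fold M in ML, MR.
  set (V := parabola 1 k M).
  assert (Vorb : forall z n, V z -> V (Nat.iter n f z) /\ Cmod (Nat.iter n f z) < r / 8 /\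
    Cmod (Nat.iter n f z) * Cmod (Nat.iter n f z) * (/ Cmod z + INR n) <= D).
  { intros z n Hz. destruct (Horb M z ML Hz n) as [O1 [O2 O3]]. repeat split; auto; try apply O1.
    apply (Hsm M); auto. }
  assert (Vz : forall z, V z -> 0 < Cmod z < r / 8).
  { intros z Hz. apply (Hsm M); auto. }
  (* From [u^2 <= D / (1/|z| + n)]: of the [j + 2] factors, [j] are spent on [|z|^j] and two on the
     telescoping [1/((n+1)(n+2))]. *)
  assert (Decay : forall z n j, V z -> Cmod (Nat.iter n f z) ^ (2 * (j + 2)) <=
    D ^ (j + 2) * Cmod z ^ j * (/ INR (S n) - / INR (S (S n)))).
  { intros z n j Hz. destruct (Vorb z n Hz) as [_ [_ O3]]. destruct (Vz z Hz) as [Z0 Z1].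
    set (u := Cmod (Nat.iter n f z)) in *. set (Y := / Cmod z + INR n) in *.
    pose proof (pos_INR n) as Hn.
    assert (HX : 2 <= / Cmod z). { replace 2 with (/ (1 / 2)) by field. apply Rinv_le_contravar; lra. }
    assert (HY : 0 < Y) by (unfold Y; lra).
    assert (U0 : 0 <= u) by apply Cmod_ge_0.
    assert (U : u * u <= D / Y) by (apply (proj1 (Rle_div_r (u * u) D Y HY)); exact O3).
    rewrite pow_mult. replace (u ^ 2) with (u * u) by ring.
    apply Rle_trans with ((D / Y) ^ (j + 2)).
    { apply pow_incr. split; auto. nra. }
    unfold Rdiv. rewrite Rpow_mult_distr. rewrite Rmult_assoc. apply Rmult_le_compat_l; [apply pow_le; lra|].
    rewrite pow_add. apply Rmult_le_compat.
    - apply pow_le. apply Rlt_le, Rinv_0_lt_compat; auto.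
    - apply pow_le. apply Rlt_le, Rinv_0_lt_compat; auto.
    - apply pow_incr. split; [apply Rlt_le, Rinv_0_lt_compat; auto|].
      rewrite <- (Rinv_inv (Cmod z)). apply Rinv_le_contravar; [lra|unfold Y; lra].
    - rewrite !S_INR. replace (/ (INR n + 1) - / (INR n + 1 + 1)) with (/ ((INR n + 1) * (INR n + 1 + 1))) by (field; lra).
      rewrite pow_inv. apply Rinv_le_contravar; [nra|]. unfold Y. simpl. nra. }
  assert (Main : forall j, exists (b : nat -> C) C0, b 0%nat = 0%C /\ 0 <= C0 /\ forall z, V z ->
    forall L p, Cmod ((orbit_sum (L + p) z + psum b (Nat.iter (L + p) f z) (2 * j + 2)) -
      (orbit_sum L z + psum b (Nat.iter L f z) (2 * j + 2))) <= C0 * Cmod z ^ j * (/ INR (S L) - / INR (S (L + p)))).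
  { intros j. destruct (formal_solution (2 * j + 2)) as [b [B [Hb0 [HB Hres]]]].
    exists b, (B * D ^ (j + 2)). split; auto. split.
    { apply Rmult_le_pos; auto. apply pow_le; lra. }
    intros z Hz L. set (G := fun L => (orbit_sum L z + psum b (Nat.iter L f z) (2 * j + 2))%C).
    induction p as [|p IH].
    - rewrite Nat.add_0_r. fold (G L). replace (G L - G L)%C with (RtoC 0) by ring. rewrite Cmod_0. lra.
    - fold (G (L + p)%nat) (G L) in IH. rewrite Nat.add_succ_r. fold (G (S (L + p))) (G L).
      set (n := (L + p)%nat) in *.
      assert (E : G (S n) = (G n - residual b (2 * j + 2) (Nat.iter n f z))%C).
      { unfold G, residual. simpl (orbit_sum (S n) z). change (Nat.iter (S n) f z) with (f (Nat.iter n f z)). ring. }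
      destruct (Vorb z n Hz) as [_ [O2 _]]. specialize (Hres _ O2). specialize (Decay z n j Hz).
      replace (S (S (2 * j + 2))) with (2 * (j + 2))%nat in Hres by lia.
      rewrite E. replace (G n - residual b (2 * j + 2) (Nat.iter n f z) - G L)%C
        with ((G n - G L) - residual b (2 * j + 2) (Nat.iter n f z))%C by ring.
      eapply Rle_trans; [apply Cmod_minus_triangle|].
      apply Rmult_le_compat_l with (r := B) in Decay; auto. lra. }
  assert (PZ : forall (b : nat -> C) m, b 0%nat = 0%C -> exists B, 0 <= B /\ forall z, Cmod z <= 1 -> Cmod (psum b z m) <= B * Cmod z).
  { intros b m Hb. destruct (psum_trunc b 0 m) as [B [HB H]]. exists B. split; auto.
    intros z Hz. specialize (H z Hz). rewrite psum_O, Hb, Cminus_0_r, pow_1 in H. auto. }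
  (* [j = 0] is enough for the limit to exist: the residual is then [O(z^4)], of size [1/n^2] along
     the orbit. *)
  destruct (Main 0%nat) as [b0 [C0 [Hb00 [HC0 Hmain0]]]].
  set (F := fun L z => (orbit_sum L z + psum b0 (Nat.iter L f z) 2)%C).
  assert (HF : forall z, V z -> forall L p, Cmod (F (L + p)%nat z - F L z) <= C0 * / INR (S L)).
  { intros z Hz L p. specialize (Hmain0 z Hz L p). simpl (2 * 0 + 2)%nat in Hmain0. fold (F (L + p)%nat z) (F L z) in Hmain0.
    apply Rle_trans with (1 := Hmain0). simpl (_ ^ 0). rewrite Rmult_1_r. apply Rmult_le_compat_l; auto.
    assert (0 < / INR (S (L + p))) by (apply Rinv_0_lt_compat, lt_0_INR; lia). lra. }
  assert (Small : forall c e, 0 < e -> exists N, forall L, (N <= L)%nat -> c * / INR (S L) < e).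
  { intros c e He. destruct (INR_unbounded (Rabs c / e)) as [N HN]. exists N. intros L HL.
    assert (HS : INR N < INR (S L)) by (apply lt_INR; lia).
    assert (P : 0 < INR (S L)) by (apply lt_0_INR; lia).
    apply Rle_lt_trans with (Rabs c * / INR (S L)).
    - apply Rmult_le_compat_r; [apply Rlt_le, Rinv_0_lt_compat; auto|apply Rle_abs].
    - apply Rlt_div_l; auto. apply Rlt_div_l in HN; auto. apply Rlt_trans with (1 := HN).
      rewrite Rmult_comm. apply Rmult_lt_compat_l; auto. }
  assert (Lim : forall z, exists l, V z -> forall L, Cmod (F L z - l) <= C0 * / INR (S L)).
  { intros z. destruct (excluded_middle_informative (V z)) as [Hz|Hz].
    2: { exists 0%C. tauto. }
    destruct (C_complete (fun L => F L z)) as [l Hl].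
    - intros e He. destruct (Small (2 * C0) e He) as [N HN]. exists N. intros n m Hn Hm.
      pose proof (HF z Hz N (n - N)%nat) as A1. pose proof (HF z Hz N (m - N)%nat) as A2.
      replace (N + (n - N))%nat with n in A1 by lia. replace (N + (m - N))%nat with m in A2 by lia.
      rewrite Cmod_minus_sym in A2. specialize (HN N (Nat.le_refl _)).
      pose proof (Cmod_minus_le (F n z) (F N z) (F m z)). lra.
    - exists l. intros _ L. apply le_epsilon. intros e He. destruct (Hl e He) as [N HN].
      specialize (HN (L + N)%nat ltac:(lia)). pose proof (HF z Hz L N) as A. rewrite Cmod_minus_sym in A.
      pose proof (Cmod_minus_le (F L z) (F (L + N)%nat z) l). lra. }
  destruct (choice _ Lim) as [Rf HRf].
  exists M, Rf. split; [lra|]. split.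
  - intros z Hz. split; [|split].
    + assert (Hop : open V) by (apply parabola_open; auto; ring).
      rewrite open_C in Hop. destruct (Hop z Hz) as [d [Hd Hdz]].
      apply (uniform_limit_analytic F Rf z d); auto.
      * intros n x Hx. specialize (Hdz x Hx).
        assert (It : forall n, sdiff (fun x => Nat.iter n f x) x).
        { induction n0 as [|n0 IH]; [apply sdiff_id|]. simpl.
          apply (sdiff_comp f (fun x => Nat.iter n0 f x)); auto.
          apply (po_sdiff f r K Hf). destruct (Vorb x n0 Hdz) as [_ [O _]]. lra. }
        assert (Os : forall n, sdiff (orbit_sum n) x).
        { induction n0 as [|n0 IH]; [apply sdiff_const|]. simpl. apply sdiff_minus; auto.
          apply (sdiff_comp (eta f) (fun x => Nat.iter n0 f x)); auto.
          apply (eta_sdiff f r K Hf). destruct (Vorb x n0 Hdz) as [_ [O _]]. lra. }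
        unfold F. apply sdiff_plus; auto. apply (analytic_psum_comp b0 (fun x => Nat.iter n f x)); auto.
      * intros e He. destruct (Small C0 e He) as [N HN]. exists N. intros n x Hn Hx.
        apply Rle_trans with (1 := HRf x (Hdz x Hx) n). apply Rlt_le; auto.
    + assert (Hfz : V (f z)) by (apply (Vorb z 1%nat Hz)).
      apply Cmod_minus_0, Rle_antisym; [|apply Cmod_ge_0]. apply le_epsilon. intros e He. rewrite Rplus_0_l.
      destruct (Small (2 * C0) e He) as [N HN].
      pose proof (HRf (f z) Hfz (S N)) as A1. pose proof (HRf z Hz (S (S N))) as A2.
      assert (E : F (S N) (f z) = (F (S (S N)) z + eta f z)%C).
      { unfold F. rewrite orbit_sum_shift, iter_shift. ring. }
      rewrite E in A1.
      pose proof (HN (S N) ltac:(lia)). pose proof (HN (S (S N)) ltac:(lia)).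
      replace (Rf (f z) - Rf z - eta f z)%C with ((F (S (S N)) z - Rf z) - (F (S (S N)) z + eta f z - Rf (f z)))%C by ring.
      eapply Rle_trans; [apply Cmod_minus_triangle|]. lra.
    + apply Vz; auto.
  (* Order [N] is read off the polynomial for [j = N + 1]. At [L = 0] the corrected sum is
     [psum b z m]; as [L] grows the polynomial terms at [u] tend to 0, having no constant term, so
     it tends to [Rf z]. The total change is [O(z^(N+1))]. *)
  - intros N. destruct (Main (S N)) as [b [C1 [Hb [HC1 Hmain]]]].
    set (m := (2 * S N + 2)%nat) in *.
    destruct (PZ b0 2%nat Hb00) as [B0 [HB0 P0]]. destruct (PZ b m Hb) as [B1 [HB1 P1]].
    destruct (psum_trunc b N (m - N)) as [B2 [HB2 P2]]. replace (N + (m - N))%nat with m in P2 by (unfold m; lia).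
    exists b, (C1 + B2). intros z Hz. destruct (Vz z Hz) as [Z0 Z1].
    assert (A : Cmod (Rf z - psum b z m) <= C1 * Cmod z ^ S N).
    { apply le_epsilon. intros e He.
      destruct (Small C0 (e / 2) ltac:(lra)) as [N1 HN1].
      set (q := e / (2 * (B0 + B1 + 1))). assert (Hq : 0 < q) by (apply Rdiv_lt_0_compat; lra).
      destruct (INR_unbounded (D / (q * q))) as [N2 HN2].
      set (L := (N1 + N2)%nat). specialize (HN1 L ltac:(lia)). pose proof (HRf z Hz L) as A1.
      pose proof (Hmain z Hz 0%nat L) as A2. simpl (0 + L)%nat in A2.
      change (orbit_sum 0 z) with (RtoC 0) in A2. change (Nat.iter 0 f z) with z in A2. rewrite Cplus_0_l in A2.
      destruct (Vorb z L Hz) as [_ [O2 O3]]. set (u := Nat.iter L f z) in *.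
      assert (Hu : Cmod u < q).
      { apply Rnot_le_lt. intros Hc. pose proof (Cmod_ge_0 u).
        assert (INR N2 <= INR L) by (apply le_INR; lia).
        assert (Qq : 0 < q * q) by nra. apply Rlt_div_l in HN2; auto.
        assert (0 < / Cmod z) by (apply Rinv_0_lt_compat; auto).
        assert (q * q * INR N2 <= Cmod u * Cmod u * (/ Cmod z + INR L)).
        { apply Rmult_le_compat; try lra; [apply pos_INR|nra]. }
        lra. }
      specialize (P0 u ltac:(lra)). specialize (P1 u ltac:(lra)).
      assert (Bq : (B0 + B1) * Cmod u <= e / 2).
      { apply Rle_trans with ((B0 + B1) * q); [apply Rmult_le_compat_l; lra|].
        apply Rle_trans with ((B0 + B1 + 1) * q); [nra|]. right. unfold q. field. lra. }
      replace (Rf z - psum b z m)%C with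
        ((orbit_sum L z + psum b u m - psum b z m) - (F L z - Rf z) + (psum b0 u 2 - psum b u m))%C.
      2: { unfold F. fold u. ring. }
      eapply Rle_trans; [apply Cmod_triangle|].
      pose proof (Cmod_minus_triangle (orbit_sum L z + psum b u m - psum b z m) (F L z - Rf z)).
      pose proof (Cmod_minus_triangle (psum b0 u 2) (psum b u m)).
      assert (0 < / INR (S L)) by (apply Rinv_0_lt_compat, lt_0_INR; lia).
      assert (0 <= C1 * Cmod z ^ S N) by (apply Rmult_le_pos; auto; apply pow_le; lra).
      change (INR 1) with 1 in A2. rewrite Rinv_1 in A2.
      assert (C1 * Cmod z ^ S N * (1 - / INR (S L)) <= C1 * Cmod z ^ S N) by nra.
      lra. }
    specialize (P2 z ltac:(lra)).
    pose proof (Cmod_minus_le (Rf z) (psum b z m) (psum b z N)). lra.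
Qed.
End FatouCoordinate.

(** * Cauchy's formula on a cusp *)

Lemma cube_root q : 0 <= q -> exists r, 0 <= r /\ q = r * r * r.
Proof.
  intros [Hq|<-].
  - exists (Rpower q (1 / 3)). split; [apply Rlt_le, exp_pos|].
    rewrite <- !Rpower_plus. replace (1 / 3 + 1 / 3 + 1 / 3) with 1 by field. rewrite Rpower_1; auto.
  - exists 0. lra.
Qed.

(** [b = 1] or [-1] selects the upper or the lower side. The lateral boundary curves, [T^2] or
    [- T^2] for the real part and [b * T^3] for the imaginary one, are tangent to the real axis;
    [wcoord] sends them close to the parabolas [|Re w| = (Im w)^2]. *)
Definition cusp (tau b : R) (z : C) : Prop :=
  0 < b * Im z < tau ^ 3 /\ Rabs (Re z) ^ 3 < (b * Im z) ^ 2.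

Definition closed_cusp (tau b : R) (z : C) : Prop :=
  0 <= b * Im z <= tau ^ 3 /\ Rabs (Re z) ^ 3 <= (b * Im z) ^ 2.

Lemma pow3_lt x y : 0 <= x -> x < y -> x ^ 3 < y ^ 3.
Proof.
  intros Hx H. replace (x ^ 3) with (x * (x * x)) by ring. replace (y ^ 3) with (y * (y * y)) by ring.
  assert (x * x < y * y) by nra. apply Rle_lt_trans with (x * (y * y)).
  - apply Rmult_le_compat_l; lra.
  - apply Rmult_lt_compat_r; nra.
Qed.

Lemma pow3_le_inv x y : 0 <= x -> 0 <= y -> x ^ 3 <= y ^ 3 -> x <= y.
Proof.
  intros Hx Hy H. apply Rnot_lt_le. intros L.
  pose proof (pow3_lt y x Hy L). lra.
Qed.

Lemma pow3_lt_inv x y : 0 <= x -> 0 <= y -> x ^ 3 < y ^ 3 -> x < y.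
Proof.
  intros Hx Hy H. apply Rnot_le_lt. intros L.
  assert (y ^ 3 <= x ^ 3) by (apply pow_incr; lra). lra.
Qed.

Lemma cusp_root tau b z : cusp tau b z ->
  exists r, 0 < r /\ b * Im z = r * r * r /\ Rabs (Re z) < r * r.
Proof.
  intros [[H1 H2] H3]. destruct (cube_root (b * Im z)) as [r [Hr E]]; [lra|].
  exists r. assert (0 < r) by (destruct Hr; auto; subst; lra). split; auto. split; auto.
  apply pow3_lt_inv; [apply Rabs_pos|nra|]. rewrite E in H3.
  replace ((r * r) ^ 3) with ((r * r * r) ^ 2) by ring. auto.
Qed.

Lemma closed_cusp_root tau b z : closed_cusp tau b z ->
  exists r, 0 <= r /\ b * Im z = r * r * r /\ Rabs (Re z) <= r * r.
Proof.
  intros [[H1 H2] H3]. destruct (cube_root (b * Im z)) as [r [Hr E]]; [lra|].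
  exists r. split; auto. split; auto.
  apply pow3_le_inv; [apply Rabs_pos|nra|]. rewrite E in H3.
  replace ((r * r) ^ 3) with ((r * r * r) ^ 2) by ring. auto.
Qed.

(** With [y = b * Im z] the cusp is [|Re z| < y^(2/3)], and [y^(2/3)] is concave. Strictness at [c]
    puts the half-open segment into the open cusp, so contracted boundary paths avoid the vertex. *)
Lemma cusp_convex tau b c x s : cusp tau b c -> closed_cusp tau b x -> 0 <= s < 1 ->
  cusp tau b (c + RtoC s * (x - c))%C.
Proof.
  intros Hc Hx Hs.
  destruct (cusp_root tau b c Hc) as [r1 [R1 [Q1 P1]]].
  destruct (closed_cusp_root tau b x Hx) as [r2 [R2 [Q2 P2]]].
  destruct Hc as [[C1 C2] C3]. destruct Hx as [[X1 X2] X3].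
  assert (EI : b * Im (c + RtoC s * (x - c))%C = (1 - s) * (b * Im c) + s * (b * Im x)).
  { unfold Im, RtoC. simpl. ring. }
  assert (ER : Re (c + RtoC s * (x - c))%C = (1 - s) * Re c + s * Re x).
  { unfold Re, RtoC. simpl. ring. }
  unfold cusp. rewrite EI, ER.
  assert (I1 : 0 < (1 - s) * (b * Im c)) by (apply Rmult_lt_0_compat; lra).
  assert (I2 : 0 <= s * (b * Im x)) by (apply Rmult_le_pos; lra).
  split.
  { split; [lra|]. assert ((1 - s) * (b * Im c) < (1 - s) * tau ^ 3) by (apply Rmult_lt_compat_l; lra).
    assert (s * (b * Im x) <= s * tau ^ 3) by (apply Rmult_le_compat_l; lra). lra. }
  rewrite Q1, Q2.
  set (M := (1 - s) * (r1 * r1) + s * (r2 * r2)).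
  assert (HM : 0 < M).
  { unfold M. assert (0 < (1 - s) * (r1 * r1)) by (apply Rmult_lt_0_compat; nra).
    assert (0 <= s * (r2 * r2)) by (apply Rmult_le_pos; nra). lra. }
  set (m := sqrt M). assert (Hm : 0 < m) by (apply sqrt_lt_R0; auto).
  assert (Em : m * m = M) by (apply sqrt_sqrt; lra).
  assert (PM : Rabs ((1 - s) * Re c + s * Re x) < m * m).
  { rewrite Em. unfold M. eapply Rle_lt_trans; [apply Rabs_triang|]. rewrite !Rabs_mult, (Rabs_pos_eq (1 - s)), (Rabs_pos_eq s) by lra.
    assert ((1 - s) * Rabs (Re c) < (1 - s) * (r1 * r1)) by (apply Rmult_lt_compat_l; lra).
    assert (s * Rabs (Re x) <= s * (r2 * r2)) by (apply Rmult_le_compat_l; lra). lra. }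
  set (q := (1 - s) * (r1 * r1 * r1) + s * (r2 * r2 * r2)).
  (* power mean inequality, from the tangent line of [x^(3/2)] at [m^2] *)
  assert (T : forall r, 0 <= r -> 3 / 2 * m * (r * r) - m * m * m / 2 <= r * r * r).
  { intros r Hr. assert (A : 0 <= (r - m) * (r - m) * (2 * r + m)) by (apply Rmult_le_pos; [apply Rle_0_sqr|lra]).
    replace ((r - m) * (r - m) * (2 * r + m)) with (2 * (r * r * r) - 3 * m * (r * r) + m * m * m) in A by ring. lra. }
  assert (Q : m * m * m <= q).
  { assert (A1 := T r1 ltac:(lra)). assert (A2 := T r2 R2).
    assert ((1 - s) * (3 / 2 * m * (r1 * r1) - m * m * m / 2) <= (1 - s) * (r1 * r1 * r1)) by (apply Rmult_le_compat_l; lra).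
    assert (s * (3 / 2 * m * (r2 * r2) - m * m * m / 2) <= s * (r2 * r2 * r2)) by (apply Rmult_le_compat_l; lra).
    assert (E : 3 / 2 * m * M - m * m * m / 2 = m * m * m) by (rewrite <- Em; field).
    unfold q. unfold M in E. lra. }
  apply Rlt_le_trans with ((m * m) ^ 3).
  - apply Rlt_le_trans with ((m * m) ^ 3); [|lra].
    apply pow3_lt; auto using Rabs_pos.
  - replace ((m * m) ^ 3) with ((m * m * m) ^ 2) by ring. apply pow_incr. split; auto.
    apply Rlt_le. repeat apply Rmult_lt_0_compat; auto.
Qed.

Definition arm (tau a b t : R) : C := (a * (tau * t) ^ 2, b * (tau * t) ^ 3)%R.
Definition arm' (tau a b t : R) : C := (a * (2 * tau * (tau * t)), b * (3 * tau * (tau * t) ^ 2))%R.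
Definition lid (tau b t : R) : C := (tau ^ 2 * (1 - 2 * t), b * tau ^ 3)%R.
Definition lid' (tau : R) (t : R) : C := (- 2 * tau ^ 2, 0)%R.

Lemma arm_rderiv tau a b t : rderiv (arm tau a b) t (arm' tau a b t).
Proof.
  apply (rderiv_pair (fun t => a * (tau * t) ^ 2) (fun t => b * (tau * t) ^ 3)); auto_derive; auto; ring.
Qed.

Lemma lid_rderiv tau b t : rderiv (lid tau b) t (lid' tau t).
Proof.
  apply (rderiv_pair (fun t => tau ^ 2 * (1 - 2 * t)) (fun _ => b * tau ^ 3)); auto_derive; auto; ring.
Qed.

Lemma arm_ccont tau a b : ccont (arm tau a b).
Proof. apply rderiv_ccont. intros; eexists; apply arm_rderiv. Qed.

Lemma lid_ccont tau b : ccont (lid tau b).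
Proof. apply rderiv_ccont. intros; eexists; apply lid_rderiv. Qed.

Lemma arm'_ccont tau a b : ccont (arm' tau a b).
Proof.
  apply rderiv_ccont. intros t Ht. eexists. unfold arm'. apply rderiv_pair; auto_derive; auto.
Qed.

Lemma lid'_ccont tau : ccont (lid' tau).
Proof. apply ccont_const. Qed.

Lemma arm_closed_cusp tau a b t : a * a = 1 -> b * b = 1 -> 0 < tau -> 0 <= t <= 1 ->
  closed_cusp tau b (arm tau a b t).
Proof.
  intros Ha Hb Ht Htt. unfold closed_cusp, arm.
  unfold Im, Re; cbn [fst snd].
  assert (E : b * (b * (tau * t) ^ 3) = (tau * t) ^ 3) by (rewrite <- Rmult_assoc, Hb; ring).
  rewrite E. rewrite unit_sign by auto.
  assert (0 <= tau * t) by (apply Rmult_le_pos; lra).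
  assert (tau * t <= tau) by nra.
  split; [split; [apply pow_le; auto|apply pow_incr; auto]|].
  rewrite Rabs_pos_eq by (apply pow_le; auto). right. ring.
Qed.

Lemma lid_closed_cusp tau b t : b * b = 1 -> 0 < tau -> 0 <= t <= 1 -> closed_cusp tau b (lid tau b t).
Proof.
  intros Hb Ht Htt. unfold closed_cusp, lid. unfold Im, Re; cbn [fst snd].
  assert (E : b * (b * tau ^ 3) = tau ^ 3) by (rewrite <- Rmult_assoc, Hb; ring).
  rewrite E. assert (0 < tau ^ 3) by (apply pow_lt; auto). split; [lra|].
  rewrite Rabs_mult, Rpow_mult_distr, (Rabs_pos_eq (tau ^ 2)) by (apply pow_le; lra).
  assert (Rabs (1 - 2 * t) ^ 3 <= 1).
  { rewrite <- (pow1 3). apply pow_incr. split; [apply Rabs_pos|]. apply Rabs_le. lra. }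
  replace ((tau ^ 3) ^ 2) with ((tau ^ 2) ^ 3 * 1) by ring. apply Rmult_le_compat_l; auto.
  apply pow_le, pow_le. lra.
Qed.

Lemma arm_neq tau a b t c : a * a = 1 -> b * b = 1 -> cusp tau b c -> arm tau a b t <> c.
Proof.
  intros Ha Hb [_ H] E. rewrite <- E in H. unfold arm, Im, Re in H. cbn [fst snd] in H.
  rewrite unit_sign in H by auto.
  assert (Eb : b * (b * (tau * t) ^ 3) = (tau * t) ^ 3) by (rewrite <- Rmult_assoc, Hb; ring).
  rewrite Eb in H. rewrite Rabs_pos_eq in H by (simpl; nra).
  replace (((tau * t) ^ 2) ^ 3) with (((tau * t) ^ 3) ^ 2) in H by ring. lra.
Qed.

Lemma lid_neq tau b t c : b * b = 1 -> cusp tau b c -> lid tau b t <> c.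
Proof.
  intros Hb [H _] E. rewrite <- E in H. unfold lid, Im in H. cbn [snd] in H.
  assert (Eb : b * (b * tau ^ 3) = tau ^ 3) by (rewrite <- Rmult_assoc, Hb; ring). lra.
Qed.

(* [loop h] is the integral of [h] around the boundary of the cusp, where [h]
   takes the boundary point and the velocity there. *)
Definition loop (tau b : R) (h : C -> C -> C) : C :=
  (CI (fun t => h (arm tau 1 b t) (arm' tau 1 b t)) + CI (fun t => h (lid tau b t) (lid' tau t))
   - CI (fun t => h (arm tau (-1) b t) (arm' tau (-1) b t)))%C.

Lemma arm_0 tau a b : arm tau a b 0 = 0%C.
Proof. unfold arm. apply injective_projections; simpl; ring. Qed.

Lemma arm_lid_right tau b : arm tau 1 b 1 = lid tau b 0.
Proof. unfold arm, lid. apply injective_projections; simpl; ring. Qed.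

Lemma arm_lid_left tau b : arm tau (-1) b 1 = lid tau b 1.
Proof. unfold arm, lid. apply injective_projections; simpl; ring. Qed.

Definition winding (tau b : R) (c : C) : C := loop tau b (fun x v => v / (x - c))%C.

Lemma ccont_quot (g g' : R -> C) (c : C) : ccont g -> ccont g' ->
  (forall t, 0 <= t <= 1 -> g t <> c) -> ccont (fun t => g' t / (g t - c))%C.
Proof.
  intros Hg Hg' Hc. apply ccont_div; auto.
  - apply (ccont_minus g (fun _ => c)); auto using ccont_const.
  - intros t Ht E. apply (Hc t Ht). replace (g t) with (g t - c + c)%C by ring. rewrite E. ring.
Qed.

Lemma quot_expands_const (g g' : R -> C) (c : C) :
  (forall t, 0 <= t <= 1 -> rderiv g t (g' t)) -> ccont g' -> (forall t, 0 <= t <= 1 -> g t <> c) ->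
  exists d, 0 < d /\ forall h, Cmod h < d -> exists a : nat -> C,
    @is_pseries C_AbsRing C_NormedModule a h (CI (fun t => g' t / (g t - (c + h)))%C) /\
    a 0%nat = CI (fun t => g' t / (g t - c))%C /\
    forall n, a (S n) = (pow_prim c n (g 1) - pow_prim c n (g 0))%C.
Proof.
  intros Hg Hg' Hc.
  assert (Cg : ccont g) by (apply rderiv_ccont; intros t Ht; eexists; apply Hg; auto).
  destruct (ccont_away (fun t => g t - c)%C) as [d [Hd Hd']].
  - apply (ccont_minus g (fun _ => c)); auto using ccont_const.
  - intros t Ht E. apply (Hc t Ht). replace (g t) with (g t - c + c)%C by ring. rewrite E. ring.
  - exists d. split; auto. intros h Hh. eexists. split; [|split].
    + apply (cauchy_integral_expands g' g c d); auto.
    + simpl. apply CI_ext. intros t _. f_equal. ring.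
    + intros n. simpl. apply (CI_pow_prim g g' c n); auto.
Qed.

Lemma psum_3 (a1 a2 a3 : nat -> C) (h : C) l1 l2 l3 :
  @is_pseries C_AbsRing C_NormedModule a1 h l1 -> @is_pseries C_AbsRing C_NormedModule a2 h l2 ->
  @is_pseries C_AbsRing C_NormedModule a3 h l3 ->
  (forall n, a1 (S n) + a2 (S n) - a3 (S n) = 0)%C ->
  (l1 + l2 - l3 = a1 0%nat + a2 0%nat - a3 0%nat)%C.
Proof.
  rewrite !is_pseries_C. intros H1 H2 H3 Hz. apply Cmod_minus_0, Rle_antisym; [|apply Cmod_ge_0].
  apply le_epsilon. intros e He. rewrite Rplus_0_l.
  destruct (H1 (e / 3)) as [N1 K1]; [lra|]. destruct (H2 (e / 3)) as [N2 K2]; [lra|]. destruct (H3 (e / 3)) as [N3 K3]; [lra|].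
  set (n := (N1 + N2 + N3)%nat). specialize (K1 n ltac:(lia)). specialize (K2 n ltac:(lia)). specialize (K3 n ltac:(lia)).
  assert (E : (psum a1 h n + psum a2 h n - psum a3 h n = a1 0%nat + a2 0%nat - a3 0%nat)%C).
  { clear K1 K2 K3. induction n as [|k IH]; [rewrite !psum_O; auto|]. rewrite !psum_S, <- IH.
    replace (psum a1 h k + a1 (S k) * h ^ S k + (psum a2 h k + a2 (S k) * h ^ S k) - (psum a3 h k + a3 (S k) * h ^ S k))%C
      with (psum a1 h k + psum a2 h k - psum a3 h k + (a1 (S k) + a2 (S k) - a3 (S k)) * h ^ S k)%C by ring.
    rewrite Hz. ring. }
  rewrite <- E. rewrite (Cmod_minus_sym (psum a1 h n)) in K1. rewrite (Cmod_minus_sym (psum a2 h n)) in K2.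
  replace (l1 + l2 - l3 - (psum a1 h n + psum a2 h n - psum a3 h n))%C
    with ((l1 - psum a1 h n) + (l2 - psum a2 h n) + (psum a3 h n - l3))%C by ring.
  eapply Rle_trans; [apply Cmod_triangle|].
  pose proof (Cmod_triangle (l1 - psum a1 h n) (l2 - psum a2 h n)). lra.
Qed.

(** The higher Taylor coefficients in [c] are increments of [pow_prim] along the three pieces, and
    these cancel because the pieces close up. *)
Lemma winding_locally_const tau b c : b * b = 1 -> cusp tau b c ->
  exists d, 0 < d /\ forall h, Cmod h < d -> winding tau b (c + h) = winding tau b c.
Proof.
  intros Hb Hc.
  destruct (quot_expands_const (arm tau 1 b) (arm' tau 1 b) c) as [d1 [Hd1 H1]].
  { intros; apply arm_rderiv. } { apply arm'_ccont. } { intros; apply arm_neq; auto; ring. }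
  destruct (quot_expands_const (lid tau b) (lid' tau) c) as [d2 [Hd2 H2]].
  { intros; apply lid_rderiv. } { apply lid'_ccont. } { intros; apply lid_neq; auto. }
  destruct (quot_expands_const (arm tau (-1) b) (arm' tau (-1) b) c) as [d3 [Hd3 H3]].
  { intros; apply arm_rderiv. } { apply arm'_ccont. } { intros; apply arm_neq; auto; ring. }
  exists (Rmin d1 (Rmin d2 d3)). split; [repeat apply Rmin_pos; auto|]. intros h Hh.
  pose proof (Rlt_le_trans _ _ _ Hh (Rmin_l _ _)) as X1. pose proof (Rlt_le_trans _ _ _ Hh (Rmin_r _ _)) as X.
  pose proof (Rlt_le_trans _ _ _ X (Rmin_l _ _)) as X2. pose proof (Rlt_le_trans _ _ _ X (Rmin_r _ _)) as X3.
  destruct (H1 h X1) as [a1 [A1 [B1 C1]]]. destruct (H2 h X2) as [a2 [A2 [B2 C2]]]. destruct (H3 h X3) as [a3 [A3 [B3 C3]]].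
  unfold winding, loop. rewrite <- B1, <- B2, <- B3. apply (psum_3 a1 a2 a3 h); auto.
  intros n. rewrite C1, C2, C3, !arm_0, arm_lid_right, arm_lid_left. ring.
Qed.

Lemma winding_const tau b c x : b * b = 1 -> cusp tau b c -> cusp tau b x -> winding tau b x = winding tau b c.
Proof.
  intros Hb Hc Hx.
  transitivity (winding tau b (c + RtoC 1 * (x - c))); [f_equal; ring|].
  rewrite (rderiv_zero_const (fun s => winding tau b (c + RtoC s * (x - c))%C) 1); [f_equal; ring|lra|].
  intros s Hs e He.
  assert (Hcs : cusp tau b (c + RtoC s * (x - c))%C).
  { destruct (Req_dec s 1) as [->|N].
    - replace (c + RtoC 1 * (x - c))%C with x by ring. auto.
    - apply cusp_convex; auto; [|lra]. destruct Hx. split; lra. }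
  destruct (winding_locally_const tau b _ Hb Hcs) as [d [Hd H]].
  pose proof (Cmod_ge_0 (x - c)) as Hxc.
  exists (d / (Cmod (x - c) + 1)). split; [apply Rdiv_lt_0_compat; lra|]. intros h Hh.
  replace (c + RtoC (s + h) * (x - c))%C with ((c + RtoC s * (x - c)) + RtoC h * (x - c))%C by (rewrite RtoC_plus; ring).
  rewrite H.
  - match goal with |- Cmod ?u <= _ => replace u with (RtoC 0) by ring end. rewrite Cmod_0.
    apply Rmult_le_pos; [lra|apply Rabs_pos].
  - rewrite Cmod_mult, Cmod_R. apply Rlt_div_r in Hh; [|lra]. pose proof (Rabs_pos h). nra.
Qed.

Lemma CI_Im_ge (b m : R) (p : R -> C) : b * b = 1 -> ccont p -> (forall t, 0 <= t <= 1 -> m <= b * Im (p t)) ->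
  m <= b * Im (CI p).
Proof.
  intros Hb Hp H.
  assert (E : b * Im (CI p) = RInt (fun t => b * Im (p t)) 0 1).
  { unfold CI. change (Im (?x, ?y)) with y. symmetry.
    apply (RInt_scal (V := R_CompleteNormedModule) (fun t => Im (p t)) 0 1 b).
    apply (ccont_ex_RInt p Im Im_lip Hp). }
  rewrite E. replace m with (RInt (fun _ => m) 0 1).
  2: { rewrite RInt_const. unfold scal; simpl. unfold mult; simpl. ring. }
  apply RInt_le; [lra|apply ex_RInt_const| |].
  - apply (ex_RInt_scal (V := R_CompleteNormedModule) (fun t => Im (p t)) 0 1 b).
    apply (ccont_ex_RInt p Im Im_lip Hp).
  - intros t Ht. apply H. lra.
Qed.

Lemma Im_div (v x : C) : x <> 0%C -> Im (v / x)%C = (Re x * Im v - Im x * Re v) / (Cmod x * Cmod x).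
Proof.
  intros Hx. pose proof (proj1 (Cmod_gt_0 _) Hx) as Hm. pose proof (Cmod_sq x) as Q. rewrite Q.
  unfold Cdiv, Im, Re in *. simpl. field. nra.
Qed.

(** The value is not computed. Seen from [c] the boundary always turns the same way: once oriented,
    each piece contributes an imaginary part of sign [b], and the lid a strictly nonzero one. *)
Lemma winding_neq_0 tau b c : b * b = 1 -> 0 < tau -> cusp tau b c -> winding tau b c <> 0%C.
Proof.
  intros Hb Ht Hc. destruct (cusp_root tau b c Hc) as [r [Hr [Eq Hp]]].
  pose proof Hc as [[Hq1 Hq2] _].
  assert (Ec : c = (Re c, Im c)) by (destruct c; reflexivity).
  assert (Arm : forall a t, a * a = 1 -> 0 <= t <= 1 ->
    0 <= a * (b * Im (arm' tau a b t / (arm tau a b t - c))%C)).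
  { intros a t Ha Htt. pose proof (arm_neq tau a b t c Ha Hb Hc) as Hn.
    assert (Hn' : (arm tau a b t - c <> 0)%C).
    { intros E. apply Hn. replace (arm tau a b t) with (arm tau a b t - c + c)%C by ring. rewrite E. ring. }
    rewrite Im_div by auto. pose proof (proj1 (Cmod_gt_0 _) Hn') as Hm.
    set (d := Cmod (arm tau a b t - c)) in *.
    unfold Rdiv. rewrite <- !Rmult_assoc. apply Rmult_le_pos; [|apply Rlt_le, Rinv_0_lt_compat; nra].
    set (T := tau * t). assert (HT : 0 <= T) by (apply Rmult_le_pos; lra).
    replace (Re (arm tau a b t - c)) with (a * T ^ 2 - Re c) by (unfold arm, Re, T; simpl; ring).
    replace (Im (arm tau a b t - c)) with (b * T ^ 3 - Im c) by (unfold arm, Im, T; simpl; ring).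
    change (Re (arm' tau a b t)) with (a * (2 * tau * T)). change (Im (arm' tau a b t)) with (b * (3 * tau * T ^ 2)).
    replace (a * b * ((a * T ^ 2 - Re c) * (b * (3 * tau * T ^ 2)) - (b * T ^ 3 - Im c) * (a * (2 * tau * T))))
      with (tau * T * ((a * a) * (b * b) * T ^ 3 - 3 * (a * (b * b) * Re c) * T + 2 * (a * a) * (b * Im c))) by ring.
    rewrite Ha, Hb, Eq.
    assert (A : a * 1 * Re c <= r * r).
    { pose proof (Rle_abs (a * Re c)) as B. rewrite unit_sign in B by auto. lra. }
    apply Rmult_le_pos; [nra|].
    (* The inequality [T^3 + 2 * r^3 >= 3 * r^2 * T] places [c] on the inner side of the tangent to
       the arm at parameter [T]. *)
    assert (A0 : 0 <= (T - r) * (T - r) * (T + 2 * r)) by (apply Rmult_le_pos; [apply Rle_0_sqr|lra]).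
    replace ((T - r) * (T - r) * (T + 2 * r)) with (T ^ 3 - 3 * (r * r * T) + 2 * (r * r * r)) in A0 by ring.
    assert (a * 1 * Re c * T <= r * r * T) by (apply Rmult_le_compat_r; auto). lra. }
  assert (CA : forall a, a * a = 1 -> ccont (fun t => arm' tau a b t / (arm tau a b t - c))%C).
  { intros a Ha. apply ccont_quot; auto using arm_ccont, arm'_ccont. intros; apply arm_neq; auto. }
  assert (CL : ccont (fun t => lid' tau t / (lid tau b t - c))%C).
  { apply ccont_quot; auto using lid_ccont, lid'_ccont. intros; apply lid_neq; auto. }
  destruct (ccont_bounded (fun t => lid tau b t - c)%C) as [B [HB HB']].
  { apply (ccont_minus (lid tau b) (fun _ => c)); auto using ccont_const, lid_ccont. }
  set (m := 2 * tau ^ 2 * (tau ^ 3 - b * Im c) / (B * B)).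
  assert (Hm : 0 < m).
  { apply Rdiv_lt_0_compat; [|nra]. assert (0 < tau ^ 2) by (apply pow_lt; auto). nra. }
  assert (L : m <= b * Im (CI (fun t => lid' tau t / (lid tau b t - c))%C)).
  { apply CI_Im_ge; auto. intros t Htt.
    assert (Hn' : (lid tau b t - c <> 0)%C).
    { intros E. apply (lid_neq tau b t c Hb Hc). replace (lid tau b t) with (lid tau b t - c + c)%C by ring. rewrite E. ring. }
    rewrite Im_div by auto. pose proof (proj1 (Cmod_gt_0 _) Hn') as Hd. specialize (HB' t Htt).
    replace (Im (lid tau b t - c)) with (b * tau ^ 3 - Im c) by (unfold lid, Im; simpl; ring).
    change (Re (lid' tau t)) with (- 2 * tau ^ 2). change (Im (lid' tau t)) with 0.
    unfold Rdiv. rewrite <- Rmult_assoc.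
    replace (b * (Re (lid tau b t - c) * 0 - (b * tau ^ 3 - Im c) * (-2 * tau ^ 2)))
      with (2 * tau ^ 2 * ((b * b) * tau ^ 3 - b * Im c)) by ring.
    rewrite Hb, Rmult_1_l. unfold m, Rdiv. apply Rmult_le_compat_l.
    - assert (0 < tau ^ 2) by (apply pow_lt; auto). nra.
    - apply Rinv_le_contravar; [nra|]. apply Rmult_le_compat; lra. }
  assert (A1 : 0 <= b * Im (CI (fun t => arm' tau 1 b t / (arm tau 1 b t - c))%C)).
  { apply CI_Im_ge; auto; [apply CA; ring|]. intros t Htt. specialize (Arm 1 t ltac:(ring) Htt). lra. }
  assert (A2 : 0 <= (- b) * Im (CI (fun t => arm' tau (-1) b t / (arm tau (-1) b t - c))%C)).
  { apply CI_Im_ge; [lra|apply CA; ring|]. intros t Htt. specialize (Arm (-1) t ltac:(ring) Htt). lra. }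
  intros E.
  assert (EI : Im (winding tau b c) = Im (CI (fun t => arm' tau 1 b t / (arm tau 1 b t - c))%C) +
    Im (CI (fun t => lid' tau t / (lid tau b t - c))%C) - Im (CI (fun t => arm' tau (-1) b t / (arm tau (-1) b t - c))%C)).
  { reflexivity. }
  rewrite E in EI. change (Im 0) with 0 in EI. nra.
Qed.

Section CuspCauchy.
Variables (tau b : R) (F : C -> C) (KF : R).
Hypotheses (Hb : b * b = 1) (Htau : 0 < tau).
Hypothesis Fdiff : forall x, closed_cusp tau b x -> x <> 0%C ->
  exists r, 0 < r /\ forall y, Cmod (y - x) < r -> sdiff F y.
Hypothesis Fbound : forall x, closed_cusp tau b x -> Cmod (F x) <= KF * Cmod x.

Lemma closed_cusp_0 : closed_cusp tau b 0.
Proof.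
  unfold closed_cusp. change (Im 0) with 0. change (Re 0) with 0.
  assert (0 < tau ^ 3) by (apply pow_lt; auto). rewrite Rabs_R0, Rmult_0_r. split; [lra|]. simpl. lra.
Qed.

Lemma cusp_F0 : F 0 = 0%C.
Proof.
  pose proof (Fbound 0 closed_cusp_0) as H. rewrite Cmod_0, Rmult_0_r in H.
  apply Cmod_eq_0, Rle_antisym; auto using Cmod_ge_0.
Qed.

Lemma cusp_cont x e : closed_cusp tau b x -> 0 < e -> exists d, 0 < d /\
  forall y, closed_cusp tau b y -> Cmod (y - x) < d -> Cmod (F y - F x) < e.
Proof.
  intros Hx He. destruct (Ceq_dec x 0) as [->|Hn].
  - exists (e / (Rabs KF + 1)). pose proof (Rabs_pos KF). split; [apply Rdiv_lt_0_compat; lra|].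
    intros y Hy Hd. rewrite cusp_F0, Cminus_0_r. rewrite Cminus_0_r in Hd.
    eapply Rle_lt_trans; [apply Fbound; auto|]. apply Rlt_div_r in Hd; [|lra].
    pose proof (Rle_abs KF). pose proof (Cmod_ge_0 y). nra.
  - destruct (Fdiff x Hx Hn) as [r [Hr H]].
    destruct (sdiff_cont F x) with (e := e) as [d [Hd H1]]; auto.
    { apply H. replace (x - x)%C with (RtoC 0) by ring. rewrite Cmod_0; auto. }
    exists d. auto.
Qed.

Lemma cusp_ccont g : ccont g -> (forall t, 0 <= t <= 1 -> closed_cusp tau b (g t)) -> ccont (fun t => F (g t)).
Proof.
  intros Cg Hg t Ht e He. destruct (cusp_cont (g t) e (Hg t Ht) He) as [d [Hd H]].
  destruct (Cg t Ht d Hd) as [d' [Hd' H']]. exists d'. split; auto.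
Qed.

Lemma cusp_neq_0 x : cusp tau b x -> x <> 0%C.
Proof. intros [[H _] _] E. rewrite E in H. change (Im 0) with 0 in H. lra. Qed.

Lemma cusp_closed x : cusp tau b x -> closed_cusp tau b x.
Proof. intros [[H1 H2] H3]. split; lra. Qed.

Section Piece.
Variables (c : C) (g g' : R -> C).
Hypotheses (Hc : cusp tau b c) (Hg : forall t, 0 <= t <= 1 -> rderiv g t (g' t)) (Hg' : ccont g')
  (Hgc : forall t, 0 <= t <= 1 -> g t <> c) (HgD : forall t, 0 <= t <= 1 -> closed_cusp tau b (g t)).

Definition scaled (s : R) : C := CI (fun t => F (homothety c g s t) * (g' t / (g t - c)))%C.

Lemma piece_ccont : ccont g.
Proof. apply rderiv_ccont. intros t Ht. eexists. apply Hg; auto. Qed.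

Lemma scaled_0 : scaled 0 = (F c * CI (fun t => g' t / (g t - c)))%C.
Proof.
  unfold scaled. rewrite <- CI_scal by (apply ccont_quot; auto using piece_ccont).
  apply CI_ext. intros t _. f_equal. f_equal. unfold homothety. ring.
Qed.

Lemma scaled_rderiv s : 0 <= s < 1 -> exists G, rderiv scaled s G /\
  (RtoC s * G = F (homothety c g s 1) - F (homothety c g s 0))%C /\ (s = 0 -> G = Der F c * (g 1 - g 0))%C.
Proof.
  intros Hs. apply (homothety_rderiv F g g' c s); auto.
  intros t Ht. assert (D : cusp tau b (homothety c g s t)) by (apply cusp_convex; auto).
  apply Fdiff; auto using cusp_closed, cusp_neq_0.
Qed.

Lemma homothety_closed s t : 0 <= s < 1 -> 0 <= t <= 1 -> closed_cusp tau b (homothety c g s t).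
Proof. intros Hs Ht. apply cusp_closed, cusp_convex; auto. Qed.

(** At the vertex [F] is only known to be continuous, so the contraction argument stops short of
    [s = 1]; continuity on the closed cusp, uniform along the path, carries the value over. *)
Lemma scaled_limit e : 0 < e -> exists S, 0 < S < 1 /\ forall s, S <= s < 1 ->
  Cmod (scaled s - CI (fun t => F (g t) * (g' t / (g t - c)))%C) <= e.
Proof.
  intros He. pose proof piece_ccont as Cg.
  assert (Cq : ccont (fun t => g' t / (g t - c))%C) by (apply ccont_quot; auto).
  destruct (ccont_bounded _ Cq) as [B [HB HB']].
  destruct (ccont_bounded (fun t => g t - c)%C) as [L [HL HL']].
  { apply (ccont_minus g (fun _ => c)); auto using ccont_const. }
  set (k := e / (2 * B)). assert (Hk : 0 < k) by (apply Rdiv_lt_0_compat; lra).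
  destruct (compact01 (fun t d => forall y, closed_cusp tau b y -> Cmod (y - g t) < d -> Cmod (F y - F (g t)) <= k)) as [d [Hd H]].
  { intros t Ht. destruct (cusp_cont (g t) (k / 2) (HgD t Ht) ltac:(lra)) as [d [Hd H]].
    destruct (Cg t Ht (d / 2) ltac:(lra)) as [d' [Hd' H']].
    exists (Rmin d' (d / 2)). split; [apply Rmin_pos; lra|]. intros t' Ht' Htt y Hy Hyg.
    specialize (H' t' Ht' (Rlt_le_trans _ _ _ Htt (Rmin_l _ _))).
    pose proof (Rlt_le_trans _ _ _ Hyg (Rmin_r _ _)) as Y.
    pose proof (Cmod_minus_le y (g t') (g t)).
    pose proof (H y Hy ltac:(lra)) as A1. pose proof (H (g t') (HgD t' Ht') ltac:(lra)) as A2.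
    rewrite Cmod_minus_sym in A2. pose proof (Cmod_minus_le (F y) (F (g t)) (F (g t'))). lra. }
  { intros t d d' Hdd HP y Hy Hyd. apply HP; auto. lra. }
  set (S := Rmax (1 / 2) (1 - d / (2 * L))).
  assert (0 < d / (2 * L)) by (apply Rdiv_lt_0_compat; lra).
  exists S. split.
  { split; [eapply Rlt_le_trans; [|apply Rmax_l]; lra|]. apply Rmax_lub_lt; lra. }
  intros s Hs. assert (S1 : 1 / 2 <= S) by apply Rmax_l. assert (S2 : 1 - d / (2 * L) <= S) by apply Rmax_r.
  assert (CF : ccont (fun t => F (g t))) by (apply cusp_ccont; auto).
  assert (CFs : ccont (fun t => F (homothety c g s t))).
  { apply cusp_ccont; [apply homothety_ccont; auto|]. intros; apply homothety_closed; auto; lra. }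
  unfold scaled. rewrite <- CI_minus by (apply ccont_mult; auto).
  apply Rle_trans with (2 * (k * B)); [|right; unfold k; field; lra].
  apply CI_bound; [apply ccont_minus; apply ccont_mult; auto|].
  intros t Ht.
  replace (F (homothety c g s t) * (g' t / (g t - c)) - F (g t) * (g' t / (g t - c)))%C
    with ((F (homothety c g s t) - F (g t)) * (g' t / (g t - c)))%C by ring.
  rewrite Cmod_mult. apply Rmult_le_compat; auto using Cmod_ge_0.
  apply H; auto; [apply homothety_closed; auto; lra|].
  unfold homothety. replace (c + RtoC s * (g t - c) - g t)%C with (- (RtoC (1 - s) * (g t - c)))%C by (rewrite RtoC_minus; ring).
  rewrite Cmod_opp, Cmod_mult, Cmod_R, Rabs_pos_eq by lra. specialize (HL' t Ht).
  assert ((1 - s) * Cmod (g t - c) <= d / (2 * L) * L) by (apply Rmult_le_compat; auto using Cmod_ge_0; lra).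
  replace (d / (2 * L) * L) with (d / 2) in * by (field; lra). lra.
Qed.
End Piece.

(** For [s < 1] the endpoint terms of the three pieces cancel in pairs and the sum [I] is constant
    in [s]; its value at 0 is [F c] times the winding, its limit at 1 is the loop integral. *)
Lemma cusp_cauchy c : cusp tau b c ->
  loop tau b (fun x v => F x * (v / (x - c)))%C = (F c * winding tau b c)%C.
Proof.
  intros Hc.
  assert (U : 1 * 1 = 1) by ring. assert (U' : -1 * -1 = 1) by ring.
  set (g1 := arm tau 1 b). set (g1' := arm' tau 1 b). set (g2 := lid tau b). set (g2' := lid' tau).
  set (g3 := arm tau (-1) b). set (g3' := arm' tau (-1) b).
  assert (D1 : forall t, 0 <= t <= 1 -> rderiv g1 t (g1' t)) by (intros; apply arm_rderiv).
  assert (D2 : forall t, 0 <= t <= 1 -> rderiv g2 t (g2' t)) by (intros; apply lid_rderiv).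
  assert (D3 : forall t, 0 <= t <= 1 -> rderiv g3 t (g3' t)) by (intros; apply arm_rderiv).
  assert (C1 : ccont g1') by apply arm'_ccont. assert (C2 : ccont g2') by apply lid'_ccont.
  assert (C3 : ccont g3') by apply arm'_ccont.
  assert (N1 : forall t, 0 <= t <= 1 -> g1 t <> c) by (intros; apply arm_neq; auto).
  assert (N2 : forall t, 0 <= t <= 1 -> g2 t <> c) by (intros; apply lid_neq; auto).
  assert (N3 : forall t, 0 <= t <= 1 -> g3 t <> c) by (intros; apply arm_neq; auto).
  assert (E1 : forall t, 0 <= t <= 1 -> closed_cusp tau b (g1 t)) by (intros; apply arm_closed_cusp; auto).
  assert (E2 : forall t, 0 <= t <= 1 -> closed_cusp tau b (g2 t)) by (intros; apply lid_closed_cusp; auto).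
  assert (E3 : forall t, 0 <= t <= 1 -> closed_cusp tau b (g3 t)) by (intros; apply arm_closed_cusp; auto).
  set (I := fun s => (scaled c g1 g1' s + scaled c g2 g2' s + (-(1)) * scaled c g3 g3' s)%C).
  assert (Const : forall S, 0 < S < 1 -> I S = I 0).
  { intros S HS. apply rderiv_zero_const; [lra|]. intros s Hs.
    destruct (scaled_rderiv c g1 g1' Hc D1 C1 N1 E1 s ltac:(lra)) as [G1 [A1 [B1 Z1]]].
    destruct (scaled_rderiv c g2 g2' Hc D2 C2 N2 E2 s ltac:(lra)) as [G2 [A2 [B2 Z2]]].
    destruct (scaled_rderiv c g3 g3' Hc D3 C3 N3 E3 s ltac:(lra)) as [G3 [A3 [B3 Z3]]].
    assert (V0 : g1 0 = g3 0) by (unfold g1, g3; rewrite !arm_0; auto).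
    assert (V1 : g1 1 = g2 0) by apply arm_lid_right. assert (V2 : g3 1 = g2 1) by apply arm_lid_left.
    assert (Z : (G1 + G2 + (-(1)) * G3 = 0)%C).
    { destruct (Req_dec s 0) as [Hs0|Hs0].
      - rewrite Z1, Z2, Z3, V1, V2, V0 by auto. ring.
      - assert (Hn : RtoC s <> 0%C) by (apply RtoC_neq_0; auto).
        assert (E : (RtoC s * (G1 + G2 + (-(1)) * G3) = 0)%C).
        { replace (RtoC s * (G1 + G2 + (-(1)) * G3))%C with (RtoC s * G1 + RtoC s * G2 - RtoC s * G3)%C by ring.
          rewrite B1, B2, B3. unfold homothety. rewrite V0, V1, V2. ring. }
        replace (G1 + G2 + (-(1)) * G3)%C with (/ RtoC s * (RtoC s * (G1 + G2 + (-(1)) * G3)))%C by (field; auto).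
        rewrite E. ring. }
    rewrite <- Z. unfold I. apply rderiv_plus; [apply rderiv_plus; auto|].
    intros e He. destruct (A3 e He) as [d [Hd H]]. exists d. split; auto. intros h Hh.
    replace ((-(1)) * scaled c g3 g3' (s + h) - (-(1)) * scaled c g3 g3' s - (-(1)) * G3 * RtoC h)%C
      with (- (scaled c g3 g3' (s + h) - scaled c g3 g3' s - G3 * RtoC h))%C by ring.
    rewrite Cmod_opp. auto. }
  assert (I0 : I 0 = (F c * winding tau b c)%C).
  { unfold I. rewrite !scaled_0 by auto. unfold winding, loop. fold g1 g2 g3 g1' g2' g3'. ring. }
  rewrite <- I0. apply Cmod_minus_0, Rle_antisym; [|apply Cmod_ge_0].
  apply le_epsilon. intros e He. rewrite Rplus_0_l.
  destruct (scaled_limit c g1 g1' Hc D1 C1 N1 E1 (e / 3) ltac:(lra)) as [S1 [P1 L1]].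
  destruct (scaled_limit c g2 g2' Hc D2 C2 N2 E2 (e / 3) ltac:(lra)) as [S2 [P2 L2]].
  destruct (scaled_limit c g3 g3' Hc D3 C3 N3 E3 (e / 3) ltac:(lra)) as [S3 [P3 L3]].
  set (S := Rmax S1 (Rmax S2 S3)).
  assert (S1 <= S) by apply Rmax_l. assert (Q : Rmax S2 S3 <= S) by apply Rmax_r.
  assert (S2 <= S) by (eapply Rle_trans; [apply Rmax_l|apply Q]).
  assert (S3 <= S) by (eapply Rle_trans; [apply Rmax_r|apply Q]).
  assert (HS : 0 < S < 1) by (split; [lra|]; repeat apply Rmax_lub_lt; lra).
  rewrite <- (Const S HS). specialize (L1 S ltac:(lra)). specialize (L2 S ltac:(lra)). specialize (L3 S ltac:(lra)).
  unfold I, loop. fold g1 g2 g3 g1' g2' g3'.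
  rewrite Cmod_minus_sym.
  match goal with |- Cmod ?u <= _ => replace u with
    ((scaled c g1 g1' S - CI (fun t => F (g1 t) * (g1' t / (g1 t - c)))) +
     (scaled c g2 g2' S - CI (fun t => F (g2 t) * (g2' t / (g2 t - c)))) -
     (scaled c g3 g3' S - CI (fun t => F (g3 t) * (g3' t / (g3 t - c)))))%C by ring end.
  eapply Rle_trans; [apply Cmod_minus_triangle|].
  pose proof (Cmod_triangle (scaled c g1 g1' S - CI (fun t => F (g1 t) * (g1' t / (g1 t - c)))%C)
     (scaled c g2 g2' S - CI (fun t => F (g2 t) * (g2' t / (g2 t - c)))%C)). lra.
Qed.
End CuspCauchy.

(** * The additive Cousin problem *)

(** The bounds force [u 0 = 0]. Differentiability is asked on a neighbourhood of each other point of
    the closed cusp, so that Cauchy's theorem reaches the boundary. *)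
Definition flat_on_cusp (tau b : R) (u : C -> C) : Prop :=
  (forall x, closed_cusp tau b x -> x <> 0%C -> exists r, 0 < r /\ forall y, Cmod (y - x) < r -> sdiff u y) /\
  (forall m, exists K, 0 <= K /\ forall x, closed_cusp tau b x -> Cmod (u x) <= K * Cmod x ^ m).

Lemma closed_cusp_mod tau b z : b * b = 1 -> 0 < tau <= 1 -> closed_cusp tau b z -> Cmod z <= 2.
Proof.
  intros Hb Ht Hz. destruct (closed_cusp_root tau b z Hz) as [r [Hr [E P]]]. destruct Hz as [[H1 H2] _].
  assert (T3 : tau ^ 3 <= 1) by (rewrite <- (pow1 3); apply pow_incr; lra).
  assert (R1 : r <= 1).
  { apply pow3_le_inv; [auto|lra|]. replace (r ^ 3) with (r * r * r) by ring. rewrite <- E. lra. }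
  assert (Rabs (Im z) <= 1).
  { rewrite <- (unit_sign b (Im z) Hb), Rabs_pos_eq; lra. }
  pose proof (Cmod_le_Re_Im z). nra.
Qed.

Lemma flat_div_pow tau b u n : flat_on_cusp tau b u -> flat_on_cusp tau b (fun x => u x / x ^ n)%C.
Proof.
  intros [H1 H2]. split.
  - intros x Hx Hn. destruct (H1 x Hx Hn) as [r [Hr H]]. pose proof (proj1 (Cmod_gt_0 _) Hn) as Hm.
    exists (Rmin r (Cmod x)). split; [apply Rmin_pos; auto|]. intros y Hy.
    apply sdiff_div.
    + apply H. eapply Rlt_le_trans; [apply Hy|apply Rmin_l].
    + apply (sdiff_pow (fun y => y)). apply sdiff_id.
    + apply Cpow_nz. intros E. rewrite E in Hy. replace (0 - x)%C with (- x)%C in Hy by ring.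
      rewrite Cmod_opp in Hy. pose proof (Rmin_r r (Cmod x)). lra.
  - intros m. destruct (H2 (n + m)%nat) as [K [HK H]]. exists K. split; auto. intros x Hx.
    (* At the vertex [u] is 0, so the quotient is 0 whatever value division by 0 has. *)
    destruct (Ceq_dec x 0) as [->|Hn].
    + destruct (H2 1%nat) as [K1 [_ H3]]. specialize (H3 0%C Hx). rewrite Cmod_0, pow_1, Rmult_0_r in H3.
      assert (E : u 0%C = 0%C) by (apply Cmod_eq_0, Rle_antisym; auto using Cmod_ge_0). rewrite E.
      unfold Cdiv. rewrite Cmult_0_l, Cmod_0. apply Rmult_le_pos; auto. apply pow_le; lra.
    + pose proof (proj1 (Cmod_gt_0 _) Hn) as Hm. rewrite Cmod_div, Cmod_pow by (apply Cpow_nz; auto).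
      specialize (H x Hx). rewrite pow_add in H. assert (0 < Cmod x ^ n) by (apply pow_lt; auto).
      apply Rle_div_l; auto. lra.
Qed.

Lemma flat_cusp_ccont tau b u g : 0 < tau -> flat_on_cusp tau b u -> ccont g ->
  (forall t, 0 <= t <= 1 -> closed_cusp tau b (g t)) -> ccont (fun t => u (g t)).
Proof.
  intros Ht [H1 H2] Hg HD. destruct (H2 1%nat) as [K [HK H]].
  apply (cusp_ccont tau b u K); auto. intros x Hx. specialize (H x Hx). rewrite pow_1 in H. auto.
Qed.

Lemma arm_mod tau a b t : a * a = 1 -> b * b = 1 -> 0 < tau <= 1 -> 0 <= t <= 1 ->
  (tau * t) ^ 2 <= Cmod (arm tau a b t) <= 2 * (tau * t) ^ 2.
Proof.
  intros Ha Hb Ht Htt. set (T := tau * t). assert (0 <= T <= 1) by (unfold T; split; nra).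
  pose proof (Re_le_Cmod (arm tau a b t)) as R1. pose proof (Cmod_le_Re_Im (arm tau a b t)) as R2.
  change (Re (arm tau a b t)) with (a * T ^ 2) in *. change (Im (arm tau a b t)) with (b * T ^ 3) in *.
  rewrite !unit_sign, !Rabs_pos_eq in * by (auto; apply pow_le; lra).
  split; auto. replace (T ^ 3) with (T ^ 2 * T) in R2 by ring. assert (0 <= T ^ 2) by (apply pow_le; lra). nra.
Qed.

Lemma arm'_mod tau a b t : a * a = 1 -> b * b = 1 -> 0 < tau <= 1 -> 0 <= t <= 1 -> Cmod (arm' tau a b t) <= 5.
Proof.
  intros Ha Hb Ht Htt. eapply Rle_trans; [apply Cmod_le_Re_Im|].
  set (T := tau * t). assert (HT : 0 <= T <= 1) by (unfold T; split; nra).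
  change (Re (arm' tau a b t)) with (a * (2 * tau * T)). change (Im (arm' tau a b t)) with (b * (3 * tau * T ^ 2)).
  rewrite (unit_sign a _ Ha), (unit_sign b _ Hb). assert (P1 : 0 <= tau * T <= 1) by nra.
  assert (P2 : 0 <= tau * T ^ 2 <= 1).
  { replace (tau * T ^ 2) with (tau * T * T) by ring. nra. }
  rewrite (Rabs_pos_eq (2 * tau * T)), (Rabs_pos_eq (3 * tau * T ^ 2)) by lra. lra.
Qed.

Lemma height_diff a z x : a * a = 1 -> height a 1 z - height a 1 x <=
  Cmod (wcoord z - wcoord x) * (2 * Cmod (wcoord x) + Cmod (wcoord z - wcoord x) + 1).
Proof.
  intros Ha. unfold height. set (w := wcoord z). set (v := wcoord x). set (d := Cmod (w - v)).
  replace (1 * (Im w * Im w) + a * Re w - (1 * (Im v * Im v) + a * Re v))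
    with ((Im w - Im v) * (2 * Im v + (Im w - Im v)) + a * (Re w - Re v)) by ring.
  pose proof (Rle_abs (a * (Re w - Re v))) as A1. rewrite unit_sign in A1 by auto.
  pose proof (Re_lip w v) as A2. fold d in A2.
  pose proof (Rle_abs ((Im w - Im v) * (2 * Im v + (Im w - Im v)))) as A3. rewrite Rabs_mult in A3.
  pose proof (Im_lip w v) as A4. fold d in A4.
  assert (A5 : Rabs (2 * Im v + (Im w - Im v)) <= 2 * Cmod v + d).
  { eapply Rle_trans; [apply Rabs_triang|]. rewrite Rabs_mult, (Rabs_pos_eq 2) by lra. pose proof (Im_le_Cmod v). lra. }
  assert (Rabs (Im w - Im v) * Rabs (2 * Im v + (Im w - Im v)) <= d * (2 * Cmod v + d)).
  { apply Rmult_le_compat; auto using Rabs_pos. }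
  lra.
Qed.

(** Each arm runs in the region excluded from the petal of the same sign [a]: the right arm misses
    the attracting petal, the left arm the repelling one. *)
Lemma arm_height tau a b t : a * a = 1 -> b * b = 1 -> arm tau a b t <> 0%C -> height a 1 (arm tau a b t) <= 0.
Proof.
  intros Ha Hb Hn. unfold height. rewrite Im_wcoord, Re_wcoord by auto.
  pose proof (proj1 (Cmod_gt_0 _) Hn) as Hm. pose proof (Cmod_sq (arm tau a b t)) as Q.
  set (m := Cmod (arm tau a b t)) in *. set (T := tau * t).
  change (Re (arm tau a b t)) with (a * T ^ 2) in *. change (Im (arm tau a b t)) with (b * T ^ 3) in *.
  replace (a * T ^ 2 * (a * T ^ 2) + b * T ^ 3 * (b * T ^ 3)) with ((a * a) * T ^ 4 + (b * b) * T ^ 6) in Q by ring.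
  rewrite Ha, Hb in Q. set (M := m * m) in *. assert (HM : 0 < M) by (unfold M; nra).
  replace (1 * (b * T ^ 3 / M * (b * T ^ 3 / M)) + a * (- (a * T ^ 2) / M))
    with ((b * b * T ^ 6 - a * a * T ^ 2 * M) / (M * M)) by (field; lra).
  rewrite Ha, Hb. apply Rle_div_l; [nra|]. rewrite Q, Rmult_0_l.
  replace (1 * T ^ 6 - 1 * T ^ 2 * (1 * T ^ 4 + 1 * T ^ 6)) with (- (T ^ 4 * T ^ 4)) by ring.
  pose proof (Rle_0_sqr (T ^ 4)) as S. unfold Rsqr in S. lra.
Qed.

(** The heights of [z] and of the arm differ by at least 1, while the height has slope of order
    [1/T^2] at the arm. So the two points are at least [T^2/4] apart in [wcoord], and going back to
    [z] multiplies by [|z| * |x|] with [|x| >= T^2]. *)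
Lemma arm_dist tau a b t z : a * a = 1 -> b * b = 1 -> 0 < tau <= 1 -> 0 <= t <= 1 -> parabola a 1 1 z ->
  Cmod z * (tau * t) ^ 4 / 4 <= Cmod (arm tau a b t - z).
Proof.
  intros Ha Hb Ht Htt [Hz Hh]. set (T := tau * t). assert (HT : 0 <= T <= 1) by (unfold T; split; nra).
  destruct (Req_dec T 0) as [E|E].
  { rewrite E. replace (Cmod z * 0 ^ 4 / 4) with 0 by (simpl; field). apply Cmod_ge_0. }
  pose proof (arm_mod tau a b t Ha Hb Ht Htt) as Hm. fold T in Hm.
  assert (HT2 : 0 < T ^ 2) by (apply pow_lt; lra).
  set (x := arm tau a b t) in *.
  assert (Hx : x <> 0%C) by (apply Cmod_neq_0; lra).
  pose proof (arm_height tau a b t Ha Hb Hx) as Hxh. fold x in Hxh.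
  pose proof (height_diff a z x Ha) as D. rewrite (wcoord_mod x Hx) in D.
  set (d := Cmod (wcoord z - wcoord x)) in *.
  assert (d0 : 0 <= d) by apply Cmod_ge_0.
  assert (Hi : / Cmod x <= / T ^ 2) by (apply Rinv_le_contravar; lra).
  assert (Hi1 : 1 <= / T ^ 2). { rewrite <- Rinv_1 at 1. apply Rinv_le_contravar; auto. simpl; nra. }
  assert (Hd : T ^ 2 / 4 <= d).
  { assert (I : 1 <= d * (2 * / T ^ 2 + d + 1)) by nra.
    destruct (Rle_lt_dec 1 d) as [G|G].
    - assert (T ^ 2 <= 1) by (simpl; nra). lra.
    - assert (1 <= d * (4 * / T ^ 2)) by nra.
      apply Rmult_le_reg_r with (4 * / T ^ 2); [lra|].
      replace (T ^ 2 / 4 * (4 * / T ^ 2)) with 1 by (field; lra). auto. }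
  assert (E2 : Cmod (x - z) = Cmod z * Cmod x * d).
  { rewrite (Cmod_minus_sym x z). unfold d. rewrite <- !Cmod_mult. f_equal. unfold wcoord. field. auto. }
  rewrite E2. pose proof (Cmod_ge_0 z).
  replace (Cmod z * T ^ 4 / 4) with (Cmod z * T ^ 2 * (T ^ 2 / 4)) by field.
  apply Rmult_le_compat; try lra.
  - apply Rmult_le_pos; lra.
  - apply Rmult_le_compat_l; lra.
Qed.

Section CauchyArm.
Variables (tau a b : R) (u : C -> C).
Hypotheses (Ha : a * a = 1) (Hb : b * b = 1) (Ht : 0 < tau <= 1) (Hu : flat_on_cusp tau b u).

Definition arm_integral (z : C) : C := CI (fun t => u (arm tau a b t) * arm' tau a b t / (arm tau a b t - z))%C.

Lemma arm_density_ccont n : ccont (fun t => u (arm tau a b t) * arm' tau a b t / arm tau a b t ^ n)%C.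
Proof.
  apply (ccont_ext (fun t => (u (arm tau a b t) / arm tau a b t ^ n) * arm' tau a b t)%C).
  - intros; unfold Cdiv; ring.
  - apply ccont_mult; [|apply arm'_ccont].
    apply (flat_cusp_ccont tau b (fun x => u x / x ^ n)%C (arm tau a b)); auto using flat_div_pow, arm_ccont; try lra.
    intros; apply arm_closed_cusp; auto; lra.
Qed.

Lemma arm_density_ccont0 : ccont (fun t => u (arm tau a b t) * arm' tau a b t)%C.
Proof.
  apply (ccont_ext (fun t => u (arm tau a b t) * arm' tau a b t / arm tau a b t ^ 0)%C).
  - intros. simpl. field.
  - apply arm_density_ccont.
Qed.

Lemma parabola_not_arm z t : parabola a 1 1 z -> 0 <= t <= 1 -> arm tau a b t <> z.
Proof.
  intros Hz Htt E. pose proof (arm_dist tau a b t z Ha Hb Ht Htt Hz) as D. rewrite E in D.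
  replace (z - z)%C with (RtoC 0) in D by ring. rewrite Cmod_0 in D.
  pose proof (proj1 (Cmod_gt_0 _) (proj1 Hz)) as Hm.
  destruct (Req_dec (tau * t) 0) as [E0|E0].
  - assert (t = 0) by (apply (Rmult_eq_reg_l tau); lra). subst t. rewrite arm_0 in E. apply (proj1 Hz). auto.
  - assert (0 < (tau * t) ^ 4).
    { apply pow_lt. assert (0 <= tau * t) by (apply Rmult_le_pos; lra). lra. }
    assert (0 < Cmod z * (tau * t) ^ 4) by (apply Rmult_lt_0_compat; auto). lra.
Qed.

Lemma arm_integral_analytic z : parabola a 1 1 z -> analytic_at arm_integral z.
Proof.
  intros Hz. destruct (ccont_away (fun t => arm tau a b t - z)%C) as [d [Hd Hd']].
  - apply (ccont_minus (arm tau a b) (fun _ => z)); auto using ccont_const, arm_ccont.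
  - intros t Htt E. apply (parabola_not_arm z t Hz Htt).
    replace (arm tau a b t) with (arm tau a b t - z + z)%C by ring. rewrite E. ring.
  - eexists. exists d. split; auto. intros h Hh.
    apply (cauchy_integral_expands (fun t => u (arm tau a b t) * arm' tau a b t)%C (arm tau a b) z d);
      auto using arm_density_ccont0, arm_ccont.
Qed.

Definition arm_coef (n : nat) : C := CI (fun t => u (arm tau a b t) * arm' tau a b t / arm tau a b t ^ S n)%C.

Lemma flat_u0 : u 0%C = 0%C.
Proof.
  destruct Hu as [_ H]. destruct (H 1%nat) as [K [_ HK]].
  specialize (HK 0%C (closed_cusp_0 tau b ltac:(lra))). rewrite Cmod_0, pow_1, Rmult_0_r in HK.
  apply Cmod_eq_0, Rle_antisym; auto using Cmod_ge_0.
Qed.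

Lemma arm_integral_remainder z N : parabola a 1 1 z ->
  (arm_integral z - psum arm_coef z N = z ^ S N *
    CI (fun t => (u (arm tau a b t) * arm' tau a b t / arm tau a b t ^ S N) / (arm tau a b t - z)))%C.
Proof.
  intros Hz.
  assert (Cz : ccont (fun t => arm tau a b t - z)%C).
  { apply (ccont_minus (arm tau a b) (fun _ => z)); auto using ccont_const, arm_ccont. }
  assert (Nz : forall t, 0 <= t <= 1 -> (arm tau a b t - z <> 0)%C).
  { intros t Htt E. apply (parabola_not_arm z t Hz Htt).
    replace (arm tau a b t) with (arm tau a b t - z + z)%C by ring. rewrite E. ring. }
  assert (C2 : forall n, ccont (fun t => (u (arm tau a b t) * arm' tau a b t / arm tau a b t ^ n) / (arm tau a b t - z))%C).
  { intros n. apply ccont_div; auto. apply arm_density_ccont. }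
  assert (C0 : ccont (fun t => u (arm tau a b t) * arm' tau a b t / (arm tau a b t - z))%C).
  { apply ccont_div; auto. apply arm_density_ccont0. }
  assert (Zero : forall t, arm tau a b t = 0%C -> (u (arm tau a b t) = 0)%C).
  { intros t E. rewrite E. apply flat_u0. }
  induction N as [|N IH].
  - rewrite psum_O. unfold arm_integral, arm_coef. rewrite <- CI_scal, <- CI_minus; auto using arm_density_ccont.
    apply CI_ext. intros t Htt. specialize (Nz t Htt).
    destruct (Ceq_dec (arm tau a b t) 0) as [E|E].
    + rewrite (Zero t E). unfold Cdiv. ring.
    + simpl. field. auto.
  - rewrite psum_S.
    replace (arm_integral z - (psum arm_coef z N + arm_coef (S N) * z ^ S N))%C
      with ((arm_integral z - psum arm_coef z N) - z ^ S N * arm_coef (S N))%C by ring.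
    rewrite IH. unfold arm_coef. rewrite <- !CI_scal; auto using arm_density_ccont. rewrite <- CI_minus.
    + apply CI_ext. intros t Htt. specialize (Nz t Htt).
      destruct (Ceq_dec (arm tau a b t) 0) as [E|E].
      * rewrite (Zero t E). unfold Cdiv. ring.
      * simpl. field. repeat split; auto. apply Cpow_nz; auto.
    + apply (ccont_mult (fun _ => z ^ S N)%C); auto using ccont_const.
    + apply (ccont_mult (fun _ => z ^ S N)%C); auto using ccont_const, arm_density_ccont.
Qed.

(** By [arm_dist] the kernel is [O(1/(|z| * T^4))] along the arm, and the flatness of [u] absorbs
    the powers of [T]. The factor [1/|z|] costs one order, so the remainder is estimated at order
    [N + 1]. *)
Lemma arm_integral_asy : asy (parabola a 1 1) arm_integral.
Proof.
  intros N. destruct Hu as [_ Hflat].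
  (* [N + 2] powers of [|x|] for the denominator of the remainder and 2 more for the [T^4] of
     [arm_dist]. *)
  destruct (Hflat (S (S N) + 2)%nat) as [K [HK H]].
  exists arm_coef, (160 * K + Cmod (arm_coef (S N))). intros z Hz.
  pose proof (proj1 (Cmod_gt_0 _) (proj1 Hz)) as Hm.
  assert (Rem : Cmod (arm_integral z - psum arm_coef z (S N)) <= 40 * K * Cmod z ^ S N * 4).
  { rewrite (arm_integral_remainder z (S N) Hz), Cmod_mult, Cmod_pow.
    apply Rle_trans with (Cmod z ^ S (S N) * (2 * (80 * K / Cmod z))).
    2: { right. simpl. field. lra. }
    apply Rmult_le_compat_l; [apply pow_le; lra|]. apply CI_bound.
    - apply ccont_div; [apply arm_density_ccont| |].
      + apply (ccont_minus (arm tau a b) (fun _ => z)); auto using ccont_const, arm_ccont.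
      + intros t Htt E. apply (parabola_not_arm z t Hz Htt).
        replace (arm tau a b t) with (arm tau a b t - z + z)%C by ring. rewrite E. ring.
    - intros t Htt. pose proof (arm_mod tau a b t Ha Hb Ht Htt) as [M1 M2].
      pose proof (arm'_mod tau a b t Ha Hb Ht Htt) as M3.
      pose proof (arm_dist tau a b t z Ha Hb Ht Htt Hz) as M4.
      specialize (H _ (arm_closed_cusp tau a b t Ha Hb ltac:(lra) Htt)).
      set (x := arm tau a b t) in *. set (T := tau * t) in *.
      assert (Hxz : (x - z <> 0)%C).
      { intros E. apply (parabola_not_arm z t Hz Htt). fold x. replace x with (x - z + z)%C by ring. rewrite E. ring. }
      assert (0 <= 80 * K / Cmod z) by (apply Rdiv_le_0_compat; lra).
      destruct (Ceq_dec x 0) as [E|E].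
      + rewrite E, flat_u0. unfold Cdiv. rewrite !Cmult_0_l, Cmod_0. auto.
      + pose proof (proj1 (Cmod_gt_0 _) E) as Hx.
        assert (HT : 0 < T ^ 2) by lra.
        rewrite !Cmod_div, Cmod_mult, Cmod_pow by (auto; apply Cpow_nz; auto).
        pose proof (proj1 (Cmod_gt_0 _) Hxz) as Hxz'.
        apply Rle_div_l; auto.
        assert (P : 0 < Cmod x ^ S (S N)) by (apply pow_lt; auto).
        apply Rle_div_l; auto.
        rewrite pow_add in H.
        apply Rle_trans with (K * (Cmod x ^ S (S N) * Cmod x ^ 2) * 5).
        { apply Rmult_le_compat; auto using Cmod_ge_0. }
        apply Rle_trans with (80 * K / Cmod z * (Cmod z * T ^ 4 / 4) * Cmod x ^ S (S N)).
        2: { apply Rmult_le_compat_r; [lra|]. apply Rmult_le_compat_l; auto. }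
        replace (80 * K / Cmod z * (Cmod z * T ^ 4 / 4) * Cmod x ^ S (S N))
          with (K * (Cmod x ^ S (S N) * (2 * T ^ 2) ^ 2) * 5) by (field; lra).
        apply Rmult_le_compat_r; [lra|]. apply Rmult_le_compat_l; auto. apply Rmult_le_compat_l; [lra|].
        apply pow_incr. lra. }
  rewrite psum_S in Rem.
  replace (arm_integral z - psum arm_coef z N)%C with
    ((arm_integral z - (psum arm_coef z N + arm_coef (S N) * z ^ S N)) + arm_coef (S N) * z ^ S N)%C by ring.
  eapply Rle_trans; [apply Cmod_triangle|]. rewrite Cmod_mult, Cmod_pow.
  assert (0 <= K * Cmod z ^ S N) by (apply Rmult_le_pos; auto; apply pow_le; lra). lra.
Qed.
End CauchyArm.

Lemma cusp_center tau b : b * b = 1 -> 0 < tau -> cusp tau b (0, b * (tau ^ 3 / 2))%R.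
Proof.
  intros Hb Ht. unfold cusp, Im, Re. cbn [fst snd].
  replace (b * (b * (tau ^ 3 / 2))) with ((b * b) * (tau ^ 3 / 2)) by ring. rewrite Hb, Rmult_1_l.
  assert (0 < tau ^ 3) by (apply pow_lt; auto). rewrite Rabs_R0. split; [lra|].
  rewrite pow_i by lia. apply pow_lt. lra.
Qed.

Lemma closed_cusp_outside tau b x z : b * b = 1 -> closed_cusp tau b x -> 0 < - b * Im z ->
  - b * Im z <= Cmod (x - z).
Proof.
  intros Hb [[H _] _] Hz. apply Rle_trans with (b * (Im x - Im z)); [lra|].
  eapply Rle_trans; [apply Rle_abs|]. rewrite unit_sign by auto. apply Im_lip.
Qed.

(* The additive Cousin problem in the cusp, solved by a Cauchy integral over
   each of the two arms of its boundary. *)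
Lemma cousin tau b u : b * b = 1 -> 0 < tau <= 1 -> flat_on_cusp tau b u ->
  exists Jr Jl d, 0 < d /\
    (forall z, parabola 1 1 1 z -> Cmod z < d -> analytic_at Jr z) /\
    (forall z, parabola (-1) 1 1 z -> Cmod z < d -> analytic_at Jl z) /\
    asy (fun z => parabola 1 1 1 z /\ Cmod z < d) Jr /\
    asy (fun z => parabola (-1) 1 1 z /\ Cmod z < d) Jl /\
    (forall z, parabola 1 1 1 z -> parabola (-1) 1 1 z -> Cmod z < d ->
      (0 < b * Im z -> Jr z - Jl z = u z)%C /\ (0 < - b * Im z -> Jr z = Jl z)).
Proof.
  intros Hb Ht Hu. set (c := (0, b * (tau ^ 3 / 2))%R : C).
  assert (Hc : cusp tau b c) by (apply cusp_center; auto; lra).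
  set (W := winding tau b c).
  assert (HW : W <> 0%C) by (apply winding_neq_0; auto; lra).
  set (lidI := fun z => CI (fun t => u (lid tau b t) * lid' tau t / (lid tau b t - z))%C).
  assert (T3 : 0 < tau ^ 3) by (apply pow_lt; lra).
  assert (LidFar : forall t z, 0 <= t <= 1 -> Cmod z < tau ^ 3 / 2 -> tau ^ 3 / 2 <= Cmod (lid tau b t - z)).
  { intros t z Htt Hz. pose proof (Im_le_Cmod (lid tau b t)) as I.
    change (Im (lid tau b t)) with (b * tau ^ 3) in I. rewrite unit_sign, Rabs_pos_eq in I by (auto; lra).
    pose proof (Cmod_le_minus (lid tau b t) z). lra. }
  assert (CL : ccont (fun t => u (lid tau b t) * lid' tau t)%C).
  { apply ccont_mult; [|apply lid'_ccont]. apply (flat_cusp_ccont tau b u (lid tau b)); auto using lid_ccont; try lra.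
    intros; apply lid_closed_cusp; auto; lra. }
  assert (LidAn : forall z, Cmod z < tau ^ 3 / 2 -> analytic_at lidI z).
  { intros z Hz. eexists. exists (tau ^ 3 / 2). split; [lra|]. intros h Hh.
    apply (cauchy_integral_expands (fun t => u (lid tau b t) * lid' tau t)%C (lid tau b) z (tau ^ 3 / 2));
      auto using lid_ccont. lra. }
  destruct (analytic_asy lidI (LidAn 0%C ltac:(rewrite Cmod_0; lra))) as [d1 [Hd1 LidAsy]].
  (* Division by the nonzero [W] plays the role of [1/(2 i pi)]. The lid is far from 0, so its
     integral is analytic there and can be given to [Jl]. *)
  set (Jr := fun z => (/ W * arm_integral tau 1 b u z)%C).
  set (Jl := fun z => (/ W * (arm_integral tau (-1) b u z + (-(1)) * lidI z))%C).
  assert (U1 : 1 * 1 = 1) by ring. assert (U2 : -1 * -1 = 1) by ring.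
  exists Jr, Jl, (Rmin d1 (tau ^ 3 / 2)).
  split; [apply Rmin_pos; lra|]. split; [|split; [|split; [|split]]].
  - intros z Hz Hd. apply analytic_at_scal. apply arm_integral_analytic; auto.
  - intros z Hz Hd. apply analytic_at_scal. apply analytic_at_plus; [apply arm_integral_analytic; auto|].
    apply analytic_at_scal, LidAn. eapply Rlt_le_trans; [apply Hd|apply Rmin_r].
  - apply (asy_subset (parabola 1 1 1)); [tauto|]. apply asy_scal. apply arm_integral_asy; auto.
  - apply asy_scal, asy_plus.
    + apply (asy_subset (parabola (-1) 1 1)); [tauto|]. apply arm_integral_asy; auto.
    + apply asy_scal. apply (asy_subset (fun z => Cmod z < d1)); auto.
      intros z [_ Hz]. eapply Rlt_le_trans; [apply Hz|apply Rmin_l].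
  - intros z Hz1 Hz2 Hd. pose proof (Rlt_le_trans _ _ _ Hd (Rmin_r _ _)) as Hz3.
    assert (E : (Jr z - Jl z = / W * loop tau b (fun x v => u x * v / (x - z)))%C).
    { unfold Jr, Jl, loop, arm_integral, lidI. ring. }
    pose proof Hu as [Ud Uf].
    split; intros Hside.
    (* Both heights above 1 mean [|Re z| * |z|^2 < (Im z)^2], and [|Re z| <= |z|] turns this into
       the cusp inequality. *)
    + assert (Hzc : cusp tau b z).
      { destruct Hz1 as [Hn H1]. destruct Hz2 as [_ H2]. unfold height in H1, H2.
        rewrite Im_wcoord, Re_wcoord in H1, H2 by auto.
        pose proof (proj1 (Cmod_gt_0 _) Hn) as Hm. pose proof (Cmod_sq z) as Q.
        set (m := Cmod z) in *. set (q := Im z) in *. set (p := Re z) in *.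
        assert (P : Rabs p * (m * m) < q * q).
        { assert (Hmm : 0 < m * m) by nra.
          assert (X : forall s, 1 < 1 * (q / (m * m) * (q / (m * m))) + s * (- p / (m * m)) -> s * p * (m * m) < q * q).
          { intros s Hs. apply Rmult_lt_compat_r with (r := m * m * (m * m)) in Hs; [|nra].
            replace ((1 * (q / (m * m) * (q / (m * m))) + s * (- p / (m * m))) * (m * m * (m * m)))
              with (q * q - s * p * (m * m)) in Hs by (field; lra).
            assert (0 < m * m * (m * m)) by nra. lra. }
          pose proof (X 1 H1). pose proof (X (-1) H2). unfold Rabs. destruct Rcase_abs; lra. }
        assert (Bq : b * q <= m).
        { eapply Rle_trans; [apply Rle_abs|]. rewrite unit_sign by auto. apply Im_le_Cmod. }
        unfold cusp. fold q p. split; [split; lra|].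
        replace ((b * q) ^ 2) with (b * b * (q * q)) by ring. rewrite Hb, Rmult_1_l.
        apply Rle_lt_trans with (2 := P). rewrite Q. pose proof (Rabs_pos p).
        replace (Rabs p ^ 3) with (Rabs p * (Rabs p * Rabs p)) by ring. apply Rmult_le_compat_l; auto.
        rewrite <- Rabs_mult, Rabs_pos_eq by nra. nra. }
      destruct (Uf 1%nat) as [K [HK Hf1]].
      rewrite E. unfold loop.
      pose proof (cusp_cauchy tau b u K Hb ltac:(lra) Ud) as CC.
      specialize (CC (fun x Hx => eq_rect _ (fun r => Cmod (u x) <= K * r) (Hf1 x Hx) _ (pow_1 _)) z Hzc).
      rewrite (winding_const tau b c z Hb Hc Hzc) in CC. fold W in CC.
      replace (u z) with (/ W * (u z * W))%C by (field; auto). rewrite <- CC. f_equal.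
      unfold loop. f_equal; [f_equal|]; apply CI_ext; intros; unfold Cdiv; ring.
    + assert (L0 : loop tau b (fun x v => u x * v / (x - z))%C = 0%C).
      (* Now [z] is outside the cusp. The factor [x - c] makes [F] vanish at [c] and cancels the
         kernel [1/(x - c)], so Cauchy's formula for [F] at [c] is Cauchy's theorem for
         [u x / (x - z)]. *)
      { set (F := fun x => (u x * (x - c) / (x - z))%C).
        destruct (Uf 1%nat) as [K [HK Hf1]].
        assert (Nx : forall x, closed_cusp tau b x -> (x - z <> 0)%C).
        { intros x Hx. apply Cmod_neq_0. pose proof (closed_cusp_outside tau b x z Hb Hx Hside). lra. }
        assert (Fd : forall x, closed_cusp tau b x -> x <> 0%C -> exists r, 0 < r /\ forall y, Cmod (y - x) < r -> sdiff F y).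
        { intros x Hx Hn. destruct (Ud x Hx Hn) as [r [Hr H]].
          exists (Rmin r (- b * Im z)). split; [apply Rmin_pos; auto|]. intros y Hy.
          unfold F. apply sdiff_div.
          - apply sdiff_mult; [apply H; eapply Rlt_le_trans; [apply Hy|apply Rmin_l]|].
            apply (sdiff_minus (fun x => x) (fun _ => c)); auto using sdiff_id, sdiff_const.
          - apply (sdiff_minus (fun x => x) (fun _ => z)); auto using sdiff_id, sdiff_const.
          - apply Cmod_neq_0. pose proof (closed_cusp_outside tau b x z Hb Hx Hside).
            pose proof (Cmod_minus_le x y z). rewrite (Cmod_minus_sym x y) in *.
            pose proof (Rmin_r r (- b * Im z)). lra. }
        assert (Fb : forall x, closed_cusp tau b x -> Cmod (F x) <= (K * 4 / (- b * Im z)) * Cmod x).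
        { intros x Hx. unfold F. rewrite Cmod_div, Cmod_mult by auto.
          pose proof (closed_cusp_outside tau b x z Hb Hx Hside) as O.
          pose proof (Hf1 x Hx) as B. rewrite pow_1 in B.
          pose proof (Cmod_minus_triangle x c) as T.
          pose proof (closed_cusp_mod tau b x Hb Ht Hx). pose proof (closed_cusp_mod tau b c Hb Ht (cusp_closed tau b c Hc)).
          replace (K * 4 / (- b * Im z) * Cmod x) with (K * Cmod x * 4 * / (- b * Im z)) by (unfold Rdiv; ring).
          apply Rmult_le_compat.
          - apply Rmult_le_pos; apply Cmod_ge_0.
          - apply Rlt_le, Rinv_0_lt_compat. lra.
          - apply Rmult_le_compat; auto using Cmod_ge_0. lra.
          - apply Rinv_le_contravar; lra. }
        pose proof (cusp_cauchy tau b F _ Hb ltac:(lra) Fd Fb c Hc) as CC.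
        replace (F c) with (RtoC 0) in CC by (unfold F; replace (c - c)%C with (RtoC 0) by ring; unfold Cdiv; ring).
        rewrite Cmult_0_l in CC. rewrite <- CC. unfold loop.
        assert (G : forall x v, closed_cusp tau b x -> x <> c -> (u x * v / (x - z) = F x * (v / (x - c)))%C).
        { intros x v Hx Hn. unfold F. specialize (Nx x Hx). field. split; auto.
          intros E'. apply Hn. replace x with (x - c + c)%C by ring. rewrite E'. ring. }
        f_equal; [f_equal|]; apply CI_ext; intros t Htt; apply G.
        - apply arm_closed_cusp; auto; lra.
        - apply arm_neq; auto.
        - apply lid_closed_cusp; auto; lra.
        - apply lid_neq; auto.
        - apply arm_closed_cusp; auto; lra.
        - apply arm_neq; auto. }
      rewrite L0 in E. replace (Jr z) with ((Jr z - Jl z) + Jl z)%C by ring. rewrite E. ring.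
Qed.

(** * Sectorial solutions of a difference equation *)

(** Write the exponential as the [k]-th power of [exp (- / (k * r))], which is at most [k * r], with
    [k = n]. *)
Lemma exp_flat n : exists A, 0 < A /\ forall r, 0 < r -> exp (- / r) <= A * r ^ n.
Proof.
  destruct n as [|n].
  - exists 1. split; [lra|]. intros r Hr. simpl. rewrite Rmult_1_r.
    assert (0 < / r) by (apply Rinv_0_lt_compat; auto). rewrite <- exp_0. apply Rlt_le, exp_increasing. lra.
  - set (k := INR (S n)). assert (Hk : 0 < k) by (apply lt_0_INR; lia).
    exists (k ^ S n). split; [apply pow_lt; auto|]. intros r Hr.
    assert (P : 0 < / (k * r)) by (apply Rinv_0_lt_compat, Rmult_lt_0_compat; auto).
    assert (E : exp (- / r) = exp (- / (k * r)) ^ S n).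
    { assert (X : forall m x, exp x ^ m = exp (INR m * x)).
      { induction m as [|m IH]; intros x; [simpl; rewrite Rmult_0_l, exp_0; auto|].
        rewrite S_INR. simpl. rewrite IH, <- exp_plus. f_equal. ring. }
      rewrite X. fold k. f_equal. field. lra. }
    rewrite E, <- Rpow_mult_distr. apply pow_incr. split; [apply Rlt_le, exp_pos|].
    rewrite exp_Ropp. rewrite <- (Rinv_inv (k * r)) at 2. apply Rinv_le_contravar; auto.
    pose proof (exp_ineq1_le (/ (k * r))). lra.
Qed.

Definition horn (Psi : C -> C) (b : R) (z : C) : C := Cexp (RtoC b * (2 * PI * Ci * Psi z)).

Lemma horn_mod Psi b z : Cmod (horn Psi b z) = exp (- (2 * PI * (b * Im (Psi z)))).
Proof.
  unfold horn. rewrite Cmod_Cexp. f_equal. unfold Re, Im, Ci, RtoC. simpl. ring.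
Qed.

Lemma horn_sdiff Psi b z : sdiff Psi z -> sdiff (horn Psi b) z.
Proof.
  intros H. unfold horn. apply (sdiff_comp Cexp (fun z => RtoC b * (2 * PI * Ci * Psi z))%C).
  - apply (sdiff_mult (fun _ => RtoC b)); [apply sdiff_const|].
    apply (sdiff_mult (fun _ => 2 * PI * Ci)%C); auto using sdiff_const.
  - eexists. apply Cexp_sderiv.
Qed.

(** The value 0 at the vertex is the limit inside the cusp, where the horn variable tends to 0;
    [g 0 = 0] in the lemmas that use it. *)
Definition horn_term (g Psi : C -> C) (b : R) (z : C) : C :=
  if Ceq_dec z 0 then 0%C else g (horn Psi b z).

(** Here [r^3 = b * Im z]. The coefficient 4 of the height makes both arms fit in the domain of the
    Fatou coordinate: [4 * (Im z)^2 = 4 * r^6], while [|Re z| * |z|^2 <= 2 * r^6]. *)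
Lemma cusp_geometry tau b z : b * b = 1 -> 0 < tau <= 1 -> closed_cusp tau b z -> z <> 0%C ->
  exists r, 0 < r <= tau /\ r ^ 3 <= Cmod z <= 2 /\ / (2 * r) <= b * Im (wcoord z) /\ / (2 * r ^ 2) <= height 1 4 z.
Proof.
  intros Hb Ht Hz Hn. pose proof (closed_cusp_mod tau b z Hb Ht Hz) as M2.
  destruct (closed_cusp_root tau b z Hz) as [r [Hr [E P]]]. destruct Hz as [[H1 H2] _].
  assert (Hr0 : 0 < r).
  { destruct Hr as [Hr|<-]; auto. exfalso. apply Hn. apply injective_projections.
    - apply Rabs_eq_0. change (fst z) with (Re z). pose proof (Rabs_pos (Re z)). change (Rabs (Re z) = 0). lra.
    - apply Rabs_eq_0. change (Rabs (Im z) = 0). rewrite <- (unit_sign b (Im z) Hb), E. rewrite !Rmult_0_l. apply Rabs_R0. }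
  exists r.
  assert (Hrt : r <= tau).
  { apply pow3_le_inv; [lra|lra|]. replace (r ^ 3) with (r * r * r) by ring. lra. }
  split; [lra|].
  pose proof (proj1 (Cmod_gt_0 _) Hn) as Hm. pose proof (Cmod_sq z) as Q.
  rewrite Im_wcoord by auto. unfold height. rewrite Im_wcoord, Re_wcoord by auto.
  set (m := Cmod z) in *. set (q := Im z) in *. set (p := Re z) in *.
  assert (Iq : q * q = r ^ 6). { replace (q * q) with (b * b * (q * q)) by (rewrite Hb; ring). replace (b * b * (q * q)) with (b * q * (b * q)) by ring. rewrite E. ring. }
  assert (Ip : p * p <= r ^ 4).
  { rewrite <- (Rabs_pos_eq (p * p)) by nra. rewrite Rabs_mult. replace (r ^ 4) with (r * r * (r * r)) by ring.
    apply Rmult_le_compat; auto using Rabs_pos. }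
  assert (R6 : r ^ 6 <= r ^ 4).
  { replace (r ^ 6) with (r ^ 4 * (r * r)) by ring. assert (0 < r ^ 4) by (apply pow_lt; auto).
    assert (r * r <= 1) by nra. set (v := r ^ 4) in *. clearbody v. nra. }
  assert (R4 : 0 < r ^ 4) by (apply pow_lt; auto).
  assert (M : m * m <= 2 * r ^ 4) by lra.
  assert (Mp : 0 < m * m) by nra.
  split; [split; auto|split].
  - replace (r ^ 3) with (b * q) by (rewrite E; ring). eapply Rle_trans; [apply Rle_abs|].
    rewrite unit_sign by auto. apply Im_le_Cmod.
  - replace (b * (q / (m * m))) with (b * q / (m * m)) by (field; lra). rewrite E.
    apply Rle_div_r; [auto|]. apply Rle_trans with (/ (2 * r) * (2 * r ^ 4)).
    + apply Rmult_le_compat_l; auto. apply Rlt_le, Rinv_0_lt_compat. lra.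
    + right. field. lra.
  - replace (4 * (q / (m * m) * (q / (m * m))) + 1 * (- p / (m * m)))
      with ((4 * (q * q) - p * (m * m)) / (m * m * (m * m))) by (field; lra).
    rewrite Iq. apply Rle_div_r; [nra|].
    apply Rle_trans with (/ (2 * r ^ 2) * (2 * r ^ 4 * (2 * r ^ 4))).
    + apply Rmult_le_compat_l.
      * apply Rlt_le, Rinv_0_lt_compat. assert (0 < r ^ 2) by (apply pow_lt; auto). lra.
      * apply Rmult_le_compat; lra.
    + replace (/ (2 * r ^ 2) * (2 * r ^ 4 * (2 * r ^ 4))) with (2 * r ^ 6) by (field; lra).
      assert (p * (m * m) <= r ^ 2 * (2 * r ^ 4)).
      { apply Rle_trans with (Rabs p * (m * m)).
        - apply Rmult_le_compat_r; [lra|apply Rle_abs].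
        - apply Rmult_le_compat; auto using Rabs_pos; try lra; replace (r ^ 2) with (r * r) by ring; auto. }
      replace (r ^ 2 * (2 * r ^ 4)) with (2 * r ^ 6) in * by ring. lra.
Qed.

(** As [|Rf| <= B], one has [b * Im Psi >= 1/(2 r) - B] on the cusp, hence
    [|horn| <= exp (2 pi B) * exp (-1/r)]. Being Lipschitz at 0 and vanishing there, [g] preserves
    flatness. *)
Lemma horn_term_flat (Rf g : C -> C) (M0 B b : R) : b * b = 1 -> 0 < M0 -> 0 <= B ->
  (forall z, parabola 1 4 M0 z -> analytic_at Rf z /\ Cmod (Rf z) <= B) ->
  analytic_at g 0 -> g 0%C = 0%C ->
  exists tau, 0 < tau <= 1 /\ flat_on_cusp tau b (horn_term g (fun z => wcoord z + Rf z)%C b).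
Proof.
  intros Hb HM0 HB HR Hg Hg0. set (Psi := fun z => (wcoord z + Rf z)%C). pose proof PI_RGT_0 as HPI.
  destruct (analytic_at_sdiff_near g 0 Hg) as [e1 [He1 Gd]].
  destruct (sderiv_lip g 0 _ (Der_spec g 0 (analytic_at_sdiff g 0 Hg))) as [e2 [He2 Gl]].
  set (L := Cmod (Der g 0) + 1) in *. assert (HL : 0 < L) by (unfold L; pose proof (Cmod_ge_0 (Der g 0)); lra).
  set (e := Rmin e1 e2). assert (He : 0 < e) by (apply Rmin_pos; auto).
  destruct (exp_flat 1) as [A1 [HA1 E1]].
  set (Q := exp (2 * PI * B)). assert (HQ : 0 < Q) by apply exp_pos.
  (* The bound [1/(2 M0 + 1)] puts the cusp into the domain of [Rf]; the last one keeps the horn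
     variable below [e], where [g] is differentiable and Lipschitz. *)
  set (tau := Rmin (Rmin 1 (/ (2 * M0 + 1))) (e / (2 * Q * A1))).
  assert (Htau : 0 < tau).
  { repeat apply Rmin_pos; try lra; [apply Rinv_0_lt_compat; lra|].
    apply Rdiv_lt_0_compat; auto. apply Rmult_lt_0_compat; lra. }
  assert (T1 : tau <= 1) by (eapply Rle_trans; [apply Rmin_l|apply Rmin_l]).
  assert (T2 : tau <= / (2 * M0 + 1)) by (eapply Rle_trans; [apply Rmin_l|apply Rmin_r]).
  assert (T3 : Q * (A1 * tau) < e).
  { assert (T : tau <= e / (2 * Q * A1)) by apply Rmin_r.
    apply Rle_lt_trans with (Q * (A1 * (e / (2 * Q * A1)))).
    - apply Rmult_le_compat_l; [lra|]. apply Rmult_le_compat_l; lra.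
    - replace (Q * (A1 * (e / (2 * Q * A1)))) with (e / 2) by (field; lra). lra. }
  exists tau. split; [lra|].
  assert (Geo : forall z, closed_cusp tau b z -> z <> 0%C -> parabola 1 4 M0 z /\
    exists r, 0 < r <= tau /\ r ^ 3 <= Cmod z /\ Cmod (horn Psi b z) <= Q * exp (- / r)).
  { intros z Hz Hn. destruct (cusp_geometry tau b z Hb ltac:(lra) Hz Hn) as [r [Hr [[G1 _] [G2 G3]]]].
    assert (Hz4 : parabola 1 4 M0 z).
    { split; auto. apply Rlt_le_trans with (2 := G3).
      assert (r * (2 * M0 + 1) <= 1).
      { apply Rle_trans with (/ (2 * M0 + 1) * (2 * M0 + 1)); [apply Rmult_le_compat_r; lra|]. right. field. lra. }
      apply Rmult_lt_reg_r with (2 * r ^ 2); [assert (0 < r ^ 2) by (apply pow_lt; lra); lra|].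
      rewrite Rinv_l by (assert (0 < r ^ 2) by (apply pow_lt; lra); lra). simpl. nra. }
    split; auto. exists r. split; auto. split; auto.
    destruct (HR z Hz4) as [_ HRB].
    rewrite horn_mod. unfold Q. rewrite <- exp_plus.
    assert (Hexp : - (2 * PI * (b * Im (Psi z))) <= 2 * PI * B + - / r).
    { unfold Psi. replace (Im (wcoord z + Rf z)) with (Im (wcoord z) + Im (Rf z)) by reflexivity.
      pose proof (Im_le_Cmod (Rf z)) as I. pose proof (Rle_abs (- (b * Im (Rf z)))) as J.
      rewrite Rabs_Ropp, unit_sign in J by auto.
      assert (K : / (2 * r) - B <= b * (Im (wcoord z) + Im (Rf z))) by lra.
      assert (2 * PI * (/ (2 * r) - B) <= 2 * PI * (b * (Im (wcoord z) + Im (Rf z)))) by (apply Rmult_le_compat_l; lra).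
      replace (2 * PI * (/ (2 * r) - B)) with (PI * / r - 2 * PI * B) in * by (field; lra).
      assert (/ r <= PI * / r).
      { rewrite <- (Rmult_1_l (/ r)) at 1. apply Rmult_le_compat_r; [apply Rlt_le, Rinv_0_lt_compat; lra|].
        pose proof PI2_1. lra. }
      lra. }
    destruct Hexp as [Hexp|Hexp]; [apply Rlt_le, exp_increasing; auto|rewrite Hexp; lra]. }
  assert (Small : forall z, closed_cusp tau b z -> z <> 0%C -> Cmod (horn Psi b z) < e).
  { intros z Hz Hn. destruct (Geo z Hz Hn) as [_ [r [Hr [_ H]]]]. specialize (E1 r ltac:(lra)). rewrite pow_1 in E1.
    apply Rle_lt_trans with (1 := H). apply Rle_lt_trans with (2 := T3).
    apply Rmult_le_compat_l; [lra|]. apply Rle_trans with (1 := E1). apply Rmult_le_compat_l; lra. }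
  assert (Glip : forall t, Cmod t < e -> Cmod (g t) <= L * Cmod t).
  { intros t Htt. specialize (Gl t 0%C). rewrite Hg0, !Cminus_0_r, Cmod_0 in Gl. apply Gl; auto.
    eapply Rlt_le_trans; [apply Htt|apply Rmin_r]. }
  split.
  - intros x Hx Hn. destruct (Geo x Hx Hn) as [Hx4 _].
    assert (Hop : open (parabola 1 4 M0)) by (apply parabola_open; lra).
    rewrite open_C in Hop. destruct (Hop x Hx4) as [d1 [Hd1 O1]].
    assert (Pd : forall y, parabola 1 4 M0 y -> sdiff (horn Psi b) y).
    { intros y Hy. apply horn_sdiff. unfold Psi. apply sdiff_plus.
      - apply wcoord_sdiff. apply Hy.
      - apply analytic_at_sdiff, HR; auto. }
    destruct (sdiff_cont _ _ (Pd x Hx4) (e - Cmod (horn Psi b x))) as [d2 [Hd2 O2]].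
    { specialize (Small x Hx Hn). lra. }
    exists (Rmin d1 d2). split; [apply Rmin_pos; auto|]. intros y Hy.
    assert (Hy4 : parabola 1 4 M0 y) by (apply O1; eapply Rlt_le_trans; [apply Hy|apply Rmin_l]).
    assert (Hye : Cmod (horn Psi b y) < e).
    { specialize (O2 y (Rlt_le_trans _ _ _ Hy (Rmin_r _ _))).
      pose proof (Cmod_le_minus (horn Psi b y) (horn Psi b x)). lra. }
    apply (sdiff_ext_loc (fun z => g (horn Psi b z)) _ y (Cmod y)).
    + apply Cmod_gt_0. apply Hy4.
    + intros z Hz. unfold horn_term. destruct (Ceq_dec z 0) as [E|E]; auto.
      rewrite E in Hz. replace (0 - y)%C with (- y)%C in Hz by ring. rewrite Cmod_opp in Hz. lra.
    + apply (sdiff_comp g (horn Psi b)); auto. apply Gd. rewrite Cminus_0_r.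
      eapply Rlt_le_trans; [apply Hye|apply Rmin_l].
  (* The exponent [3 * m] converts powers of [r] into powers of [|x|], since [r^3 <= |x|]. *)
  - intros m. destruct (exp_flat (3 * m)) as [A [HA EA]]. exists (L * (Q * A)). split.
    { apply Rmult_le_pos; [lra|]. apply Rmult_le_pos; lra. }
    intros x Hx. unfold horn_term. destruct (Ceq_dec x 0) as [E|E].
    { rewrite Cmod_0. apply Rmult_le_pos; [|apply pow_le, Cmod_ge_0]. apply Rmult_le_pos; [lra|]. apply Rmult_le_pos; lra. }
    eapply Rle_trans; [apply Glip; auto|].
    destruct (Geo x Hx E) as [_ [r [Hr [Hr3 H]]]]. specialize (EA r ltac:(lra)).
    rewrite !Rmult_assoc. apply Rmult_le_compat_l; [lra|]. apply Rle_trans with (1 := H).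
    apply Rmult_le_compat_l; [lra|]. apply Rle_trans with (1 := EA). apply Rmult_le_compat_l; [lra|].
    rewrite pow_mult. apply pow_incr. split; auto. apply pow_le; lra.
Qed.

Lemma parabola_mono a k k' M M' z : k <= k' -> M' <= M -> parabola a k M z -> parabola a k' M' z.
Proof.
  intros Hk HM [Hn H]. split; auto. apply Rle_lt_trans with (1 := HM). apply Rlt_le_trans with (1 := H).
  unfold height. apply Rplus_le_compat_r. apply Rmult_le_compat_r; auto. apply Rle_0_sqr.
Qed.

Lemma asy_bounded V h : asy V h -> (forall z, V z -> Cmod z <= 1) -> exists B, 0 <= B /\ forall z, V z -> Cmod (h z) <= B.
Proof.
  intros H HV. destruct (H 0%nat) as [b [K HK]]. exists (Cmod (b 0%nat) + Rabs K).
  split; [pose proof (Cmod_ge_0 (b 0%nat)); pose proof (Rabs_pos K); lra|].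
  intros z Hz. specialize (HK z Hz). specialize (HV z Hz). rewrite psum_O, pow_1 in HK.
  pose proof (Cmod_le_minus (h z) (b 0%nat)). pose proof (Rle_abs K). pose proof (Cmod_ge_0 z). pose proof (Rabs_pos K). nra.
Qed.

(** Two independent Cousin problems, one on the upper cusp for [g1] and one on the lower for [g2]:
    each solution has no jump on the opposite side, so they superpose. *)
Lemma sectorial_solutions f r K g1 g2 : parabolic_on f r K -> analytic_at g1 0 -> analytic_at g2 0 ->
  g1 0%C = 0%C -> g2 0%C = 0%C ->
  exists M Rf Rp Rm, 1 <= M /\ let Psi := fun z => (wcoord z + Rf z)%C in
    asy (parabola 1 1 M) Rf /\ asy (parabola 1 1 M) Rp /\ asy (parabola (-1) 1 M) Rm /\
    (forall z, parabola 1 1 M z -> analytic_at Rf z /\ analytic_at Rp z /\ (Psi (f z) - Psi z = 1)%C) /\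
    (forall z, parabola (-1) 1 M z -> analytic_at Rm z) /\
    (forall z, parabola 1 1 M z -> parabola (-1) 1 M z ->
      (0 < Im z -> (Rp z - Rm z)%C = g1 (horn Psi 1 z)) /\
      (Im z < 0 -> (Rm z - Rp z)%C = g2 (horn Psi (-1) z))).
Proof.
  intros Hf Hg1 Hg2 Hz1 Hz2.
  destruct (fatou_coordinate f r K Hf 4 ltac:(lra)) as [M0 [Rf [HM0 [HRf ARf]]]].
  destruct (po_r f r K Hf) as [R0 R1].
  destruct (asy_bounded _ _ ARf) as [B [HB HRB]].
  { intros z Hz. destruct (HRf z Hz) as [_ [_ A]]. lra. }
  assert (HR : forall z, parabola 1 4 M0 z -> analytic_at Rf z /\ Cmod (Rf z) <= B).
  { intros z Hz. split; auto. apply HRf; auto. }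
  set (Psi := fun z => (wcoord z + Rf z)%C).
  assert (U1 : 1 * 1 = 1) by ring. assert (U2 : -1 * -1 = 1) by ring.
  destruct (horn_term_flat Rf g1 M0 B 1 U1 HM0 HB HR Hg1 Hz1) as [t1 [T1 F1]].
  destruct (horn_term_flat Rf g2 M0 B (-1) U2 HM0 HB HR Hg2 Hz2) as [t2 [T2 F2]].
  fold Psi in F1, F2.
  destruct (cousin t1 1 _ U1 T1 F1) as [Jr1 [Jl1 [d1 [D1 [A1 [B1 [C1 [E1 J1]]]]]]]].
  destruct (cousin t2 (-1) _ U2 T2 F2) as [Jr2 [Jl2 [d2 [D2 [A2 [B2 [C2 [E2 J2]]]]]]]].
  destruct (parabola_small 1 1 (Rmin d1 d2) U1 ltac:(lra)) as [N1 [HN1 S1]]; [apply Rmin_pos; auto|].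
  destruct (parabola_small (-1) 1 (Rmin d1 d2) U2 ltac:(lra)) as [N2 [HN2 S2]]; [apply Rmin_pos; auto|].
  set (M := M0 + N1 + N2 + 1).
  assert (Sm : forall z, parabola 1 1 M z \/ parabola (-1) 1 M z -> Cmod z < d1 /\ Cmod z < d2).
  { intros z Hz. assert (Cmod z < Rmin d1 d2).
    { destruct Hz as [Hz|Hz]; [apply (S1 M); auto|apply (S2 M); auto]; unfold M; lra. }
    pose proof (Rmin_l d1 d2). pose proof (Rmin_r d1 d2). lra. }
  assert (P4 : forall z, parabola 1 1 M z -> parabola 1 4 M0 z).
  { intros z. apply parabola_mono; unfold M; lra. }
  assert (P1 : forall a z, parabola a 1 M z -> parabola a 1 1 z).
  { intros a z. apply parabola_mono; unfold M; lra. }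
  (* The second pair is subtracted because below the axis the prescribed jump is that of
     [Rm - Rp]. *)
  exists M, Rf, (fun z => Jr1 z + (-(1)) * Jr2 z)%C, (fun z => Jl1 z + (-(1)) * Jl2 z)%C.
  split; [unfold M; lra|]. cbv zeta. fold Psi. split; [|split; [|split; [|split; [|split]]]].
  - apply (asy_subset (parabola 1 4 M0)); auto.
  - apply asy_plus; [|apply asy_scal].
    + apply (asy_subset (fun z => parabola 1 1 1 z /\ Cmod z < d1)); auto. intros z Hz. split; [apply P1|apply Sm]; auto.
    + apply (asy_subset (fun z => parabola 1 1 1 z /\ Cmod z < d2)); auto. intros z Hz. split; [apply P1|apply Sm]; auto.
  - apply asy_plus; [|apply asy_scal].
    + apply (asy_subset (fun z => parabola (-1) 1 1 z /\ Cmod z < d1)); auto. intros z Hz. split; [apply P1|apply Sm]; auto.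
    + apply (asy_subset (fun z => parabola (-1) 1 1 z /\ Cmod z < d2)); auto. intros z Hz. split; [apply P1|apply Sm]; auto.
  - intros z Hz. destruct (HRf z (P4 z Hz)) as [X1 [X2 X3]]. split; auto. split.
    + apply analytic_at_plus; [apply A1|apply analytic_at_scal, A2]; auto; apply Sm; auto.
    + unfold Psi. unfold eta in X2. destruct (Ceq_dec z 0) as [E|E]; [destruct Hz; tauto|].
      replace (wcoord (f z) + Rf (f z) - (wcoord z + Rf z))%C with ((Rf (f z) - Rf z) + (wcoord (f z) - wcoord z))%C by ring.
      rewrite X2. ring.
  - intros z Hz. apply analytic_at_plus; [apply B1|apply analytic_at_scal, B2]; auto; apply Sm; auto.
  - intros z Hp Hm. destruct (Sm z (or_introl Hp)) as [V1 V2].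
    destruct (J1 z (P1 _ _ Hp) (P1 _ _ Hm) V1) as [Y1 Y2]. destruct (J2 z (P1 _ _ Hp) (P1 _ _ Hm) V2) as [Y3 Y4].
    unfold horn_term in Y1, Y3. destruct (Ceq_dec z 0) as [E|E]; [destruct Hp; tauto|].
    split; intros Hs.
    + rewrite <- Y1 by lra. rewrite Y4 by lra. ring.
    + rewrite <- Y3 by lra. rewrite Y2 by lra. ring.
Qed.

(** * Realization of 1-moments *)

Lemma analytic_at_quot h : analytic_at h 0 -> h 0 = 0%C ->
  exists c, sderiv h 0 c /\ analytic_at (quot_id h c) 0.
Proof.
  intros [a Ha] H0. exists (a 1%nat). split; [apply expands_at_sderiv; auto|].
  eexists. apply quot_id_expands; eauto. rewrite <- (expands_at_val h 0 a Ha). auto.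
Qed.

Lemma sderiv_unique f z l m : sderiv f z l -> sderiv f z m -> l = m.
Proof.
  intros H1 H2. assert (E : Cmod (m - l) = 0).
  { apply Rle_antisym; [|apply Cmod_ge_0]. apply le_epsilon. intros e He. rewrite Rplus_0_l.
    destruct (H1 e He) as [d [Hd H]]. apply (sderiv_approx f z l m d); auto. }
  apply Cmod_minus_0 in E. auto.
Qed.

Lemma analytic_at_Clog z : 0 < Re z -> analytic_at Clog z.
Proof.
  intros Hz. apply (analytic_at_of_sdiff _ z (Re z)); auto. intros x Hx. eexists. apply Clog_sderiv.
  pose proof (Re_lip x z) as T. assert (T' := Rle_lt_trans _ _ _ T Hx). apply Rabs_lt_between in T'. lra.
Qed.

(** * Jets of order three and conjugation of parabolic germs *)

Definition approx3 (h : C -> C) (b c : C) : Prop := exists r K, 0 < r /\ 0 <= K /\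
  forall z, Cmod z < r -> Cmod (h z - (z + b * z ^ 2 + c * z ^ 3)) <= K * Cmod z ^ 4.

Lemma approx3_expands h a : expands_at h 0 a -> a 0%nat = 0%C -> a 1%nat = 1%C -> approx3 h (a 2%nat) (a 3%nat).
Proof.
  intros Ha A0 A1. destruct (expands_at_tail h a Ha) as [r [Hr H]]. destruct (H 3%nat) as [K [HK HK']].
  exists r, K. split; auto. split; [lra|]. intros z Hz. specialize (HK' z Hz).
  rewrite !psum_S, psum_O, A0, A1 in HK'.
  replace (z + a 2%nat * z ^ 2 + a 3%nat * z ^ 3)%C with (0 + 1 * z ^ 1 + a 2%nat * z ^ 2 + a 3%nat * z ^ 3)%C by (simpl; ring).
  auto.
Qed.

Lemma approx3_unique h b c b' c' : approx3 h b c -> approx3 h b' c' -> b = b' /\ c = c'.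
Proof.
  intros [r [K [Hr [HK H]]]] [r' [K' [Hr' [HK' H']]]].
  set (a := fun n => match n return C with 2%nat => (b - b')%C | 3%nat => (c - c')%C | _ => 0%C end).
  assert (Z : forall k, (k <= 3)%nat -> a k = 0%C).
  { apply (psum_zero_coef (fun z => Cmod z < Rmin r r') a 3 (K + K')).
    - apply ball_approaches_0. apply Rmin_pos; auto.
    - intros z Hz. specialize (H z (Rlt_le_trans _ _ _ Hz (Rmin_l _ _))). specialize (H' z (Rlt_le_trans _ _ _ Hz (Rmin_r _ _))).
      rewrite !psum_S, psum_O. unfold a.
      replace (0 + 0 * z ^ 1 + (b - b') * z ^ 2 + (c - c') * z ^ 3)%C with
        ((h z - (z + b' * z ^ 2 + c' * z ^ 3)) - (h z - (z + b * z ^ 2 + c * z ^ 3)))%C by ring.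
      eapply Rle_trans; [apply Cmod_minus_triangle|]. lra. }
  assert (Z2 := Z 2%nat ltac:(lia)). assert (Z3 := Z 3%nat ltac:(lia)). simpl in Z2, Z3. split.
  - replace b with ((b - b') + b')%C by ring. rewrite Z2. ring.
  - replace c with ((c - c') + c')%C by ring. rewrite Z3. ring.
Qed.

Lemma Cmod_mult_le (x y : C) A B : Cmod x <= A -> Cmod y <= B -> Cmod (x * y) <= A * B.
Proof. intros H1 H2. rewrite Cmod_mult. apply Rmult_le_compat; auto using Cmod_ge_0. Qed.

Lemma Cmod_plus_le (x y : C) A B : Cmod x <= A -> Cmod y <= B -> Cmod (x + y) <= A + B.
Proof. intros H1 H2. eapply Rle_trans; [apply Cmod_triangle|]. lra. Qed.

Lemma approx3_comp h1 h2 b1 c1 b2 c2 : approx3 h1 b1 c1 -> approx3 h2 b2 c2 ->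
  approx3 (fun z => h1 (h2 z)) (b1 + b2)%C (c2 + 2 * b1 * b2 + c1)%C.
Proof.
  intros [r1 [K1 [Hr1 [HK1 H1]]]] [r2 [K2 [Hr2 [HK2 H2]]]].
  set (B1 := Cmod b1). set (C1 := Cmod c1). set (B2 := Cmod b2). set (C2 := Cmod c2).
  assert (PB1 : 0 <= B1) by apply Cmod_ge_0. assert (PC1 : 0 <= C1) by apply Cmod_ge_0.
  assert (PB2 : 0 <= B2) by apply Cmod_ge_0. assert (PC2 : 0 <= C2) by apply Cmod_ge_0.
  set (S := B2 + C2 + K2). assert (HS : 0 <= S) by (unfold S; lra).
  set (T := C2 + K2). assert (HT : 0 <= T) by (unfold T; lra).
  set (r := Rmin (Rmin r2 1) (r1 / (2 + S))).
  exists r, (K1 * (1 + S) ^ 4 + K2 + B1 * (2 * T + S * S) + C1 * (3 * S + 3 * (S * S) + S * S * S)).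
  split; [repeat apply Rmin_pos; try lra; apply Rdiv_lt_0_compat; lra|].
  assert (P4 : 0 <= (1 + S) ^ 4) by (apply pow_le; lra).
  split.
  { assert (0 <= S * S) by nra. assert (0 <= S * S * S) by nra.
    assert (0 <= K1 * (1 + S) ^ 4) by nra. assert (0 <= B1 * (2 * T + S * S)) by nra.
    assert (0 <= C1 * (3 * S + 3 * (S * S) + S * S * S)) by nra. lra. }
  intros z Hz. pose proof (Rlt_le_trans _ _ _ Hz (Rmin_l _ _)) as Z0.
  pose proof (Rlt_le_trans _ _ _ Hz (Rmin_r _ _)) as Z3.
  pose proof (Rlt_le_trans _ _ _ Z0 (Rmin_l _ _)) as Z1. pose proof (Rlt_le_trans _ _ _ Z0 (Rmin_r _ _)) as Z2.
  specialize (H2 z Z1). set (u := h2 z) in *. set (R := (u - (z + b2 * z ^ 2 + c2 * z ^ 3))%C) in *.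
  set (m := Cmod z) in *. assert (m0 : 0 <= m) by apply Cmod_ge_0.
  set (s := (u - z)%C).
  assert (Cp : forall n, Cmod (z ^ n) = m ^ n) by (intros; apply Cmod_pow).
  assert (M2 : m ^ 2 = m * m) by ring. assert (M3 : m ^ 3 = m * m * m) by ring. assert (M4 : m ^ 4 = m * m * m * m) by ring.
  assert (Q2 : m * m <= m) by nra. assert (Q3 : m * m * m <= m * m) by nra. assert (Q4 : m * m * m * m <= m * m * m) by nra.
  assert (Sb2 : Cmod (s - b2 * z ^ 2) <= T * (m * m * m)).
  { replace (s - b2 * z ^ 2)%C with (c2 * z ^ 3 + R)%C by (unfold s, R; ring).
    apply Rle_trans with (C2 * (m * m * m) + K2 * (m * m * m)); [|unfold T; lra].
    apply Cmod_plus_le.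
    - apply Cmod_mult_le; [unfold C2; lra|rewrite Cp; lra].
    - apply Rle_trans with (1 := H2). rewrite M4. apply Rmult_le_compat_l; auto. }
  assert (Sb : Cmod s <= S * (m * m)).
  { replace s with (b2 * z ^ 2 + (s - b2 * z ^ 2))%C by ring.
    apply Rle_trans with (B2 * (m * m) + T * (m * m * m)).
    - apply Cmod_plus_le; auto. apply Cmod_mult_le; [unfold B2; lra|rewrite Cp; lra].
    - unfold S. unfold T. assert ((C2 + K2) * (m * m * m) <= (C2 + K2) * (m * m)) by (apply Rmult_le_compat_l; lra). lra. }
  assert (Ub : Cmod u <= (1 + S) * m).
  { replace u with (z + s)%C by (unfold s; ring). apply Rle_trans with (m + S * (m * m)).
    - apply Cmod_plus_le; [unfold m; lra|auto].
    - assert (S * (m * m) <= S * m) by (apply Rmult_le_compat_l; auto). lra. }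
  assert (Ur : Cmod u < r1).
  { apply Rlt_div_r in Z3; [|lra]. nra. }
  specialize (H1 u Ur).
  assert (H1' : Cmod (h1 u - (u + b1 * u ^ 2 + c1 * u ^ 3)) <= K1 * ((1 + S) ^ 4 * m ^ 4)).
  { apply Rle_trans with (1 := H1). apply Rmult_le_compat_l; auto. rewrite <- Rpow_mult_distr.
    apply pow_incr. split; auto using Cmod_ge_0. }
  replace (h1 u - (z + (b1 + b2) * z ^ 2 + (c2 + 2 * b1 * b2 + c1) * z ^ 3))%C with
    ((h1 u - (u + b1 * u ^ 2 + c1 * u ^ 3)) + R + b1 * (2 * (z * (s - b2 * z ^ 2)) + s * s)
      + c1 * (3 * (z * z * s) + 3 * (z * (s * s)) + s * s * s))%C by (unfold R, s; ring).
  assert (C2' : Cmod 2 = 2) by (rewrite Cmod_R, Rabs_pos_eq; lra).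
  assert (C3' : Cmod 3 = 3) by (rewrite Cmod_R, Rabs_pos_eq; lra).
  assert (Cz : Cmod z <= m) by (unfold m; lra).
  assert (Sm : S * (m * m) * (S * (m * m)) <= S * S * (m * m * m * m)) by (right; ring).
  assert (X1 : Cmod (z * (s - b2 * z ^ 2)) <= T * (m * m * m * m)).
  { eapply Rle_trans; [apply Cmod_mult_le; [apply Cz|apply Sb2]|]. right; ring. }
  assert (X2 : Cmod (s * s) <= S * S * (m * m * m * m)).
  { eapply Rle_trans; [apply Cmod_mult_le; [apply Sb|apply Sb]|]. auto. }
  assert (X3 : Cmod (z * z * s) <= S * (m * m * m * m)).
  { eapply Rle_trans; [apply Cmod_mult_le; [apply Cmod_mult_le; [apply Cz|apply Cz]|apply Sb]|]. right; ring. }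
  assert (PM : 0 <= m * m * m * m) by (repeat apply Rmult_le_pos; auto).
  assert (X4 : Cmod (z * (s * s)) <= S * S * (m * m * m * m)).
  { eapply Rle_trans; [apply Cmod_mult_le; [apply Cz|apply X2]|].
    assert (0 <= S * S * (m * m * m * m)) by (apply Rmult_le_pos; auto; nra). nra. }
  assert (X5 : Cmod (s * s * s) <= S * S * S * (m * m * m * m)).
  { eapply Rle_trans; [apply Cmod_mult_le; [apply X2|apply Sb]|].
    replace (S * S * (m * m * m * m) * (S * (m * m))) with (S * S * S * (m * m * m * m) * (m * m)) by ring.
    assert (0 <= S * S * S * (m * m * m * m)) by (apply Rmult_le_pos; auto; apply Rmult_le_pos; nra). nra. }
  set (P := m * m * m * m) in *. rewrite M4 in *.
  assert (Y1 : Cmod (b1 * (2 * (z * (s - b2 * z ^ 2)) + s * s)) <= B1 * (2 * (T * P) + S * S * P)).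
  { apply Cmod_mult_le; [unfold B1; lra|]. apply Cmod_plus_le; auto. apply Cmod_mult_le; auto. lra. }
  assert (Y2 : Cmod (c1 * (3 * (z * z * s) + 3 * (z * (s * s)) + s * s * s)) <= C1 * (3 * (S * P) + 3 * (S * S * P) + S * S * S * P)).
  { apply Cmod_mult_le; [unfold C1; lra|]. apply Cmod_plus_le; auto. apply Cmod_plus_le; apply Cmod_mult_le; auto; lra. }
  eapply Rle_trans; [apply Cmod_plus_le; [apply Cmod_plus_le; [apply Cmod_plus_le; [apply H1'|apply H2]|apply Y1]|apply Y2]|].
  right. fold P. ring.
Qed.

Lemma approx3_ext h k b c d : 0 < d -> (forall z, Cmod z < d -> h z = k z) -> approx3 h b c -> approx3 k b c.
Proof.
  intros Hd E [r [K [Hr [HK H]]]]. exists (Rmin r d), K. split; [apply Rmin_pos; auto|]. split; auto.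
  intros z Hz. rewrite <- E; [apply H|]; eapply Rlt_le_trans; try apply Hz; [apply Rmin_l|apply Rmin_r].
Qed.

(** Compare the 3-jets of [phi o f1] and [f o phi]. The quadratic terms give [f1] the coefficient 1
    of [z^2]; the cross terms [2 * p 2] then agree on both sides and the cubic terms give the
    coefficient 1 of [z^3]. *)
Lemma parabolic_germ_conj f f1 phi d : 0 < d -> parabolic_germ f -> tangent_to_id phi -> analytic_at f1 0 ->
  f1 0 = 0%C -> sderiv f1 0 1 -> (forall z, Cmod z < d -> phi (f1 z) = f (phi z)) -> parabolic_germ f1.
Proof.
  intros Hd [a [Ha [A0 [A1 [A2 A3]]]]] [p [Hp [P0 P1]]] [e He] F0 F1 Hc.
  assert (E0 : e 0%nat = 0%C) by (rewrite <- (expands_at_val f1 0 e He); auto).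
  assert (E1 : e 1%nat = 1%C) by (apply (sderiv_unique f1 0); auto; apply expands_at_sderiv; auto).
  pose proof (approx3_expands f a Ha A0 A1) as Xf. pose proof (approx3_expands phi p Hp P0 P1) as Xp.
  pose proof (approx3_expands f1 e He E0 E1) as Xe.
  pose proof (approx3_comp phi f1 _ _ _ _ Xp Xe) as L. pose proof (approx3_comp f phi _ _ _ _ Xf Xp) as R.
  apply (approx3_ext _ _ _ _ d Hd Hc) in L.
  destruct (approx3_unique _ _ _ _ _ L R) as [U1 U2].
  assert (E2 : e 2%nat = 1%C).
  { replace (e 2%nat) with ((p 2%nat + e 2%nat) - p 2%nat)%C by ring. rewrite U1, A2. ring. }
  exists e. repeat split; auto.
  replace (e 3%nat) with ((e 3%nat + 2 * p 2%nat * e 2%nat + p 3%nat) - 2 * p 2%nat * e 2%nat - p 3%nat)%C by ring.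
  rewrite U2, A3, A2, E2. ring.
Qed.

(** Moving [w] by at most [B] can change [(Im w)^2] by an unbounded amount; halving its coefficient
    absorbs the cross term [2 * B * |Im w|]. This is the origin of the coefficient [1 / 2] of the
    final petals. *)
Lemma height_bounded_change a z v B : a * a = 1 -> 0 <= B ->
  Cmod (wcoord v - wcoord z) <= B ->
  height a (1 / 2) z - 2 * (B * B) - B <= height a 1 v.
Proof.
  intros Ha HB He. unfold height. set (w := wcoord z) in *. set (w' := wcoord v) in *.
  pose proof (Im_lip w' w) as I. pose proof (Re_lip w' w) as R.
  assert (I' := Rle_trans _ _ _ I He). assert (R' := Rle_trans _ _ _ R He).
  rewrite <- (unit_sign a _ Ha) in R'. apply Rabs_le_between in I', R'.
  set (y := Im w) in *. set (y' := Im w') in *.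
  assert (y' * y' >= 1 / 2 * (y * y) - 2 * (B * B)).
  { assert (Q : 0 <= (B - (y' - y)) * (B + (y' - y))) by (apply Rmult_le_pos; lra).
    assert (S : 0 <= (2 * y' - y) * (2 * y' - y)) by apply Rle_0_sqr.
    replace ((B - (y' - y)) * (B + (y' - y))) with (B * B - y' * y' + 2 * (y * y') - y * y) in Q by ring.
    replace ((2 * y' - y) * (2 * y' - y)) with (4 * (y' * y') - 4 * (y * y') + y * y) in S by ring.
    assert (0 <= B * B) by nra. lra. }
  lra.
Qed.

(** Both signs of [a] are considered for the same forward map: the height of the wrong sign
    decreases, but by at most 2. The bound on [Im] keeps a point far from the real axis on its
    side. *)
Lemma height_small_change s a K r : near_translation s 1 K r -> a * a = 1 ->
  exists rho, 0 < rho <= r /\ forall z, 0 < Cmod z < rho -> s z <> 0%C /\ height a 1 z - 2 <= height a 1 (s z) /\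
    Rabs (Im (wcoord (s z)) - Im (wcoord z)) <= 1 / 2.
Proof.
  intros [_ [Hr [HK Hs]]] Ha.
  set (q := 4 * K + 1). assert (Hq : 0 < q) by (unfold q; lra).
  exists (Rmin r (Rmin 1 (/ q))). split.
  { split; [|apply Rmin_l]. repeat apply Rmin_pos; auto; try lra. apply Rinv_0_lt_compat; auto. }
  intros z [Hz0 Hz].
  pose proof (Rlt_le_trans _ _ _ Hz (Rmin_l _ _)) as Z1.
  pose proof (Rlt_le_trans _ _ _ Hz (Rmin_r _ _)) as Z2.
  pose proof (Rlt_le_trans _ _ _ Z2 (Rmin_l _ _)) as Z3.
  pose proof (Rlt_le_trans _ _ _ Z2 (Rmin_r _ _)) as Z4.
  destruct (Hs z (conj Hz0 Z1)) as [S1 S2]. split; auto.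
  assert (Hzn : z <> 0%C) by (apply Cmod_neq_0; auto).
  set (e := (wcoord (s z) - wcoord z - RtoC 1)%C) in *.
  assert (E : wcoord (s z) = (wcoord z + RtoC 1 + e)%C) by (unfold e; ring).
  unfold height. rewrite E. set (w := wcoord z) in *.
  replace (Im (w + RtoC 1 + e)) with (Im w + Im e) by (unfold Im; simpl; ring).
  replace (Re (w + RtoC 1 + e)) with (Re w + 1 + Re e) by (unfold Re; simpl; ring).
  set (m := Cmod z) in *.
  assert (Wm : Cmod w = / m) by (apply wcoord_mod; auto).
  pose proof (Im_le_Cmod w) as Iw. rewrite Wm in Iw.
  pose proof (Im_le_Cmod e) as Ie. pose proof (Re_le_Cmod e) as Re_.
  assert (Qm : 4 * (K * m) <= 1).
  { assert (q * m <= 1).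
    { apply Rmult_le_reg_l with (/ q); [apply Rinv_0_lt_compat; auto|]. rewrite <- Rmult_assoc, Rinv_l by lra. lra. }
    unfold q in H. nra. }
  assert (Mm : K * (m * m) <= K * m) by (apply Rmult_le_compat_l; nra).
  assert (Y : Rabs (Im w * Im e) <= K * m).
  { rewrite Rabs_mult. apply Rle_trans with (/ m * (K * (m * m))).
    - apply Rmult_le_compat; auto using Rabs_pos. lra.
    - right. field. lra. }
  assert (X : Rabs (a * (1 + Re e)) <= 1 + 1 / 4).
  { rewrite unit_sign by auto. eapply Rle_trans; [apply Rabs_triang|]. rewrite Rabs_R1. lra. }
  split.
  - apply Rabs_le_between in Y, X. assert (0 <= Im e * Im e) by apply Rle_0_sqr. lra.
  - replace (Im w + Im e - Im w) with (Im e) by ring. lra.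
Qed.

Lemma horn_invariant Psi b z z' : (b = 1 \/ b = -1) -> (Psi z' - Psi z = 1)%C -> horn Psi b z' = horn Psi b z.
Proof.
  intros Hb E. unfold horn. replace (Psi z') with (Psi z + 1)%C.
  2: { replace (Psi z') with ((Psi z' - Psi z) + Psi z)%C by ring. rewrite E. ring. }
  replace (RtoC b * (2 * PI * Ci * (Psi z + 1)))%C with (RtoC b * (2 * PI * Ci * Psi z) + RtoC b * (2 * PI * Ci))%C by ring.
  rewrite Cexp_plus. replace (Cexp (RtoC b * (2 * PI * Ci))) with (RtoC 1); [ring|].
  assert (E1 : (RtoC b * (2 * PI * Ci))%C = (0, b * (2 * PI))%R).
  { unfold Ci, RtoC. apply injective_projections; simpl; ring. }
  rewrite E1. unfold Cexp, Re, Im. cbn [fst snd]. rewrite exp_0.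
  destruct Hb as [-> | ->].
  - replace (1 * (2 * PI)) with (2 * PI) by ring. rewrite cos_2PI, sin_2PI. apply injective_projections; simpl; ring.
  - replace (-1 * (2 * PI)) with (- (2 * PI)) by ring. rewrite cos_neg, sin_neg, cos_2PI, sin_2PI.
    apply injective_projections; simpl; ring.
Qed.

(** One of [Re w], [- Re w] is nonnegative, and for that sign the height is at least [|w| - 1]. *)
Lemma parabolas_cover M z : 0 <= M -> 0 < Cmod z < / (M + 2) -> parabola 1 1 M z \/ parabola (-1) 1 M z.
Proof.
  intros HM [Hz0 Hz]. assert (Hn : z <> 0%C) by (apply Cmod_neq_0; auto).
  assert (W : M + 2 < Cmod (wcoord z)).
  { rewrite wcoord_mod by auto. rewrite <- (Rinv_inv (M + 2)). apply Rinv_lt_contravar; auto.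
    apply Rmult_lt_0_compat; auto. apply Rinv_0_lt_compat. lra. }
  pose proof (Cmod_le_Re_Im (wcoord z)) as T.
  assert (Y : Rabs (Im (wcoord z)) - 1 <= Im (wcoord z) * Im (wcoord z)).
  { rewrite <- (Rabs_pos_eq (Im (wcoord z) * Im (wcoord z))) by apply Rle_0_sqr.
    rewrite Rabs_mult. pose proof (Rabs_pos (Im (wcoord z))). nra. }
  unfold parabola, height. destruct (Rle_lt_dec 0 (Re (wcoord z))) as [H|H].
  - left. split; auto. rewrite Rabs_pos_eq in T by auto. lra.
  - right. split; auto. rewrite (Rabs_left (Re (wcoord z))) in T by auto. lra.
Qed.

(** Only the expansion to order 1 is used: its linear part contributes [b 1 * (f z - z)], which is
    [O(z^2)]. *)
Lemma asy_difference (V W : C -> Prop) h (f : C -> C) A : asy V h ->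
  (forall z, W z -> V z /\ V (f z) /\ Cmod z <= 1 /\ Cmod (f z) <= 2 * Cmod z /\
    Cmod (f z - z) <= A * (Cmod z * Cmod z)) ->
  exists B, 0 <= B /\ forall z, W z -> Cmod (h (f z) - h z) <= B * (Cmod z * Cmod z).
Proof.
  intros Hh HV. destruct (Hh 1%nat) as [b [K HK]].
  exists (5 * Rabs K + Cmod (b 1%nat) * Rabs A). split.
  { pose proof (Rabs_pos K). pose proof (Rabs_pos A). pose proof (Cmod_ge_0 (b 1%nat)). nra. }
  intros z Hw. destruct (HV z Hw) as [Hz [Hfz [V1 [V2 V3]]]].
  pose proof (HK z Hz) as H1. pose proof (HK (f z) Hfz) as H2.
  rewrite psum_S, psum_O in H1, H2. simpl (Cpow _ 1) in H1, H2. rewrite Cmult_1_r in H1, H2.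
  replace (Cmod z ^ 2) with (Cmod z * Cmod z) in H1 by ring. replace (Cmod (f z) ^ 2) with (Cmod (f z) * Cmod (f z)) in H2 by ring.
  set (m := Cmod z) in *. assert (m0 : 0 <= m) by apply Cmod_ge_0.
  assert (H1' : Cmod (h z - (b 0%nat + b 1%nat * z)) <= Rabs K * (m * m)).
  { apply Rle_trans with (1 := H1). apply Rmult_le_compat_r; [nra|apply Rle_abs]. }
  assert (H2' : Cmod (h (f z) - (b 0%nat + b 1%nat * f z)) <= Rabs K * (4 * (m * m))).
  { apply Rle_trans with (1 := H2). apply Rle_trans with (Rabs K * (Cmod (f z) * Cmod (f z))).
    - apply Rmult_le_compat_r; [pose proof (Cmod_ge_0 (f z)); nra|apply Rle_abs].
    - apply Rmult_le_compat_l; [apply Rabs_pos|]. pose proof (Cmod_ge_0 (f z)). nra. }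
  replace (h (f z) - h z)%C with ((h (f z) - (b 0%nat + b 1%nat * f z)) - (h z - (b 0%nat + b 1%nat * z)) + b 1%nat * (f z - z))%C by ring.
  eapply Rle_trans; [apply Cmod_triangle|]. rewrite Cmod_mult.
  pose proof (Cmod_minus_triangle (h (f z) - (b 0%nat + b 1%nat * f z)) (h z - (b 0%nat + b 1%nat * z))).
  assert (Cmod (b 1%nat) * Cmod (f z - z) <= Cmod (b 1%nat) * (Rabs A * (m * m))).
  { apply Rmult_le_compat_l; [apply Cmod_ge_0|]. apply Rle_trans with (1 := V3).
    apply Rmult_le_compat_r; [nra|apply Rle_abs]. }
  lra.
Qed.

Lemma parabolic_quadratic f r K : parabolic_on f r K -> exists A, forall z, Cmod z < r -> Cmod (f z - z) <= A * (Cmod z * Cmod z).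
Proof.
  intros Hf. destruct (parabolic_pow f r K Hf 1) as [B [HB H]]. exists (B + 1). intros z Hz.
  specialize (H z Hz). destruct (po_r f r K Hf).
  replace (f z - z)%C with ((f z ^ 1 - z ^ 1 - RtoC (INR 1) * z ^ 2) + z ^ 2)%C by (simpl; ring).
  eapply Rle_trans; [apply Cmod_triangle|]. rewrite Cmod_pow.
  replace (Cmod z ^ 2) with (Cmod z * Cmod z) by ring. pose proof (Cmod_ge_0 z).
  replace (Cmod z ^ 3) with (Cmod z * Cmod z * Cmod z) in H by ring.
  assert (B * (Cmod z * Cmod z * Cmod z) <= B * (Cmod z * Cmod z)) by (apply Rmult_le_compat_l; nra). lra.
Qed.

(** Invariance of the jump makes the two differences agree on the overlap; the two regions cover a
    punctured disc, and the bound [O(z^2)] from [asy_difference] removes the singularity with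
    derivative 0. *)
Lemma glued_difference f r K M Rp Rm : parabolic_on f r K -> 1 <= M ->
  asy (parabola 1 1 M) Rp -> asy (parabola (-1) 1 M) Rm ->
  (forall z, parabola 1 1 M z -> analytic_at Rp z) -> (forall z, parabola (-1) 1 M z -> analytic_at Rm z) ->
  (forall z, Cmod z < r -> parabola 1 1 M z -> parabola (-1) 1 M z -> parabola 1 1 M (f z) -> parabola (-1) 1 M (f z) ->
     0 < Im z * Im (f z) -> (Rp (f z) - Rm (f z) = Rp z - Rm z)%C) ->
  exists delta M1, M <= M1 /\ analytic_at delta 0 /\ delta 0 = 0%C /\ sderiv delta 0 0 /\
    (forall z, parabola 1 1 M1 z -> delta z = (Rp (f z) - Rp z)%C) /\
    (forall z, parabola (-1) 1 M1 z -> delta z = (Rm (f z) - Rm z)%C).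
Proof.
  intros Hf HM Ap Am Hp Hm Hinv. destruct (po_r f r K Hf) as [R0 R1].
  assert (U1 : 1 * 1 = 1) by ring. assert (U2 : -1 * -1 = 1) by ring.
  pose proof (parabolic_translation f r K Hf) as NT.
  destruct (height_small_change f 1 _ r NT U1) as [rho1 [Hrho1 H1]].
  destruct (height_small_change f (-1) _ r NT U2) as [rho2 [Hrho2 H2]].
  destruct (parabola_small 1 1 (Rmin rho1 rho2) U1 ltac:(lra)) as [N1 [HN1 S1]]; [apply Rmin_pos; lra|].
  destruct (parabola_small (-1) 1 (Rmin rho1 rho2) U2 ltac:(lra)) as [N2 [HN2 S2]]; [apply Rmin_pos; lra|].
  (* The 2 compensates the height lost under [f] by the parabola with [a = -1]. *)
  set (M1 := M + 2 + N1 + N2).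
  assert (Sm : forall a z, (a = 1 \/ a = -1) -> parabola a 1 M1 z -> 0 < Cmod z /\ Cmod z < rho1 /\ Cmod z < rho2).
  { intros a z Haa Hz. assert (0 < Cmod z < Rmin rho1 rho2).
    { destruct Haa as [-> | ->]; [apply (S1 M1)|apply (S2 M1)]; auto; unfold M1; lra. }
    pose proof (Rmin_l rho1 rho2). pose proof (Rmin_r rho1 rho2). lra. }
  assert (In : forall a z, (a = 1 \/ a = -1) -> parabola a 1 M1 z -> parabola a 1 M z /\ parabola a 1 M (f z)).
  { intros a z Haa Hz. destruct (Sm a z Haa Hz) as [Z0 [Z1 Z2]]. split.
    - apply (parabola_mono a 1 1 M1 M); auto; [lra|unfold M1; lra].
    - destruct Hz as [_ Hz]. destruct (H1 z (conj Z0 Z1)) as [A1 [A2 A3]]. destruct (H2 z (conj Z0 Z2)) as [_ [B2 _]].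
      split; auto. unfold M1 in Hz. destruct Haa as [-> | ->]; lra. }
  assert (Eq : forall z, parabola 1 1 M1 z -> parabola (-1) 1 M1 z -> (Rp (f z) - Rp z = Rm (f z) - Rm z)%C).
  { intros z Z1 Z2. destruct (In 1 z ltac:(auto) Z1) as [P1 P2]. destruct (In (-1) z ltac:(auto) Z2) as [P3 P4].
    destruct (Sm 1 z ltac:(auto) Z1) as [Z0 [Zr _]].
    (* Both heights above [M1] give [|Im w| > 1], whereas [f] moves [Im w] by at most [1 / 2]. *)
    assert (Side : 0 < Im z * Im (f z)).
    { destruct (H1 z (conj Z0 Zr)) as [A1 [_ A3]]. destruct Z1 as [Hn X1]. destruct Z2 as [_ X2].
      unfold height in X1, X2. rewrite !Im_wcoord in A3 by auto. rewrite Im_wcoord in X1, X2 by auto.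
      pose proof (proj1 (Cmod_gt_0 _) Hn) as Q1. pose proof (proj1 (Cmod_gt_0 _) A1) as Q2.
      set (y := Im z / (Cmod z * Cmod z)) in *. set (y' := Im (f z) / (Cmod (f z) * Cmod (f z))) in *.
      assert (Y1 : 1 < y * y) by (unfold M1 in *; lra).
      replace (Im z) with (y * (Cmod z * Cmod z)) by (unfold y; field; lra).
      replace (Im (f z)) with (y' * (Cmod (f z) * Cmod (f z))) by (unfold y'; field; lra).
      replace (y * (Cmod z * Cmod z) * (y' * (Cmod (f z) * Cmod (f z)))) with
        (y * y' * (Cmod z * Cmod z * (Cmod (f z) * Cmod (f z)))) by ring.
      apply Rmult_lt_0_compat; [|apply Rmult_lt_0_compat; nra].
      apply Rabs_le_between in A3. destruct (Rle_lt_dec 0 y).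
      - assert (1 < y) by nra. nra.
      - assert (y < -1) by nra. nra. }
    pose proof (Hinv z ltac:(lra) P1 P3 P2 P4 Side) as E.
    replace (Rp (f z) - Rp z)%C with ((Rp (f z) - Rm (f z)) - (Rp z - Rm z) + (Rm (f z) - Rm z))%C by ring.
    rewrite E. ring. }
  (* The last default supplies the value at the origin; elsewhere it is taken only away from 0. *)
  set (delta := fun z => if excluded_middle_informative (parabola 1 1 M1 z) then (Rp (f z) - Rp z)%C
    else if excluded_middle_informative (parabola (-1) 1 M1 z) then (Rm (f z) - Rm z)%C else 0%C).
  assert (Dp : forall z, parabola 1 1 M1 z -> delta z = (Rp (f z) - Rp z)%C).
  { intros z Hz. unfold delta. destruct excluded_middle_informative; tauto. }
  assert (Dm : forall z, parabola (-1) 1 M1 z -> delta z = (Rm (f z) - Rm z)%C).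
  { intros z Hz. unfold delta. destruct excluded_middle_informative; [apply Eq; auto|].
    destruct excluded_middle_informative; tauto. }
  assert (D0 : delta 0 = 0%C).
  { unfold delta. destruct excluded_middle_informative as [[E _]|_]; [tauto|].
    destruct excluded_middle_informative as [[E _]|_]; [tauto|auto]. }
  set (rho := / (M1 + 2)). assert (Hrho : 0 < rho) by (apply Rinv_0_lt_compat; unfold M1; lra).
  assert (Cover : forall z, 0 < Cmod z < rho -> parabola 1 1 M1 z \/ parabola (-1) 1 M1 z).
  { intros z Hz. apply parabolas_cover; auto. unfold M1; lra. }
  destruct (parabolic_quadratic f r K Hf) as [A HA].
  assert (HV : forall a z, (a = 1 \/ a = -1) -> parabola a 1 M1 z -> Cmod z <= 1 /\ Cmod (f z) <= 2 * Cmod z /\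
    Cmod (f z - z) <= A * (Cmod z * Cmod z)).
  { intros a z Haa Hz. destruct (Sm a z Haa Hz) as [Z0 [Z1 _]]. split; [lra|]. split.
    - apply (parabolic_mod f r K Hf). lra.
    - apply HA. lra. }
  assert (Bd : forall a h, (a = 1 \/ a = -1) -> asy (parabola a 1 M) h ->
    exists B, 0 <= B /\ forall z, parabola a 1 M1 z -> Cmod (h (f z) - h z) <= B * (Cmod z * Cmod z)).
  { intros a h Haa Hh. apply (asy_difference (parabola a 1 M) (parabola a 1 M1) h f A); auto.
    intros z Hz. destruct (In a z Haa Hz). destruct (HV a z Haa Hz) as [V1 [V2 V3]]. auto. }
  destruct (Bd 1 Rp (or_introl eq_refl) Ap) as [Bp [HBp HBp']].
  destruct (Bd (-1) Rm (or_intror eq_refl) Am) as [Bm [HBm HBm']].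
  assert (Quad : forall z, Cmod z < rho -> Cmod (delta z) <= (Bp + Bm) * (Cmod z * Cmod z)).
  { intros z Hz. destruct (Req_dec (Cmod z) 0) as [E|E].
    - apply Cmod_eq_0 in E. rewrite E, D0, Cmod_0. lra.
    - pose proof (Cmod_ge_0 z). assert (0 <= Cmod z * Cmod z) by nra.
      destruct (Cover z ltac:(lra)) as [C1|C1].
      + rewrite Dp by auto. apply Rle_trans with (1 := HBp' z C1). apply Rmult_le_compat_r; lra.
      + rewrite Dm by auto. apply Rle_trans with (1 := HBm' z C1). apply Rmult_le_compat_r; lra. }
  assert (Diff : forall z, 0 < Cmod z < rho -> sdiff delta z).
  { assert (G : forall a h, (a = 1 \/ a = -1) -> (forall z, parabola a 1 M z -> analytic_at h z) ->
      (forall z, parabola a 1 M1 z -> delta z = (h (f z) - h z)%C) -> forall z, parabola a 1 M1 z -> sdiff delta z).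
    { intros a h Haa Hh Hd z Hz. assert (Op : open (parabola a 1 M1)).
      { apply parabola_open; [destruct Haa; subst; ring|lra]. }
      rewrite open_C in Op. destruct (Op z Hz) as [d [Hd0 Hd1]].
      apply (sdiff_ext_loc (fun z => h (f z) - h z)%C delta z d); auto.
      { intros y Hy. rewrite Hd; auto. }
      destruct (In a z Haa Hz) as [I1 I2]. apply sdiff_minus.
      - apply (sdiff_comp h f); [|apply analytic_at_sdiff, Hh; auto].
        apply (po_sdiff f r K Hf). destruct (Sm a z Haa Hz). lra.
      - apply analytic_at_sdiff, Hh; auto. }
    intros z Hz. destruct (Cover z Hz) as [C1|C1].
    - apply (G 1 Rp); auto.
    - apply (G (-1) Rm); auto. }
  assert (S0 : sderiv delta 0 0) by (apply (removable_quadratic delta rho (Bp + Bm)); auto).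
  exists delta, M1. split; [unfold M1; lra|]. split; [|auto].
  apply (analytic_at_of_sdiff delta 0 rho); auto. intros x Hx. rewrite Cminus_0_r in Hx.
  destruct (Req_dec (Cmod x) 0) as [E|E].
  - apply Cmod_eq_0 in E. rewrite E. eexists; eauto.
  - apply Diff. pose proof (Cmod_ge_0 x). lra.
Qed.

Definition near0 (P : C -> Prop) : Prop := exists d, 0 < d /\ forall z, Cmod z < d -> P z.

Lemma near0_and P Q : near0 P -> near0 Q -> near0 (fun z => P z /\ Q z).
Proof.
  intros [d [Hd H]] [d' [Hd' H']]. exists (Rmin d d'). split; [apply Rmin_pos; auto|].
  intros z Hz. split; [apply H|apply H']; eapply Rlt_le_trans; try apply Hz; [apply Rmin_l|apply Rmin_r].
Qed.

Lemma near0_comp P f : near0 P -> sdiff f 0 -> f 0 = 0%C -> near0 (fun z => P (f z)).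
Proof.
  intros [d [Hd H]] Hf H0. destruct (sdiff_cont f 0 Hf d Hd) as [d' [Hd' H']].
  exists d'. split; auto. intros z Hz. apply H. specialize (H' z). rewrite H0, !Cminus_0_r in H'. auto.
Qed.

Lemma near0_cont f e : sdiff f 0 -> 0 < e -> near0 (fun z => Cmod (f z - f 0) < e).
Proof.
  intros Hf He. destruct (sdiff_cont f 0 Hf e He) as [d [Hd H]]. exists d. split; auto.
  intros z Hz. apply H. rewrite Cminus_0_r. auto.
Qed.

Lemma near0_analytic f : analytic_at f 0 -> near0 (analytic_at f).
Proof.
  intros Hf. destruct (analytic_at_near f 0 Hf) as [d [Hd H]]. exists d. split; auto.
  intros z Hz. apply H. rewrite Cminus_0_r. auto.
Qed.

Lemma analytic_at_div f g (z : C) : analytic_at f z -> analytic_at g z -> g z <> 0%C ->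
  analytic_at (fun x => f x / g x)%C z.
Proof.
  intros Hf Hg Hn. destruct (analytic_at_sdiff_near f z Hf) as [d [Hd H]].
  destruct (analytic_at_sdiff_near g z Hg) as [d' [Hd' H']].
  destruct (sdiff_cont g z (analytic_at_sdiff g z Hg) (Cmod (g z))) as [d2 [Hd2 H2]]; [apply Cmod_gt_0; auto|].
  apply (analytic_at_of_sdiff _ z (Rmin d (Rmin d' d2))); [repeat apply Rmin_pos; auto|]. intros x Hx.
  pose proof (Rlt_le_trans _ _ _ Hx (Rmin_l _ _)). pose proof (Rlt_le_trans _ _ _ Hx (Rmin_r _ _)) as X.
  pose proof (Rlt_le_trans _ _ _ X (Rmin_l _ _)). pose proof (Rlt_le_trans _ _ _ X (Rmin_r _ _)) as X2.
  apply sdiff_div; auto. intros E. specialize (H2 x X2). rewrite E in H2.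
  replace (0 - g z)%C with (- g z)%C in H2 by ring. rewrite Cmod_opp in H2. lra.
Qed.

Lemma analytic_at_wcoord (z : C) : z <> 0%C -> analytic_at wcoord z.
Proof.
  intros Hz. apply (analytic_at_of_sdiff _ z (Cmod z)); [apply Cmod_gt_0; auto|]. intros x Hx.
  apply wcoord_sdiff. intros E. rewrite E in Hx. replace (0 - z)%C with (- z)%C in Hx by ring.
  rewrite Cmod_opp in Hx. lra.
Qed.

Lemma parabola_approaches_0 a theta k M : (a = 1 /\ theta = PI) \/ (a = -1 /\ theta = 0) -> 0 < k ->
  forall e, 0 < e -> exists z, parabola a k M z /\ 0 < Cmod z < e.
Proof.
  intros Ha Hk e He. pose proof PI_RGT_0.
  destruct (parabola_sector a theta k M (PI / 2) Ha ltac:(lra) Hk) as [rho [Hrho H']].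
  assert (0 < Rmin rho e) by (apply Rmin_pos; auto). pose proof (Rmin_l rho e). pose proof (Rmin_r rho e).
  exists (polar (Rmin rho e / 2) theta). split.
  - apply H'. exists (Rmin rho e / 2), theta. split; [lra|]. split; auto. rewrite Rminus_diag, Rabs_R0. lra.
  - rewrite Cmod_polar; lra.
Qed.

Lemma asy_has_asymptotic a theta k M h : (a = 1 /\ theta = PI) \/ (a = -1 /\ theta = 0) -> 0 < k ->
  asy (parabola a k M) h -> has_asymptotic_series theta h.
Proof.
  intros Ha Hk Hh.
  destruct (asy_uniform_coef _ h (parabola_approaches_0 a theta k M Ha Hk) Hh) as [b Hb].
  exists b. intros alpha N Halpha. destruct (Hb N) as [K HK].
  destruct (parabola_sector a theta k M alpha Ha Halpha Hk) as [rho [Hrho H]].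
  exists K, rho. split; [exact Hrho|]. intros z Hz. apply HK, H. exact Hz.
Qed.

(** By [height_bounded_change], coefficient [1 / 2] upstairs gives coefficient 1 for the image. On
    the overlap [(Im w)^2 > M2 > B^2], so a displacement of at most [B] cannot cross the real
    axis. *)
Lemma parabola_image (phi : C -> C) d B M : 0 <= B -> 0 <= M ->
  (forall z, 0 < Cmod z < d -> phi z <> 0%C /\ Cmod (wcoord (phi z) - wcoord z) <= B) ->
  exists M1, 0 < M1 /\ forall M2, M1 <= M2 ->
    (forall a z, a * a = 1 -> Cmod z < d -> parabola a (1 / 2) M2 z -> parabola a 1 M (phi z)) /\
    (forall z, Cmod z < d -> parabola 1 (1 / 2) M2 z -> parabola (-1) (1 / 2) M2 z -> 0 < Im z * Im (phi z)).
Proof.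
  intros HB HM Hphi. exists (M + 2 * (B * B) + B + 1). split; [nra|]. intros M2 HM2. split.
  - intros a z Ha Hz [Hn Hh]. destruct (Hphi z (conj (proj1 (Cmod_gt_0 _) Hn) Hz)) as [P1 P2]. split; auto.
    pose proof (height_bounded_change a z (phi z) B Ha HB P2). lra.
  - intros z Hz [Hn H1] [_ H2]. destruct (Hphi z (conj (proj1 (Cmod_gt_0 _) Hn) Hz)) as [P1 P2].
    pose proof (Im_lip (wcoord (phi z)) (wcoord z)) as L. assert (L' := Rle_trans _ _ _ L P2).
    unfold height in H1, H2. rewrite !Im_wcoord in L' by auto. rewrite Im_wcoord in H1, H2 by auto.
    pose proof (proj1 (Cmod_gt_0 _) Hn) as Q1. pose proof (proj1 (Cmod_gt_0 _) P1) as Q2.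
    set (y := Im z / (Cmod z * Cmod z)) in *. set (y' := Im (phi z) / (Cmod (phi z) * Cmod (phi z))) in *.
    assert (Y1 : B * B + B + 1 < y * y) by nra.
    replace (Im z) with (y * (Cmod z * Cmod z)) by (unfold y; field; lra).
    replace (Im (phi z)) with (y' * (Cmod (phi z) * Cmod (phi z))) by (unfold y'; field; lra).
    replace (y * (Cmod z * Cmod z) * (y' * (Cmod (phi z) * Cmod (phi z)))) with
      (y * y' * (Cmod z * Cmod z * (Cmod (phi z) * Cmod (phi z)))) by ring.
    apply Rmult_lt_0_compat; [|apply Rmult_lt_0_compat; nra].
    apply Rabs_le_between in L'. destruct (Rle_lt_dec 0 y).
    + assert (B < y) by nra. nra.
    + assert (y < - B) by nra. nra.
Qed.

Lemma sderiv_germ_eq f z l m : sderiv f z l -> l = m -> sderiv f z m.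
Proof. intros H <-. auto. Qed.

(* The germ is [psi o f o phi] with [phi] inverse to [psi = Log (f z / z) - delta],
   [delta] being the common value of the two sectorial differences: the 1-Abel
   equation of the new germ, transported by [phi], is then the equation
   [R o f - R = delta] up to the analytic term [Log (phi z / z)]. *)
Lemma realization f g1 g2 : parabolic_germ f -> analytic_at g1 0 -> analytic_at g2 0 -> (g1 0 + g2 0 = 0)%C ->
  exists f1, analytic_class f f1 /\ one_moment f1 (g1, g2).
Proof.
  intros Hpf Hg1 Hg2 Hsum. pose proof Hpf as [af [Haf [A0 [A1 [A2 A3]]]]].
  destruct (parabolic_germ_local f Hpf) as [r [K Hf]]. destruct (po_r f r K Hf) as [R0 R1].
  (* The Cousin data have to vanish at the vertex; the constant [g1 0 = - g2 0] is put back into the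
     attracting solution at the end. *)
  set (h1 := fun t => (g1 t + - g1 0)%C). set (h2 := fun t => (g2 t + - g2 0)%C).
  assert (Hh1 : analytic_at h1 0) by (apply analytic_at_plus; auto using analytic_at_const).
  assert (Hh2 : analytic_at h2 0) by (apply analytic_at_plus; auto using analytic_at_const).
  destruct (sectorial_solutions f r K h1 h2 Hf Hh1 Hh2) as [M [Rf [Rp [Rm [HM H]]]]].
  { unfold h1. ring. } { unfold h2. ring. }
  cbv zeta in H. set (Psi := fun z => (wcoord z + Rf z)%C) in H.
  destruct H as [ARf [ARp [ARm [HP [HN HD]]]]].
  destruct (glued_difference f r K M Rp Rm Hf HM ARp ARm) as [delta [M1 [HM1 [Dan [D0 [Dd [Dp Dm]]]]]]].
  { intros z Hz. apply HP; auto. } { auto. }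
  { intros z Hz P1 P2 P3 P4 Hs. destruct (HD z P1 P2) as [X1 X2]. destruct (HD (f z) P3 P4) as [Y1 Y2].
    destruct (HP z P1) as [_ [_ E]].
    destruct (Rlt_le_dec 0 (Im z)) as [S|S].
    - rewrite X1 by auto. rewrite Y1 by nra. f_equal. apply horn_invariant; auto.
    - assert (S' : Im z < 0) by (destruct S as [S|S]; auto; rewrite S in Hs; lra).
      replace (Rp (f z) - Rm (f z))%C with (- (Rm (f z) - Rp (f z)))%C by ring.
      replace (Rp z - Rm z)%C with (- (Rm z - Rp z))%C by ring. rewrite X2 by auto. rewrite Y2 by nra.
      f_equal. f_equal. apply horn_invariant; auto. }
  set (q := quot_id f 1).
  assert (Qex : expands_at q 0 (fun n => af (S n))) by (unfold q; rewrite <- A1; apply quot_id_expands; auto).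
  assert (Q0 : q 0 = 1%C) by (unfold q, quot_id; destruct (Ceq_dec 0 0); tauto).
  assert (Qan : analytic_at q 0) by (eexists; eauto).
  assert (Qd : sderiv q 0 1) by (rewrite <- A2; apply (expands_at_sderiv q 0 _ Qex)).
  set (psi := fun z => (Clog (q z) + (-(1)) * delta z)%C).
  assert (C1 : 0 < Re (q 0)) by (rewrite Q0; unfold Re; simpl; lra).
  assert (Pan : analytic_at psi 0).
  { apply analytic_at_plus; [|apply analytic_at_scal; auto].
    apply (analytic_at_comp Clog q); auto. apply analytic_at_Clog; auto. }
  assert (P0 : psi 0 = 0%C) by (unfold psi; rewrite Q0, D0, Clog_1; ring).
  (* The derivative of [Log (f z / z)] at 0 is the coefficient of [z^2] in [f], namely 1, and that
     of [delta] is 0: this makes [psi] tangent to the identity. *)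
  assert (Pd : sderiv psi 0 1).
  { apply (sderiv_germ_eq _ _ (/ (q 0) * 1 + (0 * delta 0 + (-(1)) * 0))%C).
    - apply sderiv_plus.
      + apply (sderiv_comp Clog q); auto. apply Clog_sderiv; auto.
      + apply (sderiv_mult (fun _ => (-(1))%C)); auto using sderiv_const.
    - rewrite Q0. field. }
  destruct (analytic_at_sdiff_near psi 0 Pan) as [r0 [Hr0 Psd]].
  assert (N1 : RtoC 1 <> 0%C) by (apply RtoC_neq_0; lra).
  destruct (inverse_function psi 0 1 r0 N1 Pd Hr0 Psd) as [phi [r' [d [Hr' [Hd [Pinj [Hphi [Phs Phd]]]]]]]].
  rewrite P0 in *.
  assert (Hphi' : forall y, Cmod y < d -> psi (phi y) = y /\ Cmod (phi y) < r' /\ Cmod (phi y) <= 2 * Cmod y).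
  { intros y Hy. destruct (Hphi y) as [X1 [X2 X3]]; [rewrite Cminus_0_r; auto|].
    rewrite !Cminus_0_r in *. rewrite Cmod_1 in X3. split; auto. split; auto. lra. }
  assert (F0 : phi 0 = 0%C).
  { destruct (Hphi' 0%C) as [_ [_ X]]; [rewrite Cmod_0; auto|]. rewrite Cmod_0, Rmult_0_r in X.
    apply Cmod_eq_0, Rle_antisym; auto using Cmod_ge_0. }
  assert (Phan : analytic_at phi 0).
  { apply (analytic_at_of_sdiff _ 0 d); auto. }
  assert (Phd' : sderiv phi 0 1) by (apply (sderiv_germ_eq _ _ _ _ Phd); field).
  assert (Fan : analytic_at f 0) by (eexists; eauto).
  assert (Ff0 : f 0 = 0%C) by apply (po_0 f r K Hf).
  assert (Fd : sderiv f 0 1) by (rewrite <- A1; apply (expands_at_sderiv f 0 _ Haf)).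
  set (f1 := fun z => psi (f (phi z))).
  assert (FPan : analytic_at (fun z => f (phi z)) 0) by (apply (analytic_at_comp f phi); auto; rewrite F0; auto).
  assert (F1an : analytic_at f1 0).
  { apply (analytic_at_comp psi (fun z => f (phi z))); auto. rewrite F0, Ff0; auto. }
  assert (F10 : f1 0 = 0%C) by (unfold f1; rewrite F0, Ff0; auto).
  assert (F1d : sderiv f1 0 1).
  { apply (sderiv_germ_eq _ _ (1 * (1 * 1))%C); [|ring].
    apply (sderiv_comp psi (fun z => f (phi z))).
    - apply (sderiv_comp f phi); auto. rewrite F0; auto.
    - rewrite F0, Ff0; auto. }
  assert (Left : near0 (fun x => phi (psi x) = x)).
  { assert (N : near0 (fun x => Cmod x < r' /\ Cmod (psi x - psi 0) < d)).
    { apply near0_and; [exists r'; auto|apply near0_cont; auto; eexists; eauto]. }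
    destruct N as [d' [Hd' N]]. exists d'. split; auto. intros x Hx. destruct (N x Hx) as [X1 X2].
    rewrite P0, Cminus_0_r in X2. destruct (Hphi' _ X2) as [Y1 [Y2 _]].
    apply Pinj; auto; rewrite Cminus_0_r; auto. }
  assert (Conj : near0 (fun z => phi (f1 z) = f (phi z))).
  { apply (near0_comp _ (fun z => f (phi z)) Left).
    - apply analytic_at_sdiff; auto.
    - rewrite F0; auto. }
  assert (Tan : tangent_to_id phi).
  { pose proof Phan as [p Hp]. exists p. split; auto. split.
    - rewrite <- (expands_at_val phi 0 p Hp). auto.
    - apply (sderiv_unique phi 0); auto. apply expands_at_sderiv; auto. }
  assert (Hpf1 : parabolic_germ f1).
  { destruct Conj as [d' [Hd' Cj]]. apply (parabolic_germ_conj f f1 phi d'); auto. }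
  exists f1. split.
  { split; auto. exists phi, psi. split; auto. split.
    - exists d. split; auto. intros z Hz. apply Hphi'; auto.
    - exists 1. split; [lra|]. intros; reflexivity. }
  destruct (parabolic_germ_local f1 Hpf1) as [r1 [K1 Hf1]]. destruct (po_r f1 r1 K1 Hf1) as [R10 R11].
  destruct (analytic_at_quot phi Phan F0) as [c [Hc Qphan]].
  assert (c = 1%C) by (apply (sderiv_unique phi 0); auto). subst c.
  set (qphi := quot_id phi 1) in *.
  assert (Qph0 : qphi 0 = 1%C) by (unfold qphi, quot_id; destruct (Ceq_dec 0 0); tauto).
  assert (QphE : forall z : C, z <> 0%C -> qphi z = (phi z / z)%C).
  { intros z Hz. unfold qphi, quot_id. destruct (Ceq_dec z 0) as [E|E]; [destruct (Hz E)|reflexivity]. }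
  (* Dividing [phi z / z - 1] once more by [z] shows that [wcoord (phi z) - wcoord z] extends
     analytically to 0, as [nu]. This bounds the displacement of [phi] and gives the expansion of
     the new Fatou coordinate. *)
  destruct (analytic_at_quot (fun z => qphi z + (- (1)))%C) as [c2 [_ Q2an]].
  { apply analytic_at_plus; auto using analytic_at_const. }
  { rewrite Qph0. ring. }
  set (q2 := quot_id (fun z => qphi z + (- (1)))%C c2) in *.
  set (nu := fun z => (q2 z / qphi z)%C).
  assert (Nuan : analytic_at nu 0).
  { apply analytic_at_div; auto. rewrite Qph0; auto. }
  assert (NuE : forall z : C, z <> 0%C -> phi z <> 0%C -> nu z = (wcoord (phi z) + 1 / z)%C).
  { intros z Hz Hp. unfold nu, q2, quot_id. destruct (Ceq_dec z 0); [tauto|]. rewrite QphE by auto.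
    unfold wcoord. field. auto. }
  destruct (analytic_at_quot f1 F1an F10) as [c [Hc3 Q1an]].
  assert (c = 1%C) by (apply (sderiv_unique f1 0); auto). subst c.
  set (qf1 := quot_id f1 1) in *.
  assert (Qf10 : qf1 0 = 1%C) by (unfold qf1, quot_id; destruct (Ceq_dec 0 0); tauto).
  (* Transport by [phi] turns [- Log z] into [- Log (phi z)]; [lam] is the difference, which passes
     into the regular part of the solution. *)
  set (lam := fun z => ((-(1)) * Clog (qphi z))%C).
  assert (Laman : analytic_at lam 0).
  { apply analytic_at_scal. apply (analytic_at_comp Clog qphi); auto. apply analytic_at_Clog.
    rewrite Qph0. unfold Re; simpl; lra. }
  destruct (analytic_asy lam Laman) as [dl [Hdl Lamasy]].
  destruct (analytic_asy nu Nuan) as [dn [Hdn Nuasy]].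
  assert (Half : 0 < 1 / 2) by lra.
  assert (SD : forall h, analytic_at h 0 -> sdiff h 0) by (intros; apply analytic_at_sdiff; auto).
  assert (Ev : near0 (fun z => (Cmod z < d / 8 /\ Cmod z < r1 /\ Cmod z < dl /\ Cmod z < dn) /\
      (phi (f1 z) = f (phi z) /\ Cmod (nu z - nu 0) < 1) /\
      (Cmod (qphi z - qphi 0) < 1 / 2 /\ Cmod (qphi (f1 z) - qphi 0) < 1 / 2) /\
      (Cmod (q (phi z) - q 0) < 1 / 2 /\ Cmod (qf1 z - qf1 0) < 1 / 2) /\ analytic_at lam z)).
  { repeat apply near0_and; auto.
    - exists (d / 8). split; [lra|auto].
    - exists r1. auto.
    - exists dl. auto.
    - exists dn. auto.
    - apply near0_cont; auto; lra.
    - apply near0_cont; auto.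
    - apply (near0_comp (fun z => Cmod (qphi z - qphi 0) < 1 / 2) f1); auto. apply near0_cont; auto.
    - apply (near0_comp (fun z => Cmod (q z - q 0) < 1 / 2) phi); auto. apply near0_cont; auto.
    - apply near0_cont; auto.
    - apply near0_analytic; auto. }
  destruct Ev as [rho [Hrho Ev]].
  assert (Phn : forall z, 0 < Cmod z < rho -> phi z <> 0%C).
  { intros z [Z0 Z1] E. destruct (Ev z Z1) as [[Y _] _]. destruct (Hphi' z ltac:(lra)) as [X _].
    rewrite E, P0 in X. rewrite <- X, Cmod_0 in Z0. lra. }
  set (B := Cmod (nu 0) + 1). assert (HB : 0 <= B) by (unfold B; pose proof (Cmod_ge_0 (nu 0)); lra).
  assert (Himg : forall z, 0 < Cmod z < rho -> phi z <> 0%C /\ Cmod (wcoord (phi z) - wcoord z) <= B).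
  { intros z Hz. pose proof (Phn z Hz) as Hn. assert (Hzn : z <> 0%C) by (apply Cmod_neq_0; lra). split; auto.
    replace (wcoord (phi z) - wcoord z)%C with (nu z).
    - destruct (Ev z (proj2 Hz)) as [_ [[_ X] _]]. pose proof (Cmod_le_minus (nu z) (nu 0)). unfold B. lra.
    - rewrite NuE by auto. unfold wcoord. field. auto. }
  destruct (parabola_image phi rho B M1 HB ltac:(lra) Himg) as [L1 [HL1 Img]].
  pose proof (parabolic_translation f1 r1 K1 Hf1) as NT.
  destruct (parabolic_inverse f1 r1 K1 Hf1) as [gi [di [Hdi [NTi Hgi]]]].
  destruct (parabola_petal (fun z w => w = f1 z) f1 1 PI (1 / 2) _ r1 rho (or_introl (conj eq_refl eq_refl)) NT Half Hrho)
    as [L2 [HL2 Pet1]]; [auto|].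
  destruct (parabola_petal (fun z w => z = f1 w) gi (-1) 0 (1 / 2) _ di rho (or_intror (conj eq_refl eq_refl)) NTi Half Hrho)
    as [L3 [HL3 Pet2]].
  { intros z Hz. symmetry. apply Hgi. lra. }
  set (M2 := L1 + L2 + L3).
  specialize (Pet1 M2 ltac:(unfold M2; lra)). specialize (Pet2 M2 ltac:(unfold M2; lra)).
  destruct (Img M2 ltac:(unfold M2; lra)) as [ImgV ImgS]. clear Img.
  set (Vp := parabola 1 (1 / 2) M2) in *. set (Vm := parabola (-1) (1 / 2) M2) in *.
  assert (Vrho : forall a z, (a = 1 \/ a = -1) -> parabola a (1 / 2) M2 z -> 0 < Cmod z < rho).
  { intros a z [-> | ->] Hz; [apply Pet1|apply Pet2]; auto. }
  assert (Mono : forall a z, parabola a 1 M1 z -> parabola a 1 M z).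
  { intros a z. apply parabola_mono; lra. }
  assert (Sq : forall a, a = 1 \/ a = -1 -> a * a = 1) by (intros a [-> | ->]; ring).
  assert (ImgM : forall a z, (a = 1 \/ a = -1) -> parabola a (1 / 2) M2 z -> parabola a 1 M1 (phi z)).
  { intros a z Ha Hz. apply ImgV; auto. apply (Vrho a z Ha Hz). }
  assert (PhAn : forall z, Cmod z < rho -> analytic_at phi z).
  { intros z Hz. destruct (Ev z Hz) as [[X _] _].
    apply (analytic_at_of_sdiff _ z (d - Cmod z)); [pose proof (Cmod_ge_0 z); lra|].
    intros x Hx. apply Phs. rewrite Cminus_0_r. pose proof (Cmod_le_minus x z). lra. }
  assert (CompAsy : forall a h, (a = 1 \/ a = -1) -> asy (parabola a 1 M) h -> asy (parabola a (1 / 2) M2) (fun z => h (phi z))).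
  { intros a h Ha Hh. apply (asy_comp (parabola a 1 M) _ h phi d 2); auto.
    - intros x Hx. apply Phs. rewrite Cminus_0_r. auto.
    - intros z Hz. destruct (Ev z (proj2 (Vrho a z Ha Hz))) as [[X _] _]. split; auto.
      split; [apply Hphi'; pose proof (Cmod_ge_0 z); lra|]. apply Mono, ImgM; auto. }
  assert (Abel : forall a theta h c0, (a = 1 /\ theta = PI) \/ (a = -1 /\ theta = 0) -> asy (parabola a 1 M) h ->
    (forall z, parabola a 1 M z -> analytic_at h z) -> (forall z, parabola a 1 M1 z -> delta z = (h (f z) - h z)%C) ->
    abel1_solution f1 theta (parabola a (1 / 2) M2) (fun z => h (phi z) + (lam z + c0))%C).
  { intros a theta h c0 Hat Ah Han Hdel. assert (Ha : a = 1 \/ a = -1) by (destruct Hat as [[X _]|[X _]]; auto).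
    split; [|split].
    - intros z Hz. pose proof (Vrho a z Ha Hz) as Hzr. destruct (Ev z (proj2 Hzr)) as [_ [_ [_ [_ X]]]].
      apply analytic_at_plus; [|apply analytic_at_plus; auto using analytic_at_const].
      apply (analytic_at_comp h phi); [apply PhAn; lra|]. apply Han, Mono, ImgM; auto.
    - intros z Hz Hfz. pose proof (Vrho a z Ha Hz) as Hzr. pose proof (Vrho a _ Ha Hfz) as Hfzr.
      destruct (Ev z (proj2 Hzr)) as [_ [[E1 _] [[E2 E3] [[E4 E5] _]]]].
      rewrite E1. pose proof (Hdel (phi z) (ImgM a z Ha Hz)) as E6.
      assert (Hzn : z <> 0%C) by (apply Cmod_neq_0; lra). assert (Hfzn : f1 z <> 0%C) by (apply Cmod_neq_0; lra).
      pose proof (Phn z Hzr) as Hpn. pose proof (Phn _ Hfzr) as Hpfn.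
      assert (E7 : psi (phi z) = z).
      { apply Hphi'. destruct (Ev z (proj2 Hzr)) as [[X _] _]. pose proof (Cmod_ge_0 z). lra. }
      unfold psi in E7. rewrite E6 in E7.
      assert (E8 : q (phi z) = (f (phi z) / phi z)%C) by (unfold q, quot_id; destruct (Ceq_dec (phi z) 0); tauto).
      assert (E9 : qf1 z = (f1 z / z)%C) by (unfold qf1, quot_id; destruct (Ceq_dec z 0); tauto).
      rewrite Q0 in E4. rewrite Qph0 in E2, E3. rewrite Qf10 in E5.
      (* Both products equal [f (phi z) / z], and all four factors are within [1 / 2] of 1, so their
         logarithms add without ambiguity. *)
      assert (E10 : (Clog (q (phi z)) + Clog (qphi z) = Clog (qf1 z) + Clog (qphi (f1 z)))%C).
      { apply Clog_div_mult; auto. rewrite E8, E9, !QphE, E1 by auto. field. auto. }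
      unfold lam. rewrite <- E9.
      replace (h (f (phi z)) + ((-(1)) * Clog (qphi (f1 z)) + c0) - (h (phi z) + ((-(1)) * Clog (qphi z) + c0)))%C
        with ((h (f (phi z)) - h (phi z)) + Clog (qphi z) - Clog (qphi (f1 z)))%C by ring.
      replace (h (f (phi z)) - h (phi z))%C with (Clog (q (phi z)) - z)%C by (rewrite <- E7 at 2; ring).
      replace (Clog (q (phi z)) - z + Clog (qphi z) - Clog (qphi (f1 z)))%C
        with ((Clog (q (phi z)) + Clog (qphi z)) - z - Clog (qphi (f1 z)))%C by ring.
      rewrite E10. ring.
    - apply (asy_has_asymptotic a theta (1 / 2) M2); auto. apply asy_plus; [apply CompAsy; auto|].
      apply asy_plus; [|apply asy_const]. apply (asy_subset (fun z => Cmod z < dl)); auto.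
      intros z Hz. apply (Ev z). apply (Vrho a z Ha Hz). }
  set (Psi1 := fun z => Psi (phi z)).
  split; [exact Hg1|]. split; [exact Hg2|].
  exists rho, Vp, Vm, Psi1, (fun z => Rp (phi z) + (lam z + g1 0))%C, (fun z => Rm (phi z) + (lam z + 0))%C.
  split; [|split; [exact Pet1|split; [exact Pet2|split; [|split; [|split]]]]].
  - split; auto. split; [|split].
    + intros z Hz. apply (analytic_at_of_sdiff f1 z (r1 - Cmod z)).
      * destruct (Ev z Hz) as [[_ [X _]] _]. lra.
      * intros x Hx. apply (po_sdiff f1 r1 K1 Hf1). pose proof (Cmod_le_minus x z). lra.
    + intros z w Hz Hw. apply (parabolic_inj f1 r1 K1 Hf1); [apply (Ev z Hz)|apply (Ev w Hw)].
    + intros z Hz. pose proof (parabolic_near_id f1 r1 K1 Hf1 z ltac:(apply (Ev z (proj2 Hz)))). lra.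
  - split; [|split].
    + intros z Hz. pose proof (Vrho 1 z (or_introl eq_refl) Hz) as Hzr.
      unfold Psi1, Psi. apply analytic_at_plus.
      * apply (analytic_at_comp wcoord phi); [apply PhAn; lra|]. apply analytic_at_wcoord. apply Phn; auto.
      * apply (analytic_at_comp Rf phi); [apply PhAn; lra|]. apply HP, Mono, ImgM; auto.
    + intros z Hz. pose proof (Vrho 1 z (or_introl eq_refl) Hz) as Hzr.
      destruct (Ev z (proj2 Hzr)) as [_ [[E1 _] _]]. unfold Psi1. rewrite E1. apply HP, Mono, ImgM; auto.
    + apply (asy_has_asymptotic 1 PI (1 / 2) M2); auto.
      apply (asy_ext _ (fun z => Rf (phi z) + nu z)%C).
      * intros z Hz. pose proof (Vrho 1 z (or_introl eq_refl) Hz) as Hzr.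
        rewrite NuE; [|apply Cmod_neq_0; lra|apply Phn; auto]. unfold Psi1, Psi. ring.
      * apply asy_plus; [apply CompAsy; auto|]. apply (asy_subset (fun z => Cmod z < dn)); auto.
        intros z Hz. apply (Ev z). apply (Vrho 1 z (or_introl eq_refl) Hz).
  - apply Abel; auto. intros z Hz. apply HP; auto.
  - apply Abel; auto.
  - assert (HM2 : 0 <= M2) by (unfold M2; lra). pose proof PI_RGT_0.
    assert (Both : forall z, Vp z /\ Vm z -> Im z <> 0).
    { intros z [X Y]. apply (parabola_both_Im (1 / 2) M2); auto. }
    (* The identities hold on the whole of both components, so the bound on the horn variable is
       arbitrary. *)
    exists 1. split; [lra|]. split.
    + intros z Hz t _. assert (S1 : 0 < 1 * sin (PI / 2)) by (rewrite sin_PI2; lra).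
      destruct (component_towards_half _ 1 _ z S1 Both Hz) as [[Zp Zm] Zi].
      assert (Hzr := Vrho 1 z (or_introl eq_refl) Zp).
      pose proof (ImgS z (proj2 Hzr) Zp Zm) as Side.
      destruct (HD (phi z)) as [X _]; [apply Mono, ImgM; auto..|].
      replace (Rp (phi z) + (lam z + g1 0) - (Rm (phi z) + (lam z + 0)))%C with ((Rp (phi z) - Rm (phi z)) + g1 0)%C by ring.
      rewrite X by nra. unfold h1, horn, t. cbn [fst].
      replace (RtoC 1 * (2 * PI * Ci * Psi (phi z)))%C with (2 * PI * Ci * Psi1 z)%C by (unfold Psi1; ring). ring.
    + intros z Hz t _. assert (S1 : 0 < -1 * sin (- (PI / 2))) by (rewrite sin_neg, sin_PI2; lra).
      destruct (component_towards_half _ (-1) _ z S1 Both Hz) as [[Zp Zm] Zi].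
      assert (Hzr := Vrho 1 z (or_introl eq_refl) Zp).
      pose proof (ImgS z (proj2 Hzr) Zp Zm) as Side.
      destruct (HD (phi z)) as [_ X]; [apply Mono, ImgM; auto..|].
      replace (Rm (phi z) + (lam z + 0) - (Rp (phi z) + (lam z + g1 0)))%C with ((Rm (phi z) - Rp (phi z)) - g1 0)%C by ring.
      rewrite X by nra. unfold h2, horn, t. cbn [snd].
      replace (RtoC (-1) * (2 * PI * Ci * Psi (phi z)))%C with (- (2 * PI * Ci * Psi1 z))%C.
      * replace (g1 0) with (- g2 0)%C; [ring|]. replace (g1 0) with ((g1 0 + g2 0) - g2 0)%C by ring. rewrite Hsum. ring.
      * unfold Psi1. change (-1) with (- (1))%R. rewrite RtoC_opp. ring.
Qed.

(** * Uniqueness of the 1-moment *)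

Lemma Carg_half_bound (z : C) : z <> 0%C -> 0 <= Re z -> Rabs (Carg z) <= PI / 2.
Proof.
  intros Hz [H|H]; [left; apply Carg_bound; auto|]. unfold Carg. rewrite <- H.
  replace (0 / Cmod z) with 0 by (unfold Rdiv; ring). rewrite acos_0. pose proof PI_RGT_0.
  destruct (Rlt_dec (Im z) 0); unfold Rabs; destruct Rcase_abs; lra.
Qed.

Lemma polar_Carg (z : C) : z <> 0%C -> z = polar (Cmod z) (Carg z).
Proof.
  intros Hz. rewrite <- (Cexp_Clog z Hz) at 1. unfold Cexp, Clog, polar.
  change (Re (ln (Cmod z), Carg z)) with (ln (Cmod z)). change (Im (ln (Cmod z), Carg z)) with (Carg z).
  rewrite exp_ln; auto. apply Cmod_gt_0; auto.
Qed.

(** The half-opening [3 * PI / 4] is taken above [PI / 2], to contain the closed half-plane, and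
    below [PI], where the asymptotic expansions are uniform. *)
Lemma half_plane_sector a theta rho (z : C) : (a = 1 /\ theta = PI) \/ (a = -1 /\ theta = 0) ->
  0 < Cmod z < rho -> 0 <= - (a * Re z) -> sector theta (3 * PI / 4) rho z.
Proof.
  intros Ha Hz Hr. assert (Hn : z <> 0%C) by (apply Cmod_neq_0; lra). pose proof PI_RGT_0.
  destruct Ha as [[-> ->]|[-> ->]].
  - assert (Hn' : (- z)%C <> 0%C) by (apply Cmod_neq_0; rewrite Cmod_opp; lra).
    assert (R : 0 <= Re (- z)) by (replace (Re (- z)) with (- Re z) by reflexivity; lra).
    pose proof (Carg_half_bound _ Hn' R) as B. pose proof (polar_Carg _ Hn') as P. rewrite Cmod_opp in P.
    exists (Cmod z), (Carg (- z) + PI). split; auto. split.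
    + replace (Carg (- z) + PI - PI) with (Carg (- z)) by ring. lra.
    + replace z with (- - z)%C at 1 by ring. rewrite P at 1. unfold polar. rewrite neg_cos, neg_sin.
      apply injective_projections; simpl; ring.
  - pose proof (Carg_half_bound z Hn ltac:(lra)) as B. exists (Cmod z), (Carg z). split; auto. split.
    + rewrite Rminus_0_r. lra.
    + apply polar_Carg; auto.
Qed.

Lemma asymptotic_limit theta h : has_asymptotic_series theta h -> exists b0 K rho, 0 < rho /\ 0 <= K /\
  forall z, sector theta (3 * PI / 4) rho z -> Cmod (h z - b0) <= K * Cmod z.
Proof.
  intros [b H]. pose proof PI_RGT_0. destruct (H (3 * PI / 4) 0%nat ltac:(lra)) as [K [rho [Hrho HK]]].
  exists (b 0%nat), (Rabs K), rho. split; auto. split; [apply Rabs_pos|]. intros z Hz. specialize (HK z Hz).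
  change (sum_n (fun k => (b k * z ^ k)%C) 0) with (psum b z 0) in HK. rewrite psum_O, pow_1 in HK.
  apply Rle_trans with (1 := HK). apply Rmult_le_compat_r; [apply Cmod_ge_0|apply Rle_abs].
Qed.

(** The shape of an arbitrary petal is unknown, so orbits are followed in the half-plane
    [a * Re w >= 0]. Each step adds at least [1 - K * |z|^2 >= 0] to [a * Re w], and all iterates
    remain in a sector where the asymptotics apply. *)
Lemma translation_half_orbit s a K r rho : near_translation s a K r -> 0 < rho ->
  exists M0, 0 < M0 /\ forall z, parabola a 1 M0 z -> 0 <= a * Re (wcoord z) -> forall n,
    0 < Cmod (Nat.iter n s z) < rho /\ 0 <= - (a * Re (Nat.iter n s z)) /\
    (forall e, 0 < e -> exists N, forall m, (N <= m)%nat -> Cmod (Nat.iter m s z) < e).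
Proof.
  intros Hs Hrho. assert (Ha : a * a = 1) by apply Hs.
  destruct (parabola_orbit s a 1 K r Hs ltac:(lra)) as [M1 [D [HM1 [HD H]]]].
  assert (HK : 0 <= K) by apply Hs.
  destruct (parabola_small a 1 (Rmin rho (Rmin 1 (/ (K + 1)))) Ha ltac:(lra)) as [M2 [HM2 Sm]].
  { repeat apply Rmin_pos; auto; try lra. apply Rinv_0_lt_compat; lra. }
  exists (M1 + M2). split; [lra|]. intros z Hz Hre.
  assert (Orb := fun n => H (M1 + M2) z ltac:(lra) Hz n).
  assert (Small : forall n, 0 < Cmod (Nat.iter n s z) /\ Cmod (Nat.iter n s z) < rho /\
    K * (Cmod (Nat.iter n s z) * Cmod (Nat.iter n s z)) <= 1).
  { intros n. destruct (Orb n) as [O1 _]. destruct (Sm (M1 + M2) _ ltac:(lra) O1) as [X1 X2].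
    pose proof (Rlt_le_trans _ _ _ X2 (Rmin_l _ _)). pose proof (Rlt_le_trans _ _ _ X2 (Rmin_r _ _)) as X3.
    pose proof (Rlt_le_trans _ _ _ X3 (Rmin_l _ _)) as X5. pose proof (Rlt_le_trans _ _ _ X3 (Rmin_r _ _)) as X4.
    split; auto. split; auto. set (m := Cmod (Nat.iter n s z)) in *.
    assert ((K + 1) * m <= 1).
    { apply Rmult_le_reg_l with (/ (K + 1)); [apply Rinv_0_lt_compat; lra|]. rewrite <- Rmult_assoc, Rinv_l by lra. lra. }
    assert (K * (m * m) <= K * m) by (apply Rmult_le_compat_l; auto; rewrite <- (Rmult_1_r m) at 3; apply Rmult_le_compat_l; lra).
    lra. }
  assert (Re_pos : forall n, 0 <= a * Re (wcoord (Nat.iter n s z))).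
  { induction n as [|n IH]; auto. destruct (Orb n) as [_ [O2 _]]. destruct (Small n) as [_ [_ S3]].
    change (Nat.iter (S n) s z) with (s (Nat.iter n s z)). set (u := Nat.iter n s z) in *.
    destruct Hs as [_ [_ [_ Hs]]]. destruct (Hs u O2) as [_ S].
    pose proof (Re_le_Cmod (wcoord (s u) - wcoord u - RtoC a)) as B.
    replace (Re (wcoord (s u) - wcoord u - RtoC a)) with (Re (wcoord (s u)) - Re (wcoord u) - a) in B
      by (unfold Re, RtoC; simpl; ring).
    rewrite <- (unit_sign a _ Ha) in B. apply Rabs_le_between in B.
    replace (a * (Re (wcoord (s u)) - Re (wcoord u) - a)) with (a * Re (wcoord (s u)) - a * Re (wcoord u) - a * a) in B by ring.
    rewrite Ha in B. lra. }
  intros n. destruct (Small n) as [S1 [S2 _]]. split; auto. split.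
  - specialize (Re_pos n). rewrite Re_wcoord in Re_pos by (apply Cmod_neq_0; auto).
    set (u := Nat.iter n s z) in *.
    assert (P : 0 < Cmod u * Cmod u) by nra.
    replace (- (a * Re u)) with (a * (- Re u / (Cmod u * Cmod u)) * (Cmod u * Cmod u)) by (field; lra).
    apply Rmult_le_pos; lra.
  - intros e He. destruct (INR_unbounded (D / (e * e))) as [N HN]. exists N. intros m Hm.
    destruct (Orb m) as [_ [_ O3]]. set (u := Cmod (Nat.iter m s z)) in *.
    assert (u0 : 0 <= u) by apply Cmod_ge_0. apply Rnot_le_lt. intros Hc.
    assert (HNn : INR N <= INR m) by (apply le_INR; auto). assert (Ee : 0 < e * e) by nra.
    apply Rlt_div_l in HN; auto.
    assert (0 < / Cmod z) by (apply Rinv_0_lt_compat, Cmod_gt_0, Hz).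
    assert (e * e <= u * u) by nra.
    assert (e * e * INR m <= u * u * (/ Cmod z + INR m)).
    { apply Rmult_le_compat; try lra. apply pos_INR. }
    nra.
Qed.

(** The difference [h' - h] is constant along [u] and tends to [b' - b]. As [u] is any sequence,
    forward orbits serve the attracting side and backward orbits the repelling one. *)
Lemma invariant_difference (u : nat -> C) (a theta : R) (h h' : C -> C) (b b' : C) K K' rho :
  (a = 1 /\ theta = PI) \/ (a = -1 /\ theta = 0) -> 0 <= K -> 0 <= K' ->
  (forall z, sector theta (3 * PI / 4) rho z -> Cmod (h z - b) <= K * Cmod z) ->
  (forall z, sector theta (3 * PI / 4) rho z -> Cmod (h' z - b') <= K' * Cmod z) ->
  (forall n, 0 < Cmod (u n) < rho /\ 0 <= - (a * Re (u n))) ->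
  (forall e, 0 < e -> exists N, forall m, (N <= m)%nat -> Cmod (u m) < e) ->
  (forall n, (h' (u (S n)) - h (u (S n)) = h' (u n) - h (u n))%C) ->
  (h' (u 0%nat) - h (u 0%nat) = b' - b)%C.
Proof.
  intros Ha HK HK' H H' Hu Hlim Hinv.
  assert (Inv : forall n, (h' (u n) - h (u n) = h' (u 0%nat) - h (u 0%nat))%C).
  { induction n; auto. rewrite Hinv. auto. }
  apply Cmod_minus_0, Rle_antisym; [|apply Cmod_ge_0]. apply le_epsilon. intros e He. rewrite Rplus_0_l.
  destruct (Hlim (e / (K + K' + 1))) as [N HN]; [apply Rdiv_lt_0_compat; lra|].
  specialize (HN N (Nat.le_refl _)). rewrite <- (Inv N). destruct (Hu N) as [U1 U2].
  pose proof (half_plane_sector a theta rho (u N) Ha U1 U2) as S.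
  specialize (H _ S). specialize (H' _ S).
  replace (h' (u N) - h (u N) - (b' - b))%C with ((h' (u N) - b') - (h (u N) - b))%C by ring.
  eapply Rle_trans; [apply Cmod_minus_triangle|]. apply Rlt_div_r in HN; [|lra].
  pose proof (Cmod_ge_0 (u N)). nra.
Qed.

(** All Taylor coefficients of [F - G] vanish by [psum_zero_coef], applied to the set of coincidence
    points, which accumulates at 0. *)
Lemma identity_theorem F G : analytic_at F 0 -> analytic_at G 0 ->
  (forall e, 0 < e -> exists t, 0 < Cmod t < e /\ F t = G t) -> germ_eq F G.
Proof.
  intros HF HG H.
  assert (HH : analytic_at (fun t => F t + (-(1)) * G t)%C 0) by (apply analytic_at_plus; auto using analytic_at_scal).
  destruct HH as [a Ha]. destruct (expands_at_tail _ a Ha) as [r [Hr Htail]].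
  assert (Z : forall k, a k = 0%C).
  { intros k. destruct (Htail k) as [K [HK HT]].
    apply (psum_zero_coef (fun t => F t = G t /\ Cmod t < r) a k K); auto.
    - intros e He. destruct (H (Rmin e r)) as [t [Ht E]]; [apply Rmin_pos; auto|].
      pose proof (Rmin_l e r). pose proof (Rmin_r e r). exists t. repeat split; auto; lra.
    - intros t [E Ht]. specialize (HT t Ht). rewrite E in HT.
      replace (G t + (-(1)) * G t - psum a t k)%C with (- psum a t k)%C in HT by ring. rewrite Cmod_opp in HT. auto. }
  destruct Ha as [d [Hd Ha]]. exists d. split; auto. intros t Ht. specialize (Ha t Ht). rewrite Cplus_0_l in Ha.
  pose proof (is_pseries_C_unique _ _ _ _ Ha (is_pseries_const a t (fun k => Z (S k)))) as E. rewrite Z in E.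
  replace (F t) with ((F t + (-(1)) * G t) + G t)%C by ring. rewrite E. ring.
Qed.

(** Points of the imaginary axis lie in the closed half-planes of both petals: the same point starts
    a forward orbit for the attracting data and a backward orbit for the repelling data. *)
Definition axis_point (b s : R) : C := (0, b * s)%R.

Lemma axis_point_polar b s : b = 1 \/ b = -1 -> axis_point b s = polar s (b * (PI / 2)).
Proof.
  intros [-> | ->]; unfold axis_point, polar.
  - rewrite Rmult_1_l, Rmult_1_l, cos_PI2, sin_PI2. f_equal; ring.
  - replace (-1 * (PI / 2)) with (- (PI / 2)) by ring. rewrite cos_neg, sin_neg, cos_PI2, sin_PI2. f_equal; ring.
Qed.

Lemma axis_point_mod b s : b * b = 1 -> 0 <= s -> Cmod (axis_point b s) = s.
Proof.
  intros Hb Hs. unfold Cmod, axis_point. cbn [fst snd].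
  replace (0 ^ 2 + (b * s) ^ 2) with ((b * b) * (s * s)) by ring. rewrite Hb, Rmult_1_l. apply sqrt_square; auto.
Qed.

Lemma axis_point_wcoord b s : b * b = 1 -> 0 < s -> wcoord (axis_point b s) = (0, b / s)%R.
Proof.
  intros Hb Hs. assert (Hn : axis_point b s <> 0%C).
  { apply Cmod_neq_0. rewrite axis_point_mod; lra. }
  apply injective_projections.
  - change (fst (wcoord (axis_point b s))) with (Re (wcoord (axis_point b s))). rewrite Re_wcoord by auto.
    change (Re (axis_point b s)) with 0. rewrite axis_point_mod by lra. simpl. field. lra.
  - change (snd (wcoord (axis_point b s))) with (Im (wcoord (axis_point b s))). rewrite Im_wcoord by auto.
    change (Im (axis_point b s)) with (b * s). rewrite axis_point_mod by lra. simpl. field. lra.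
Qed.

Lemma axis_point_sector a theta b rho s : (a = 1 /\ theta = PI) \/ (a = -1 /\ theta = 0) -> b * b = 1 ->
  0 < s < rho -> sector theta (3 * PI / 4) rho (axis_point b s).
Proof.
  intros Ha Hb Hs. apply (half_plane_sector a); auto; [rewrite axis_point_mod; lra|].
  change (Re (axis_point b s)) with 0. lra.
Qed.

Lemma axis_component b (Vp Vm : C -> Prop) s1 : b = 1 \/ b = -1 ->
  (forall s, 0 < s < s1 -> Vp (axis_point b s) /\ Vm (axis_point b s)) ->
  forall s, 0 < s < s1 -> component_towards (b * (PI / 2)) (fun z => Vp z /\ Vm z) (axis_point b s).
Proof.
  intros Hb HV s Hs. exists (fun z => exists s, 0 < s < s1 /\ z = axis_point b s).
  split; [|split; [|split]].
  - apply path_connected. intros x y [sx [Hx ->]] [sy [Hy ->]].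
    exists (fun t => axis_point b (sx + t * (sy - sx))). split; [|split; [|split]].
    + apply rderiv_ccont. intros t _. eexists. unfold axis_point. apply rderiv_pair; auto_derive; auto.
    + f_equal. ring.
    + f_equal. ring.
    + intros t Ht. eexists. split; [|reflexivity].
      destruct (Rle_or_lt sx sy); split; try (assert (0 <= t * (sy - sx)) by (apply Rmult_le_pos; lra));
        try (assert (0 <= (1 - t) * (sx - sy)) by (apply Rmult_le_pos; lra)); try (assert (0 <= (1 - t) * (sy - sx)) by (apply Rmult_le_pos; lra));
        try (assert (0 <= t * (sx - sy)) by (apply Rmult_le_pos; lra)); lra.
  - intros w [s' [Hs' ->]]. auto.
  - exists s. auto.
  - exists s1. split; [lra|]. intros s' Hs'. exists s'. split; auto. rewrite axis_point_polar; auto.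
Qed.

(** [Psi] differs from [wcoord] by a bounded term and [wcoord] has imaginary part [b / s] here, so
    the horn variable decays like [exp (-2 pi / s)]. It is never 0, as the identity theorem
    requires. *)
Lemma axis_small_argument b Psi b0 K rho : b = 1 \/ b = -1 -> 0 < rho -> 0 <= K ->
  (forall z, sector PI (3 * PI / 4) rho z -> Cmod (Psi z + 1 / z - b0) <= K * Cmod z) ->
  forall e, 0 < e -> exists s1, 0 < s1 /\ forall s, 0 < s < s1 -> 0 < Cmod (horn Psi b (axis_point b s)) < e.
Proof.
  intros Hb Hrho HK H e He. assert (Hbb : b * b = 1) by (destruct Hb; subst; ring).
  pose proof PI_RGT_0 as HPI. pose proof (Cmod_ge_0 b0) as Hb0.
  set (X := Rabs (ln e) + Cmod b0 + K * rho + 1).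
  assert (HX : 0 < X). { unfold X. pose proof (Rabs_pos (ln e)). assert (0 <= K * rho) by (apply Rmult_le_pos; lra). lra. }
  exists (Rmin rho (/ X)). split; [apply Rmin_pos; auto; apply Rinv_0_lt_compat; auto|].
  intros s Hs. assert (S1 : s < rho) by (eapply Rlt_le_trans; [apply Hs|apply Rmin_l]).
  assert (S2 : s < / X) by (eapply Rlt_le_trans; [apply Hs|apply Rmin_r]).
  assert (IS : X < / s). { rewrite <- (Rinv_inv X). apply Rinv_lt_contravar; auto. apply Rmult_lt_0_compat; [lra|apply Rinv_0_lt_compat; auto]. }
  specialize (H _ (axis_point_sector 1 PI b rho s (or_introl (conj eq_refl eq_refl)) Hbb ltac:(lra))).
  rewrite axis_point_mod in H by lra. pose proof (axis_point_wcoord b s Hbb ltac:(lra)) as W.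
  set (z := axis_point b s) in *. rewrite horn_mod. split; [apply exp_pos|].
  assert (Hz : z <> 0%C) by (apply Cmod_neq_0; unfold z; rewrite axis_point_mod; lra).
  set (v := (Psi z + 1 / z - b0)%C) in *.
  assert (E : Psi z = (wcoord z + (b0 + v))%C) by (unfold v, wcoord; field; auto).
  rewrite E, W. replace (Im ((0, b / s) + (b0 + v))) with (b / s + (Im (b0 + v))) by reflexivity.
  assert (B : Rabs (b * Im (b0 + v)) <= Cmod b0 + K * rho).
  { rewrite unit_sign by auto. eapply Rle_trans; [apply Im_le_Cmod|]. eapply Rle_trans; [apply Cmod_triangle|].
    assert (K * s <= K * rho) by (apply Rmult_le_compat_l; lra). lra. }
  apply Rabs_le_between in B.
  replace (b * (b / s + Im (b0 + v))) with ((b * b) * / s + b * Im (b0 + v)) by (unfold Rdiv; ring). rewrite Hbb, Rmult_1_l.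
  assert (L : Rabs (ln e) < / s + b * Im (b0 + v)) by (unfold X in IS; lra).
  rewrite <- (exp_ln e) at 1 by auto. apply exp_increasing.
  pose proof PI2_1. pose proof (Rabs_pos (ln e)). pose proof (Rle_abs (- ln e)) as N. rewrite Rabs_Ropp in N. nra.
Qed.

Lemma horn_shift Psi Psi' b (c z : C) : (Psi' z = Psi z + c)%C ->
  horn Psi' b z = (Cexp (RtoC b * (2 * PI * Ci * c)) * horn Psi b z)%C.
Proof.
  intros E. unfold horn. rewrite E, <- Cexp_plus. f_equal. ring.
Qed.

Lemma horn_up Psi z : Cexp (2 * PI * Ci * Psi z) = horn Psi 1 z.
Proof. unfold horn. f_equal. ring. Qed.

Lemma horn_low Psi z : Cexp (- (2 * PI * Ci * Psi z)) = horn Psi (-1) z.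
Proof. unfold horn. f_equal. change (-1) with (- (1))%R. rewrite RtoC_opp. ring. Qed.

Lemma attracting_petal_orbit f r V z : attracting_petal f r V -> V z -> forall n, V (Nat.iter n f z).
Proof.
  intros [_ [_ [_ [_ H]]]] Hz. destruct (H z Hz) as [u [U0 [U1 _]]].
  assert (E : forall n, u n = Nat.iter n f z).
  { induction n as [|n IH]; auto. change (Nat.iter (S n) f z) with (f (Nat.iter n f z)). rewrite <- IH. apply U1. }
  intros n. rewrite <- E. apply U1.
Qed.

(** The petal only provides some backward orbit inside it; injectivity of [f] on the disc identifies
    this orbit with the iterates of the local inverse [g]. *)
Lemma repelling_petal_orbit f g r V z : disc_of_germ f r -> repelling_petal f r V -> V z ->
  (forall n, Cmod (Nat.iter n g z) < r /\ f (g (Nat.iter n g z)) = Nat.iter n g z) ->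
  forall n, V (Nat.iter n g z).
Proof.
  intros [_ [_ [Inj _]]] [_ [_ [Hr [_ H]]]] Hz Hg. destruct (H z Hz) as [u [U0 [U1 _]]].
  assert (E : forall n, u n = Nat.iter n g z).
  { induction n as [|n IH]; auto. apply Inj.
    - apply Hr. apply U1.
    - apply Hg.
    - change (Nat.iter (S n) g z) with (g (Nat.iter n g z)). rewrite (proj2 (Hg n)), <- IH.
      symmetry. apply U1. }
  intros n. rewrite <- E. apply U1.
Qed.

Lemma parabola_axis_point a M b s : b * b = 1 -> 0 < M -> 0 < s -> s < / (M + 1) ->
  parabola a 1 M (axis_point b s) /\ Re (wcoord (axis_point b s)) = 0.
Proof.
  intros Hb HM Hs Hs2. pose proof (axis_point_wcoord b s Hb Hs) as W. split; [|rewrite W; reflexivity].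
  split; [apply Cmod_neq_0; rewrite axis_point_mod; lra|].
  unfold height. rewrite W. change (Im (0, b / s)%R) with (b / s). change (Re (0, b / s)%R) with 0.
  replace (1 * (b / s * (b / s)) + a * 0) with ((b * b) * (/ s * / s)) by (field; lra). rewrite Hb, Rmult_1_l.
  assert (M + 1 < / s). { rewrite <- (Rinv_inv (M + 1)). apply Rinv_lt_contravar; auto.
    apply Rmult_lt_0_compat; [auto|apply Rinv_0_lt_compat; lra]. }
  nra.
Qed.

Lemma translation_axis_orbit s a K r rho : near_translation s a K r -> 0 < rho ->
  exists s1, 0 < s1 /\ forall b x, b = 1 \/ b = -1 -> 0 < x < s1 -> forall n,
    0 < Cmod (Nat.iter n s (axis_point b x)) < rho /\ 0 <= - (a * Re (Nat.iter n s (axis_point b x))) /\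
    (forall e, 0 < e -> exists N, forall m, (N <= m)%nat -> Cmod (Nat.iter m s (axis_point b x)) < e).
Proof.
  intros Hs Hrho. destruct (translation_half_orbit s a K r rho Hs Hrho) as [M [HM H]].
  exists (/ (M + 1)). split; [apply Rinv_0_lt_compat; lra|]. intros b x Hb Hx.
  destruct (parabola_axis_point a M b x) as [P Q]; try lra. { destruct Hb; subst; ring. }
  apply H; auto. rewrite Q. lra.
Qed.

Definition moment_data f r Vp Vm Psi Rp Rm : Prop :=
  disc_of_germ f r /\ attracting_petal f r Vp /\ repelling_petal f r Vm /\
  trivialisation f Vp Psi /\ abel1_solution f PI Vp Rp /\ abel1_solution f 0 Vm Rm.

Lemma moment_data_axis f r Vp Vm Psi Rp Rm : moment_data f r Vp Vm Psi Rp Rm ->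
  exists s1, 0 < s1 /\ forall b s, b = 1 \/ b = -1 -> 0 < s < s1 ->
    Vp (axis_point b s) /\ Vm (axis_point b s) /\
    component_towards (b * (PI / 2)) (fun z => Vp z /\ Vm z) (axis_point b s).
Proof.
  intros [_ [[_ [_ [_ [Sp _]]]] [[_ [_ [_ [Sm _]]]] _]]]. pose proof PI_RGT_0.
  destruct (Sp (3 * PI / 4) ltac:(lra)) as [r1 [H1 S1]]. destruct (Sm (3 * PI / 4) ltac:(lra)) as [r2 [H2 S2]].
  assert (HV : forall b s, b = 1 \/ b = -1 -> 0 < s < Rmin r1 r2 -> Vp (axis_point b s) /\ Vm (axis_point b s)).
  { intros b s Hb Hs. pose proof (Rmin_l r1 r2). pose proof (Rmin_r r1 r2).
    assert (b * b = 1) by (destruct Hb; subst; ring).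
    split; [apply S1, (axis_point_sector 1)|apply S2, (axis_point_sector (-1))]; auto; lra. }
  exists (Rmin r1 r2). split; [apply Rmin_pos; auto|]. intros b s Hb Hs.
  destruct (HV b s Hb Hs). repeat split; auto. apply (axis_component b Vp Vm (Rmin r1 r2)); auto.
Qed.

Lemma one_moment_axis f p : one_moment f p -> exists r Vp Vm Psi Rp Rm, moment_data f r Vp Vm Psi Rp Rm /\
  forall e, 0 < e -> exists s1, 0 < s1 /\ forall s, 0 < s < s1 ->
    let z := axis_point 1 s in let w := axis_point (-1) s in
    0 < Cmod (horn Psi 1 z) < e /\ (Rp z - Rm z = fst p (horn Psi 1 z))%C /\
    0 < Cmod (horn Psi (-1) w) < e /\ (Rm w - Rp w = snd p (horn Psi (-1) w))%C.
Proof.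
  intros [_ [_ [r [Vp [Vm [Psi [Rp [Rm [H1 [H2 [H3 [H4 [H5 [H6 [eps [Heps [Up Low]]]]]]]]]]]]]]]]].
  assert (D : moment_data f r Vp Vm Psi Rp Rm) by (repeat (split; auto)).
  exists r, Vp, Vm, Psi, Rp, Rm. split; auto. intros e He.
  destruct (moment_data_axis _ _ _ _ _ _ _ D) as [s1 [Hs1 Ax]].
  destruct H4 as [_ [_ As]]. destruct (asymptotic_limit _ _ As) as [b0 [K [rho [Hrho [HK Lim]]]]].
  assert (He' : 0 < Rmin e eps) by (apply Rmin_pos; auto).
  destruct (axis_small_argument 1 Psi b0 K rho (or_introl eq_refl) Hrho HK Lim _ He') as [s2 [Hs2 Q2]].
  destruct (axis_small_argument (-1) Psi b0 K rho (or_intror eq_refl) Hrho HK Lim _ He') as [s3 [Hs3 Q3]].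
  exists (Rmin s1 (Rmin s2 s3)). split; [repeat apply Rmin_pos; auto|]. intros s Hs.
  pose proof (Rmin_l s1 (Rmin s2 s3)). pose proof (Rmin_r s1 (Rmin s2 s3)).
  pose proof (Rmin_l s2 s3). pose proof (Rmin_r s2 s3). pose proof (Rmin_l e eps). pose proof (Rmin_r e eps).
  specialize (Q2 s ltac:(lra)). specialize (Q3 s ltac:(lra)). cbv zeta.
  destruct (Ax 1 s (or_introl eq_refl) ltac:(lra)) as [_ [_ A1]].
  destruct (Ax (-1) s (or_intror eq_refl) ltac:(lra)) as [_ [_ A2]].
  rewrite Rmult_1_l in A1. replace (-1 * (PI / 2)) with (- (PI / 2)) in A2 by ring.
  specialize (Up _ A1). specialize (Low _ A2). cbv zeta in Up, Low.
  rewrite horn_up in Up. rewrite horn_low in Low.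
  repeat split; try lra; [apply Up|apply Low]; lra.
Qed.

(** Along orbits the differences of two solutions are constant, equal to the difference of their
    limits at 0. These limits are taken over a whole sector, so the same constants serve both
    half-axes; this ties the identification of the upper germs to that of the lower ones. *)
Lemma moment_data_difference f r Vp Vm Psi Rp Rm r' Vp' Vm' Psi' Rp' Rm' : parabolic_germ f ->
  moment_data f r Vp Vm Psi Rp Rm -> moment_data f r' Vp' Vm' Psi' Rp' Rm' ->
  exists c ap am s1, 0 < s1 /\ forall b s, b = 1 \/ b = -1 -> 0 < s < s1 -> let z := axis_point b s in
    (Psi' z = Psi z + c)%C /\ (Rp' z = Rp z + ap)%C /\ (Rm' z = Rm z + am)%C.
Proof.
  intros Hf D D'. destruct (parabolic_germ_local f Hf) as [r0 [K0 Hp]].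
  pose proof (parabolic_translation _ _ _ Hp) as Tf.
  destruct (parabolic_inverse _ _ _ Hp) as [g [d [Hd [Tg Hg]]]].
  destruct (moment_data_axis _ _ _ _ _ _ _ D) as [s1 [Hs1 Ax]].
  destruct (moment_data_axis _ _ _ _ _ _ _ D') as [s1' [Hs1' Ax']].
  destruct D as [Dd [Da [Dr [[_ [Ps PsA]] [[_ [Pp PpA]] [_ [Pm PmA]]]]]]].
  destruct D' as [Dd' [Da' [Dr' [[_ [Ps' PsA']] [[_ [Pp' PpA']] [_ [Pm' PmA']]]]]]].
  destruct (asymptotic_limit _ _ PsA) as [b1 [K1 [R1 [HR1 [HK1 L1]]]]].
  destruct (asymptotic_limit _ _ PsA') as [b1' [K1' [R1' [HR1' [HK1' L1']]]]].
  destruct (asymptotic_limit _ _ PpA) as [b2 [K2 [R2 [HR2 [HK2 L2]]]]].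
  destruct (asymptotic_limit _ _ PpA') as [b2' [K2' [R2' [HR2' [HK2' L2']]]]].
  destruct (asymptotic_limit _ _ PmA) as [b3 [K3 [R3 [HR3 [HK3 L3]]]]].
  destruct (asymptotic_limit _ _ PmA') as [b3' [K3' [R3' [HR3' [HK3' L3']]]]].
  assert (Rho : exists rho, 0 < rho /\ rho <= r /\ rho <= r' /\ rho <= d /\
    rho <= R1 /\ rho <= R1' /\ rho <= R2 /\ rho <= R2' /\ rho <= R3 /\ rho <= R3').
  { destruct Dd as [Dd _]. destruct Dd' as [Dd' _].
    exists (Rmin r (Rmin r' (Rmin d (Rmin R1 (Rmin R1' (Rmin R2 (Rmin R2' (Rmin R3 R3')))))))).
    split; [repeat apply Rmin_pos; lra|].
    repeat split; repeat (try apply Rle_refl; first [apply Rmin_l|eapply Rle_trans; [apply Rmin_r|]]). }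
  destruct Rho as [rho [Hrho Hle]].
  assert (SM : forall theta R z, rho <= R -> sector theta (3 * PI / 4) rho z -> sector theta (3 * PI / 4) R z).
  { intros theta R z HR [s [t [Hs Ht]]]. exists s, t. split; auto. lra. }
  destruct (translation_axis_orbit f 1 _ _ rho Tf Hrho) as [s2 [Hs2 Of]].
  destruct (translation_axis_orbit g (-1) _ _ rho Tg Hrho) as [s3 [Hs3 Og]].
  exists (b1' - b1)%C, (b2' - b2)%C, (b3' - b3)%C, (Rmin s1 (Rmin s1' (Rmin s2 s3))).
  split; [repeat apply Rmin_pos; auto|]. intros b s Hb Hs z.
  pose proof (Rmin_l s1 (Rmin s1' (Rmin s2 s3))). pose proof (Rmin_r s1 (Rmin s1' (Rmin s2 s3))).
  pose proof (Rmin_l s1' (Rmin s2 s3)). pose proof (Rmin_r s1' (Rmin s2 s3)).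
  pose proof (Rmin_l s2 s3). pose proof (Rmin_r s2 s3).
  destruct (Ax b s Hb ltac:(lra)) as [Zp [Zm _]]. destruct (Ax' b s Hb ltac:(lra)) as [Zp' [Zm' _]].
  specialize (Of b s Hb ltac:(lra)). specialize (Og b s Hb ltac:(lra)). fold z in Zp, Zm, Zp', Zm', Of, Og.
  pose proof (attracting_petal_orbit f r Vp z Da Zp) as OP.
  pose proof (attracting_petal_orbit f r' Vp' z Da' Zp') as OP'.
  assert (Og' : forall n, Cmod (Nat.iter n g z) < rho) by (intros n; apply Og).
  assert (Gf : forall n, f (g (Nat.iter n g z)) = Nat.iter n g z).
  { intros n. apply Hg. specialize (Og' n). lra. }
  assert (OM : forall n, Vm (Nat.iter n g z)).
  { apply (repelling_petal_orbit f g r Vm z Dd Dr Zm). intros n. split; auto. specialize (Og' n). lra. }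
  assert (OM' : forall n, Vm' (Nat.iter n g z)).
  { apply (repelling_petal_orbit f g r' Vm' z Dd' Dr' Zm'). intros n. split; auto. specialize (Og' n). lra. }
  assert (Fwd : forall h h' c c' k k', 0 <= k -> 0 <= k' ->
    (forall y, sector PI (3 * PI / 4) rho y -> Cmod (h y - c) <= k * Cmod y) ->
    (forall y, sector PI (3 * PI / 4) rho y -> Cmod (h' y - c') <= k' * Cmod y) ->
    (forall y, Vp y -> Vp' y -> Vp (f y) -> Vp' (f y) -> h' (f y) - h (f y) = h' y - h y)%C ->
    (h' z - h z = c' - c)%C).
  { intros h h' c c' k k' Hk Hk' Hh Hh' E.
    apply (invariant_difference (fun n => Nat.iter n f z) 1 PI h h' c c' k k' rho); auto.
    - intros n. split; apply Of.
    - intros e He. apply Of; auto. exact 0%nat.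
    - intros n. apply E; [apply OP|apply OP'|apply (OP (S n))|apply (OP' (S n))]. }
  assert (Bwd : forall h h' c c' k k', 0 <= k -> 0 <= k' ->
    (forall y, sector 0 (3 * PI / 4) rho y -> Cmod (h y - c) <= k * Cmod y) ->
    (forall y, sector 0 (3 * PI / 4) rho y -> Cmod (h' y - c') <= k' * Cmod y) ->
    (forall y, Vm y -> Vm' y -> Vm (f y) -> Vm' (f y) -> h' (f y) - h (f y) = h' y - h y)%C ->
    (h' z - h z = c' - c)%C).
  { intros h h' c c' k k' Hk Hk' Hh Hh' E.
    apply (invariant_difference (fun n => Nat.iter n g z) (-1) 0 h h' c c' k k' rho); auto.
    - intros n. split; apply Og.
    - intros e He. apply Og; auto. exact 0%nat.
    - intros n. specialize (E (Nat.iter (S n) g z)). change (Nat.iter (S n) g z) with (g (Nat.iter n g z)) in E |- *.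
      rewrite Gf in E. symmetry. apply E; auto; [apply (OM (S n))|apply (OM' (S n))]. }
  repeat split.
  - assert (E : ((Psi' z + 1 / z) - (Psi z + 1 / z) = b1' - b1)%C).
    { apply (Fwd (fun z => Psi z + 1 / z)%C (fun z => Psi' z + 1 / z)%C b1 b1' K1 K1'); auto.
      - intros y Hy. apply L1. apply SM with (2 := Hy). lra.
      - intros y Hy. apply L1'. apply SM with (2 := Hy). lra.
      - intros y Y1 Y2 _ _. specialize (Ps y Y1). specialize (Ps' y Y2).
        replace (Psi' (f y) + 1 / f y - (Psi (f y) + 1 / f y))%C with ((Psi' (f y) - Psi' y) - (Psi (f y) - Psi y) + (Psi' y - Psi y))%C by ring.
        rewrite Ps, Ps'. ring. }
    rewrite <- E. ring.
  - assert (E : (Rp' z - Rp z = b2' - b2)%C).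
    { apply (Fwd Rp Rp' b2 b2' K2 K2'); auto.
      - intros y Hy. apply L2. apply SM with (2 := Hy). lra.
      - intros y Hy. apply L2'. apply SM with (2 := Hy). lra.
      - intros y Y1 Y2 Y3 Y4. specialize (Pp y Y1 Y3). specialize (Pp' y Y2 Y4).
        replace (Rp' (f y) - Rp (f y))%C with ((Rp' (f y) - Rp' y) - (Rp (f y) - Rp y) + (Rp' y - Rp y))%C by ring.
        rewrite Pp, Pp'. ring. }
    rewrite <- E. ring.
  - assert (E : (Rm' z - Rm z = b3' - b3)%C).
    { apply (Bwd Rm Rm' b3 b3' K3 K3'); auto.
      - intros y Hy. apply L3. apply SM with (2 := Hy). lra.
      - intros y Hy. apply L3'. apply SM with (2 := Hy). lra.
      - intros y Y1 Y2 Y3 Y4. specialize (Pm y Y1 Y3). specialize (Pm' y Y2 Y4).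
        replace (Rm' (f y) - Rm (f y))%C with ((Rm' (f y) - Rm' y) - (Rm (f y) - Rm y) + (Rm' y - Rm y))%C by ring.
        rewrite Pm, Pm'. ring. }
    rewrite <- E. ring.
Qed.

(** A shift [c] of [Psi] multiplies the horn variable by [B] above and by its inverse below; shifts
    of the two solutions change the two jumps by opposite constants. The horn values at axis points
    accumulate at 0, which is all the identity theorem asks. *)
Lemma one_moment_identified f p p' : parabolic_germ f -> one_moment f p -> one_moment f p' -> identified p p'.
Proof.
  intros Hf Hp Hp'. destruct (one_moment_axis f p Hp) as [r [Vp [Vm [Psi [Rp [Rm [D Ax]]]]]]].
  destruct (one_moment_axis f p' Hp') as [r' [Vp' [Vm' [Psi' [Rp' [Rm' [D' Ax']]]]]]].
  destruct (moment_data_difference f _ _ _ _ _ _ _ _ _ _ _ _ Hf D D') as [c [ap [am [s1 [Hs1 E]]]]].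
  set (B := Cexp (2 * PI * Ci * c)). assert (HB : B <> 0%C) by apply Cexp_neq_0.
  assert (HB' : Cexp (RtoC (-1) * (2 * PI * Ci * c)) = (/ B)%C).
  { assert (X : (Cexp (RtoC (-1) * (2 * PI * Ci * c)) * B = RtoC 1)%C).
    { unfold B. rewrite <- Cexp_plus. replace (RtoC (-1) * (2 * PI * Ci * c) + 2 * PI * Ci * c)%C with (RtoC 0).
      apply Cexp_0. change (-1) with (- (1))%R. rewrite RtoC_opp. ring. }
    rewrite <- (Cmult_1_l (/ B)), <- X. field. auto. }
  destruct Hp as [A1 [A2 _]]. destruct Hp' as [A1' [A2' _]].
  exists (am - ap)%C, B. split; auto. split.
  - apply identity_theorem; auto.
    { apply analytic_at_plus; auto using analytic_at_const.
      apply analytic_at_ext with (fun t => fst p' (t * B)%C); [intros; f_equal; ring|]. apply analytic_at_rescale; auto. }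
    intros e He. destruct (Ax e He) as [s2 [Hs2 Q]]. destruct (Ax' 1 ltac:(lra)) as [s3 [Hs3 Q']].
    set (s := Rmin s1 (Rmin s2 s3) / 2).
    assert (P : 0 < Rmin s1 (Rmin s2 s3)) by (repeat apply Rmin_pos; auto).
    pose proof (Rmin_l s1 (Rmin s2 s3)). pose proof (Rmin_r s1 (Rmin s2 s3)).
    pose proof (Rmin_l s2 s3). pose proof (Rmin_r s2 s3).
    assert (HS : 0 < s < s1 /\ s < s2 /\ s < s3) by (unfold s; lra).
    destruct (Q s ltac:(lra)) as [Q1 [Q2 _]]. destruct (Q' s ltac:(lra)) as [_ [Q2' _]].
    destruct (E 1 s (or_introl eq_refl) ltac:(lra)) as [E1 [E2 E3]].
    exists (horn Psi 1 (axis_point 1 s)). split; auto.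
    rewrite (horn_shift Psi Psi' 1 c _ E1) in Q2'. rewrite Cmult_1_l in Q2'. fold B in Q2'.
    rewrite <- Q2, <- Q2', E2, E3. ring.
  - apply identity_theorem; auto.
    { apply analytic_at_plus; auto using analytic_at_const.
      apply (analytic_at_rescale (snd p') (/ B)%C); auto. }
    intros e He. destruct (Ax e He) as [s2 [Hs2 Q]]. destruct (Ax' 1 ltac:(lra)) as [s3 [Hs3 Q']].
    set (s := Rmin s1 (Rmin s2 s3) / 2).
    assert (P : 0 < Rmin s1 (Rmin s2 s3)) by (repeat apply Rmin_pos; auto).
    pose proof (Rmin_l s1 (Rmin s2 s3)). pose proof (Rmin_r s1 (Rmin s2 s3)).
    pose proof (Rmin_l s2 s3). pose proof (Rmin_r s2 s3).
    assert (HS : 0 < s < s1 /\ s < s2 /\ s < s3) by (unfold s; lra).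
    destruct (Q s ltac:(lra)) as [_ [_ [Q1 Q2]]]. destruct (Q' s ltac:(lra)) as [_ [_ [_ Q2']]].
    destruct (E (-1) s (or_intror eq_refl) ltac:(lra)) as [E1 [E2 E3]].
    exists (horn Psi (-1) (axis_point (-1) s)). split; auto.
    rewrite (horn_shift Psi Psi' (-1) c _ E1), HB' in Q2'.
    rewrite <- Q2. unfold Cdiv. rewrite (Cmult_comm _ (/ B)), <- Q2', E2, E3. ring.
Qed.

Lemma analytic_at_0_Lipschitz F : analytic_at F 0 -> exists d K, 0 < d /\ 0 < K /\
  forall t, Cmod t < d -> Cmod (F t - F 0%C) <= K * Cmod t.
Proof.
  intros [a Ha]. destruct (expands_at_tail _ _ Ha) as [d [Hd H]]. destruct (H 0%nat) as [K [HK HT]].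
  exists d, K. repeat split; auto. intros t Ht. specialize (HT t Ht). rewrite psum_O, pow_1 in HT.
  rewrite (expands_at_val _ _ _ Ha). auto.
Qed.

(** [Rp] has the same limit at 0 from above and from below, and so has [Rm]. The two jumps therefore
    have opposite limits, and these are the values of the germs at horn variable 0. *)
Lemma one_moment_pair f p : one_moment f p -> moment_pair p.
Proof.
  intros Hp. destruct (one_moment_axis f p Hp) as [r [Vp [Vm [Psi [Rp [Rm [D Ax]]]]]]].
  destruct Hp as [A1 [A2 _]]. split; auto. split; auto.
  destruct D as [_ [_ [_ [_ [[_ [_ Ap]] [_ [_ Am]]]]]]].
  destruct (asymptotic_limit _ _ Ap) as [b2 [K2 [R2 [HR2 [HK2 L2]]]]].
  destruct (asymptotic_limit _ _ Am) as [b3 [K3 [R3 [HR3 [HK3 L3]]]]].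
  destruct (analytic_at_0_Lipschitz _ A1) as [d1 [k1 [Hd1 [Hk1 T1]]]].
  destruct (analytic_at_0_Lipschitz _ A2) as [d2 [k2 [Hd2 [Hk2 T2]]]].
  rewrite <- (Cminus_0_r (fst p 0%C + snd p 0%C)%C).
  apply Cmod_eq_0, Rle_antisym; [|apply Cmod_ge_0]. apply le_epsilon. intros e He. rewrite Rplus_0_l.
  set (e1 := e / (k1 + k2 + 2 * K2 + 2 * K3)).
  assert (He1 : 0 < e1) by (apply Rdiv_lt_0_compat; lra).
  destruct (Ax (Rmin e1 (Rmin d1 d2))) as [s1 [Hs1 Q]]; [repeat apply Rmin_pos; auto|].
  pose proof (Rmin_l e1 (Rmin d1 d2)). pose proof (Rmin_r e1 (Rmin d1 d2)).
  pose proof (Rmin_l d1 d2). pose proof (Rmin_r d1 d2).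
  set (m := Rmin (Rmin s1 e1) (Rmin R2 R3)).
  assert (Hm : 0 < m) by (repeat apply Rmin_pos; auto).
  assert (m <= s1 /\ m <= e1 /\ m <= R2 /\ m <= R3).
  { unfold m. pose proof (Rmin_l (Rmin s1 e1) (Rmin R2 R3)). pose proof (Rmin_r (Rmin s1 e1) (Rmin R2 R3)).
    pose proof (Rmin_l s1 e1). pose proof (Rmin_r s1 e1). pose proof (Rmin_l R2 R3). pose proof (Rmin_r R2 R3). lra. }
  destruct (Q (m / 2) ltac:(lra)) as [Q1 [Q2 [Q3 Q4]]].
  set (z := axis_point 1 (m / 2)) in *. set (w := axis_point (-1) (m / 2)) in *.
  assert (Mz : Cmod z = m / 2) by (apply axis_point_mod; lra).
  assert (Mw : Cmod w = m / 2) by (apply axis_point_mod; lra).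
  assert (X1 : Cmod (Rp z - b2) <= K2 * e1).
  { eapply Rle_trans; [apply L2, (axis_point_sector 1); auto; lra|]. fold z. rewrite Mz. apply Rmult_le_compat_l; lra. }
  assert (X2 : Cmod (Rp w - b2) <= K2 * e1).
  { eapply Rle_trans; [apply L2, (axis_point_sector 1); auto; lra|]. fold w. rewrite Mw. apply Rmult_le_compat_l; lra. }
  assert (X3 : Cmod (Rm z - b3) <= K3 * e1).
  { eapply Rle_trans; [apply L3, (axis_point_sector (-1)); auto; lra|]. fold z. rewrite Mz. apply Rmult_le_compat_l; lra. }
  assert (X4 : Cmod (Rm w - b3) <= K3 * e1).
  { eapply Rle_trans; [apply L3, (axis_point_sector (-1)); auto; lra|]. fold w. rewrite Mw. apply Rmult_le_compat_l; lra. }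
  specialize (T1 (horn Psi 1 z) ltac:(lra)). specialize (T2 (horn Psi (-1) w) ltac:(lra)).
  rewrite <- Q2 in T1. rewrite <- Q4 in T2.
  assert (Y1 : k1 * Cmod (horn Psi 1 z) <= k1 * e1) by (apply Rmult_le_compat_l; lra).
  assert (Y2 : k2 * Cmod (horn Psi (-1) w) <= k2 * e1) by (apply Rmult_le_compat_l; lra).
  replace (fst p 0%C + snd p 0%C - 0)%C with
    (((Rp z - b2) - (Rp w - b2)) - ((Rm z - b3) - (Rm w - b3)) - ((Rp z - Rm z - fst p 0%C) + (Rm w - Rp w - snd p 0%C)))%C by ring.
  assert (Ee : (k1 + k2 + 2 * K2 + 2 * K3) * e1 = e) by (unfold e1; field; lra).
  eapply Rle_trans; [apply Cmod_minus_triangle|]. eapply Rle_trans; [apply Rplus_le_compat; [apply Cmod_minus_triangle|apply Cmod_triangle]|].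
  pose proof (Cmod_minus_triangle (Rp z - b2)%C (Rp w - b2)%C). pose proof (Cmod_minus_triangle (Rm z - b3)%C (Rm w - b3)%C). lra.
Qed.

Lemma psum_plus_const b c z N :
  (psum b z N + c = sum_n (fun k => (match k with O => b 0%nat + c | _ => b k end) * z ^ k) N)%C.
Proof.
  induction N as [|N IH].
  - rewrite psum_O, sum_O. simpl. ring.
  - rewrite psum_S, sum_Sn, <- IH. unfold plus. simpl. ring.
Qed.

Lemma has_asymptotic_series_plus_const theta h c : has_asymptotic_series theta h ->
  has_asymptotic_series theta (fun z => h z + c)%C.
Proof.
  intros [b H]. exists (fun k => match k with O => b 0%nat + c | _ => b k end)%C. intros alpha N Ha.
  destruct (H alpha N Ha) as [K [rho [Hr HK]]]. exists K, rho. split; auto. intros z Hz.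
  rewrite <- (psum_plus_const b c z N).
  replace (h z + c - (psum b z N + c))%C with (h z - psum b z N)%C by ring. exact (HK z Hz).
Qed.

Lemma analytic_on_plus_const V F c : analytic_on V F -> analytic_on V (fun z => F z + c)%C.
Proof. intros H z Hz. apply analytic_at_plus; auto using analytic_at_const. Qed.

(** The free constants realise every identification: with [Cexp (2 * PI * Ci * c) = b], subtract [c]
    from [Psi] and add [a] to the attracting solution only. *)
Lemma one_moment_of_identified f g p : one_moment f g -> moment_pair p -> identified p g -> one_moment f p.
Proof.
  intros [_ [_ [r [Vp [Vm [Psi [Rp [Rm [H1 [H2 [H3 [H4 [H5 [H6 [eps [Heps [Up Low]]]]]]]]]]]]]]]]]
    [P1 [P2 _]] [a [b [Hb [[r1 [Hr1 G1]] [r2 [Hr2 G2]]]]]].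
  split; auto. split; auto. pose proof PI_RGT_0.
  assert (HP : RtoC PI <> 0%C) by (apply RtoC_neq_0; lra).
  assert (HI : Ci <> 0%C) by (intros E; apply (f_equal Im) in E; simpl in E; lra).
  set (c := (Clog b / (2 * PI * Ci))%C).
  assert (Ec : (2 * PI * Ci * c)%C = Clog b) by (unfold c; field; auto).
  exists r, Vp, Vm, (fun z => Psi z + - c)%C, (fun z => Rp z + a)%C, Rm.
  split; auto. split; auto. split; auto. split; [|split; [|split; auto]].
  - destruct H4 as [A1 [A2 A3]]. split; [apply analytic_on_plus_const; auto|]. split.
    + intros z Hz. rewrite <- (A2 z Hz). ring.
    + destruct (has_asymptotic_series_plus_const _ _ (- c)%C A3) as [q Hq]. exists q. intros alpha N Ha.
      destruct (Hq alpha N Ha) as [K [rho [Hr HK]]]. exists K, rho. split; auto. intros z Hz.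
      replace (Psi z + - c + 1 / z)%C with (Psi z + 1 / z + - c)%C by ring. auto.
  - destruct H5 as [A1 [A2 A3]]. split; [apply analytic_on_plus_const; auto|]. split.
    + intros z Hz Hz'. rewrite <- (A2 z Hz Hz'). ring.
    + apply has_asymptotic_series_plus_const; auto.
  - assert (Hm : 0 < Cmod b) by (apply Cmod_gt_0; auto).
    assert (Hi : 0 < / Cmod b) by (apply Rinv_0_lt_compat; auto).
    (* Below [e] both [b * t] and [t / b] stay below [eps], and [t] stays in the discs of the two
       germ equalities. *)
    set (e := Rmin (Rmin r1 r2) (Rmin (eps / Cmod b) (eps * Cmod b))).
    assert (E : e <= r1 /\ e <= r2 /\ e <= eps / Cmod b /\ e <= eps * Cmod b).
    { unfold e. pose proof (Rmin_l (Rmin r1 r2) (Rmin (eps / Cmod b) (eps * Cmod b))). pose proof (Rmin_r (Rmin r1 r2) (Rmin (eps / Cmod b) (eps * Cmod b))).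
      pose proof (Rmin_l r1 r2). pose proof (Rmin_r r1 r2). pose proof (Rmin_l (eps / Cmod b) (eps * Cmod b)).
      pose proof (Rmin_r (eps / Cmod b) (eps * Cmod b)). lra. }
    exists e. split; [unfold e; repeat apply Rmin_pos; auto; [apply Rdiv_lt_0_compat|apply Rmult_lt_0_compat]; auto|].
    split; intros z Hz t Ht.
    + assert (Et : Cexp (2 * PI * Ci * Psi z) = (b * t)%C).
      { unfold t. rewrite <- (Cexp_Clog b Hb), <- Ec, <- Cexp_plus. f_equal. ring. }
      specialize (Up z Hz). cbv zeta in Up. rewrite Et in Up.
      rewrite G1 by lra. rewrite <- Up; [ring|]. rewrite Cmod_mult.
      replace eps with (Cmod b * (eps / Cmod b)) by (field; lra). apply Rmult_lt_compat_l; lra.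
    + assert (Et : Cexp (- (2 * PI * Ci * Psi z)) = (t / b)%C).
      { assert (X : (Cexp (- (2 * PI * Ci * Psi z)) * b = t)%C).
        { unfold t. rewrite <- (Cexp_Clog b Hb) at 1. rewrite <- Ec, <- Cexp_plus. f_equal. ring. }
        rewrite <- X. field. auto. }
      specialize (Low z Hz). cbv zeta in Low. rewrite Et in Low.
      rewrite G2 by lra. rewrite <- Low; [ring|]. rewrite Cmod_div by auto.
      apply Rlt_div_l; lra.
Qed.

Theorem theorem4p8 (f : C -> C) (hf : parabolic_germ f)
    (X : germ_pair -> Prop) (hX : one_conjugacy_class X) :
  exists f1 : C -> C,
    analytic_class f f1 /\ (forall p : germ_pair, Phi f1 p <-> X p).
Proof.
  destruct hX as [g [[A1 [A2 A3]] HX]].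
  destruct (realization f (fst g) (snd g) hf A1 A2 A3) as [f1 [Hc Hm]]. rewrite <- surjective_pairing in Hm.
  (* One realised pair determines the whole class: every moment of [f1] is identified with [g], and
     every pair identified with [g] is again a moment. *)
  exists f1. split; auto. intros p. rewrite HX. split.
  - intros Hp. split; [apply (one_moment_pair f1); auto|]. apply (one_moment_identified f1); auto. apply Hc.
  - intros [H1 H2]. apply (one_moment_of_identified f1 g); auto.
Qed.
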